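(* Let $d\ge2$, $0<\alpha\le\beta$, and consider i.i.d. random conductances in $[\alpha,\beta]$ on the edges of $\mathbb{Z}^d$, with homogenized matrix $A_{\mathrm{hom}}$ and, for $\mu>0$ and $k\ge1$, approximations $A_{\mu,k}$ as defined in the context. For $D,q,k\ge0$ define $$\mathrm{Err}_{D,q,k}(\mu)=\begin{cases}\mu^{2k}&\text{if }k<D/4,\\ \mu^{2k}\ln_+^{1+q}(\mu^{-1})&\text{if }k=D/4,\\ \mu^{D/2}\ln_+^q(\mu^{-1})&\text{if }k>D/4,\end{cases}\qquad \ln_+(x)=\max\{\ln x,1\}.$$ Then there exists $q\ge0$ depending only on $\alpha$ and $\beta$ such that for all $\xi\in\mathbb{R}^d$ with $|\xi|=1$, all $\mu>0$ and all $k\ge1$, $$0\le\xi\cdot(A_{\mu,k}-A_{\mathrm{hom}})\xi\lesssim\begin{cases}\mathrm{Err}_{2,q,k}(\mu)&\text{if }d=2,\\ \mathrm{Err}_{d,0,k}(\mu)&\text{if }2<d\le5,\\ \mathrm{Err}_{6,1,k}(\mu)&\text{if }d=6,\\ \mathrm{Err}_{6,0,k}(\mu)&\text{if }6<d\le12,\\ \mathrm{Err}_{d-6,0,k}(\mu)&\text{if }d>12,\end{cases}$$ where $\lesssim$ means $\le$ up to a multiplicative constant depending only on $d,\alpha,\beta$.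
   Context: Environment: $\mathbb{B}$ is the set of non-oriented nearest-neighbour edges of $\mathbb{Z}^d$, $\Omega=[\alpha,\beta]^{\mathbb{B}}$, $\nu$ is a probability measure on $[\alpha,\beta]$, $\mathbb{P}=\nu^{\otimes\mathbb{B}}$, $\langle\cdot\rangle$ is expectation under $\mathbb{P}$; $\omega_{x,y}=\omega_{y,x}=\omega_e$ for $e=(x,y)$. Shifts: $(\theta_z\omega)_{x,y}=\omega_{x+z,y+z}$. A function $f:\mathbb{Z}^d\times\Omega\to\mathbb{R}$ is stationary if $f(x+z,\omega)=f(x,\theta_z\omega)$. $A(x,\omega)=\mathrm{diag}[\omega_{x,x+\mathbf{e}_1},\dots,\omega_{x,x+\mathbf{e}_d}]$, $A(\omega)=A(0,\omega)$. $\nabla u(x)=(u(x+\mathbf{e}_i)-u(x))_{i}$ and $\nabla^*\cdot F(x)=\sum_i(F_i(x)-F_i(x-\mathbf{e}_i))$. Homogenized matrix: for $\xi\in\mathbb{R}^d$ there is a unique measurable $\phi:\mathbb{Z}^d\times\Omega\to\mathbb{R}$ with $\phi(0,\cdot)\equiv0$, $\nabla\phi$ stationary (and square-integrable), $\langle\nabla\phi\rangle=0$, and $-\nabla^*\cdot A(\xi+\nabla\phi)=0$ in $\mathbb{Z}^d$ almost surely; $A_{\mathrm{hom}}$ is the symmetric matrix with $\xi\cdot A_{\mathrm{hom}}\xi=\langle(\xi+\nabla\phi)\cdot A(\xi+\nabla\phi)\rangle$. Operator and spectral measure: $\mathcal{L}u(\omega)=\sum_{z\sim0}\omega_{0,z}(u(\omega)-u(\theta_z\omega))$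 on $L^2(\Omega)$ (sum over the $2d$ neighbours of $0$) is bounded, nonnegative and self-adjoint. The local drift is $\mathfrak{d}(\omega)=\sum_{i=1}^d\xi_i(\omega_{0,\mathbf{e}_i}-\omega_{-\mathbf{e}_i,0})$. For $f\in L^2(\Omega)$, $e_f$ is the spectral measure of $\mathcal{L}$ projected on $f$: $\langle f\,\Psi(\mathcal{L})f\rangle=\int_{\mathbb{R}^+}\Psi(\lambda)\,\mathrm{d}e_f(\lambda)$ for bounded continuous $\Psi:\mathbb{R}_+\to\mathbb{R}$. Approximations: with $P_k(\mu,\lambda)=\lambda^{-1}\big((\mu+\lambda)^2(2\mu+\lambda)^2\cdots(2^{k-1}\mu+\lambda)^2-2^{k(k-1)}\mu^{2k}\big)$ (a polynomial), $A_{\mu,k}$ is the symmetric matrix with $$\xi\cdot A_{\mu,k}\xi=\langle\xi\cdot A\xi\rangle-\int_{\mathbb{R}^+}\frac{P_k(\mu,\lambda)}{(\mu+\lambda)^2(2\mu+\lambda)^2\cdots(2^{k-1}\mu+\lambda)^2}\,\mathrm{d}e_{\mathfrak{d}}(\lambda).$$ *)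

(* Defs.v *)
From HB Require Import structures.
From mathcomp Require Import all_boot all_order all_algebra.
From mathcomp Require Import all_classical all_reals all_analysis.

Set Implicit Arguments.
Unset Strict Implicit.
Unset Printing Implicit Defensive.

Import Order.TTheory GRing.Theory Num.Theory.
Import numFieldNormedType.Exports.

Local Open Scope classical_set_scope.
Local Open Scope ring_scope.

Section Lattice.
Variables (R : realType) (d : nat).

Definition site : Type := 'rV[int]_d.

Definition unit_vec (i : 'I_d) : site := delta_mx 0 i.

(* Non-oriented nearest-neighbour edges: (x, i) stands for {x, x + e_i}; every
   edge of Z^d has exactly one such representation. *)
Definition edge : Type := (site * 'I_d)%type.

Definition grad (u : site -> R) (x : site) : 'rV[R]_d :=
  \row_i (u (x + unit_vec i) - u x).

Definition div_star (F : site -> 'rV[R]_d) (x : site) : R :=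
  \sum_i (F x 0 i - F (x - unit_vec i) 0 i).

Definition qform (A : 'M[R]_d) (xi : 'rV[R]_d) : R := (xi *m A *m xi^T) 0 0.

(* The library norm on matrices is the sup norm, hence this definition. *)
Definition euclid_norm (xi : 'rV[R]_d) : R := Num.sqrt (\sum_i xi 0 i ^+ 2).

End Lattice.

Section ConductanceSpace.
Variables (R : realType) (alpha beta : R) (hab : alpha <= beta).

(* The interval [alpha, beta] as a type. The proof of alpha <= beta is a
   parameter because measurable types must be inhabited. *)
Record conductance_set (h : alpha <= beta) : Type := Conductance
  { conductance_val : R; _ : alpha <= conductance_val <= beta }.

HB.instance Definition _ := [isSub for @conductance_val hab].
HB.instance Definition _ := [Choice of conductance_set hab by <:].
HB.instance Definition _ := isPointed.Build (conductance_set hab)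
  (Conductance hab (introT andP (conj (lexx alpha) hab))).

(* [alpha, beta] with the trace of the Borel sigma-algebra. *)
Definition conductance := g_sigma_algebra_preimageType
  (@conductance_val hab : conductance_set hab -> measurableTypeR R).

Definition cylinders (d : nat) : set (set (edge d -> conductance)) :=
  [set C | exists (e : edge d) (A : set conductance),
     measurable A /\ C = [set w | A (w e)]].

(* [alpha, beta]^B with the product sigma-algebra. *)
Definition Omega (d : nat) := g_sigma_algebraType (@cylinders d).

End ConductanceSpace.

Section SpectralMeasure.
Context {disp : measure_display} {T : measurableType disp} {R : realType}.
Variable P : probability T R.

Definition norm2 (f : T -> R) : \bar R := 'N[P]_2%:E[EFin \o f]%E.

Definition poly_op (L : (T -> R) -> (T -> R)) (p : {poly R}) (f : T -> R)
  : T -> R := fun w => \sum_(i < size p) p`_i * iter i L f w.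

(* Continuous functional calculus of a bounded nonnegative self-adjoint
   operator L on L^2: g represents Psi(L) f when g is the L^2-limit of p_n(L) f
   for polynomials p_n converging to Psi uniformly on [0, K], which contains the
   spectrum of L as soon as K bounds the operator norm of L. *)
Definition functional_calculus (L : (T -> R) -> (T -> R)) (Psi : R -> R)
    (f g : T -> R) : Prop :=
  g \in Lfun P 2%:E /\
  forall (K : R) (p : nat -> {poly R}),
    (forall u, u \in Lfun P 2%:E -> (norm2 (L u) <= K%:E * norm2 u)%E) ->
    (forall eps : R, 0 < eps -> \forall n \near \oo,
       forall lambda : R, 0 <= lambda <= K ->
         `|(p n).[lambda] - Psi lambda| <= eps) ->
    norm2 (fun w => poly_op L (p n) f w - g w) @[n --> \oo] --> (0 : \bar R)%E.

(* The measure e_f on R_+ with <f Psi(L) f> = \int Psi de_f for all bounded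
   continuous Psi on R_+, seen as a measure on R which does not charge the
   negative half-line. *)
Definition spectral_measure (L : (T -> R) -> (T -> R)) (f : T -> R)
    (e : {measure set (measurableTypeR R) -> \bar R}) : Prop :=
  e `]-oo, 0[%classic = 0%E /\
  forall (Psi : R -> R) (g : T -> R),
    {within `[0, +oo[%classic, continuous Psi} ->
    (exists M : R, forall lambda : R, 0 <= lambda -> `|Psi lambda| <= M) ->
    functional_calculus L Psi f g ->
    ('E_P[(f \* g)%R] = \int[e]_(lambda in `[0%R, +oo[%classic) (Psi lambda)%:E)%E.

End SpectralMeasure.

Section Homogenization.
Variables (R : realType) (alpha beta : R) (hab : alpha <= beta) (d : nat).

Local Notation Omega := (Omega hab d).

(* P is the product of copies of nu indexed by the edges: the finite-dimensional
   cylinders form a pi-system generating the sigma-algebra of Omega, so P is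
   unique. *)
Definition product_measure (nu : probability (conductance hab) R)
    (P : probability Omega R) : Prop :=
  forall (s : seq (edge d)) (A : edge d -> set (conductance hab)),
    uniq s -> (forall e, measurable (A e)) ->
    P [set w | forall e, e \in s -> A e (w e)] = (\prod_(e <- s) nu (A e))%E.

Definition cond (w : Omega) (x : site d) (i : 'I_d) : R :=
  conductance_val (w (x, i)).

Definition shift (z : site d) (w : Omega) : Omega :=
  fun e => w (e.1 + z, e.2).

Definition stationary (V : Type) (f : site d -> Omega -> V) : Prop :=
  forall x z w, f (x + z) w = f x (shift z w).

Definition Amat (w : Omega) (x : site d) : 'M[R]_d :=
  diag_mx (\row_i cond w x i).

Definition corrector (P : probability Omega R) (xi : 'rV[R]_d)
    (phi : site d -> Omega -> R) : Prop :=
  [/\ forall x, measurable_fun setT (phi x),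
      forall w, phi 0 w = 0,
      stationary (fun x w => grad (phi ^~ w) x),
      forall x i, (fun w => grad (phi ^~ w) x 0 i) \in Lfun P 2%:E /\
        ('E_P[(fun w => grad (phi ^~ w) x 0 i)%R] = 0)%E &
      {ae P, forall w, forall x : site d,
        - div_star (fun y => (xi + grad (phi ^~ w) y) *m Amat w y) x = 0}].

Definition homogenized_matrix (P : probability Omega R) (A : 'M[R]_d) : Prop :=
  A^T = A /\
  forall xi : 'rV[R]_d, exists phi : site d -> Omega -> R,
    corrector P xi phi /\
    ((qform A xi)%:E =
      'E_P[(fun w => qform (Amat w 0) (xi + grad (phi ^~ w) 0))%R])%E.

(* The neighbours of 0 are the e_i and the - e_i, and the edge {- e_i, 0} is
   represented by (- e_i, i). *)
Definition opL (u : Omega -> R) (w : Omega) : R :=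
  \sum_i (cond w 0 i * (u w - u (shift (unit_vec i) w))
          + cond w (- unit_vec i) i * (u w - u (shift (- unit_vec i) w))).

Definition drift (xi : 'rV[R]_d) (w : Omega) : R :=
  \sum_i xi 0 i * (cond w 0 i - cond w (- unit_vec i) i).

Definition Qpoly (mu : R) (k : nat) : {poly R} :=
  \prod_(i < k) ((2 ^+ i * mu)%:P + 'X) ^+ 2.

(* The division by 'X is exact. *)
Definition Ppoly (mu : R) (k : nat) : {poly R} :=
  (Qpoly mu k - (2 ^+ (k * k.-1) * mu ^+ (2 * k))%:P) %/ 'X.

Definition approx_matrix (P : probability Omega R) (mu : R) (k : nat)
    (A : 'M[R]_d) : Prop :=
  A^T = A /\
  forall xi : 'rV[R]_d,
    exists e : {measure set (measurableTypeR R) -> \bar R},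
      spectral_measure P opL (drift xi) e /\
      ((qform A xi)%:E =
         'E_P[(fun w => qform (Amat w 0) xi)%R] -
         \int[e]_(lambda in `[0%R, +oo[%classic)
           ((Ppoly mu k).[lambda] / (Qpoly mu k).[lambda])%R%:E)%E.

End Homogenization.

Section ErrorBounds.
Variable R : realType.

Definition ln_plus (x : R) : R := Num.max (ln x) 1.

Definition Err (D q k mu : R) : R :=
  if k < D / 4 then mu `^ (2 * k)
  else if k == D / 4 then mu `^ (2 * k) * ln_plus mu^-1 `^ (1 + q)
  else mu `^ (D / 2) * ln_plus mu^-1 `^ q.

Definition error_bound (d : nat) (q : R) (k : nat) (mu : R) : R :=
  if (d == 2)%N then Err 2 q k%:R mu
  else if (2 < d <= 5)%N then Err d%:R 0 k%:R mu
  else if (d == 6)%N then Err 6 1 k%:R mu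
  else if (6 < d <= 12)%N then Err 6 0 k%:R mu
  else Err (d%:R - 6) 0 k%:R mu.

End ErrorBounds.

(* Main.v *)
Require Import Defs.
From HB Require Import structures.
From mathcomp Require Import all_boot all_order all_algebra.
From mathcomp Require Import all_classical all_reals all_analysis.
From mathcomp Require Import measurable_realfun.
From mathcomp Require Import ring lra zify.

Set Implicit Arguments.
Unset Strict Implicit.
Unset Printing Implicit Defensive.

Import Order.TTheory GRing.Theory Num.Theory.
Import numFieldNormedType.Exports.

Local Open Scope classical_set_scope.
Local Open Scope ring_scope.

(* Put [c = 4 d beta], [T = 1 - L / c] (so [0 <= T <= 1]), [U_n = T^n drift] and
   [m_j = <drift U_j>]. Everything rests on the sharp decay
   [<U_n^2> <= C (n+1)^-(d/2+1)], valid without logarithms for every [d >= 2].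

   [U_n] is the value at the origin of a solution of a discrete heat equation whose
   initial datum is the divergence of a local field, so on a finite torus (where
   finitely many values of the conductances may be assumed) an Efron-Stein
   inequality bounds its moments by the sensitivities to single conductances.
   Duhamel's formula turns these into a convolution inequality for the moments of
   [U_n] and of its gradients, with kernels given by the decay of [T^n] on dipoles
   (Nash inequality; in dimension two, hole filling and Davies weights gain a small
   power). A first pass, with high moments, gives an almost optimal rate; in a
   second pass the dipole decay is decorrelated from the gradient by resampling the
   conductances of a small cube, which gives the optimal rate.

   Testing the corrector equation with [c^-1 sum_j U_j] and using mixing yields
   [xi . Ahom xi = <xi . A xi> - c^-1 sum_j m_j]. Positivity of the functional
   [p |-> <drift p(L) drift>] on Bernstein polynomials identifies [m_j] with the
   integral of [(1 - x/c)^j] against the spectral measure, which is carried by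
   [0 < x <= c]. The error is then the integral of [h / x], where
   [h = Q(0) / Q(x) <= C (mu / (mu + x))^2k]; expanding this power in powers of
   [1 - x/c] bounds it by sums of the [m_j], and the decay of [m_j] gives the error
   functions with [q = 0]. *)

(** * Elementary inequalities *)

(** The sensitivity of [u] at time n to one edge is a sum over k of products of two correlated
    factors: the gradient of the heat kernel at time t = n-1-k and the gradient of [u] at time k.
    The square of the first has two bounds, valid in every environment: summed over edges it decays
    like t^-(d/2+1); summed over sites with the edge fixed, only like t^-(1+del). Hölder with p-th
    moments interpolates between them and misses the optimal exponent by O(1/p): high moments come
    close to it and never reach it. To reach it, the kernel is averaged over edges independently of
    the gradient. This is possible because the gradient at time k sees only a cube of size about k;
    the price is a small power of k, paid by the decay of the gradients of [u]. Both del > 0 and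
    that decay come with room to spare for d >= 3 and are borderline in dimension two, which is why
    hole filling and total variation appear there. The constant does not depend on k because h
    decreases in k while [Err] is constant in k once k > D/4, with D <= d in all cases: finitely
    many constants remain. *)

Section Inequalities.
Variable R : realType.
Implicit Types (x y : R) (n p : nat).

Lemma pow_tangent p x y : 0 <= x -> 0 <= y ->
  x ^+ p.+1 + p.+1%:R * x ^+ p * (y - x) <= y ^+ p.+1.
Proof.
move=> x0 y0; elim: p => [|p IH]; first by rewrite !expr1 expr0; lra.
have h : y * (x ^+ p.+1 + p.+1%:R * x ^+ p * (y - x)) <= y * y ^+ p.+1 by rewrite ler_wpM2l.
rewrite [in leRHS]exprS; apply: le_trans h.
rewrite -subr_ge0 -(natr1 p.+1) !exprS.
have -> : y * (x * x ^+ p + p.+1%:R * x ^+ p * (y - x)) -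
  (x * (x * x ^+ p) + (p.+1%:R + 1) * (x * x ^+ p) * (y - x)) =
  p.+1%:R * x ^+ p * (y - x) ^+ 2 by ring.
by rewrite mulr_ge0 ?sqr_ge0 // mulr_ge0 ?exprn_ge0.
Qed.

Lemma jensen_pow (I : finType) (l u : I -> R) p :
  (forall i, 0 <= l i) -> \sum_i l i = 1 -> (forall i, 0 <= u i) ->
  (\sum_i l i * u i) ^+ p.+1 <= \sum_i l i * u i ^+ p.+1.
Proof.
move=> l0 l1 u0; set m := \sum_i l i * u i.
have m0 : 0 <= m by rewrite sumr_ge0 // => i _; rewrite mulr_ge0.
have : \sum_i l i * (m ^+ p.+1 + p.+1%:R * m ^+ p * (u i - m)) <= \sum_i l i * u i ^+ p.+1.
  by apply: ler_sum => i _; rewrite ler_wpM2l // pow_tangent.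
suff -> : \sum_i l i * (m ^+ p.+1 + p.+1%:R * m ^+ p * (u i - m)) = m ^+ p.+1 by [].
under eq_bigr do rewrite mulrDr.
rewrite big_split /= -mulr_suml l1 mul1r.
under eq_bigr => i _ do rewrite mulrCA mulrBr.
by rewrite -mulr_sumr sumrB -mulr_suml l1 mul1r -/m subrr mulr0 addr0.
Qed.

Lemma jensen_even (I : finType) (l u : I -> R) p :
  (forall i, 0 <= l i) -> \sum_i l i = 1 ->
  (\sum_i l i * u i) ^+ (2 * p.+1) <= \sum_i l i * u i ^+ (2 * p.+1).
Proof.
move=> l0 l1; rewrite exprM.
have h : (\sum_i l i * u i) ^+ 2 <= \sum_i l i * (u i) ^+ 2.
  set m := \sum_i l i * u i.
  have : 0 <= \sum_i l i * (u i - m) ^+ 2 by apply: sumr_ge0 => i _; rewrite mulr_ge0 ?sqr_ge0.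
  have E (z : R) : \sum_i l i * (u i - z) ^+ 2 =
     \sum_i l i * u i ^+ 2 - 2 * z * \sum_i l i * u i + z ^+ 2 * \sum_i l i.
    by rewrite !mulr_sumr -sumrB -big_split /=; apply: eq_bigr => i _; ring.
  by rewrite E l1 -/m; lra.
apply: le_trans (_ : (\sum_i l i * u i ^+ 2) ^+ p.+1 <= _).
  by rewrite lerXn2r ?nnegrE ?sqr_ge0 // sumr_ge0 // => i _; rewrite mulr_ge0 ?sqr_ge0.
apply: le_trans (jensen_pow _ l0 l1 _) _; first by move=> i; rewrite sqr_ge0.
by apply: ler_sum => i _; rewrite exprM.
Qed.

Lemma sum_sqr_le (I : finType) (l u : I -> R) :
  (forall i, 0 < l i) -> \sum_i l i = 1 ->
  (\sum_i u i) ^+ 2 <= \sum_i u i ^+ 2 / l i.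
Proof.
move=> l0 l1.
have := @jensen_even I l (fun i => u i / l i) 0 (fun i => ltW (l0 i)) l1.
rewrite muln1; have -> : \sum_i l i * (u i / l i) = \sum_i u i.
  by apply: eq_bigr => i _; rewrite mulrC divfK // gt_eqF.
move/le_trans; apply; apply: ler_sum => i _.
by rewrite expr_div_n expr2 mulrC expr2 invfM -!mulrA mulVf ?gt_eqF // mulr1.
Qed.

Lemma pow_limit n (X Y : R) : 0 <= Y ->
  (forall eta, 0 < eta -> X <= (Y + eta) ^+ n.+1) -> X <= Y ^+ n.+1.
Proof.
move=> Y0 h; have [X0|X0] := leP X 0; first by rewrite (le_trans X0) ?exprn_ge0.
pose r := X `^ (n.+1%:R^-1).
have r0 : 0 <= r by exact: powR_ge0.
have rX : r ^+ n.+1 = X by rewrite -powR_mulrn // -powRrM mulVf // powRr1 // ltW.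
suff: r <= Y by move=> rY; rewrite -rX lerXn2r ?nnegrE.
apply/ler_addgt0Pr => eta eta0; move: (h _ eta0); rewrite -rX.
by rewrite ler_pXn2r // nnegrE addr_ge0 // ltW.
Qed.

(* The weights are free: optimizing them over the simplex gives l i = k i / sum k. *)
Lemma minkowski_weights (I : finType) (k : I -> R) (X : R) n :
  (forall i, 0 <= k i) ->
  (forall l : I -> R, (forall i, 0 < l i) -> \sum_i l i = 1 ->
     X <= \sum_i l i * (k i / l i) ^+ n.+1) ->
  (0 < #|I|)%N -> X <= (\sum_i k i) ^+ n.+1.
Proof.
move=> k0 h I0; apply: pow_limit; first exact: sumr_ge0.
move=> eta eta0; pose z := eta / #|I|%:R.
have z0 : 0 < z by rewrite divr_gt0 // ltr0n.
have Se : \sum_i (k i + z) = \sum_i k i + eta.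
  rewrite big_split /= sumr_const -mulr_natr /z -mulrA mulVf ?mulr1 //.
  by rewrite pnatr_eq0 -lt0n.
have S0 : 0 < \sum_i k i + eta by rewrite ltr_wpDl // sumr_ge0.
set Sm := \sum_i k i + eta in Se S0 *.
pose l i := (k i + z) / Sm.
have l0 i : 0 < l i by rewrite divr_gt0 // ltr_wpDl.
apply: le_trans (h l l0 _) _; first by rewrite -mulr_suml Se divff ?gt_eqF.
apply: (@le_trans _ _ (\sum_i l i * Sm ^+ n.+1)); last first.
  by rewrite -mulr_suml /l -mulr_suml Se divff ?gt_eqF // mul1r.
apply: ler_sum => i _; rewrite ler_wpM2l ?(ltW (l0 _)) //.
have kl : 0 <= k i / l i by exact: divr_ge0 (k0 i) (ltW (l0 i)).
rewrite lerXn2r ?nnegrE ?(ltW S0) //.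
rewrite ler_pdivrMr // /l mulrC divfK ?gt_eqF //.
by rewrite lerDl ltW.
Qed.

(** Weight in time. The base n+1 keeps negative exponents meaningful at time 0, where the weight is
    1. *)
Definition pw n x : R := n.+1%:R `^ x.

Lemma pw_gt0 n x : 0 < pw n x. Proof. by rewrite powR_gt0 // ltr0n. Qed.
Lemma pw_ge0 n x : 0 <= pw n x. Proof. exact: powR_ge0. Qed.
Lemma pwD n x y : pw n (x + y) = pw n x * pw n y.
Proof. by rewrite /pw powRD // pnatr_eq0 implybT. Qed.
Lemma pw0 n : pw n 0 = 1. Proof. exact: powRr0. Qed.
Lemma pw1 n : pw n 1 = n.+1%:R. Proof. by rewrite /pw powRr1. Qed.
Lemma pwN n x : pw n (- x) = (pw n x)^-1. Proof. exact: powRN. Qed.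
Lemma pwV n x : pw n x * pw n (- x) = 1.
Proof. by rewrite -pwD subrr pw0. Qed.
Lemma pw_exp n x k : pw n x ^+ k = pw n (x * k%:R).
Proof. by rewrite -powR_mulrn ?pw_ge0 // -powRrM. Qed.
Lemma pw0n x : pw 0 x = 1. Proof. by rewrite /pw powR1. Qed.

Lemma pw_ler n x y : x <= y -> pw n x <= pw n y.
Proof. by move=> h; apply: ler_powR => //; rewrite ler1n. Qed.

Lemma pw_anti m n x : x <= 0 -> (m <= n)%N -> pw n x <= pw m x.
Proof.
move=> x0 mn; rewrite -(opprK x) ![pw _ (- - x)]pwN lef_pV2 ?posrE ?pw_gt0 //.
by rewrite /pw ge0_ler_powR ?nnegrE ?ler0n ?ler_nat // lerNr oppr0.
Qed.

Lemma pw_mono m n x : 0 <= x -> (m <= n)%N -> pw m x <= pw n x.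
Proof. by move=> x0 mn; rewrite ge0_ler_powR ?nnegrE ?ler0n ?ler_nat. Qed.

Lemma pw_scale K m n x : x <= 0 -> (n < K * m.+1)%N ->
  pw m x <= K%:R `^ (- x) * pw n x.
Proof.
move=> x0 nm; have K0 : (0 < K)%N by case: K nm.
have h : n.+1%:R `^ (- x) <= K%:R `^ (- x) * m.+1%:R `^ (- x) :> R.
  rewrite -powRM ?ler0n // -natrM ge0_ler_powR ?nnegrE ?ler0n ?ler_nat //; lra.
have hn := pw_gt0 n (- x); have hm := pw_gt0 m (- x).
rewrite -[in leLHS](opprK x) -[in pw n x](opprK x) ![pw _ (- - x)]pwN.
by rewrite ler_pdivlMr // mulrC ler_pdivrMr // mulrC [leRHS]mulrC.
Qed.

Lemma pw_root n x k : (0 < k)%N -> pw n (x / k%:R) ^+ k = pw n x.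
Proof. by move=> k0; rewrite pw_exp divfK // pnatr_eq0 -lt0n. Qed.

Definition rt q (x : R) : R := x `^ q%:R^-1.
Lemma rt_ge0 q x : 0 <= rt q x. Proof. exact: powR_ge0. Qed.
Lemma rtK q x : (0 < q)%N -> 0 <= x -> rt q x ^+ q = x.
Proof.
move=> q0 x0; rewrite /rt -powR_mulrn ?powR_ge0 // -powRrM mulVf ?powRr1 //.
by rewrite pnatr_eq0 -lt0n.
Qed.
Lemma rt_le q (x y : R) : (0 < q)%N -> 0 <= x -> 0 <= y -> x <= y ^+ q -> rt q x <= y.
Proof.
move=> q0 x0 y0 h; rewrite -(@ler_pXn2r _ q) ?nnegrE ?rt_ge0 // rtK //.
Qed.

Lemma norm_even (y : R) p : `|y| ^+ (2 * p) = y ^+ (2 * p).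
Proof. by rewrite !exprM real_normK ?num_real. Qed.

End Inequalities.

(** * Random walks on a finite quotient of the lattice *)

Section Walk.
Variables (R : realType) (V : finZmodType) (d : nat) (e : 'I_d -> V).
Implicit Types (f g : V -> R) (a b : V * 'I_d -> R) (E : V * 'I_d).

Definition dg E f : R := f (E.1 + e E.2) - f E.1.
Definition dot f g : R := \sum_x f x * g x.
Definition lap a f x : R :=
  \sum_i (a (x, i) * (f x - f (x + e i)) + a (x - e i, i) * (f x - f (x - e i))).
Definition gradsq f : R := \sum_E dg E f ^+ 2.
Definition delta (y x : V) : R := (x == y)%:R.
(** The dipole carried by an edge. By symmetry of the walk, its evolution is the gradient of the
    heat kernel in the starting point. *)
Definition dlt E (x : V) : R := delta (E.1 + e E.2) x - delta E.1 x.

Lemma sum_edges (F : V * 'I_d -> R) : \sum_E F E = \sum_x \sum_i F (x, i).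
Proof. by rewrite pair_bigA /=; apply: eq_bigr => -[]. Qed.

Lemma sum_shift (F : V -> R) y : \sum_x F (x + y) = \sum_x F x.
Proof. by rewrite [RHS](reindex_inj (addIr y)). Qed.

(* Each edge has two endpoints; [F x y E] is a contribution of the edge [E] seen from [x]. *)
Lemma sum_nbrs (F : V -> V -> V * 'I_d -> R) :
  \sum_x \sum_i (F x (x + e i) (x, i) + F x (x - e i) (x - e i, i)) =
  \sum_E (F E.1 (E.1 + e E.2) E + F (E.1 + e E.2) E.1 E).
Proof.
rewrite (sum_edges (fun E => F E.1 (E.1 + e E.2) E + F (E.1 + e E.2) E.1 E)) exchange_big /=.
rewrite [RHS]exchange_big; apply: eq_bigr => i _ /=.
rewrite !big_split /=; congr (_ + _).
by rewrite -(sum_shift _ (e i)); apply: eq_bigr => x _; rewrite addrK.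
Qed.

Lemma dot_lap a f g : dot f (lap a g) = \sum_E a E * dg E f * dg E g.
Proof.
rewrite /dot; under eq_bigr do rewrite /lap mulr_sumr.
under eq_bigr => x _ do under eq_bigr => i _ do rewrite mulrDr.
rewrite (sum_nbrs (fun x y E => f x * (a E * (g x - g y)))).
by apply: eq_bigr => -[x i] _; rewrite /dg /=; ring.
Qed.

Lemma dotC f g : dot f g = dot g f.
Proof. by apply: eq_bigr => x _; rewrite mulrC. Qed.
Lemma dotBr f g h : dot f (fun x => g x - h x) = dot f g - dot f h.
Proof. by rewrite /dot -sumrB; apply: eq_bigr => x _; rewrite mulrBr. Qed.
Lemma dotZr k f g : dot f (fun x => k * g x) = k * dot f g.
Proof. by rewrite /dot mulr_sumr; apply: eq_bigr => x _; rewrite mulrCA. Qed.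
Lemma dotBl f g h : dot (fun x => f x - g x) h = dot f h - dot g h.
Proof. by rewrite dotC dotBr !(dotC h). Qed.
Lemma dot_sumr (I : finType) f (F : I -> V -> R) :
  dot f (fun x => \sum_j F j x) = \sum_j dot f (F j).
Proof.
by rewrite /dot exchange_big; apply: eq_bigr => x _; rewrite mulr_sumr.
Qed.
Lemma sq_ge0 f : 0 <= dot f f.
Proof. by rewrite sumr_ge0 // => x _; rewrite -expr2 sqr_ge0. Qed.

Lemma dot_delta y f : dot (delta y) f = f y.
Proof.
rewrite /dot (bigD1 y) //= /delta eqxx mul1r big1 ?addr0 // => x /negPf ->.
by rewrite mul0r.
Qed.
Lemma dot_dlt E f : dot (dlt E) f = dg E f.
Proof. by rewrite dotBl !dot_delta. Qed.

Lemma dot_CS f g : dot f g ^+ 2 <= dot f f * dot g g.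
Proof.
have q (t : R) : 0 <= dot f f - 2 * t * dot f g + t ^+ 2 * dot g g.
  have := sq_ge0 (fun x => f x - t * g x).
  rewrite dotBl !dotBr !dotZr !(dotC (fun x => t * g x)) !dotZr; lra.
have [g0|g0] := leP (dot g g) 0.
  have g0' : dot g g = 0 by apply/eqP; rewrite eq_le g0 sq_ge0.
  have gx x : g x = 0.
    have /psumr_eq0P -/(_ _ x isT) : \sum_x g x * g x = 0 by [].
    move=> H; apply/eqP; rewrite -sqrf_eq0 expr2; apply/eqP; apply: H => y _.
    by rewrite -expr2 sqr_ge0.
  have -> : dot f g = 0 by rewrite /dot big1 // => x _; rewrite gx mulr0.
  by rewrite expr0n mulr_ge0 ?sq_ge0.
have := q (dot f g / dot g g); set D := dot f g; set G := dot g g in g0 *.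
have -> : dot f f - 2 * (D / G) * D + (D / G) ^+ 2 * G = dot f f - D ^+ 2 / G.
  by field; lra.
by rewrite subr_ge0 ler_pdivrMr.
Qed.

Lemma lapB a f g x : lap a (fun y => f y - g y) x = lap a f x - lap a g x.
Proof. by rewrite /lap -sumrB; apply: eq_bigr => i _; ring. Qed.
Lemma lapD a f g x : lap a (fun y => f y + g y) x = lap a f x + lap a g x.
Proof. by rewrite /lap -big_split; apply: eq_bigr => i _ /=; ring. Qed.
Lemma lapZ a k f x : lap a (fun y => k * f y) x = k * lap a f x.
Proof. by rewrite /lap mulr_sumr; apply: eq_bigr => i _; ring. Qed.

Variables (alpha beta : R).
Hypotheses (d_gt0 : (0 < d)%N) (alpha_gt0 : 0 < alpha) (le_ab : alpha <= beta).
Definition elliptic a := forall E, alpha <= a E <= beta.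

(* With this normalization the walk generated by [Tw] is lazy: it stays put with probability at least 1/2. *)
Fact cst_key : unit. Proof. by []. Qed.
Definition cst : R := locked_with cst_key (4 * d%:R * beta).
Lemma cstE : cst = 4 * d%:R * beta. Proof. by rewrite /cst unlock. Qed.

Definition Sw a f x : R := cst^-1 * lap a f x.
Definition Tw a f x : R := f x - Sw a f x.
Definition Tn a n f := iter n (Tw a) f.
Definition En a f : R := dot f (Sw a f).

Lemma beta_gt0 : 0 < beta. Proof. exact: lt_le_trans le_ab. Qed.
Lemma dR_gt0 : 0 < d%:R :> R. Proof. by rewrite ltr0n. Qed.
Lemma cst_gt0 : 0 < cst.
Proof. by rewrite cstE !mulr_gt0 // ?dR_gt0 // beta_gt0. Qed.

Lemma EnE a f : En a f = cst^-1 * \sum_E a E * dg E f ^+ 2.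
Proof.
rewrite /En /Sw dotZr dot_lap; congr (_ * _).
by apply: eq_bigr => E _; rewrite expr2 mulrA.
Qed.

Lemma dot_S a f g : dot f (Sw a g) = dot (Sw a f) g.
Proof.
rewrite [RHS]dotC /Sw !dotZr !dot_lap; congr (_ * _).
by apply: eq_bigr => E _; rewrite mulrAC.
Qed.
Lemma dot_T a f g : dot f (Tw a g) = dot (Tw a f) g.
Proof. by rewrite dotBr dotBl dot_S. Qed.
Lemma dot_Tn a n f g : dot f (Tn a n g) = dot (Tn a n f) g.
Proof.
elim: n f => //= n IH f; rewrite dot_T IH /Tn; congr dot.
by rewrite -iterS iterSr.
Qed.
Lemma TnD a m n f : Tn a (m + n) f = Tn a m (Tn a n f).
Proof. exact: iterD. Qed.

Lemma TB a f g x : Tw a (fun y => f y - g y) x = Tw a f x - Tw a g x.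
Proof. by rewrite /Tw /Sw lapB; ring. Qed.
Lemma TD a f g x : Tw a (fun y => f y + g y) x = Tw a f x + Tw a g x.
Proof. by rewrite /Tw /Sw lapD; ring. Qed.
Lemma TZ a k f x : Tw a (fun y => k * f y) x = k * Tw a f x.
Proof. by rewrite /Tw /Sw lapZ; ring. Qed.
Lemma TnB a n f g x : Tn a n (fun y => f y - g y) x = Tn a n f x - Tn a n g x.
Proof.
elim: n x => //= n IH x; rewrite -TB; congr Tw; apply/funext => y; exact: IH.
Qed.
Lemma TnDl a n f g x : Tn a n (fun y => f y + g y) x = Tn a n f x + Tn a n g x.
Proof.
elim: n x => //= n IH x; rewrite -TD; congr Tw; apply/funext => y; exact: IH.
Qed.
Lemma TnZ a n k f x : Tn a n (fun y => k * f y) x = k * Tn a n f x.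
Proof.
elim: n x => //= n IH x; rewrite -TZ; congr Tw; apply/funext => y; exact: IH.
Qed.
Lemma Tn_sum a n (I : finType) (F : I -> V -> R) x :
  Tn a n (fun y => \sum_j F j y) x = \sum_j Tn a n (F j) x.
Proof.
rewrite -[LHS]dot_delta dot_Tn dot_sumr; apply: eq_bigr => j _.
by rewrite -dot_Tn dot_delta.
Qed.

Lemma sum_T a f : \sum_x Tw a f x = \sum_x f x.
Proof.
have -> : \sum_x Tw a f x = dot (fun _ => 1) (Tw a f).
  by apply: eq_bigr => x _; rewrite mul1r.
rewrite /Tw dotBr /Sw dotZr dot_lap [X in _ - _ * X]big1 ?mulr0 ?subr0.
  by apply: eq_bigr => x _; rewrite mul1r.
by move=> E _; rewrite /dg subrr mulr0 mul0r.
Qed.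
Lemma sum_Tn a n f : \sum_x Tn a n f x = \sum_x f x.
Proof. by elim: n => //= n IH; rewrite sum_T. Qed.

Section Elliptic.
Variable a : V * 'I_d -> R.
Hypothesis ha : elliptic a.

Let a_ge0 E : 0 <= a E.
Proof. by have /andP[h _] := ha E; exact: le_trans (ltW alpha_gt0) h. Qed.

Lemma sum_cond_le x : \sum_i (a (x, i) + a (x - e i, i)) <= cst / 2.
Proof.
apply: (@le_trans _ _ (\sum_(i < d) (beta + beta))).
  by apply: ler_sum => i _; apply: lerD; [case/andP: (ha (x, i))|case/andP: (ha (x - e i, i))].
by rewrite sumr_const card_ord -mulr_natr cstE; lra.
Qed.

(** Cauchy-Schwarz with the conductances at [x] as weights; their total is at most [cst / 2], which
    produces the factor 1/(2 cst). *)
Lemma S_sqr_le f x : Sw a f x ^+ 2 <= (2 * cst)^-1 *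
  \sum_i (a (x, i) * (f x - f (x + e i)) ^+ 2 + a (x - e i, i) * (f x - f (x - e i)) ^+ 2).
Proof.
set Q := \sum_i _; have c0 := cst_gt0.
have key (t : R) : 0 <= Q - 2 * t * lap a f x + t ^+ 2 * \sum_i (a (x, i) + a (x - e i, i)).
  rewrite /Q /lap !mulr_sumr -sumrB -big_split /=; apply: sumr_ge0 => i _.
  have h1 := mulr_ge0 (a_ge0 (x, i)) (sqr_ge0 (f x - f (x + e i) - t)).
  have h2 := mulr_ge0 (a_ge0 (x - e i, i)) (sqr_ge0 (f x - f (x - e i) - t)).
  lra.
(* The minimizer in [t] when the total conductance at [x] takes its largest value [cst / 2]. *)
have := key (2 / cst * lap a f x); rewrite /Sw.
set s := \sum_i _ => h; have hs : s <= cst / 2 := sum_cond_le x.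
have h2 : (2 / cst * lap a f x) ^+ 2 * s <= (2 / cst * lap a f x) ^+ 2 * (cst / 2).
  by rewrite ler_wpM2l ?sqr_ge0.
have h3 : 0 <= Q - 2 / cst * lap a f x ^+ 2.
  apply: (le_trans h); rewrite -subr_ge0; move: h2; rewrite -subr_ge0; congr (0 <= _).
  by field; lra.
have -> : (2 * cst)^-1 * Q = (cst^-1 * lap a f x) ^+ 2 + (2 * cst)^-1 * (Q - 2 / cst * lap a f x ^+ 2).
  by field; lra.
by rewrite lerDl mulr_ge0 // invr_ge0; lra.
Qed.

Lemma S_weighted (w f : V -> R) : (forall x, 0 <= w x) ->
  \sum_x w x * Sw a f x ^+ 2 <= (2 * cst)^-1 *
    \sum_E a E * (w E.1 + w (E.1 + e E.2)) * dg E f ^+ 2.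
Proof.
move=> w0; have -> : \sum_E a E * (w E.1 + w (E.1 + e E.2)) * dg E f ^+ 2 =
  \sum_E (w E.1 * (a E * (f E.1 - f (E.1 + e E.2)) ^+ 2) +
          w (E.1 + e E.2) * (a E * (f (E.1 + e E.2) - f E.1) ^+ 2)).
  by apply: eq_bigr => E _; rewrite /dg; ring.
rewrite -(sum_nbrs (fun x y E => w x * (a E * (f x - f y) ^+ 2))) mulr_sumr.
apply: ler_sum => x _; under eq_bigr => i _ do rewrite -mulrDr.
by rewrite -[in leRHS]mulr_sumr [leRHS]mulrCA; apply: ler_wpM2l => //; exact: S_sqr_le.
Qed.

(** Laziness: [Sw] lies between 0 and 1 as a quadratic form, so its square is below itself. *)
Lemma sqS_le f : dot (Sw a f) (Sw a f) <= En a f.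
Proof.
have := @S_weighted (fun _ => 1) f (fun _ => ler01); rewrite EnE.
under eq_bigr do rewrite mul1r expr2.
move/le_trans; apply; rewrite invfM [2^-1 * _]mulrC -mulrA ler_wpM2l ?invr_ge0 ?(ltW cst_gt0) //.
rewrite mulr_sumr; apply: ler_sum => E _.
by rewrite le_eqVlt; apply/orP; left; apply/eqP; field.
Qed.

Lemma En_ge0 f : 0 <= En a f.
Proof.
rewrite EnE mulr_ge0 ?invr_ge0 ?(ltW cst_gt0) // sumr_ge0 // => E _.
by rewrite mulr_ge0 ?sqr_ge0.
Qed.

Lemma sqT f : dot (Tw a f) (Tw a f) = dot f f - 2 * En a f + dot (Sw a f) (Sw a f).
Proof. by rewrite /Tw dotBl !dotBr -dot_S /En; ring. Qed.

Lemma sqT_le f : dot (Tw a f) (Tw a f) <= dot f f - En a f.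
Proof. by rewrite sqT; have := sqS_le f; lra. Qed.

Lemma sqT_mono f : dot (Tw a f) (Tw a f) <= dot f f.
Proof. by have := sqT_le f; have := En_ge0 f; lra. Qed.

Lemma En_le f : En a f <= dot f f.
Proof. by have := sqT_le f; have := sq_ge0 (Tw a f); lra. Qed.

(** Expanding, the new energy is [En f] minus twice the squared norm of [Sw f] plus the energy of
    [Sw f], and the last term is at most that squared norm. *)
Lemma En_T_le f : En a (Tw a f) <= En a f.
Proof.
have ST : Sw a (Tw a f) = fun x => Sw a f x - Sw a (Sw a f) x.
  by apply/funext => x; rewrite /Sw /Tw lapB mulrBr.
rewrite {1}/En ST {1}/Tw dotBl !dotBr -[dot f (Sw a (Sw a f))]/(dot f (Sw a _)) (dot_S a f (Sw a f)).
have := En_le (Sw a f); rewrite /En.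
have := sqS_le f; have := sq_ge0 (Sw a f); rewrite /En; lra.
Qed.

Lemma Tn_sq_mono f m n : (m <= n)%N -> dot (Tn a n f) (Tn a n f) <= dot (Tn a m f) (Tn a m f).
Proof.
move=> /subnK <-; elim: (n - m)%N => // k IH.
by rewrite addSn; apply: le_trans IH; exact: sqT_mono.
Qed.

(** Each step lowers the squared norm by at least the current energy, and energies decrease; so m+1
    times the last energy is at most the total loss. *)
Lemma En_decay f m : m.+1%:R * En a (Tn a m f) <= dot f f.
Proof.
have Em k n : (k <= n)%N -> En a (Tn a n f) <= En a (Tn a k f).
  move=> /subnK <-; elim: (n - k)%N => // j IH.
  by rewrite addSn; apply: le_trans IH; exact: En_T_le.
suff h : \sum_(k < m.+1) En a (Tn a k f) + dot (Tn a m.+1 f) (Tn a m.+1 f) <= dot f f.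
  apply: le_trans h; rewrite -[leLHS]addr0 lerD ?sq_ge0 //.
  rewrite -[m.+1 in leLHS]card_ord mulr_natl -sumr_const; apply: ler_sum => k _.
  by apply: Em; rewrite -ltnS.
elim: m.+1 => [|n IH]; first by rewrite big_ord0 add0r.
rewrite big_ord_recr /=; apply: le_trans IH; rewrite -addrA lerD2l.
by have := sqT_le (Tn a n f); rewrite /Tn; lra.
Qed.

Lemma gradsq_En f : alpha * gradsq f <= cst * En a f.
Proof.
rewrite EnE mulrA divff ?gt_eqF ?cst_gt0 // mul1r /gradsq mulr_sumr.
by apply: ler_sum => E _; rewrite ler_wpM2r ?sqr_ge0 //; case/andP: (ha E).
Qed.

Lemma gradsq_Tn f m : gradsq (Tn a m f) <= cst / alpha * dot f f / m.+1%:R.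
Proof.
rewrite ler_pdivlMr ?ltr0n // mulrAC ler_pdivlMr //.
have := gradsq_En (Tn a m f); have := En_decay f m => h1 h2.
have h3 : cst * (m.+1%:R * En a (Tn a m f)) <= cst * dot f f by rewrite ler_pM2l ?cst_gt0.
have h4 : m.+1%:R * (alpha * gradsq (Tn a m f)) <= m.+1%:R * (cst * En a (Tn a m f)).
  by rewrite ler_wpM2l.
by apply: le_trans h3; rewrite mulrCA; apply: le_trans h4; rewrite le_eqVlt; apply/orP; left; apply/eqP; ring.
Qed.

Lemma TE f x : Tw a f x = (1 - cst^-1 * \sum_i (a (x, i) + a (x - e i, i))) * f x
  + cst^-1 * \sum_i (a (x, i) * f (x + e i) + a (x - e i, i) * f (x - e i)).
Proof.
rewrite /Tw /Sw; have -> : lap a f x = (\sum_i (a (x, i) + a (x - e i, i))) * f x -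
    \sum_i (a (x, i) * f (x + e i) + a (x - e i, i) * f (x - e i)).
  by rewrite /lap mulr_suml -sumrB; apply: eq_bigr => i _; ring.
by ring.
Qed.

Lemma T_ge0 f : (forall x, 0 <= f x) -> forall x, 0 <= Tw a f x.
Proof.
move=> f0 x; rewrite TE addr_ge0 // mulr_ge0 ?invr_ge0 ?(ltW cst_gt0) ?f0 //; last first.
  by rewrite sumr_ge0 // => i _; rewrite addr_ge0 // mulr_ge0.
rewrite subr_ge0 ler_pdivrMl ?cst_gt0 // mulr1; apply: le_trans (sum_cond_le x) _.
by have := cst_gt0; lra.
Qed.

Lemma Tn_ge0 f n : (forall x, 0 <= f x) -> forall x, 0 <= Tn a n f x.
Proof. by move=> f0; elim: n => //= n IH; exact: T_ge0. Qed.

Lemma Tn_abs f n x : `|Tn a n f x| <= Tn a n (fun y => `|f y|) x.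
Proof.
have h1 : 0 <= Tn a n (fun y => `|f y| - f y) x.
  by apply: Tn_ge0 => y; rewrite subr_ge0 ler_norm.
have h2 : 0 <= Tn a n (fun y => `|f y| + f y) x.
  by apply: Tn_ge0 => y; have := ler_norm (- f y); rewrite normrN; lra.
rewrite ler_norml; move: h1 h2; rewrite TnB TnDl; lra.
Qed.

Lemma Tn_l1 f n : \sum_x `|Tn a n f x| <= \sum_x `|f x|.
Proof.
rewrite -(sum_Tn a n (fun y => `|f y|)); apply: ler_sum => x _; exact: Tn_abs.
Qed.

Lemma sum_delta y : \sum_x delta y x = 1.
Proof.
rewrite /delta (bigD1 y) //= eqxx big1 ?addr0 // => x /negPf -> //.
Qed.

Lemma Tn_delta_l1 n y : \sum_x `|Tn a n (delta y) x| = 1.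
Proof.
rewrite -[RHS](sum_delta y) -(sum_Tn a n); apply: eq_bigr => x _.
by rewrite ger0_norm // Tn_ge0 // => z; rewrite /delta ler0n.
Qed.

End Elliptic.
End Walk.
Arguments delta {R V} y x.
Arguments dlt {R V d} e E x.

(** * Nash inequality and heat-kernel decay *)

Lemma sum_inj_le (R : realType) (I J : finType) (h : I -> J) (F : J -> R) :
  injective h -> (forall j, 0 <= F j) -> \sum_i F (h i) <= \sum_j F j.
Proof.
move=> hi F0; rewrite -(big_imset _ (in2W hi)) /=.
rewrite [leRHS](bigID (mem [set h x | x in xpredT]%SET)) /= lerDl sumr_ge0 //.
Qed.

Section Nash.
Variables (R : realType) (V : finZmodType) (d : nat) (e : 'I_d -> V).
Implicit Types (f : V -> R) (k l : 'I_d -> nat).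

Definition lat k : V := \sum_i e i *+ k i.

(* The box of side N embeds: up to that scale the quotient V of Z^d looks like Z^d. *)
Definition torus N := forall k l, (forall i, k i < N)%N -> (forall i, l i < N)%N ->
  lat k = lat l -> k =1 l.

(** Cauchy-Schwarz along a path, by induction on its length m: Young's inequality with weights 1 +
    1/m and 1 + m gives both terms the constant m + 1. *)
Lemma path_sq f (s : seq 'I_d) :
  \sum_x (f (x + \sum_(i <- s) e i) - f x) ^+ 2 <=
  (size s)%:R * \sum_(i <- s) \sum_x dg e (x, i) f ^+ 2.
Proof.
elim: s => [|j s IH].
  by rewrite !big_nil mul0r big1 // => x _; rewrite addr0 subrr expr0n.
rewrite !big_cons /=; set y := \sum_(i <- s) e i in IH *.
set W := \sum_(i <- s) _ in IH *; set D := \sum_x dg e (x, j) f ^+ 2.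
have D0 : 0 <= D by rewrite sumr_ge0 // => x _; rewrite sqr_ge0.
have W0 : 0 <= W by rewrite sumr_ge0 // => i _; rewrite sumr_ge0 // => x _; rewrite sqr_ge0.
have [s0|s0] := posnP (size s).
  have y0 : y = 0 by rewrite /y (size0nil s0) big_nil.
  have -> : W = 0 by rewrite /W (size0nil s0) big_nil.
  rewrite s0 mul1r addr0; apply: ler_sum => x _; by rewrite y0 addr0.
have m0 : 0 < (size s)%:R :> R by rewrite ltr0n.
set m : R := (size s)%:R in IH m0 *.
apply: (@le_trans _ _ (\sum_x ((1 + m^-1) * (f (x + e j + y) - f (x + e j)) ^+ 2
   + (1 + m) * dg e (x, j) f ^+ 2))).
  apply: ler_sum => x _; rewrite addrA /dg /=.
  set A := f (x + e j + y); set B := f (x + e j); set C := f x.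
  have h : 0 <= m^-1 * ((A - B) - m * (B - C)) ^+ 2 by rewrite mulr_ge0 ?sqr_ge0 // invr_ge0 ltW.
  rewrite -subr_ge0; apply: (le_trans h); rewrite le_eqVlt; apply/orP; left; apply/eqP.
  by field; lra.
rewrite big_split /= -!mulr_sumr.
rewrite (sum_shift (fun z => (f (z + y) - f z) ^+ 2) (e j)) -/D.
rewrite -natr1 -/m mulrDr addrC [m + 1]addrC lerD2l.
have h : (1 + m^-1) * \sum_x (f (x + y) - f x) ^+ 2 <= (1 + m^-1) * (m * W).
  by rewrite ler_wpM2l // addr_ge0 // invr_ge0 ltW.
by apply: le_trans h _; rewrite le_eqVlt; apply/orP; left; apply/eqP; field; lra.
Qed.

Lemma big_lat_path (M : nmodType) (F : 'I_d -> M) k :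
  \sum_(i <- flatten [seq nseq (k i) i | i <- enum 'I_d]) F i = \sum_i F i *+ k i.
Proof.
rewrite big_flatten big_map big_enum /=; apply: eq_bigr => i _.
by rewrite big_nseq; elim: (k i) => //= n ->; rewrite mulrS.
Qed.

Lemma shift_sq f k r : (forall i, k i <= r)%N ->
  \sum_x (f (x + lat k) - f x) ^+ 2 <= d%:R * r%:R ^+ 2 * gradsq e f.
Proof.
move=> kr; have := path_sq f (flatten [seq nseq (k i) i | i <- enum 'I_d]).
rewrite !big_lat_path -/(lat k) => /le_trans; apply.
have D0 i : 0 <= \sum_x dg e (x, i) f ^+ 2 by rewrite sumr_ge0 // => x _; rewrite sqr_ge0.
have h1 : (size (flatten [seq nseq (k i) i | i <- enum 'I_d]) <= d * r)%N.
  rewrite -sum1_size big_lat_path (leq_trans (n := \sum_(i < d) r)) //.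
    have mulrn1 n : (1%N *+ n)%R = n by elim: n => // n IH; rewrite mulrS IH.
    by apply: leq_sum => i _; rewrite mulrn1.
  by rewrite sum_nat_const card_ord.
have h2 : \sum_i (\sum_x dg e (x, i) f ^+ 2) *+ k i <= r%:R * gradsq e f.
  rewrite /gradsq sum_edges exchange_big mulr_sumr; apply: ler_sum => i _.
  by rewrite -mulr_natl ler_wpM2r // ler_nat.
move: h1; rewrite -(ler_nat R) => h1.
have := ler_pM (ler0n _ _) (sumr_ge0 _ (fun i _ => mulrn_wge0 (k i) (D0 i))) h1 h2.
move=> /le_trans; apply.
by rewrite natrM le_eqVlt; apply/orP; left; apply/eqP; ring.
Qed.

(** [f] is compared with its average [A] over boxes of side [r]. The difference is controlled by
    gradients along paths; since boxes of side at most [N] embed, [A] is pointwise at most r^-d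
    times the [l^1] norm. *)
Lemma nash f N r : torus N -> (0 < r <= N)%N ->
  dot f f <= 2 * (d%:R * r%:R ^+ 2) * gradsq e f + 2 * (r%:R ^+ d)^-1 * (\sum_x `|f x|) ^+ 2.
Proof.
move=> tor /andP[r0 rN].
pose K := {ffun 'I_d -> 'I_r}; pose w : R := (r%:R ^+ d)^-1.
have rd0 : 0 < r%:R ^+ d :> R by rewrite exprn_gt0 // ltr0n.
have w0 : 0 < w by rewrite invr_gt0.
have wK : \sum_(k : K) w = 1.
  by rewrite sumr_const card_ffun !card_ord -mulr_natl natrX divff // gt_eqF.
pose y (k : K) := lat (fun i => k i).
pose A x := \sum_(k : K) w * f (x + y k).
have yinj : injective y.
  move=> k l /tor h; apply/ffunP => i; apply/val_inj; apply: h => j.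
    exact: leq_trans (ltn_ord _) rN.
  exact: leq_trans (ltn_ord _) rN.
have h1 : \sum_x (A x - f x) ^+ 2 <= d%:R * r%:R ^+ 2 * gradsq e f.
  apply: (@le_trans _ _ (\sum_x \sum_(k : K) w * (f (x + y k) - f x) ^+ 2)).
    apply: ler_sum => x _.
    have := @jensen_even R K (fun=> w) (fun k : K => f (x + y k) - f x) 0 (fun=> ltW w0) wK.
    rewrite muln1; suff -> : \sum_k w * (f (x + y k) - f x) = A x - f x by [].
    under eq_bigr do rewrite mulrBr.
    by rewrite sumrB -mulr_suml wK mul1r.
  rewrite exchange_big /=.
  apply: (@le_trans _ _ (\sum_(k : K) w * (d%:R * r%:R ^+ 2 * gradsq e f))).
    apply: ler_sum => k _; rewrite -mulr_sumr ler_wpM2l ?(ltW w0) //.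
    by apply: shift_sq => i; rewrite ltnW.
  by rewrite -mulr_suml wK mul1r.
have Abd x : `|A x| <= w * \sum_z `|f z|.
  rewrite /A -mulr_sumr normrM (gtr0_norm w0) ler_wpM2l ?(ltW w0) //.
  apply: le_trans (ler_norm_sum _ _ _) _.
  apply: (@sum_inj_le R _ V (fun k : K => x + y k) (fun z => `|f z|)) => // k l /addrI; exact: yinj.
have A1 : \sum_x `|A x| <= \sum_z `|f z|.
  apply: (@le_trans _ _ (\sum_x \sum_(k : K) w * `|f (x + y k)|)).
    apply: ler_sum => x _; apply: le_trans (ler_norm_sum _ _ _) _.
    by apply: ler_sum => k _; rewrite normrM (gtr0_norm w0).
  rewrite exchange_big /=; under eq_bigr => k _ do rewrite -mulr_sumr (sum_shift (fun z => `|f z|)).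
  by rewrite -mulr_suml wK mul1r.
have h2 : \sum_x A x ^+ 2 <= w * (\sum_x `|f x|) ^+ 2.
  rewrite expr2 mulrA; apply: (@le_trans _ _ (\sum_x (w * \sum_z `|f z|) * `|A x|)).
    by apply: ler_sum => x _; rewrite -real_normK ?num_real // expr2 ler_wpM2r.
  rewrite -mulr_sumr ler_wpM2l // mulr_ge0 ?(ltW w0) // sumr_ge0 // => z _; exact: normr_ge0.
have -> : 2 * (d%:R * r%:R ^+ 2) * gradsq e f + 2 * (r%:R ^+ d)^-1 * (\sum_x `|f x|) ^+ 2 =
  2 * (d%:R * r%:R ^+ 2 * gradsq e f + w * (\sum_x `|f x|) ^+ 2) by rewrite -/w; ring.
apply: (@le_trans _ _ (2 * (\sum_x (A x - f x) ^+ 2 + \sum_x A x ^+ 2))).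
  rewrite -big_split mulr_sumr; apply: ler_sum => x _ /=.
  by have := sqr_ge0 (2 * A x - f x); lra.
by rewrite ler_pM2l // lerD.
Qed.

End Nash.

Lemma max_sqr_scale (K n : nat) : (0 < K)%N ->
  exists r, (r ^ 2 * K <= n < r.+1 ^ 2 * K)%N.
Proof.
move=> K0; have ex : exists r, (r ^ 2 * K <= n)%N by exists 0%N.
have ub r : (r ^ 2 * K <= n)%N -> (r <= n)%N.
  move=> h; apply: leq_trans h; rewrite -[X in (X <= _)%N]muln1 leq_mul //.
  by rewrite -mulnn; case: r => // r; rewrite leq_pmulr.
case: (ex_maxnP ex ub) => r h1 h2; exists r; rewrite h1 /= ltnNge; apply/negP => /h2.
by rewrite ltnn.
Qed.

Lemma half_double_le m : ((m./2).*2 <= m)%N.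
Proof. by rewrite -[leqRHS]odd_double_half leq_addl. Qed.

Lemma half_le m : (m./2 <= m)%N.
Proof. lia. Qed.

Lemma half_scale m : (m < 2 * (m./2).+1)%N.
Proof. lia. Qed.

Lemma scale_half m n r K : (0 < r)%N -> (m < 2 * n.+1)%N -> (n.+1 < r.+1 ^ 2 * K)%N ->
  (m.+1 <= 8 * K * r ^ 2)%N.
Proof.
move=> r0 mn r2; have h : (r.+1 ^ 2 <= 4 * r ^ 2)%N.
  by rewrite -[4%N]/(2 ^ 2)%N -expnMn leq_exp2r // mul2n -addnn -addn1 leq_add2l.
have h' : (r.+1 ^ 2 * K <= 4 * r ^ 2 * K)%N by rewrite leq_mul2r h orbT.
rewrite -mulnA [(K * _)%N]mulnC; rewrite -mulnA in h'.
move: r2 mn h'; move: (r ^ 2 * K)%N (r.+1 ^ 2 * K)%N => Z Z2; lia.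
Qed.

Lemma scale_bound m n r K : (0 < K)%N -> (0 < m)%N -> (n < m)%N -> (r ^ 2 * K <= n.+1)%N -> (r <= m)%N.
Proof.
move=> K0 m0 nm rK; have : (r * r <= n.+1)%N by rewrite mulnn (leq_trans _ rK) // leq_pmulr.
move: nm; clear; nia.
Qed.

Section HeatKernel.
Variables (R : realType) (d : nat) (alpha beta : R).
Hypotheses (d_gt0 : (0 < d)%N) (alpha_gt0 : 0 < alpha) (le_ab : alpha <= beta).
Let c0 := cst_gt0 d_gt0 alpha_gt0 le_ab.
Let hd : R := d%:R / 2.
Let hd0 : 0 <= hd. Proof. by rewrite divr_ge0. Qed.

Lemma dot_delta_delta (V : finZmodType) (y : V) : dot (@delta R V y) (delta y) = 1.
Proof. by rewrite dot_delta /delta eqxx. Qed.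

(** Nash's argument as a strong induction from time m/2 to time m. The squared side of the box is a
    small fraction of m: the gradient term, bounded by the energy decay over the second half of the
    time, is absorbed, and the [l^1] term, whose mass is 1, gives the rate. *)
Lemma heat_kernel : exists2 C : R, 0 < C &
  forall (V : finZmodType) (e : 'I_d -> V) N a, torus e N -> elliptic alpha beta a ->
  forall n y, (n <= N)%N ->
  dot (Tn e beta a n (delta y)) (Tn e beta a n (delta y)) <= C * pw n (- hd).
Proof.
(* With [A <= K] the gradient term is at most x_n / (2 * 2^hd): the power of two pays for passing
   from time n back to time m, and the other factor leaves half of the bound to the [l^1] term. *)
pose A : R := 2 * d%:R * (cst d beta / alpha) * (2 * 2 `^ hd).
have [K K0 AK] : exists2 K : nat, (0 < K)%N & A <= K%:R.
  by exists (Num.truncn A).+1 => //; apply: ltW; apply: truncnS_gt.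
have q0 : 0 < cst d beta / alpha by exact: divr_gt0.
have A0 : 0 < A.
  rewrite /A; apply: mulr_gt0; last by rewrite mulr_gt0 // powR_gt0.
  by apply: mulr_gt0 => //; rewrite mulr_gt0 // ltr0n.
(* The factor 8 K comes from m+1 <= 8 K r^2 ([scale_half]); it also covers the times so short that r
   = 0. *)
pose C : R := 4 * (8 * K%:R) `^ hd.
have C0 : 0 < C by rewrite mulr_gt0 // powR_gt0 // mulr_gt0 ?ltr0n.
have K1 : 1 <= K%:R :> R by rewrite ler1n.
have powle (m : nat) (B : R) : m.+1%:R <= B -> B <= 8 * K%:R -> 1 <= C * pw m (- hd).
  move=> mB BK; rewrite pwN ler_pdivlMr ?pw_gt0 // mul1r.
  apply: (@le_trans _ _ ((8 * K%:R) `^ hd)).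
    by rewrite ge0_ler_powR ?nnegrE ?ler0n ?(le_trans mB) // mulr_ge0.
  by rewrite /C ler_peMl ?powR_ge0 //; lra.
exists C => // V e N a tor ha n y; elim/ltn_ind: n => m IH mN.
have x1 k : dot (Tn e beta a k (delta y)) (Tn e beta a k (delta y)) <= 1.
  by rewrite -(dot_delta_delta y); apply: (@Tn_sq_mono R V d e alpha beta _ _ _ a ha _ 0).
have [m0|m0] := posnP m.
  apply: le_trans (x1 _) _; apply: (powle m 1); rewrite ?m0 //.
  by apply: le_trans (_ : 8 * 1 <= _); [lra|rewrite ler_pM2l].
pose n := m./2; have nm : (n < m)%N by rewrite ltn_half_double -addnn -[X in (X < _)%N]addn0 ltn_add2l.
have mn : (m < 2 * n.+1)%N := half_scale m.
have [r /andP[r1 r2]] := @max_sqr_scale K n.+1 K0.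
have [r0|r0] := posnP r.
  apply: le_trans (x1 _) _; apply: (powle m (2 * K%:R)).
    rewrite -natrM ler_nat (leq_trans mn) // leq_mul2l /= ltnW //.
    by move: r2; rewrite r0 exp1n mul1n.
  by rewrite ler_pM2r //; lra.
have rN : (0 < r <= N)%N.
  by rewrite r0 /= (leq_trans _ mN) // (scale_bound K0 m0 nm r1).
set x_ := fun k => dot (Tn e beta a k (delta y)) (Tn e beta a k (delta y)).
have step : x_ m <= x_ (n + n)%N.
  by apply: (@Tn_sq_mono R V d e alpha beta) => //; rewrite addnn half_double_le.
apply: (le_trans step); rewrite {1}/x_ TnD.
have gr := gradsq_Tn e d_gt0 alpha_gt0 le_ab ha (Tn e beta a n (delta y)) n.
apply: le_trans (nash _ tor rN) _.
have -> : \sum_x `|Tn e beta a n (Tn e beta a n (delta y)) x| = 1.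
  rewrite -TnD; exact: (Tn_delta_l1 e d_gt0 alpha_gt0 le_ab ha).
rewrite expr1n mulr1 -/(x_ n) in gr *.
have hn := IH n nm (leq_trans (ltnW nm) mN); rewrite -/(x_ n) in hn.
have pwnm : pw n (- hd) <= 2 `^ hd * pw m (- hd).
  by have := @pw_scale R 2 n m (- hd); rewrite opprK; apply => //; rewrite oppr_le0.
have two : 0 < 2 `^ hd :> R by rewrite powR_gt0.
have t1 : 2 * (d%:R * r%:R ^+ 2) * gradsq e (Tn e beta a n (Tn e beta a n (delta y))) <= C / 2 * pw m (- hd).
  apply: (@le_trans _ _ (2 * (d%:R * r%:R ^+ 2) * (cst d beta / alpha * x_ n / n.+1%:R))).
    by rewrite ler_wpM2l // mulr_ge0 // mulr_ge0 ?sqr_ge0.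
  have r1' : r%:R ^+ 2 * K%:R <= n.+1%:R :> R by rewrite -natrX -natrM ler_nat.
  have rA : r%:R ^+ 2 * A <= n.+1%:R by apply: le_trans r1'; rewrite ler_wpM2l ?sqr_ge0.
  have -> : 2 * (d%:R * r%:R ^+ 2) * (cst d beta / alpha * x_ n / n.+1%:R) =
    (r%:R ^+ 2 * A) / n.+1%:R * (x_ n / (2 * 2 `^ hd)).
    by rewrite /A; field; rewrite ?gt_eqF ?pnatr_eq0.
  have q : r%:R ^+ 2 * A / n.+1%:R <= 1 by rewrite ler_pdivrMr ?mul1r // ltr0n.
  have xd : x_ n / (2 * 2 `^ hd) <= C / 2 * pw m (- hd).
    rewrite ler_pdivrMr ?mulr_gt0 //; apply: (le_trans hn).
    have := ler_wpM2l (ltW C0) pwnm; lra.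
  apply: (le_trans _ xd); rewrite ler_piMl // divr_ge0 ?sq_ge0 // mulr_ge0 // ltW //.
have t2 : 2 * (r%:R ^+ d)^-1 <= C / 2 * pw m (- hd).
  have rr : (m.+1%:R : R) <= 8 * K%:R * r%:R ^+ 2.
    by have := scale_half r0 mn r2; rewrite -(ler_nat R) natrM natrM natrX.
  have h : pw m hd <= (8 * K%:R) `^ hd * r%:R ^+ d.
    have -> : r%:R ^+ d = (r%:R ^+ 2) `^ hd :> R.
      rewrite -[_ ^+ 2]powR_mulrn ?ler0n // -powRrM -powR_mulrn ?ler0n //; congr (_ `^ _).
      by rewrite /hd; field.
    by rewrite -powRM ?mulr_ge0 ?sqr_ge0 // ge0_ler_powR ?nnegrE ?ler0n // !mulr_ge0 ?sqr_ge0.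
  have rd : 0 < r%:R ^+ d :> R by rewrite exprn_gt0 // ltr0n.
  rewrite pwN ler_pdivrMr // mulrAC ler_pdivlMr ?pw_gt0 //.
  by rewrite /C; move: h; lra.
by have := lerD t1 t2; lra.
Qed.

(** Half of the time spreads the mass, the other half dissipates: the energy is smaller by a factor
    1/n than the squared norm at half time. *)
Lemma grad_decay : exists2 C : R, 0 < C &
  forall (V : finZmodType) (e : 'I_d -> V) N a, torus e N -> elliptic alpha beta a ->
  forall n y, (n <= N)%N -> gradsq e (Tn e beta a n (delta y)) <= C * pw n (- (hd + 1)).
Proof.
have [C C0 hC] := heat_kernel.
exists (cst d beta / alpha * (2 * 2 `^ hd * C)).
  by apply: mulr_gt0; [exact: divr_gt0|rewrite mulr_gt0 // mulr_gt0 // powR_gt0].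
move=> V e N a tor ha n y nN; pose m := n./2.
have -> : Tn e beta a n (delta y) = Tn e beta a (n - m) (Tn e beta a m (delta y)).
  by rewrite -TnD subnK // half_le.
apply: le_trans (gradsq_Tn e d_gt0 alpha_gt0 le_ab ha _ _) _.
rewrite -!mulrA ler_pM2l ?cst_gt0 // ler_pM2l ?invr_gt0 //.
have mn : (m <= n)%N by rewrite half_le.
have h := hC V e N a tor ha m y (leq_trans mn nN).
have pwnm : pw m (- hd) <= 2 `^ hd * pw n (- hd).
  have := @pw_scale R 2 m n (- hd); rewrite opprK; apply; first by rewrite oppr_le0.
  exact: half_scale.
rewrite opprD pwD [pw n (- 1)]pwN pw1.
have i : (n - m).+1%:R^-1 <= 2 * n.+1%:R^-1 :> R.
  rewrite -[2]invrK -invfM lef_pV2 ?posrE ?mulr_gt0 ?invr_gt0 ?ltr0n //.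
  rewrite ler_pdivrMl // -natrM ler_nat mul2n -addnn -[X in (X < _)%N](subnK mn).
  by rewrite -addSn leq_add // leqW // leq_subRL // addnn half_double_le.
have z : 0 <= (n - m).+1%:R^-1 :> R by rewrite invr_ge0.
apply: (le_trans (ler_pM (sq_ge0 _) z (le_trans h (ler_wpM2l (ltW C0) pwnm)) i)).
by rewrite le_eqVlt; apply/orP; left; apply/eqP; ring.
Qed.

Lemma sqB_le (V : finZmodType) (f g : V -> R) :
  dot (fun x => f x - g x) (fun x => f x - g x) <= 2 * dot f f + 2 * dot g g.
Proof.
rewrite /dot !mulr_sumr -big_split; apply: ler_sum => x _ /=.
by have := sqr_ge0 (f x + g x); lra.
Qed.

(** The cancellation between the two masses is given up, so the exponent is that of the heat kernel:
    above 1 for d >= 3, exactly 1 in the plane. *)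
Lemma dipole_decay : exists2 C : R, 0 < C &
  forall (V : finZmodType) (e : 'I_d -> V) N a, torus e N -> elliptic alpha beta a ->
  forall n E, (n <= N)%N ->
  dot (Tn e beta a n (dlt e E)) (Tn e beta a n (dlt e E)) <= C * pw n (- hd).
Proof.
have [C C0 hC] := heat_kernel; exists (4 * C); first by rewrite mulr_gt0.
move=> V e N a tor ha n E nN.
have -> : Tn e beta a n (dlt e E) = fun x =>
  Tn e beta a n (delta (E.1 + e E.2)) x - Tn e beta a n (delta E.1) x.
  by apply/funext => x; rewrite /dlt TnB.
apply: le_trans (sqB_le _ _) _.
have := hC V e N a tor ha n (E.1 + e E.2) nN; have := hC V e N a tor ha n E.1 nN.
lra.
Qed.

End HeatKernel.

(** * Product spaces and the Efron-Stein inequality *)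

Section FiniteProduct.
Variables (R : realType) (S J : finType) (w : S -> R).
Hypotheses (w_ge0 : forall s, 0 <= w s) (w_sum : \sum_s w s = 1).
Local Notation Om := {ffun J -> S}.
Implicit Types (F G : Om -> R) (s t : Om).

Definition wt s : R := \prod_j w (s j).
Definition Ex F : R := \sum_s wt s * F s.

Lemma wt_ge0 s : 0 <= wt s. Proof. by rewrite prodr_ge0. Qed.

Lemma sum_wt : \sum_s wt s = 1.
Proof.
rewrite /wt -(bigA_distr_bigA (fun _ x => w x)) /= big1 //.
Qed.

Lemma Ex_cst k : Ex (fun=> k) = k.
Proof. by rewrite /Ex -mulr_suml sum_wt mul1r. Qed.
Lemma ExD F G : Ex (fun s => F s + G s) = Ex F + Ex G.
Proof. by rewrite /Ex -big_split; apply: eq_bigr => s _; rewrite mulrDr. Qed.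
Lemma ExB F G : Ex (fun s => F s - G s) = Ex F - Ex G.
Proof. by rewrite /Ex -sumrB; apply: eq_bigr => s _; rewrite mulrBr. Qed.
Lemma ExZ k F : Ex (fun s => k * F s) = k * Ex F.
Proof. by rewrite /Ex mulr_sumr; apply: eq_bigr => s _; rewrite mulrCA. Qed.
Lemma Ex_sum (I : finType) (P : pred I) (F : I -> Om -> R) :
  Ex (fun s => \sum_(i | P i) F i s) = \sum_(i | P i) Ex (F i).
Proof.
by rewrite /Ex exchange_big; apply: eq_bigr => s _; rewrite mulr_sumr.
Qed.
Lemma Ex_le F G : (forall s, F s <= G s) -> Ex F <= Ex G.
Proof. by move=> h; apply: ler_sum => s _; rewrite ler_wpM2l ?wt_ge0. Qed.
Lemma Ex_ge0 F : (forall s, 0 <= F s) -> 0 <= Ex F.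
Proof. by move=> h; rewrite sumr_ge0 // => s _; rewrite mulr_ge0 ?wt_ge0. Qed.
Lemma Ex_ext F G : F =1 G -> Ex F = Ex G.
Proof. by move=> h; apply: eq_bigr => s _; rewrite h. Qed.

Lemma Ex_pow F p : (forall s, 0 <= F s) -> Ex F ^+ p.+1 <= Ex (fun s => F s ^+ p.+1).
Proof. by move=> F0; apply: jensen_pow => //; [exact: wt_ge0|exact: sum_wt]. Qed.

Lemma Ex_reindex (h : J -> J) F : injective h ->
  Ex (fun s => F [ffun j => s (h j)]) = Ex F.
Proof.
move=> hi; have hb : bijective h by apply: injF_bij.
have pi : injective (fun s : Om => [ffun j => s (h j)] : Om).
  case: hb => g hg gh s t /ffunP e; apply/ffunP => j.
  by move: (e (g j)); rewrite !ffunE gh.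
rewrite [RHS](reindex_inj pi); apply: eq_bigr => s _; congr (_ * _).
rewrite /wt (reindex_inj hi) /=; apply: eq_bigr => j _; by rewrite ffunE.
Qed.

Definition dep (A : pred J) F := forall s t, (forall j, A j -> s j = t j) -> F s = F t.

(** Doubling: for two independent samples, exchanging the coordinates outside [A] preserves the
    weight of the pair and moves [G] to the second sample. *)
Lemma Ex_indep (A : pred J) F G : dep A F -> dep (predC A) G ->
  Ex (fun s => F s * G s) = Ex F * Ex G.
Proof.
move=> dF dG; pose mix s t : Om := [ffun j => if A j then s j else t j].
rewrite -[LHS]mul1r -sum_wt [LHS]mulr_suml.
transitivity (\sum_s \sum_t wt s * wt t * (F s * G s)).
  rewrite exchange_big; apply: eq_bigr => t _; rewrite /Ex mulr_sumr.
  by apply: eq_bigr => s _; rewrite mulrA (mulrC (wt t)).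
rewrite pair_bigA /=.
have mi : injective (fun p : Om * Om => (mix p.1 p.2, mix p.2 p.1)).
  move=> [s t] [s' t'] [] /ffunP e1 /ffunP e2; congr (_, _); apply/ffunP => j.
    by move: (e1 j) (e2 j); rewrite !ffunE; case: ifP.
  by move: (e1 j) (e2 j); rewrite !ffunE; case: ifP.
rewrite (reindex_inj mi) /=.
transitivity (\sum_(p : Om * Om) wt p.1 * wt p.2 * (F p.1 * G p.2)).
  apply: eq_bigr => -[s t] _ /=; congr (_ * (_ * _)).
  - rewrite /wt -!big_split /=; apply: eq_bigr => j _; rewrite !ffunE.
    by case: ifP => _ //; rewrite mulrC.
  - by apply: dF => j Aj; rewrite ffunE Aj.
  - by apply: dG => j /negPf Aj; rewrite ffunE Aj.
rewrite -(pair_bigA _ (fun s t => wt s * wt t * (F s * G t))) /=.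
rewrite /Ex mulr_suml; apply: eq_bigr => s _; rewrite mulr_sumr; apply: eq_bigr => t _.
by ring.
Qed.

End FiniteProduct.

Section Young.
Variable R : realType.
Implicit Types x y : R.

Lemma young_pow p (eps V y : R) : 0 < eps -> 0 <= V -> 0 <= y ->
  V * y ^+ p <= eps * y ^+ p.+1 + (eps ^+ p)^-1 * V ^+ p.+1.
Proof.
move=> e0 V0 y0; have ep : 0 < eps ^+ p by rewrite exprn_gt0.
have [h|h] := leP V (eps * y).
  apply: (@le_trans _ _ (eps * y ^+ p.+1)).
    by rewrite exprS mulrA ler_wpM2r ?exprn_ge0.
  by rewrite lerDl mulr_ge0 ?exprn_ge0 // invr_ge0 ltW.
apply: (@le_trans _ _ ((eps ^+ p)^-1 * V ^+ p.+1)); last first.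
  by rewrite lerDr mulr_ge0 ?exprn_ge0 // ltW.
rewrite exprS mulrCA ler_wpM2l // ler_pdivlMl // -exprMn lerXn2r ?nnegrE ?(ltW h) //.
by rewrite mulr_ge0 // ltW.
Qed.

Lemma sqr_diff_pow p x y : (x ^+ p.+1 - y ^+ p.+1) ^+ 2 <=
  p.+1%:R ^+ 2 * ((x - y) ^+ 2 * (x ^+ (2 * p) + y ^+ (2 * p))).
Proof.
pose M : R := Num.max `|x| `|y|.
have h : `|x ^+ p.+1 - y ^+ p.+1| <= `|x - y| * (p.+1%:R * M ^+ p).
  rewrite subrXX normrM ler_wpM2l //; apply: le_trans (ler_norm_sum _ _ _) _.
  apply: (@le_trans _ _ (\sum_(i < p.+1) M ^+ p)); last first.
    by rewrite sumr_const card_ord mulr_natl.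
  apply: ler_sum => i _.
  have -> : M ^+ p = M ^+ (p - i) * M ^+ i by rewrite -exprD subnK // -ltnS.
  rewrite normrM !normrX.
  by rewrite ler_pM ?exprn_ge0 // lerXn2r ?nnegrE ?le_max ?lexx ?normr_ge0 ?orbT.
rewrite -[_ ^+ 2 in leLHS]real_normK ?num_real //.
apply: (@le_trans _ _ ((`|x - y| * (p.+1%:R * M ^+ p)) ^+ 2)).
  by rewrite lerXn2r ?nnegrE // mulr_ge0 // mulr_ge0 // exprn_ge0 // le_max normr_ge0.
rewrite exprMn exprMn mulrCA ler_wpM2l ?sqr_ge0 // real_normK ?num_real //.
rewrite ler_wpM2l ?sqr_ge0 // -exprM mulnC /M.
have e2 (z : R) : `|z| ^+ (2 * p) = z ^+ (2 * p) by rewrite !exprM real_normK ?num_real.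
have z2 (z : R) : 0 <= z ^+ (2 * p) by rewrite exprM exprn_ge0 ?sqr_ge0.
by rewrite maxEle; case: ifP => _; rewrite e2 ?lerDr ?lerDl z2.
Qed.
End Young.

Section EfronStein.
Variables (R : realType) (S E : finType) (w : S -> R).
Hypotheses (w_ge0 : forall s, 0 <= w s) (w_sum : \sum_s w s = 1).
(* Three independent copies of the environment, labelled None, Some false and Some true. *)
Let J := (E * option bool)%type.
Local Notation Om := {ffun J -> S}.
Local Notation Ex := (@Ex R S (E * option bool)%type w).
Implicit Types (Z : Om -> R) (s : Om) (k : bool) (A B : pred E).

(** Resampling the edges of [A] as an involution of the probability space: the main copy is
    exchanged with copy [k] there, and the third copy is left alone. *)
Definition swj A k (j : E * option bool) : E * option bool :=
  if A j.1 then (j.1, if j.2 == None then Some k else if j.2 == Some k then None else j.2) else j.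
Definition sw A k s : Om := [ffun j => s (swj A k j)].

Lemma swjK A k : involutive (swj A k).
Proof. by case=> x [[]|]; case: k; rewrite /swj /=; case Ax: (A x); rewrite /= ?Ax. Qed.

Lemma swK A k : involutive (sw A k).
Proof. by move=> s; apply/ffunP => j; rewrite !ffunE swjK. Qed.

Lemma Ex_sw A k Z : Ex (fun s => Z (sw A k s)) = Ex Z.
Proof. exact: (Ex_reindex _ _ (can_inj (swjK A k))). Qed.

Lemma sw_sw A B k s : sw A k (sw B k s) = sw (fun x => A x (+) B x) k s.
Proof.
apply/ffunP => -[x c]; rewrite !ffunE; congr (s _); rewrite /swj /=.
by case Ax: (A x); case Bx: (B x); rewrite /= ?Bx //; case: c => [[]|]; case: k.
Qed.

Definition main_dep Z := dep (fun j : E * option bool => j.2 == None) Z.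

Lemma Ex_sw_all Z : main_dep Z -> Ex (fun s => Z s * Z (sw xpredT false s)) = Ex Z ^+ 2.
Proof.
move=> hZ; rewrite (Ex_indep w_sum hZ); first by rewrite (Ex_sw xpredT false Z).
move=> s t h; apply: hZ => -[x c] /= /eqP ->; rewrite !ffunE /swj /=; exact: h.
Qed.

Definition sw1 (x : E) s := sw (pred1 x) false s.

Lemma sw1K x : involutive (sw1 x). Proof. exact: swK. Qed.
Lemma Ex_sw1 x Z : Ex (fun s => Z (sw1 x s)) = Ex Z. Proof. exact: Ex_sw. Qed.

(** Edges are resampled one after the other. An increment is antisymmetric under the exchange
    [sw1 x], so [Z] may be replaced by half of its own increment at [x]; a product of two increments
    with the same second moment is then split by Young's inequality. *)
Lemma efron_stein_seq Z (l : seq E) : uniq l ->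
  Ex (fun s => Z s * (Z s - Z (sw (mem l) false s))) <=
  2^-1 * \sum_(x <- l) Ex (fun s => (Z s - Z (sw1 x s)) ^+ 2).
Proof.
elim: l => [_|x l IH /andP[xl ul]].
  rewrite big_nil mulr0; have -> : (fun s => Z s * (Z s - Z (sw (mem [::]) false s))) = fun=> 0.
    apply/funext => s; suff -> : sw (mem [::]) false s = s by rewrite subrr mulr0.
    by apply/ffunP => j; rewrite ffunE /swj.
  by rewrite Ex_cst.
pose B := sw (mem l) false.
have eB s : sw (mem (x :: l)) false s = sw1 x (B s).
  rewrite /sw1 /B sw_sw; congr sw; apply/funext => y /=; rewrite inE.
  by case: eqP => [->|//] /=; rewrite (negPf xl).
have eB' s : sw1 x (B s) = B (sw1 x s).
  by rewrite /sw1 /B !sw_sw; congr sw; apply/funext => y; rewrite addbC.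
rewrite big_cons mulrDr addrC.
have -> : Ex (fun s => Z s * (Z s - Z (sw (mem (x :: l)) false s))) =
  Ex (fun s => Z s * (Z s - Z (B s))) + Ex (fun s => Z s * (Z (B s) - Z (B (sw1 x s)))).
  by rewrite -ExD; apply: Ex_ext => s; rewrite eB eB'; ring.
apply: lerD; first exact: IH.
have e1 : Ex (fun s => Z s * (Z (B s) - Z (B (sw1 x s)))) =
  Ex (fun s => 2^-1 * ((Z s - Z (sw1 x s)) * (Z (B s) - Z (B (sw1 x s))))).
  rewrite ExZ; apply: (@mulfI _ 2) => //; rewrite mulVKf //.
  have -> : 2 * Ex (fun s => Z s * (Z (B s) - Z (B (sw1 x s)))) =
    Ex (fun s => Z s * (Z (B s) - Z (B (sw1 x s)))) + Ex (fun s => Z (sw1 x s) * (Z (B (sw1 x s)) - Z (B s))).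
    rewrite mulr_natl mulr2n; congr (_ + _).
    rewrite -(Ex_sw1 x (fun s => Z s * (Z (B s) - Z (B (sw1 x s))))).
    by apply: Ex_ext => s; rewrite sw1K.
  by rewrite -ExD; apply: Ex_ext => s; ring.
rewrite e1; have e2 : Ex (fun s => (Z (B s) - Z (B (sw1 x s))) ^+ 2) = Ex (fun s => (Z s - Z (sw1 x s)) ^+ 2).
  rewrite -(Ex_sw (mem l) false (fun s => (Z s - Z (sw1 x s)) ^+ 2)).
  by apply: Ex_ext => s; rewrite -/(B s) eB'.
apply: (@le_trans _ _ (Ex (fun s => 4^-1 * (Z s - Z (sw1 x s)) ^+ 2 + 4^-1 * (Z (B s) - Z (B (sw1 x s))) ^+ 2))).
  apply: Ex_le => // s; set u := Z s - _; set v := Z (B s) - _.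
  have := sqr_ge0 (u - v); lra.
by rewrite ExD !ExZ e2; lra.
Qed.

Lemma efron_stein Z : main_dep Z ->
  Ex (fun s => Z s ^+ 2) <= Ex Z ^+ 2 + 2^-1 * \sum_x Ex (fun s => (Z s - Z (sw1 x s)) ^+ 2).
Proof.
move=> hZ; have := @efron_stein_seq Z (enum E) (enum_uniq E).
rewrite big_enum /= -lerBlDl -(Ex_sw_all hZ).
have -> : Ex (fun s => Z s * (Z s - Z (sw (mem (enum E)) false s))) =
  Ex (fun s => Z s ^+ 2) - Ex (fun s => Z s * Z (sw xpredT false s)).
  rewrite -ExB; apply: Ex_ext => s; rewrite mulrBr expr2; congr (_ - _ * Z _).
  by apply/ffunP => j; rewrite !ffunE /swj /= mem_enum.
by [].
Qed.

Definition vfun Z s := \sum_x (Z s - Z (sw1 x s)) ^+ 2.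
Lemma vfun_ge0 Z s : 0 <= vfun Z s.
Proof. by rewrite sumr_ge0 // => x _; rewrite sqr_ge0. Qed.

End EfronStein.

(** The power doubles at each step: Efron-Stein is applied to [Z ^+ p.+1], whose mean is controlled
    by the previous step and whose increments by [sqr_diff_pow]. Young's inequality returns part of
    the top moment, which is absorbed. *)
Lemma efron_stein_pow (R : realType) (m : nat) : exists2 C : R, 0 < C &
  forall (S E : finType) (w : S -> R), (forall s, 0 <= w s) -> \sum_s w s = 1 ->
  forall Z : {ffun E * option bool -> S} -> R, main_dep Z -> Ex w Z = 0 ->
  Ex w (fun s => Z s ^+ (2 * 2 ^ m)) <= C * Ex w (fun s => vfun Z s ^+ (2 ^ m)).
Proof.
elim: m => [|m [C C0 IH]].
  exists 2^-1; first by rewrite invr_gt0.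
  move=> S E w w0 w1 Z hZ Z0; have := efron_stein w0 w1 hZ.
  by rewrite Z0 expr0n add0r expn0 muln1 /vfun; under [X in _ -> _ <= _ * X]Ex_ext do rewrite expr1; rewrite Ex_sum.
pose p := (2 ^ m.+1).-1; have p1 : p.+1 = (2 ^ m.+1)%N by rewrite prednK // expn_gt0.
have p0 : 0 < p.+1%:R :> R by rewrite ltr0n.
(* With this value the top moment comes back with coefficient 1/2. *)
pose eps : R := (2 * p.+1%:R ^+ 2)^-1.
have e0 : 0 < eps by rewrite invr_gt0 mulr_gt0 // exprn_gt0.
exists (2 * C ^+ 2 + 2 * (p.+1%:R ^+ 2 * (eps ^+ p)^-1)).
  by rewrite addr_gt0 // ?mulr_gt0 ?exprn_gt0 ?invr_gt0 ?exprn_gt0.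
move=> S E w w0 w1 Z hZ Z0; rewrite -p1.
have hY : main_dep (fun s => Z s ^+ p.+1) by move=> s t h; rewrite (hZ s t).
have := efron_stein w0 w1 hY; under [X in X <= _ -> _]Ex_ext do rewrite -exprM mulnC.
set X := Ex w (fun s => Z s ^+ (2 * p.+1)) => es.
have V0 := vfun_ge0 Z.
have h1 : Ex w (fun s => Z s ^+ p.+1) ^+ 2 <= C ^+ 2 * Ex w (fun s => vfun Z s ^+ p.+1).
  have e : p.+1 = (2 * 2 ^ m)%N by rewrite p1 expnS.
  apply: (@le_trans _ _ ((C * Ex w (fun s => vfun Z s ^+ (2 ^ m))) ^+ 2)).
    rewrite lerXn2r ?nnegrE //.
    - by apply: Ex_ge0 => // s; rewrite e exprM exprn_ge0 // sqr_ge0.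
    - by rewrite mulr_ge0 ?(ltW C0) // Ex_ge0 // => s; rewrite exprn_ge0.
    - by rewrite e; apply: IH.
  rewrite exprMn ler_wpM2l ?sqr_ge0 //.
  have := @Ex_pow R S _ w w0 w1 (fun s => vfun Z s ^+ (2 ^ m)) 1.
  move=> /(_ (fun s => exprn_ge0 _ (V0 s))) /le_trans; apply.
  by apply: Ex_le => // s; rewrite -exprM e mulnC.
have h2 : \sum_x Ex w (fun s => (Z s ^+ p.+1 - Z (sw1 x s) ^+ p.+1) ^+ 2) <=
  p.+1%:R ^+ 2 * (2 * Ex w (fun s => vfun Z s * Z s ^+ (2 * p))).
  have -> : Ex w (fun s => vfun Z s * Z s ^+ (2 * p)) =
    \sum_x Ex w (fun s => (Z s - Z (sw1 x s)) ^+ 2 * Z s ^+ (2 * p)).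
    by rewrite -Ex_sum; apply: Ex_ext => s; rewrite /vfun mulr_suml.
  rewrite !mulr_sumr; apply: ler_sum => x _.
  apply: (@le_trans _ _ (Ex w (fun s => p.+1%:R ^+ 2 *
     ((Z s - Z (sw1 x s)) ^+ 2 * (Z s ^+ (2 * p) + Z (sw1 x s) ^+ (2 * p)))))).
    by apply: Ex_le => // s; apply: sqr_diff_pow.
  rewrite ExZ ler_wpM2l ?sqr_ge0 //.
  have -> : Ex w (fun s => (Z s - Z (sw1 x s)) ^+ 2 * (Z s ^+ (2 * p) + Z (sw1 x s) ^+ (2 * p))) =
    Ex w (fun s => (Z s - Z (sw1 x s)) ^+ 2 * Z s ^+ (2 * p)) +
    Ex w (fun s => (Z s - Z (sw1 x s)) ^+ 2 * Z (sw1 x s) ^+ (2 * p)).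
    by rewrite -ExD; apply: Ex_ext => s; rewrite mulrDr.
  rewrite -[X in _ + X <= _](Ex_sw1 w x).
  rewrite mulr_natl mulr2n lerD2l le_eqVlt; apply/orP; left; apply/eqP; apply: Ex_ext => s.
  by rewrite /sw1 swK -sqrrN opprB.
have h3 : Ex w (fun s => vfun Z s * Z s ^+ (2 * p)) <= eps * X + (eps ^+ p)^-1 * Ex w (fun s => vfun Z s ^+ p.+1).
  rewrite /X -!ExZ -ExD; apply: Ex_le => // s; rewrite !exprM.
  by apply: young_pow => //; rewrite sqr_ge0.
have h4 : p.+1%:R ^+ 2 * (2 * Ex w (fun s => vfun Z s * Z s ^+ (2 * p))) <=
  p.+1%:R ^+ 2 * (2 * (eps * X + (eps ^+ p)^-1 * Ex w (fun s => vfun Z s ^+ p.+1))).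
  by rewrite ler_wpM2l ?sqr_ge0 // ler_pM2l.
have e2 : p.+1%:R ^+ 2 * (2 * (eps * X)) = X.
  rewrite /eps; clear -p0; move: X => X; move: (p.+1%:R) p0 => n n0.
  by field; rewrite gt_eqF.
move: h4; rewrite [2 * (_ + _)]mulrDr [_ * (_ + _)]mulrDr e2 => h4.
rewrite mulrDl; move: es h1 h2 h4; rewrite -!mulrA.
set Vp := Ex w (fun s => vfun Z s ^+ p.+1).
lra.
Qed.

(** * Duhamel formula and the finite model *)

Section Duhamel.
Variables (R : realType) (V : finZmodType) (d : nat) (e : 'I_d -> V) (beta : R).
Implicit Types (f g : V -> R) (a b : V * 'I_d -> R) (E : V * 'I_d).
Local Notation Tn := (Tn e beta).
Local Notation Tw := (Tw e beta).
Local Notation c := (cst d beta).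

Lemma dot_Tdiff a b f g :
  dot g (Tw a f) - dot g (Tw b f) = - c^-1 * \sum_E (a E - b E) * dg e E g * dg e E f.
Proof.
rewrite /Tw !dotBr /Sw !dotZr !dot_lap.
have -> : \sum_E (a E - b E) * dg e E g * dg e E f =
  \sum_E a E * dg e E g * dg e E f - \sum_E b E * dg e E g * dg e E f.
  by rewrite -sumrB; apply: eq_bigr => E _; ring.
by ring.
Qed.

(** Telescoping over the time at which the walk in [b] is replaced by the walk in [a]; a one-step
    difference is a bilinear form in the two gradients. *)
Lemma duhamel a b n f g :
  dot g (Tn a n f) - dot g (Tn b n f) =
  - c^-1 * \sum_(k < n) \sum_E (a E - b E) * dg e E (Tn a (n.-1 - k) g) * dg e E (Tn b k f).
Proof.
elim: n g => [|n IH] g; first by rewrite big_ord0 mulr0 subrr.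
have e1 : dot g (Tn a n.+1 f) = dot (Tw a g) (Tn a n f) by rewrite -dot_T.
have e2 : dot g (Tn b n.+1 f) = dot g (Tw b (Tn b n f)) by [].
have := IH (Tw a g); have := dot_Tdiff a b (Tn b n f) g; rewrite dot_T -e1 -e2 => h1 h2.
rewrite big_ord_recr /= subnn mulrDr -h1.
have -> : \sum_(i < n) \sum_E (a E - b E) * dg e E (Tn a (n - i) g) * dg e E (Tn b i f) =
  \sum_(k < n) \sum_E (a E - b E) * dg e E (Tn a (n.-1 - k) (Tw a g)) * dg e E (Tn b k f).
  apply: eq_bigr => k _; apply: eq_bigr => E _; congr (_ * dg e E _ * _).
  have -> : (n - k)%N = (n.-1 - k).+1 by have := ltn_ord k; case: (n) k => // m k km; rewrite subSn.
  by rewrite -addn1 TnD.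
by rewrite -h2; ring.
Qed.

Variable xi : 'I_d -> R.
Definition u0 a x : R := \sum_i xi i * (a (x, i) - a (x - e i, i)).
Definition sol a n := Tn a n (u0 a).

Lemma dot_u0 a f : dot f (u0 a) = - \sum_E xi E.2 * a E * dg e E f.
Proof.
rewrite /dot /u0; under eq_bigr do rewrite mulr_sumr.
pose F (s : bool) x y (E : V * 'I_d) := f x * xi E.2 * a E.
rewrite [LHS]exchange_big sum_edges [X in - X]exchange_big /= -sumrN; apply: eq_bigr => i _.
under eq_bigr => x _ do rewrite mulrBr mulrBr.
rewrite sumrB -[X in _ - X](sum_shift _ (e i)) -sumrB -sumrN; apply: eq_bigr => x _.
by rewrite addrK /dg /=; ring.
Qed.

Lemma sum_u0 a : \sum_x u0 a x = 0.
Proof.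
have -> : \sum_x u0 a x = dot (fun=> 1) (u0 a) by apply: eq_bigr => x _; rewrite mul1r.
rewrite dot_u0 big1 ?oppr0 // => E _; by rewrite /dg subrr mulr0.
Qed.

Lemma sol_diff a b E0 n x : (forall E, E != E0 -> a E = b E) ->
  sol a n x - sol b n x =
  - (a E0 - b E0) * xi E0.2 * dg e E0 (Tn a n (delta x)) -
  c^-1 * \sum_(k < n) (a E0 - b E0) * dg e E0 (Tn a (n.-1 - k) (delta x)) * dg e E0 (sol b k).
Proof.
move=> ab; have one (F : V * 'I_d -> R) : \sum_E (a E - b E) * F E = (a E0 - b E0) * F E0.
  by rewrite (bigD1 E0) //= big1 ?addr0 // => E /ab ->; rewrite subrr mul0r.
have := duhamel a b n (u0 b) (delta x); rewrite !dot_delta -/(sol b n) => h.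
have h0 : Tn a n (u0 a) x - Tn a n (u0 b) x = - (a E0 - b E0) * xi E0.2 * dg e E0 (Tn a n (delta x)).
  have -> : forall f, Tn a n f x = dot (Tn a n (delta x)) f by move=> f; rewrite -dot_Tn dot_delta.
  have -> : forall f, Tn a n f x = dot (Tn a n (delta x)) f by move=> f; rewrite -dot_Tn dot_delta.
  rewrite !dot_u0 -opprB opprK addrC -sumrB.
  rewrite !mulNr -mulrA -(one (fun E => xi E.2 * dg e E (Tn a n (delta x)))).
  by congr (- _); apply: eq_bigr => E _; ring.
have -> : sol a n x - sol b n x = (Tn a n (u0 a) x - Tn a n (u0 b) x) + (Tn a n (u0 b) x - sol b n x).
  by rewrite /sol; ring.
rewrite h0 h [- c^-1 * _]mulNr; congr (_ - _ * _); apply: eq_bigr => k _.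
under eq_bigr => E _ do rewrite -mulrA.
by rewrite one -mulrA.
Qed.

End Duhamel.

(** A torus that looks like Z^d up to scale [mN], with finitely many values of the conductances.
    Constants below are quantified before the model: they depend neither on the size of the torus
    nor on the law, which is what allows the later passage to the lattice. *)
Record model (R : realType) (d : nat) (alpha beta : R) := Model {
  mV : finZmodType;
  me : 'I_d -> mV;
  mN : nat;
  m_torus : torus me mN;
  mS : finType;
  mw : mS -> R;
  mw_ge0 : forall s, 0 <= mw s;
  mw_sum : \sum_s mw s = 1;
  mva : mS -> R;
  mva_bnd : forall s, alpha <= mva s <= beta;
  mxi : 'I_d -> R;
  mxi_le : forall i, `|mxi i| <= 1 }.

Arguments m_torus {R d alpha beta} _ k l _ _ _ _.

Section Model.
Variables (R : realType) (d : nat) (alpha beta : R) (M : model d alpha beta).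
Hypotheses (d_gt0 : (0 < d)%N) (alpha_gt0 : 0 < alpha) (le_ab : alpha <= beta).
Local Notation V := (mV M).
Local Notation e := (@me _ _ _ _ M).
Local Notation ed := (V * 'I_d)%type.
Local Notation Om := {ffun ed * option bool -> mS M}.
Local Notation Ex := (@Ex R (mS M) (ed * option bool)%type (@mw _ _ _ _ M)).
Implicit Types (s t : Om) (E : ed) (x z : V).

Definition env s E : R := mva (s (E, None)).
Definition u s n := sol e beta (@mxi _ _ _ _ M) (env s) n.
Definition hk s n x E := dg e E (Tn e beta (env s) n (delta x)).
Definition dip s n E := Tn e beta (env s) n (dlt e E).

Lemma env_ell s : elliptic alpha beta (env s).
Proof. by move=> E; exact: mva_bnd. Qed.

Lemma env_sw1 s E E' : E' != E -> env (sw1 E s) E' = env s E'.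
Proof. by move=> h; rewrite /env ffunE /swj /= (negPf h). Qed.

Lemma u_dep n x : main_dep (fun s => u s n x).
Proof.
move=> s t h; have hE : env s = env t by apply/funext => E; rewrite /env h.
by rewrite /u hE.
Qed.

Definition trj z (j : ed * option bool) := ((j.1.1 + z, j.1.2), j.2).
Definition tr z s : Om := [ffun j => s (trj z j)].
Lemma trj_inj z : injective (trj z).
Proof. by move=> [[x i] k] [[y j] l] [] /addIr -> -> ->. Qed.
Lemma Ex_tr z (F : Om -> R) : Ex (fun s => F (tr z s)) = Ex F.
Proof. exact: (Ex_reindex _ _ (@trj_inj z)). Qed.
Lemma env_tr z s E : env (tr z s) E = env s (E.1 + z, E.2).
Proof. by rewrite /env ffunE. Qed.

Lemma Tn_tr z s n (f : V -> R) x :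
  Tn e beta (env (tr z s)) n (fun y => f (y + z)) x = Tn e beta (env s) n f (x + z).
Proof.
elim: n f x => //= n IH f x; rewrite /Tw /Sw /lap IH; congr (_ - _ * _); apply: eq_bigr => i _.
by rewrite !IH !env_tr /= !(addrAC _ _ z).
Qed.

Lemma u_tr z s n x : u (tr z s) n x = u s n (x + z).
Proof.
rewrite /u /sol -Tn_tr; congr (Tn _ _ _ _ _ x); apply/funext => y; rewrite /u0.
by apply: eq_bigr => i _; rewrite !env_tr /= addrAC.
Qed.

Lemma card_gt0 : 0 < #|V|%:R :> R.
Proof. by rewrite ltr0n; apply/card_gt0P; exists 0. Qed.

Lemma mEx_cst k : Ex (fun=> k) = k.
Proof. by rewrite Ex_cst ?mw_sum. Qed.

Lemma Ex_u n x : Ex (fun s => u s n x) = 0.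
Proof.
have h z : Ex (fun s => u s n z) = Ex (fun s => u s n x).
  rewrite -[RHS](Ex_tr (z - x)); apply: Ex_ext => s; by rewrite u_tr addrC subrK.
have := Ex_sum (@mw _ _ _ _ M) xpredT (fun z s => u s n z).
under eq_bigr do rewrite h.
rewrite sumr_const; have -> : (fun s => \sum_z u s n z) = fun=> 0.
  by apply/funext => s; rewrite sum_Tn sum_u0.
rewrite Ex_cst ?mw_sum // => /esym/eqP; rewrite mulrn_eq0 => /orP[|/eqP //].
by have := card_gt0; rewrite ltr0n lt0n => /negPf ->.
Qed.

Definition mean (F : V -> R) : R := #|V|%:R^-1 * \sum_x F x.
Lemma mean_le F G : (forall x, F x <= G x) -> mean F <= mean G.
Proof.
by move=> h; rewrite ler_wpM2l ?invr_ge0 ?(ltW card_gt0) //; apply: ler_sum.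
Qed.
Lemma mean_ge0 F : (forall x, 0 <= F x) -> 0 <= mean F.
Proof. by move=> h; rewrite mulr_ge0 ?invr_ge0 ?(ltW card_gt0) // sumr_ge0. Qed.
Lemma meanZ k F : mean (fun x => k * F x) = k * mean F.
Proof. by rewrite /mean -mulr_sumr mulrCA. Qed.
Lemma mean_cst k : mean (fun=> k) = k.
Proof. by rewrite /mean sumr_const -[k *+ _]mulr_natl mulKf // gt_eqF // card_gt0. Qed.
Lemma mean_sum (I : finType) (F : I -> V -> R) : mean (fun x => \sum_k F k x) = \sum_k mean (F k).
Proof. by rewrite /mean exchange_big mulr_sumr. Qed.

(** By stationarity all sites have the same moment; the spatial average is kept because the
    estimates exchange sums over sites with sums over edges. *)
Definition aq q n : R := rt q (mean (fun x => Ex (fun s => `|u s n x| ^+ q))).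
Definition bq q n : R := rt q (#|V|%:R^-1 * \sum_E Ex (fun s => `|dg e E (u s n)| ^+ q)).
Lemma aq_ge0 q n : 0 <= aq q n. Proof. exact: rt_ge0. Qed.
Lemma bq_ge0 q n : 0 <= bq q n. Proof. exact: rt_ge0. Qed.
Let Ex0 F : (forall s, 0 <= F s) -> 0 <= Ex F.
Proof. by move=> h; apply: Ex_ge0 => //; exact: mw_ge0. Qed.
Lemma aqE q n : (0 < q)%N -> aq q n ^+ q = mean (fun x => Ex (fun s => `|u s n x| ^+ q)).
Proof.
by move=> q0; rewrite rtK // mean_ge0 // => x; apply: Ex0 => s; rewrite exprn_ge0.
Qed.
Lemma bqE q n : (0 < q)%N ->
  bq q n ^+ q = #|V|%:R^-1 * \sum_E Ex (fun s => `|dg e E (u s n)| ^+ q).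
Proof.
move=> q0; rewrite rtK // mulr_ge0 ?invr_ge0 ?(ltW card_gt0) // sumr_ge0 // => E _.
by apply: Ex0 => s; rewrite exprn_ge0.
Qed.

End Model.

(** * Convexity inequalities for even powers, and dissipation of high moments *)

Section PowerInequalities.
Variable R : realType.

(** Minkowski's inequality for square functions, in a form with free weights that survives taking
    expectations; [minkowski_weights] optimizes them afterwards. *)
Lemma mixed_jensen (I E : finType) (l : I -> R) (f : I -> E -> R) p :
  (forall i, 0 < l i) -> \sum_i l i = 1 ->
  (\sum_x (\sum_k f k x) ^+ 2) ^+ p.+1 <=
  \sum_k l k * ((\sum_x f k x ^+ 2) / l k ^+ 2) ^+ p.+1.
Proof.
move=> l0 l1; have f0 k : 0 <= \sum_x f k x ^+ 2 by rewrite sumr_ge0 // => x _; rewrite sqr_ge0.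
apply: (@le_trans _ _ ((\sum_k l k * ((\sum_x f k x ^+ 2) / l k ^+ 2)) ^+ p.+1)); last first.
  by apply: jensen_pow => // i; [exact: ltW|rewrite divr_ge0 ?sqr_ge0].
rewrite lerXn2r ?nnegrE //.
- by rewrite sumr_ge0 // => x _; rewrite sqr_ge0.
- by rewrite sumr_ge0 // => k _; rewrite mulr_ge0 ?(ltW (l0 _)) // divr_ge0 ?sqr_ge0.
apply: (@le_trans _ _ (\sum_x \sum_k f k x ^+ 2 / l k)).
  by apply: ler_sum => x _; exact: sum_sqr_le.
rewrite exchange_big /=; apply: ler_sum => k _; rewrite -mulr_suml.
by rewrite le_eqVlt; apply/orP; left; apply/eqP; field; rewrite gt_eqF.
Qed.

Lemma weighted_pow (E : finType) (A B : E -> R) p :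
  (forall x, 0 <= A x) -> (forall x, 0 <= B x) ->
  (\sum_x A x * B x) ^+ p.+1 <= (\sum_x A x) ^+ p * \sum_x A x * B x ^+ p.+1.
Proof.
move=> A0 B0; set s := \sum_x A x.
have s0 : 0 <= s by exact: sumr_ge0.
have [sp|sn] := ltP 0 s; last first.
  have se : s = 0 by apply/eqP; rewrite eq_le sn s0.
  have Ax x : A x = 0 by apply: (psumr_eq0P _ se).
  rewrite big1; last by move=> x _; rewrite Ax mul0r.
  by rewrite expr0n mulr_ge0 ?exprn_ge0 // sumr_ge0 // => x _; rewrite Ax mul0r.
have := @jensen_pow R E (fun x => A x / s) B p.
have -> : \sum_x A x / s = 1 by rewrite -mulr_suml divff // gt_eqF.
move=> /(_ (fun x => divr_ge0 (A0 x) s0) erefl B0).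
have -> : \sum_x A x / s * B x = (\sum_x A x * B x) / s.
  by rewrite mulr_suml; apply: eq_bigr => x _; rewrite mulrAC.
have -> : \sum_x A x / s * B x ^+ p.+1 = (\sum_x A x * B x ^+ p.+1) / s.
  by rewrite mulr_suml; apply: eq_bigr => x _; rewrite mulrAC.
rewrite expr_div_n ler_pdivrMr ?exprn_gt0 // => /le_trans; apply.
rewrite exprS -!mulrA; set X := \sum_x _.
rewrite [s^-1 * _]mulrCA.
by rewrite mulVKf ?gt_eqF // mulrC.
Qed.

Lemma tangent_even p (y m : R) :
  m ^+ (2 * p.+1) + (2 * p.+1%:R * m ^+ (2 * p).+1) * (y - m) <= y ^+ (2 * p.+1).
Proof.
have := pow_tangent p (sqr_ge0 m) (sqr_ge0 y); rewrite -!exprM => /(le_trans _); apply.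
rewrite lerD2l exprS.
have -> : 2 * p.+1%:R * (m * m ^+ (2 * p)) * (y - m) = p.+1%:R * m ^+ (2 * p) * (2 * m * (y - m)) by ring.
rewrite ler_wpM2l //; first by rewrite mulr_ge0 // exprM exprn_ge0 // sqr_ge0.
by have := sqr_ge0 (y - m); lra.
Qed.

Lemma pow_superadd p (A B : R) : 0 <= A -> 0 <= B -> A ^+ p.+1 + B ^+ p.+1 <= (A + B) ^+ p.+1.
Proof.
move=> A0 B0; elim: p => [|p IH]; first by rewrite !expr1.
have h := ler_wpM2l (addr_ge0 A0 B0) IH.
rewrite [leRHS]exprS; apply: le_trans h; rewrite ![_ ^+ p.+2]exprS mulrDl !mulrDr.
have := mulr_ge0 A0 (exprn_ge0 p.+1 B0); have := mulr_ge0 B0 (exprn_ge0 p.+1 A0); lra.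
Qed.

Lemma clarkson p (x y : R) : ((x + y) / 2) ^+ (2 * p.+1) + ((x - y) / 2) ^+ (2 * p.+1) <=
  (x ^+ (2 * p.+1) + y ^+ (2 * p.+1)) / 2.
Proof.
rewrite !exprM; apply: le_trans (pow_superadd _ (sqr_ge0 _) (sqr_ge0 _)) _.
have -> : ((x + y) / 2) ^+ 2 + ((x - y) / 2) ^+ 2 = (x ^+ 2 + y ^+ 2) / 2 by field.
have h (z : R) := pow_tangent p (divr_ge0 (addr_ge0 (sqr_ge0 x) (sqr_ge0 y)) (ler0n R 2)) (sqr_ge0 z).
have := h x; have := h y; set m := (_ / 2); set K := p.+1%:R * m ^+ p.
have -> : y ^+ 2 - m = - (x ^+ 2 - m) by rewrite /m; field.
by rewrite mulrN; lra.
Qed.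
End PowerInequalities.

Section Dissipation.
Variables (R : realType) (V : finZmodType) (d : nat) (e : 'I_d -> V) (alpha beta : R).
Hypotheses (d_gt0 : (0 < d)%N) (alpha_gt0 : 0 < alpha) (le_ab : alpha <= beta).
Variable a : V * 'I_d -> R.
Hypothesis ha : elliptic alpha beta a.
Local Notation c := (cst d beta).

(** Because the walk is lazy, [Tw f x] is a convex combination of [f x] and of the midpoints of [f]
    along the edges at [x]. Convexity of the q-th power at midpoints, in Clarkson's form, leaves the
    q-th powers of the half differences as a gain. *)
Lemma dissipation p (f : V -> R) :
  (4 * alpha / c / 2 ^+ (2 * p.+1)) * \sum_E dg e E f ^+ (2 * p.+1) <=
  \sum_x f x ^+ (2 * p.+1) - \sum_x Tw e beta a f x ^+ (2 * p.+1).
Proof.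
set q := (2 * p.+1)%N; have c0 := cst_gt0 d_gt0 alpha_gt0 le_ab.
have a0 E : 0 <= a E by have /andP[h _] := ha E; exact: le_trans (ltW alpha_gt0) h.
have pt x : Tw e beta a f x ^+ q <= Tw e beta a (fun y => f y ^+ q) x -
   2 / c * \sum_i (a (x, i) * ((f x - f (x + e i)) / 2) ^+ q + a (x - e i, i) * ((f x - f (x - e i)) / 2) ^+ q).
  set m := Tw e beta a f x; set K := 2 * p.+1%:R * m ^+ (2 * p).+1.
  have tg y : m ^+ q + K * (y - m) <= y ^+ q by exact: tangent_even.
  have ck (y z : R) : ((y + z) / 2) ^+ q <= (y ^+ q + z ^+ q) / 2 - ((y - z) / 2) ^+ q.
    by have := clarkson p y z; rewrite -/q; lra.
  set W := \sum_i (a (x, i) + a (x - e i, i)).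
  have r0 : 0 <= 1 - 2 / c * W.
    have h := ler_wpM2l (ltW (divr_gt0 (ltr0n R 2) c0)) (sum_cond_le e ha x).
    have : 2 / c * (c / 2) = 1 by field; rewrite gt_eqF.
    by rewrite -/W in h; lra.
  have key : \sum_i (a (x, i) * (m ^+ q + K * ((f x + f (x + e i)) / 2 - m)) +
       a (x - e i, i) * (m ^+ q + K * ((f x + f (x - e i)) / 2 - m))) <=
     \sum_i (a (x, i) * ((f x ^+ q + f (x + e i) ^+ q) / 2 - ((f x - f (x + e i)) / 2) ^+ q) +
       a (x - e i, i) * ((f x ^+ q + f (x - e i) ^+ q) / 2 - ((f x - f (x - e i)) / 2) ^+ q)).
    by apply: ler_sum => i _; apply: lerD; rewrite ler_wpM2l //; apply: le_trans (tg _) (ck _ _).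
  have key2 := ler_wpM2l r0 (tg (f x)).
  have := lerD (ler_wpM2l (ltW (divr_gt0 (ltr0n R 2) c0)) key) key2.
  set N1 := \sum_i (a (x, i) * f (x + e i) + a (x - e i, i) * f (x - e i)).
  set Nq := \sum_i (a (x, i) * f (x + e i) ^+ q + a (x - e i, i) * f (x - e i) ^+ q).
  set Dq := \sum_i (a (x, i) * ((f x - f (x + e i)) / 2) ^+ q + a (x - e i, i) * ((f x - f (x - e i)) / 2) ^+ q).
  have -> : \sum_i (a (x, i) * (m ^+ q + K * ((f x + f (x + e i)) / 2 - m)) +
       a (x - e i, i) * (m ^+ q + K * ((f x + f (x - e i)) / 2 - m))) =
     W * (m ^+ q + K * (f x / 2 - m)) + K / 2 * N1.
    by rewrite /W /N1 mulr_suml mulr_sumr -big_split; apply: eq_bigr => i _ /=; field.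
  have -> : \sum_i (a (x, i) * ((f x ^+ q + f (x + e i) ^+ q) / 2 - ((f x - f (x + e i)) / 2) ^+ q) +
       a (x - e i, i) * ((f x ^+ q + f (x - e i) ^+ q) / 2 - ((f x - f (x - e i)) / 2) ^+ q)) =
     W * (f x ^+ q / 2) + Nq / 2 - Dq.
    rewrite /W /Nq /Dq [in RHS]mulr_suml [in RHS]mulr_suml -big_split -sumrB /=; apply: eq_bigr => i _ /=.
    by move: (f x ^+ q) (f (x + e i) ^+ q) (f (x - e i) ^+ q) (((f x - f (x + e i)) / 2) ^+ q)
     (((f x - f (x - e i)) / 2) ^+ q) => *; field.
  have mE : m = (1 - c^-1 * W) * f x + c^-1 * N1 by rewrite /m TE.
  have mqE : Tw e beta a (fun y => f y ^+ q) x = (1 - c^-1 * W) * f x ^+ q + c^-1 * Nq by rewrite TE.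
  rewrite mqE => h.
  have e1 : 2 / c * (W * (m ^+ q + K * (f x / 2 - m)) + K / 2 * N1) + (1 - 2 / c * W) * (m ^+ q + K * (f x - m))
     = m ^+ q + K * ((1 - c^-1 * W) * f x + c^-1 * N1 - m).
    by field; rewrite gt_eqF.
  rewrite e1 -mE subrr mulr0 addr0 in h.
  apply: le_trans h _; rewrite le_eqVlt; apply/orP; left; apply/eqP.
  by field; rewrite gt_eqF.
have := ler_sum _ (fun x _ => pt x) : \sum_x _ <= \sum_x _.
rewrite sumrB sum_T -mulr_sumr (sum_nbrs e (fun x y E => a E * ((f x - f y) / 2) ^+ q)).
move=> h; rewrite lerBrDl -lerBrDr; apply: le_trans h _; rewrite lerB //.
rewrite !mulr_sumr; apply: ler_sum => E _.
have qe (y z : R) : ((y - z) / 2) ^+ q = (z - y) ^+ q / 2 ^+ q.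
  by rewrite expr_div_n !exprM -sqrrN opprB.
rewrite !qe -/(dg e E f); set D := dg e E f ^+ q.
have -> : (f E.1 - f (E.1 + e E.2)) ^+ q = D.
  by rewrite /D /dg /q !exprM -sqrrN opprB.
have D0 : 0 <= D by rewrite /D /q exprM exprn_ge0 // sqr_ge0.
have aE : alpha <= a E by case/andP: (ha E).
have w0 : 0 <= 4 / c / 2 ^+ q * D by apply: mulr_ge0 => //; rewrite !divr_ge0 ?exprn_ge0 // ltW.
have := ler_wpM2l w0 aE; lra.
Qed.
End Dissipation.

(** * From sensitivities to a convolution inequality for moments *)

Section OneStep.
Variables (R : realType) (d : nat) (alpha beta : R).
Hypotheses (d_gt0 : (0 < d)%N) (alpha_gt0 : 0 < alpha) (le_ab : alpha <= beta).
Local Notation c := (cst d beta).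
Let c0 : 0 < c := cst_gt0 d_gt0 alpha_gt0 le_ab.
(** The target rate for norms: half of the exponent of the variance. *)
Definition gam : R := (d%:R / 2 + 1) / 2.

Lemma hkE (M : model d alpha beta) s n x E : hk (M := M) s n x E = dip s n E x.
Proof. by rewrite /hk -dot_dlt dot_Tn dotC dot_delta. Qed.

Lemma sum_hk (M : model d alpha beta) s n E :
  \sum_x hk (M := M) s n x E ^+ 2 = dot (dip s n E) (dip s n E).
Proof. by apply: eq_bigr => x _; rewrite hkE expr2. Qed.

(** Contribution of the Duhamel time [k] to the square function of [u], with [t] steps left for the
    kernel, raised to the power [p]. Each gradient is taken in the environment resampled at its own
    edge, as [sol_diff] produces it. *)
Definition KK (M : model d alpha beta) p t k : R :=
  mean (fun x => Ex (@mw _ _ _ _ M) (fun s =>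
    (\sum_E hk (M := M) s t x E ^+ 2 * dg (@me _ _ _ _ M) E (u (sw1 E s) k) ^+ 2) ^+ p)).

Lemma norm_diff_le (k x y : R) : beta - alpha <= k -> alpha <= x <= beta -> alpha <= y <= beta -> `|x - y| <= k.
Proof. by move=> k0 /andP[h1 h2] /andP[h3 h4]; rewrite ler_norml; apply/andP; split; lra. Qed.

Lemma env_diff (M : model d alpha beta) s E : `|env (M := M) s E - env (sw1 E s) E| <= beta.
Proof.
by apply: norm_diff_le (env_ell s E) (env_ell (sw1 E s) E); rewrite gerBl ltW.
Qed.

(** The moments given by [efron_stein_pow], with sensitivities expanded by [sol_diff]. The sum over
    Duhamel times leaves the moment through [minkowski_weights]. *)
Lemma es_bound m : exists2 C : R, 0 < C & forall (M : model d alpha beta) n (kap : nat -> R),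
  (n <= mN M)%N -> (forall k, (k < n)%N -> 0 <= kap k) ->
  (forall k, (k < n)%N -> KK M (2 ^ m) (n.-1 - k) k <= kap k ^+ (2 * 2 ^ m)) ->
  aq M (2 * 2 ^ m) n <= C * (pw n (- gam) + \sum_(k < n) kap k).
Proof.
have [C1 C10 ES] := efron_stein_pow R m.
have [Cg Cg0 Hg] := grad_decay d_gt0 alpha_gt0 le_ab.
set q := (2 * 2 ^ m)%N; pose p := (2 ^ m).-1.
have pE : (2 ^ m)%N = p.+1 by rewrite prednK // expn_gt0.
have q0 : (0 < q)%N by rewrite muln_gt0 expn_gt0.
have b0 : 0 < beta := beta_gt0 alpha_gt0 le_ab.
pose L := beta * Num.sqrt Cg + beta / c.
have L0 : 0 < L by rewrite addr_gt0 ?mulr_gt0 ?invr_gt0 ?sqrtr_gt0.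
exists (rt q C1 * L); first by rewrite mulr_gt0 // /rt powR_gt0.
move=> M n kap nN kap0 hk_le.
(* The extra index [n] stands for the dependence through the initial datum; [grad_decay] gives it
   the optimal rate. *)
pose Kf k := if (k < n)%N then beta / c * kap k else beta * Num.sqrt Cg * pw n (- gam).
have Kf0 k : 0 <= Kf k.
  rewrite /Kf; case: ifP => [kn|_].
    by rewrite mulr_ge0 ?kap0 // divr_ge0 // ltW.
  by rewrite mulr_ge0 ?pw_ge0 // mulr_ge0 ?sqrtr_ge0 // ltW.
pose f s x k E : R := if (k < n)%N then
   - c^-1 * ((env s E - env (sw1 E s) E) * hk s (n.-1 - k) x E * dg (@me _ _ _ _ M) E (u (sw1 E s) k))
   else - (env s E - env (sw1 E s) E) * mxi M E.2 * hk s n x E.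
have fE s x E : u s n x - u (sw1 E s) n x = \sum_(k < n.+1) f s x k E.
  rewrite big_ord_recr /= /f ltnn (@sol_diff _ _ _ _ _ _ (env s) (env (sw1 E s)) E).
    rewrite addrC -/(hk s n x E); congr (_ + _); rewrite mulr_sumr -sumrN; apply: eq_bigr => k _.
    by rewrite ltn_ord mulNr.
  by move=> E' h; rewrite env_sw1.
have V1 x s : vfun (fun s => u s n x) s = \sum_E (\sum_(k < n.+1) f s x k E) ^+ 2.
  by apply: eq_bigr => E _; rewrite fE.
have d2 (s : {ffun mV M * 'I_d * option bool -> mS M}) E : (env s E - env (sw1 E s) E) ^+ 2 <= beta ^+ 2.
  by rewrite -real_normK ?num_real // lerXn2r ?nnegrE ?(ltW b0) // env_diff.
have mK (k : 'I_n.+1) : mean (fun x => Ex (@mw _ _ _ _ M) (fun s => (\sum_E f s x k E ^+ 2) ^+ p.+1)) <= Kf k ^+ q.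
  rewrite /Kf /f; case: ifP => kn.
    rewrite exprMn {1}/q exprM -pE.
    apply: (@le_trans _ _ ((beta / c) ^+ 2 ^+ (2 ^ m) * KK M (2 ^ m) (n.-1 - k) k)); last first.
      by apply: ler_wpM2l; [rewrite exprn_ge0 ?sqr_ge0|exact: hk_le].
    rewrite /KK -meanZ; apply: mean_le => x; rewrite -ExZ; apply: Ex_le; first exact: mw_ge0.
    move=> s; rewrite -exprMn lerXn2r ?nnegrE //.
    - by rewrite sumr_ge0 // => E _; rewrite sqr_ge0.
    - by rewrite mulr_ge0 ?sqr_ge0 // sumr_ge0 // => E _; rewrite mulr_ge0 ?sqr_ge0.
    rewrite mulr_sumr; apply: ler_sum => E _.
    have -> : (- c^-1 * ((env s E - env (sw1 E s) E) * hk s (n.-1 - k) x E * dg (@me _ _ _ _ M) E (u (sw1 E s) k))) ^+ 2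
      = (env s E - env (sw1 E s) E) ^+ 2 * (c^-1 ^+ 2 * (hk s (n.-1 - k) x E ^+ 2 * dg (@me _ _ _ _ M) E (u (sw1 E s) k) ^+ 2)).
      by ring.
    rewrite [(beta / c) ^+ 2]exprMn -mulrA ler_wpM2r ?d2 //.
    by rewrite mulr_ge0 ?sqr_ge0 // mulr_ge0 ?sqr_ge0.
  rewrite -[leRHS](mean_cst M); apply: mean_le => x.
  rewrite -[leRHS](mEx_cst M); apply: Ex_le; first exact: mw_ge0.
  move=> s; rewrite {1}/q exprM pE lerXn2r ?nnegrE ?sqr_ge0 //.
    by rewrite sumr_ge0 // => E _; rewrite sqr_ge0.
  rewrite !exprMn sqr_sqrtr ?(ltW Cg0) // -mulrA.
  have -> : pw n (- gam) ^+ 2 = pw n (- (d%:R / 2 + 1)) :> R by rewrite pw_exp /gam; congr pw; field.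
  apply: (@le_trans _ _ (beta ^+ 2 * gradsq (@me _ _ _ _ M) (Tn (@me _ _ _ _ M) beta (env s) n (delta x)))).
    rewrite /gradsq mulr_sumr; apply: ler_sum => E _.
    rewrite !exprMn sqrrN ler_wpM2r ?sqr_ge0 // -[leRHS]mulr1 ler_pM ?sqr_ge0 ?d2 //.
    by rewrite -real_normK ?num_real // -(expr1n _ 2) lerXn2r ?nnegrE ?mxi_le.
  by apply: ler_wpM2l; [rewrite sqr_ge0|exact: Hg _ _ _ _ (m_torus M) (env_ell s) _ _ nN].
have main : mean (fun x => Ex (@mw _ _ _ _ M) (fun s => vfun (fun s => u s n x) s ^+ (2 ^ m))) <=
   (\sum_(k < n.+1) Kf k) ^+ q.
  have -> : q = q.-1.+1 by rewrite prednK.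
  apply: minkowski_weights => [k|l l0 l1|]; [exact: Kf0| |by rewrite card_ord].
  apply: (@le_trans _ _ (mean (fun x => Ex (@mw _ _ _ _ M) (fun s =>
     \sum_(k < n.+1) l k * ((\sum_E f s x k E ^+ 2) / l k ^+ 2) ^+ p.+1)))).
    apply: mean_le => x; apply: Ex_le; first exact: mw_ge0.
    by move=> s; rewrite V1 pE; exact: mixed_jensen.
  have -> : (fun x => Ex (@mw _ _ _ _ M) (fun s => \sum_(k < n.+1) l k * ((\sum_E f s x k E ^+ 2) / l k ^+ 2) ^+ p.+1)) =
     fun x => \sum_(k < n.+1) (l k / l k ^+ 2 ^+ p.+1) * Ex (@mw _ _ _ _ M) (fun s => (\sum_E f s x k E ^+ 2) ^+ p.+1).
    apply/funext => x; rewrite Ex_sum; apply: eq_bigr => k _; rewrite -ExZ; apply: Ex_ext => s.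
    by rewrite expr_div_n; ring.
  rewrite mean_sum; apply: ler_sum => k _; rewrite meanZ.
  have -> : l k * (Kf k / l k) ^+ q.-1.+1 = (l k / l k ^+ 2 ^+ p.+1) * Kf k ^+ q.
    have lq : l k ^+ 2 ^+ p.+1 = l k ^+ q by rewrite -exprM -pE.
    by rewrite lq expr_div_n prednK // mulrA mulrAC.
  by rewrite ler_wpM2l ?mK // divr_ge0 ?exprn_ge0 ?sqr_ge0 // ltW.
have sK : \sum_(k < n.+1) Kf k <= L * (pw n (- gam) + \sum_(k < n) kap k).
  rewrite big_ord_recr /= {2}/Kf ltnn mulrDr addrC lerD //.
    by rewrite ler_wpM2r ?pw_ge0 // lerDl divr_ge0 // ltW.
  rewrite mulr_sumr; apply: ler_sum => k _; rewrite /Kf ltn_ord ler_wpM2r ?kap0 //.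
  by rewrite lerDr mulr_ge0 ?sqrtr_ge0 // ltW.
have S0 : 0 <= \sum_(k < n.+1) Kf k by exact: sumr_ge0.
apply: rt_le => //.
- by apply: mean_ge0 => x; apply: Ex_ge0 => [|s]; [exact: mw_ge0|rewrite exprn_ge0].
- rewrite mulr_ge0 ?mulr_ge0 ?rt_ge0 ?(ltW L0) // addr_ge0 ?pw_ge0 // sumr_ge0 // => k _.
  by rewrite kap0.
apply: (@le_trans _ _ (C1 * (\sum_(k < n.+1) Kf k) ^+ q)); last first.
  rewrite -mulrA exprMn rtK // ?(ltW C10) // ler_wpM2l ?(ltW C10) // lerXn2r ?nnegrE //.
  exact: le_trans sK.
apply: (@le_trans _ _ (C1 * mean (fun x => Ex (@mw _ _ _ _ M) (fun s => vfun (fun s => u s n x) s ^+ (2 ^ m))))); last first.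
  by rewrite ler_wpM2l ?(ltW C10).
rewrite -meanZ; apply: mean_le => x.
under Ex_ext do rewrite norm_even.
apply: ES; [exact: mw_ge0|exact: mw_sum|exact: u_dep|exact: Ex_u].
Qed.

(** Written with the excess over the critical exponent 1: it is d/2 - 1 for d >= 3 and a small
    number obtained by hole filling in the plane. *)
Definition dipole_bound (C del : R) := 0 < C /\
  forall (V : finZmodType) (e : 'I_d -> V) N a, torus e N -> elliptic alpha beta a ->
  forall n E, (n <= N)%N ->
  dot (Tn e beta a n (dlt e E)) (Tn e beta a n (dlt e E)) <= C * pw n (- (1 + del)).

(** The interpolation exponent of [KK_le]: p - 1 factors of rate 2 gam and one of rate 1 + del,
    divided by 2p. *)
Definition sig (del : R) (p : nat) : R := gam - (2 * gam - 1 - del) / (2 * p%:R).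

(** Hölder with weights [hk ^+ 2]: [p] factors are bounded by the sum over edges, the last one is
    summed over sites and becomes a dipole energy. Both bounds hold in every environment, so the
    gradient is left alone in the expectation and its resampling is undone. *)
Lemma KK_le C del p : dipole_bound C del -> exists2 C' : R, 0 < C' &
  forall (M : model d alpha beta) t k, (t <= mN M)%N ->
  KK M p.+1 t k <= (C' * pw t (- sig del p.+1) * bq M (2 * p.+1) k) ^+ (2 * p.+1).
Proof.
move=> [C0 HC]; have [Cg Cg0 Hg] := grad_decay d_gt0 alpha_gt0 le_ab.
set q := (2 * p.+1)%N; have q0 : (0 < q)%N by rewrite muln_gt0.
exists (rt q (Cg ^+ p * C)); first by rewrite /rt powR_gt0 // mulr_gt0 // exprn_gt0.
move=> M t k tN.
have P0 : 0 < Cg ^+ p * C by rewrite mulr_gt0 // exprn_gt0.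
rewrite !exprMn rtK ?(ltW P0) // bqE //.
have -> : pw t (- sig del p.+1) ^+ q = pw t (- (d%:R / 2 + 1)) ^+ p * pw t (- (1 + del)) :> R.
  rewrite !pw_exp -pwD; congr pw; rewrite /sig /gam /q natrM -[p.+1%:R]natr1.
  have : 0 < p%:R + 1 :> R by rewrite natr1 ltr0n.
  by move: (p%:R) => P Pp; field; rewrite gt_eqF.
set G := Cg * pw t (- (d%:R / 2 + 1)); set D := C * pw t (- (1 + del)).
have -> : Cg ^+ p * C * (pw t (- (d%:R / 2 + 1)) ^+ p * pw t (- (1 + del))) *
   (#|mV M|%:R^-1 * \sum_E Ex (@mw _ _ _ _ M) (fun s => `|dg (@me _ _ _ _ M) E (u s k)| ^+ q)) =
   G ^+ p * (#|mV M|%:R^-1 * \sum_E (D * Ex (@mw _ _ _ _ M) (fun s => `|dg (@me _ _ _ _ M) E (u s k)| ^+ q))).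
  by rewrite -mulr_sumr /G /D exprMn; ring.
have G0 : 0 <= G by rewrite mulr_ge0 ?pw_ge0 // ltW.
apply: (@le_trans _ _ (mean (fun x => Ex (@mw _ _ _ _ M) (fun s => G ^+ p *
   \sum_E hk (M := M) s t x E ^+ 2 * (dg (@me _ _ _ _ M) E (u (sw1 E s) k) ^+ 2) ^+ p.+1)))).
  apply: mean_le => x; apply: Ex_le; first exact: mw_ge0.
  move=> s; apply: le_trans (weighted_pow _ _ _) _; [by move=> ?; rewrite sqr_ge0|by move=> ?; rewrite sqr_ge0|].
  rewrite ler_wpM2r //.
    by apply: sumr_ge0 => E _; apply: mulr_ge0; [exact: sqr_ge0|apply: exprn_ge0; exact: sqr_ge0].
  rewrite lerXn2r ?nnegrE //; first by apply: sumr_ge0 => E _; exact: sqr_ge0.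
  exact: Hg _ _ _ _ (m_torus M) (env_ell s) _ _ tN.
under [X in mean X <= _]eq_fun do rewrite ExZ.
rewrite meanZ ler_wpM2l ?exprn_ge0 // /mean ler_wpM2l ?invr_ge0 ?ler0n //.
under eq_bigr do rewrite Ex_sum.
rewrite exchange_big /=; apply: ler_sum => E _.
rewrite -(Ex_sw1 _ E (fun s => `|dg (@me _ _ _ _ M) E (u s k)| ^+ q)) -ExZ -Ex_sum.
apply: Ex_le; first exact: mw_ge0.
move=> s; rewrite -mulr_suml sum_hk /q norm_even -exprM ler_wpM2r //.
  by rewrite exprM exprn_ge0 // sqr_ge0.
exact: HC _ _ _ _ (m_torus M) (env_ell s) _ _ tN.
Qed.

(** The integrated form of [dissipation]. Its right side telescopes in time, which is how gradients
    are summed over dyadic blocks. *)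
Lemma bq_le_aq p : exists2 C : R, 0 < C & forall (M : model d alpha beta) n,
  bq M (2 * p.+1) n ^+ (2 * p.+1) <= C * (aq M (2 * p.+1) n ^+ (2 * p.+1) - aq M (2 * p.+1) n.+1 ^+ (2 * p.+1)).
Proof.
set q := (2 * p.+1)%N; have q0 : (0 < q)%N by rewrite muln_gt0.
pose k := 4 * alpha / c / 2 ^+ q; have k0 : 0 < k by rewrite !divr_gt0 ?exprn_gt0 // mulr_gt0.
exists k^-1; first by rewrite invr_gt0.
move=> M n; rewrite ler_pdivlMl // bqE // !aqE // /mean -mulrBr mulrCA ler_wpM2l ?invr_ge0 ?ler0n //.
rewrite -!Ex_sum -ExB -ExZ; apply: Ex_le; first exact: mw_ge0.
move=> s; have := dissipation (@me _ _ _ _ M) d_gt0 alpha_gt0 le_ab (env_ell s) p (u s n).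
rewrite -/q -/k /q; under eq_bigr do rewrite -norm_even.
under [X in _ <= X - _ -> _]eq_bigr do rewrite -norm_even.
by under [X in _ <= _ - X -> _]eq_bigr do rewrite -norm_even.
Qed.

Lemma aq0_le q (M : model d alpha beta) : (0 < q)%N -> aq M q 0 <= 2 * d%:R * beta.
Proof.
move=> q0; have b0 : 0 < beta := beta_gt0 alpha_gt0 le_ab.
have B0 : 0 <= 2 * d%:R * beta by rewrite mulr_ge0 ?mulr_ge0 // ltW.
have h0 : 0 <= mean (fun x => Ex (@mw _ _ _ _ M) (fun s => `|u s 0 x| ^+ q)).
  by apply: mean_ge0 => x; apply: Ex_ge0 => [|s]; [exact: mw_ge0|rewrite exprn_ge0].
apply: rt_le => //; rewrite -[leRHS](mean_cst M); apply: mean_le => x.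
rewrite -[leRHS](mEx_cst M); apply: Ex_le; first exact: mw_ge0.
move=> s; rewrite lerXn2r ?nnegrE // /u /sol /= /u0; apply: le_trans (ler_norm_sum _ _ _) _.
apply: (@le_trans _ _ (\sum_(i < d) 2 * beta)); last first.
  by rewrite sumr_const card_ord -mulr_natl; lra.
apply: ler_sum => i _; rewrite normrM -[leRHS]mul1r ler_pM ?mxi_le //.
apply: norm_diff_le (env_ell s (x, i)) (env_ell s (x - me M i, i)).
by apply: (@le_trans _ _ beta); rewrite ?gerBl ?ler_peMl ?ler1n ?(ltW b0) ?(ltW alpha_gt0).
Qed.

Lemma aq_mono p (M : model d alpha beta) n m : (m <= n)%N -> aq M (2 * p.+1) n <= aq M (2 * p.+1) m.
Proof.
have [C C0 h] := bq_le_aq p.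
have st k : aq M (2 * p.+1) k.+1 <= aq M (2 * p.+1) k.
  have hk0 := le_trans (exprn_ge0 (2 * p.+1) (bq_ge0 M (2 * p.+1) k)) (h M k).
  rewrite pmulr_rge0 // subr_ge0 in hk0.
  by rewrite -(@ler_pXn2r _ (2 * p.+1)) ?nnegrE ?aq_ge0.
move=> /subnK <-; elim: (n - m)%N => [|j IH]; first exact: lexx.
by apply: le_trans IH; rewrite addSn; exact: st.
Qed.

End OneStep.

(** * Sequences satisfying a convolution inequality *)

Section Sequences.
Variable R : realType.
Implicit Types (a b v g : nat -> R).

Lemma pw_double m x : pw (2 * m).+1 x = 2 `^ x * pw m x :> R.
Proof.
rewrite /pw -powRM ?ler0n // -natrM; congr (_%:R `^ _); rewrite mulnS.
by rewrite -addn2 addnC.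
Qed.

Lemma two_pow_lt1 (x : R) : 0 < x -> 2 `^ (- x) < 1 :> R.
Proof.
move=> x0; rewrite powRN invf_lt1 ?powR_gt0 //.
have := @gt0_ltr_powR R x x0 1 2; rewrite !nnegrE ler01 ler0n ltr1n powR1; exact.
Qed.

(* The constant is the sum of the geometric series of ratio 2^-eta. *)
Lemma dyadic_sum (D eta : R) b Nb : 0 < eta -> 0 <= D -> (forall s, 0 <= b s) ->
  (forall m, (m <= Nb)%N -> \sum_(m <= s < (2 * m).+1) b s <= D * pw m (- eta)) ->
  forall m n, (n <= Nb.+1)%N -> \sum_(m <= s < n) b s <= (1 - 2 `^ (- eta))^-1 * D * pw m (- eta).
Proof.
move=> eta0 D0 b0 blk; have lt1 := two_pow_lt1 eta0; set K := (1 - 2 `^ (- eta))^-1.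
have K0 : 0 < K by rewrite invr_gt0 subr_gt0.
have K1 : 1 + K * 2 `^ (- eta) = K.
  by rewrite /K; field; rewrite subr_eq0 gt_eqF.
move=> m n nN; have [k] := ubnP (n - m)%N; elim: k m => // k IH m km.
have [nm|mn] := leqP n m; first by rewrite big_geq // !mulr_ge0 ?pw_ge0 // ltW.
have mN : (m <= Nb)%N by rewrite -ltnS (leq_trans mn).
have [n2|n2] := leqP n (2 * m).+1.
  apply: (@le_trans _ _ (D * pw m (- eta))).
    apply: le_trans (blk m mN); rewrite [leRHS](@big_cat_nat _ _ _ n) ?(ltnW mn) //= lerDl.
    by rewrite sumr_ge0.
  by rewrite ler_wpM2r ?pw_ge0 // ler_peMl // -K1 lerDl mulr_ge0 ?powR_ge0 // ltW.
rewrite (@big_cat_nat _ _ _ (2 * m).+1) /=; [|lia|exact: ltnW].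
apply: (@le_trans _ _ (D * pw m (- eta) + K * D * pw (2 * m).+1 (- eta))).
  apply: lerD; first exact: blk.
  by apply: IH; lia.
by rewrite pw_double -{2}K1 le_eqVlt; apply/orP; left; apply/eqP; ring.
Qed.

Lemma block_le b m : (forall k, (m <= k)%N -> b k <= b m) ->
  \sum_(m <= s < (2 * m).+1) b s <= m.+1%:R * b m.
Proof.
move=> h; apply: (@le_trans _ _ (\sum_(m <= s < (2 * m).+1) b m)).
  by apply: ler_sum_nat => s /andP[ms _]; exact: h.
have -> : m.+1 = ((2 * m).+1 - m)%N by lia.
by rewrite sumr_const_nat -[b m *+ _]mulr_natl.
Qed.

Lemma sum_pw_tail (x : R) m n : 0 < x -> \sum_(m <= s < n) pw s (- (1 + x)) <= (1 - 2 `^ (- x))^-1 * pw m (- x).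
Proof.
move=> x0; have := @dyadic_sum 1 x (fun s => pw s (- (1 + x))) n x0 ler01 (fun s => pw_ge0 _ _).
rewrite mulr1; apply => // l _; apply: le_trans (block_le _) _.
  by move=> i li; apply: pw_anti => //; lra.
by rewrite mul1r -pw1 -pwD; apply: pw_ler; lra.
Qed.

Lemma sum_pw_conv (x : R) n : 1 < x -> \sum_(0 <= s < n) pw s (- x) <= (1 - 2 `^ (- (x - 1)))^-1.
Proof.
by move=> x1; have := @sum_pw_tail (x - 1) 0 n; rewrite pw0n mulr1 subr_gt0 [1 + _]addrC subrK; apply.
Qed.

Lemma sum_pw (th : R) n : 0 < th <= 1 -> \sum_(0 <= s < n) pw s (th - 1) <= (1 - 2 `^ (- th))^-1 * pw n th.
Proof.
move=> /andP[th0 th1]; have lt1 := two_pow_lt1 th0; set K := (1 - 2 `^ (- th))^-1.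
have K0 : 0 < K by rewrite invr_gt0 subr_gt0.
have K1 : 1 + K * 2 `^ (- th) = K.
  by rewrite /K; field; rewrite subr_eq0 gt_eqF.
apply: (@le_trans _ _ (K * n%:R `^ th)); last first.
  by rewrite ler_pM2l // ge0_ler_powR ?nnegrE ?ler0n ?ler_nat // ltW.
elim/ltn_ind: n => n IH; have [->|n0] := posnP n.
  by rewrite big_geq // powR0 ?mulr0 // gt_eqF.
pose m := n./2; have mn : (m < n)%N by rewrite /m; lia.
have n2 : (n <= (2 * m).+1)%N by rewrite /m; lia.
have n3 : (2 * m <= n)%N by rewrite /m; lia.
rewrite (@big_cat_nat _ _ _ m) //=; last exact: ltnW.
apply: (@le_trans _ _ (K * m%:R `^ th + n%:R `^ th)).
  apply: lerD; first exact: IH.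
  apply: (@le_trans _ _ (\sum_(m <= s < (2 * m).+1) pw s (th - 1))).
    rewrite [leRHS](@big_cat_nat _ _ _ n) ?(ltnW mn) //= lerDl sumr_ge0 // => i _.
    exact: pw_ge0.
  apply: le_trans (block_le _) _; first by move=> k mk; apply: pw_anti => //; lra.
  rewrite -pw1 -pwD addrC subrK ge0_ler_powR ?nnegrE ?ler0n ?ler_nat //; exact: ltW.
rewrite -{2}K1 mulrDl mul1r addrC lerD2l -mulrA ler_pM2l // powRN mulrC ler_pdivlMr ?powR_gt0 //.
by rewrite -powRM ?ler0n // -natrM ge0_ler_powR ?nnegrE ?ler0n ?ler_nat ?(ltW th0) // mulnC.
Qed.

Lemma block_holder q b m : (0 < q)%N -> (forall s, 0 <= b s) ->
  \sum_(m <= s < (2 * m).+1) b s <= pw m (1 - q%:R^-1) * rt q (\sum_(m <= s < (2 * m).+1) b s ^+ q).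
Proof.
move=> q0 b0; set X := \sum_(m <= s < _) b s ^+ q.
have X0 : 0 <= X by rewrite sumr_ge0 // => s _; rewrite exprn_ge0.
rewrite -(@ler_pXn2r _ q) ?nnegrE //; last 2 first.
- by rewrite sumr_ge0.
- by rewrite mulr_ge0 ?pw_ge0 ?rt_ge0.
rewrite exprMn [rt q X ^+ q]rtK // pw_exp.
have -> : (1 - q%:R^-1) * q%:R = q%:R - 1 :> R.
  by have : q%:R != 0 :> R; [rewrite pnatr_eq0 -lt0n|move: (q%:R : R) => z z0; field].
have eqn : ((2 * m).+1 - m = m.+1)%N by lia.
have E (F : nat -> R) : \sum_(m <= s < (2 * m).+1) F s = \sum_(i < m.+1) F (m + i)%N.
  rewrite -{1}(add0n m) big_addn big_mkord eqn; apply: eq_bigr => i _; by rewrite addnC.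
rewrite /X !E; have w0 : 0 < m.+1%:R :> R by rewrite ltr0n.
have := @jensen_pow R 'I_m.+1 (fun=> m.+1%:R^-1) (fun i => b (m + i)%N) q.-1.
have w0V : 0 < m.+1%:R^-1 :> R by rewrite invr_gt0.
have s1 : \sum_(i < m.+1) m.+1%:R^-1 = 1 :> R.
  by rewrite sumr_const card_ord -[_^-1 *+ _]mulr_natl divff // gt_eqF.
move=> /(_ (fun i => ltW w0V) s1 (fun i => b0 _)).
rewrite -!mulr_sumr exprMn prednK //; set Y := _ ^+ q; set Z := \sum_i _ => h.
rewrite /Y exprVn ler_pdivrMl ?exprn_gt0 // in h; apply: (le_trans h).
rewrite pwD [pw m (-1)]pwN pw1 /pw powR_mulrn ?ler0n //.
by rewrite mulrA.
Qed.

End Sequences.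

Section Gronwall.
Variable R : realType.
Implicit Types (a b v g : nat -> R).

Lemma triangle_sum (b g : nat -> R) m M' n : (forall s, 0 <= b s) -> (forall s, 0 <= g s) ->
  \sum_(m <= k < n.+1) \sum_(M' <= s < k) g (k.-1 - s)%N * b s <=
  (\sum_(0 <= t < n) g t) * \sum_(M' <= s < n) b s.
Proof.
move=> b0 g0; have gb t s : 0 <= g t * b s by rewrite mulr_ge0.
apply: (@le_trans _ _ (\sum_(m <= k < n.+1) \sum_(M' <= s < n | (s < k)%N) g (k.-1 - s)%N * b s)).
  apply: ler_sum_nat => k /andP[_ kn]; rewrite (@big_nat_widen _ _ _ _ _ n) //.
rewrite (exchange_big_dep xpredT) //= mulr_sumr; apply: ler_sum_nat => s /andP[_ sn].
rewrite -mulr_suml ler_wpM2r //.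
apply: (@le_trans _ _ (\sum_(0 <= k < n.+1 | (s < k)%N) g (k.-1 - s)%N)).
  rewrite (big_nat_widenl m 0) // [leRHS](bigID (fun k => (m <= k)%N)) /= lerDl.
  by rewrite sumr_ge0.
rewrite -[X in X <= _](big_nat_widenl s.+1 0 n.+1 xpredT) // -{1}(add0n s.+1) big_addn subSS.
rewrite [leRHS](@big_cat_nat _ _ _ (n - s)) ?leq_subr //=.
rewrite -[leLHS]addr0 lerD ?sumr_ge0 //.
by apply: ler_sum => t _; rewrite addnS /= addnK.
Qed.

(** Since [a] decreases, its value at 2M+1 is below its average over M < k <= 2M+1. Averaging turns
    the late part of the convolution, where kernel times may be short, into a product of two full
    sums divided by M+1. The early part has long kernel times and may use another, better kernel
    bound. *)
Lemma avg_conv (gm C : R) a v g b (kap : nat -> nat -> R) M : 0 <= gm -> 0 <= C ->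
  (forall s, 0 <= v s) -> (forall s, 0 <= b s) -> (forall s, 0 <= g s) ->
  (forall m n, (m <= n)%N -> a n <= a m) ->
  (forall k, (M < k <= (2 * M).+1)%N -> a k <= C * (pw k (- gm) + \sum_(s < k) kap (k.-1 - s)%N s)) ->
  (forall t s, (t + s <= 2 * M)%N -> (s < M./2)%N -> kap t s <= pw t (- gm) * v s) ->
  (forall t s, (t + s <= 2 * M)%N -> kap t s <= g t * b s) ->
  a (2 * M).+1 <= C * (2 `^ gm * pw M (- gm) * (1 + \sum_(0 <= s < M./2) v s) +
     M.+1%:R^-1 * ((\sum_(0 <= t < (2 * M).+1) g t) * \sum_(M./2 <= s < (2 * M).+1) b s)).
Proof.
move=> gm0 C0 v0 b0 g0 amono ha k1 k2.
set M' := M./2; have M'M : (M' <= M)%N by rewrite /M'; lia.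
have w0 : 0 < M.+1%:R :> R by rewrite ltr0n.
set A := 2 `^ gm * pw M (- gm) * (1 + \sum_(0 <= s < M') v s).
set B := (\sum_(0 <= t < (2 * M).+1) g t) * _.
suff h : M.+1%:R * a (2 * M).+1 <= C * (M.+1%:R * A + B).
  rewrite -(ler_pM2l w0); apply: (le_trans h); rewrite le_eqVlt; apply/orP; left; apply/eqP.
  by field; rewrite -natr1 in w0 *; rewrite ?(gt_eqF w0).
apply: (@le_trans _ _ (\sum_(M.+1 <= k < (2 * M).+2) a k)).
  have -> : M.+1%:R * a (2 * M).+1 = \sum_(M.+1 <= k < (2 * M).+2) a (2 * M).+1.
    by rewrite sumr_const_nat -[a _ *+ _]mulr_natl; congr (_%:R * _); clear; lia.
  by apply: ler_sum_nat => k /andP[_ k2']; apply: amono.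
apply: (@le_trans _ _ (\sum_(M.+1 <= k < (2 * M).+2) C * (A + \sum_(M' <= s < k) g (k.-1 - s)%N * b s))).
  apply: ler_sum_nat => k /andP[Mk k2M]; apply: (le_trans (ha k _)); first by rewrite Mk -ltnS.
  rewrite ler_wpM2l //.
  have two1 : 1 <= 2 `^ gm :> R by rewrite -[leLHS](powRr0 2) ler_powR // ler1n.
  have p1 : pw k (- gm) <= 2 `^ gm * pw M (- gm).
    apply: (@le_trans _ _ (pw M (- gm))); first by apply: pw_anti; rewrite ?oppr_le0 // ltnW.
    by rewrite ler_peMl ?pw_ge0.
  rewrite -(big_mkord xpredT (fun s => kap (k.-1 - s)%N s)) (@big_cat_nat _ _ _ M') //=; last first.
    by rewrite (leq_trans M'M) // ltnW.
  rewrite addrA; apply: lerD.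
    rewrite /A mulrDr mulr1 lerD // mulr_sumr; apply: ler_sum_nat => s /andP[_ sM].
    apply: (le_trans (k1 _ _ _ sM)); first by clear -sM Mk k2M M'M; lia.
    rewrite ler_wpM2r // -[gm in X in _ <= X * _]opprK; apply: pw_scale; rewrite ?oppr_le0 //.
    by clear -sM Mk; move: sM; rewrite /M'; lia.
  by apply: ler_sum_nat => s /andP[_ sk]; apply: k2; clear -sk k2M; lia.
rewrite -mulr_sumr ler_wpM2l // big_split /= sumr_const_nat -[A *+ _]mulr_natl.
have -> : ((2 * M).+2 - M.+1 = M.+1)%N by clear; lia.
by rewrite lerD2l; apply: triangle_sum.
Qed.

Lemma pw_small (z : R) K : 0 < z -> 0 < K -> exists M0, forall M, (M0 <= M)%N -> pw M (- z) <= K :> R.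
Proof.
move=> z0 K0; pose B := (K^-1) `^ z^-1; exists (Num.truncn B) => M MB.
have BM : B <= M.+1%:R.
  by apply: ltW; apply: lt_le_trans (truncnS_gt _) _; rewrite ler_nat ltnS.
rewrite pwN -[leRHS]invrK lef_pV2 ?posrE ?pw_gt0 ?invr_gt0 //.
have -> : K^-1 = B `^ z by rewrite /B -powRrM mulVf ?gt_eqF // powRr1 // invr_ge0 ltW.
by rewrite ge0_ler_powR ?nnegrE ?powR_ge0 ?ler0n // ltW.
Qed.

(* A priori bound: with L the best constant in a n <= L (n+1)^-sg, averaging over a dyadic block gives L <= C + L/2. *)
Lemma ode (q : nat) (sg C : R) : (0 < q)%N -> 0 < C -> 1 - q%:R^-1 < sg -> 0 <= sg ->
  exists2 C2 : R, 0 < C2 & forall N a b, (forall n, 0 <= a n) -> (forall n, 0 <= b n) ->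
  (forall m n, (m <= n)%N -> a n <= a m) -> a 0%N <= C ->
  (forall n, b n ^+ q <= C * (a n ^+ q - a n.+1 ^+ q)) ->
  (forall n, (n <= N)%N -> a n <= C * (pw n (- sg) + \sum_(s < n) pw (n.-1 - s) (- sg) * b s)) ->
  forall n, (n <= N)%N -> a n <= C2 * pw n (- sg).
Proof.
move=> q0 C0 sgq sg0; set iq : R := q%:R^-1 in sgq.
have iq0 : 0 < iq by rewrite invr_gt0 ltr0n.
have iq1 : iq <= 1 by rewrite invf_le1 ?ltr0n // ler1n.
(* Decay exponent of the block sums of [b] when [a] decays at rate [sg]: Hölder on a dyadic block
   costs 1 - iq. *)
pose eps := sg - 1 + iq; have eps0 : 0 < eps by rewrite /eps; lra.
(* Above 1 - sg, so that it bounds the growth of the summed kernel; below [iq], so that the late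
   part of the convolution keeps a negative power of M as a small factor. *)
pose th : R := (Num.max 0 (1 - sg) + iq) / 2.
have th0 : 0 < th by rewrite /th divr_gt0 // ltr_wpDl // le_max lexx.
have mx : Num.max 0 (1 - sg) < iq by rewrite gt_max iq0 /=; lra.
have thi : th < iq by rewrite /th ltr_pdivrMr //; lra.
have th1 : 1 - sg < th.
  have : 1 - sg <= Num.max 0 (1 - sg) by rewrite le_max lexx orbT.
  by rewrite /th => h; rewrite ltr_pdivlMr //; lra.
pose C1 := rt q C; have C10 : 0 < C1 by rewrite powR_gt0.
pose Ke := (1 - 2 `^ (- eps))^-1 : R.
have Ke0 : 0 < Ke by rewrite invr_gt0 subr_gt0 two_pow_lt1.
pose Kt := (1 - 2 `^ (- th))^-1 : R.
have Kt0 : 0 < Kt by rewrite invr_gt0 subr_gt0 two_pow_lt1.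
have tw0 (x : R) : 0 < 2 `^ x :> R by rewrite powR_gt0.
pose B1 := C * 2 `^ sg * 2 `^ sg * 2 `^ sg * (Ke * C1).
have B10 : 0 < B1 by rewrite !mulr_gt0.
have four : 0 < 4^-1 :> R by rewrite invr_gt0.
(* Beyond [m0] the sum of [b] carries only a small multiple of the unknown constant; the first [m0]
   terms are bounded outright by the initial value. [M0] plays the same part for the late half. Each
   absorbs a quarter. *)
have [m0 hm0] := @pw_small eps (4^-1 / B1) eps0 (divr_gt0 four B10).
pose B2 := C * 2 `^ sg * 2 `^ sg * (2 `^ th * Kt) * (Ke * C1 * 2 `^ eps).
have B20 : 0 < B2 by rewrite !mulr_gt0.
have z0 : 0 < iq - th by lra.
have [M0 hM0] := @pw_small (iq - th) (4^-1 / B2) z0 (divr_gt0 four B20).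
pose D1 := C * 2 `^ sg * 2 `^ sg * 2 `^ sg * (1 + m0%:R * (C1 * C)).
have D10 : 0 < D1 by rewrite !mulr_gt0 // ltr_pwDl // mulr_ge0 // mulr_ge0 // ltW.
pose D2 := C * pw (2 * M0).+2 sg; have D20 : 0 < D2 by rewrite mulr_gt0 // pw_gt0.
exists (2 * (D1 + D2)); first by rewrite mulr_gt0 // addr_gt0.
move=> N a b a0 b0 amono aC bq ha n nN.
pose L : R := \big[Num.max/0]_(k < n.+1) (a k * pw k sg).
have L0 : 0 <= L by exact: bigmax_ge_id.
have aL k : (k <= n)%N -> a k <= L * pw k (- sg).
  move=> kn; rewrite pwN ler_pdivlMr ?pw_gt0 //.
  by rewrite /L (@le_bigmax _ _ _ 0 (fun k : 'I_n.+1 => a k * pw k sg) (Ordinal (kn : (k < n.+1)%N))).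
suff LL : L <= D1 + D2 + L / 2.
  have : L <= 2 * (D1 + D2) by lra.
  by move=> h; apply: le_trans (aL n (leqnn _)) _; rewrite ler_wpM2r ?pw_ge0.
have bs m : \sum_(m <= s < (2 * m).+1) b s <= pw m (1 - iq) * (C1 * a m).
  apply: le_trans (block_holder m q0 b0) _; rewrite -/iq ler_wpM2l ?pw_ge0 //.
  have hb : 0 <= \sum_(m <= s < (2 * m).+1) b s ^+ q by rewrite sumr_ge0 // => s _; rewrite exprn_ge0.
  apply: rt_le => //; first by rewrite mulr_ge0 // ltW.
  rewrite exprMn rtK ?(ltW C0) //; apply: (@le_trans _ _ (\sum_(m <= s < (2 * m).+1) C * (a s ^+ q - a s.+1 ^+ q))).
    by apply: ler_sum_nat => s _; exact: bq.
  rewrite -mulr_sumr ler_wpM2l ?(ltW C0) // -[X in X <= _]opprK -sumrN.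
  under eq_bigr do rewrite opprB.
  rewrite telescope_sumr; last by clear; lia.
  by rewrite opprB gerBl exprn_ge0.
have b1 s : b s <= C1 * C.
  have h := ler_wpM2l (ltW C0) (lerB (lexx (a s ^+ q)) (exprn_ge0 q (a0 s.+1))).
  rewrite subr0 in h; have {}h := le_trans (bq s) h.
  have : b s <= C1 * a s.
    by rewrite -(@ler_pXn2r _ q) ?nnegrE ?mulr_ge0 ?(ltW C10) // exprMn rtK // ltW.
  move/le_trans; apply; rewrite ler_pM2l //; apply: le_trans aC; exact: amono.
have dy := @dyadic_sum R (C1 * L) eps b n eps0 (mulr_ge0 (ltW C10) L0) b0.
have {}dy m k : (k <= n.+1)%N -> \sum_(m <= s < k) b s <= Ke * (C1 * L) * pw m (- eps).
  apply: dy => j jn; apply: le_trans (bs j) _.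
  apply: (@le_trans _ _ (pw j (1 - iq) * (C1 * (L * pw j (- sg))))).
    by rewrite ler_wpM2l ?pw_ge0 // ler_pM2l // aL.
  rewrite le_eqVlt; apply/orP; left; apply/eqP.
  have -> : pw j (- eps) = pw j (1 - iq) * pw j (- sg) by rewrite -pwD /eps; congr pw; ring.
  by ring.
have sumb k : (k <= n.+1)%N -> \sum_(0 <= s < k) b s <= m0%:R * (C1 * C) + Ke * (C1 * L) * pw m0 (- eps).
  move=> kn; have lo j : \sum_(0 <= s < j) b s <= j%:R * (C1 * C).
    rewrite mulr_natl -[X in X <= _]subr0 subr0 -[j in leRHS]subn0 -sumr_const_nat.
    by apply: ler_sum_nat => s _.
  have [km|mk] := leqP k m0.
    apply: (@le_trans _ _ (m0%:R * (C1 * C))); last first.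
      by rewrite lerDl !mulr_ge0 ?pw_ge0 // ltW.
    by apply: le_trans (lo k) _; rewrite ler_wpM2r ?ler_nat // mulr_ge0 // ltW.
  by rewrite (@big_cat_nat _ _ _ m0) ?(ltnW mk) //= lerD // dy.
rewrite /L; apply/bigmax_leP; split.
  by rewrite !addr_ge0 ?divr_ge0 // ltW.
move=> k _; have kn : (k <= n)%N by rewrite -ltnS.
have [k0|k0] := leqP k (2 * M0).+2.
  apply: (@le_trans _ _ D2); last by have := ltW D10; have := L0; rewrite -/L; lra.
  rewrite /D2 ler_pM ?pw_ge0 //; last exact: pw_mono.
  by apply: le_trans aC; exact: amono.
pose M := (k.-1)./2; have kM : ((2 * M).+1 <= k <= (2 * M).+2)%N by rewrite /M; clear -k0; lia.
have M0M : (M0 <= M)%N by clear -kM k0; lia.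
have kM1 : ((2 * M).+1 <= k)%N by case/andP: kM.
have := @avg_conv sg C a b (fun t => pw t (- sg)) b (fun t s => pw t (- sg) * b s) M
  sg0 (ltW C0) b0 b0 (fun t => pw_ge0 _ _) amono.
move=> /(_ _ (fun t s _ _ => lexx _) (fun t s _ => lexx _)).
have pre : forall k, (M < k <= (2 * M).+1)%N -> a k <= C * (pw k (- sg) + \sum_(s < k) pw (k.-1 - s) (- sg) * b s).
  by move=> j /andP[_ jM]; apply: ha; apply: leq_trans nN; apply: leq_trans kn; apply: leq_trans kM1.
move=> /(_ pre) hM.
set s1 := \sum_(0 <= s < M./2) b s in hM.
set s2 := \sum_(M./2 <= s < (2 * M).+1) b s in hM.
set s3 := \sum_(0 <= t < (2 * M).+1) pw t (- sg) in hM.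
have h1 : s1 <= m0%:R * (C1 * C) + Ke * (C1 * L) * pw m0 (- eps).
  by apply: sumb; clear -kM1 kn; lia.
have h2 : s2 <= Ke * (C1 * L) * (2 `^ eps * pw M (- eps)).
  apply: le_trans (dy _ _ _) _; first by clear -kM1 kn; lia.
  rewrite ler_wpM2l; [|by rewrite !mulr_ge0 // ltW|].
    by [].
  rewrite -[eps in X in _ <= X * _]opprK; apply: pw_scale; first by rewrite oppr_le0 ltW.
  by clear; lia.
have h3 : s3 <= Kt * (2 `^ th * pw M th).
  rewrite -pw_double; apply: (@le_trans _ _ (\sum_(0 <= t < (2 * M).+1) pw t (th - 1))).
    by apply: ler_sum_nat => t _; apply: pw_ler; lra.
  by apply: sum_pw; rewrite th0 /=; lra.
have s20 : 0 <= s2 by rewrite sumr_ge0.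
have s30 : 0 <= s3 by rewrite sumr_ge0 // => t _; exact: pw_ge0.
have h23 : M.+1%:R^-1 * (s3 * s2) <= (2 `^ th * Kt) * (Ke * C1 * 2 `^ eps) * L * (pw M (- sg) * pw M (- (iq - th))).
  have := ler_pM s30 s20 h3 h2 => h; rewrite ler_pdivrMl ?ltr0n //; apply: (le_trans h).
  rewrite le_eqVlt; apply/orP; left; apply/eqP.
  have -> : pw M (- sg) * pw M (- (iq - th)) = pw M th * pw M (- eps) * M.+1%:R^-1.
    by rewrite -[M.+1%:R]pw1 -pwN -!pwD; congr pw; rewrite /eps; ring.
  by field; rewrite nat1r pnatr_eq0.
have hMM := hM0 M M0M; have hmm := hm0 m0 (leqnn _).
have t1 : C * (2 `^ sg * pw M (- sg) * (1 + s1)) <=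
   C * (2 `^ sg * pw M (- sg) * (1 + (m0%:R * (C1 * C) + Ke * (C1 * L) * (4^-1 / B1)))).
  rewrite ler_pM2l // ler_wpM2l ?mulr_ge0 ?pw_ge0 ?(ltW (tw0 _)) // lerD2l (le_trans h1) // lerD2l.
  by rewrite ler_wpM2l // !mulr_ge0 // ltW.
have t2 : C * (M.+1%:R^-1 * (s3 * s2)) <= C * ((2 `^ th * Kt) * (Ke * C1 * 2 `^ eps) * L * (pw M (- sg) * (4^-1 / B2))).
  rewrite ler_pM2l // (le_trans h23) // ler_wpM2l; [by []| |by rewrite ler_wpM2l ?pw_ge0].
  by rewrite mulr_ge0 // !mulr_ge0 // ltW.
have tot : a k <= pw M (- sg) * (D1 + L / 2) / (2 `^ sg * 2 `^ sg).
  apply: (le_trans (amono _ _ kM1)); apply: (le_trans hM); rewrite mulrDr.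
  apply: (le_trans (lerD t1 t2)).
  have := tw0 sg; have := tw0 th; have := tw0 eps; rewrite /D1 /B1 /B2.
  have ph := pw_ge0 M (- sg) : 0 <= _ :> R.
  move: (2 `^ sg) (2 `^ th) (2 `^ eps) (pw M (- sg)) ph => x y z w w0 z0' y0 x0.
  rewrite -subr_ge0; set X := (X in 0 <= X).
  have -> : X = 0.
    by rewrite /X; field; rewrite !gt_eqF.
  by [].
have pk : pw k sg <= 2 `^ sg * 2 `^ sg * pw M sg.
  rewrite -mulrA -pw_double.
  apply: (@le_trans _ _ (pw (2 * (2 * M).+1).+1 sg)); last by rewrite pw_double.
  by apply: pw_mono => //; clear -kM; lia.
apply: (@le_trans _ _ (D1 + L / 2)); last by rewrite -/L; have := ltW D20; lra.
apply: (@le_trans _ _ (pw M (- sg) * (D1 + L / 2) / (2 `^ sg * 2 `^ sg) * (2 `^ sg * 2 `^ sg * pw M sg))).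
  by rewrite ler_pM ?pw_ge0.
rewrite le_eqVlt; apply/orP; left; apply/eqP; rewrite pwN.
have := pw_gt0 M sg : 0 < _ :> R; have := tw0 sg; move: (2 `^ sg) (pw M sg) => x w x0 w0.
by field; rewrite !gt_eqF.
Qed.

End Gronwall.

Section Sharp.
Variable R : realType.
Implicit Types (a b v g : nat -> R).

Lemma scale_le2 (x : R) m n : 0 <= x -> (n < 2 * m.+1)%N -> pw m (- x) <= 2 `^ x * pw n (- x).
Proof. by move=> x0 h; rewrite -[x in 2 `^ x]opprK; apply: pw_scale; rewrite ?oppr_le0. Qed.

(** [avg_conv] with the sharp kernel bound for early times and the weaker one for late times. The
    early loss [ups] is summable because block sums of [b] decay at the faster rate [w1]; the late
    part has size M^(th - w1 - 1), which the condition on [gm] makes sufficient. *)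
Lemma sharp (gm sg ups w1 th C : R) : 0 <= gm -> 0 <= ups -> ups < w1 -> 0 <= th ->
  gm <= 1 - th + w1 -> 0 < C ->
  (forall n, \sum_(0 <= t < n) pw t (- sg) <= C * pw n th) ->
  exists2 C2 : R, 0 < C2 & forall N a b (kap : nat -> nat -> R), (forall n, 0 <= b n) ->
  (forall m n, (m <= n)%N -> a n <= a m) -> a 0%N <= C ->
  (forall m, (m <= N)%N -> \sum_(m <= s < (2 * m).+1) b s <= C * pw m (- w1)) ->
  (forall n, (n <= N)%N -> a n <= C * (pw n (- gm) + \sum_(s < n) kap (n.-1 - s)%N s)) ->
  (forall t s, (t + s < N)%N -> kap t s <= C * pw t (- gm) * (pw s ups * b s)) ->
  (forall t s, (t + s < N)%N -> kap t s <= C * pw t (- sg) * b s) ->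
  forall n, (n <= N)%N -> a n <= C2 * pw n (- gm).
Proof.
move=> gm0 up0 upw th0 gmw C0 sumg; have w10 : 0 < w1 by exact: le_lt_trans up0 upw.
have tw0 (x : R) : 0 < 2 `^ x :> R by rewrite powR_gt0.
pose K1 : R := (1 - 2 `^ (- (w1 - ups)))^-1.
have K10 : 0 < K1 by rewrite invr_gt0 subr_gt0 two_pow_lt1 // subr_gt0.
pose K2 : R := (1 - 2 `^ (- w1))^-1.
have K20 : 0 < K2 by rewrite invr_gt0 subr_gt0 two_pow_lt1.
pose A1 := 2 `^ gm * (1 + C * (K1 * (C * 2 `^ ups))).
have A10 : 0 < A1 by rewrite mulr_gt0 // ltr_pwDl // !mulr_ge0 // ltW.
pose A2 := C * (C * 2 `^ th) * (K2 * C * 2 `^ w1).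
have A20 : 0 < A2 by rewrite !mulr_gt0.
pose D := C * (A1 + A2); have D0 : 0 < D by rewrite mulr_gt0 // addr_gt0.
exists (C + 2 `^ gm * 2 `^ gm * D); first by apply: addr_gt0 => //; apply: mulr_gt0 => //; exact: mulr_gt0.
move=> N a b kap b0 amono aC blk ha k1 k2 n nN.
have [->|n0] := posnP n.
  rewrite pw0n mulr1 (le_trans aC) // lerDl; apply: mulr_ge0; last exact: ltW.
  by rewrite mulr_ge0 // ltW.
pose M := (n.-1)./2; have nM : ((2 * M).+1 <= n <= (2 * M).+2)%N by rewrite /M; clear -n0; lia.
have nM1 : ((2 * M).+1 <= n)%N by case/andP: nM.
have MN : (2 * M < N)%N := leq_trans nM1 nN.
have vb s : 0 <= C * (pw s ups * b s) by rewrite !mulr_ge0 ?pw_ge0 // ltW.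
have := @avg_conv R gm C a (fun s => C * (pw s ups * b s)) (fun t => C * pw t (- sg)) b kap M
  gm0 (ltW C0) vb b0 (fun t => mulr_ge0 (ltW C0) (pw_ge0 _ _)) amono.
have h1 k : (M < k <= (2 * M).+1)%N -> a k <= C * (pw k (- gm) + \sum_(s < k) kap (k.-1 - s)%N s).
  by move=> /andP[_ kM]; apply: ha; apply: leq_trans nN; exact: leq_trans nM1.
have h2 t s : (t + s <= 2 * M)%N -> (s < M./2)%N -> kap t s <= pw t (- gm) * (C * (pw s ups * b s)).
  by move=> ts _; rewrite mulrCA mulrA; apply: k1; exact: leq_ltn_trans MN.
have h3 t s : (t + s <= 2 * M)%N -> kap t s <= C * pw t (- sg) * b s.
  by move=> ts; apply: k2; exact: leq_ltn_trans MN.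
move=> /(_ h1 h2 h3) hM; rewrite -!mulr_sumr in hM.
set s1 := \sum_(0 <= s < M./2) pw s ups * b s in hM.
set s2 := \sum_(M./2 <= s < (2 * M).+1) b s in hM.
set s3 := \sum_(0 <= t < (2 * M).+1) pw t (- sg) in hM.
have e1 : s1 <= K1 * (C * 2 `^ ups).
  have := @dyadic_sum R (C * 2 `^ ups) (w1 - ups) (fun s => pw s ups * b s) N.
  rewrite subr_gt0 => /(_ upw (mulr_ge0 (ltW C0) (ltW (tw0 _))) (fun s => mulr_ge0 (pw_ge0 _ _) (b0 _))).
  move=> dy; have {}dy := dy _ 0%N (M./2).
  rewrite pw0n mulr1 in dy; apply: dy; last by clear -MN; lia.
  move=> m mN; apply: (@le_trans _ _ (\sum_(m <= s < (2 * m).+1) 2 `^ ups * pw m ups * b s)).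
    apply: ler_sum_nat => s /andP[_ sm]; rewrite ler_wpM2r // -pw_double; apply: pw_mono => //.
    exact: ltnW.
  rewrite -mulr_sumr.
  apply: (@le_trans _ _ (2 `^ ups * pw m ups * (C * pw m (- w1)))).
    by rewrite ler_wpM2l ?blk // mulr_ge0 ?pw_ge0 // ltW.
  have -> : pw m (- (w1 - ups)) = pw m ups * pw m (- w1) by rewrite -pwD; congr pw; ring.
  by rewrite le_eqVlt; apply/orP; left; apply/eqP; ring.
have e2 : s2 <= K2 * C * 2 `^ w1 * pw M (- w1).
  have := @dyadic_sum R C w1 b N w10 (ltW C0) b0 blk M./2 (2 * M).+1.
  move=> /(_ _) /le_trans; apply; first by clear -MN; lia.
  rewrite -/K2 -[leRHS]mulrA ler_wpM2l ?mulr_ge0 ?(ltW K20) ?(ltW C0) //.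
  by apply: scale_le2; [exact: ltW|clear; lia].
have e3 : s3 <= C * 2 `^ th * pw M th by rewrite -mulrA -pw_double; exact: sumg.
have s20 : 0 <= s2 by exact: sumr_ge0.
have s30 : 0 <= s3 by rewrite sumr_ge0 // => t _; exact: pw_ge0.
have aM : a (2 * M).+1 <= D * pw M (- gm).
  apply: (le_trans hM); rewrite /D -[leRHS]mulrA ler_pM2l // mulrDl lerD //.
    rewrite /A1 mulrAC ler_wpM2r ?pw_ge0 // ler_pM2l // lerD2l ler_pM2l //.
  rewrite ler_pdivrMl ?ltr0n // -mulrA.
  apply: (@le_trans _ _ (C * (C * 2 `^ th * pw M th * (K2 * C * 2 `^ w1 * pw M (- w1))))).
    by rewrite ler_pM2l // ler_pM.
  apply: (@le_trans _ _ (A2 * pw M (th - w1))).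
    by rewrite pwD /A2 le_eqVlt; apply/orP; left; apply/eqP; ring.
  rewrite mulrCA ler_pM2l // -[M.+1%:R]pw1 -pwD; apply: pw_ler; lra.
apply: (@le_trans _ _ (2 `^ gm * 2 `^ gm * D * pw n (- gm))); last first.
  by rewrite ler_wpM2r ?pw_ge0 // lerDr ltW.
apply: (le_trans (amono _ _ nM1)); apply: (le_trans aM); rewrite [leRHS]mulrAC mulrC ler_pM2r //.
apply: (@le_trans _ _ (2 `^ gm * pw (2 * M).+1 (- gm))).
  by apply: scale_le2 => //; clear; lia.
by rewrite -mulrA ler_pM2l //; apply: scale_le2 => //; clear -nM; lia.
Qed.
End Sharp.

(** * Cubes, finite speed of propagation, and comparison of dipole energies *)

Section Cubes.
Variables (R : realType) (V : finZmodType) (d : nat) (e : 'I_d -> V).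
Implicit Types (x y z : V) (k : 'I_d -> nat) (r l : nat).
Local Notation lat := (lat e).

Definition cube z l (y : V) : bool :=
  [exists k : {ffun 'I_d -> 'I_l}, y == z + lat (fun i => k i)].

Lemma cubeP z l y : reflect (exists2 k, (forall i, k i < l)%N & y = z + lat k) (cube z l y).
Proof.
apply: (iffP existsP) => [[k /eqP ->]|[k kl ->]]; first by exists (fun i => nat_of_ord (k i)).
exists [ffun i => Ordinal (kl i)]; apply/eqP; congr (_ + _).
by apply: eq_bigr => i _; rewrite ffunE.
Qed.

Lemma latD k (l : 'I_d -> nat) : lat (fun i => k i + l i)%N = lat k + lat l.
Proof. by rewrite /lat -big_split; apply: eq_bigr => i _; rewrite mulrnDr. Qed.

Lemma lat1 i : lat (fun j => (j == i)) = e i.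
Proof.
by rewrite /lat (bigD1 i) //= eqxx mulr1n big1 ?addr0 // => j /negPf ->; rewrite mulr0n.
Qed.

Definition rr r : V := lat (fun=> r).
Lemma rrS r : rr r.+1 = rr r + rr 1.
Proof. by rewrite /rr -latD; apply: eq_bigr => i _; rewrite addn1. Qed.

(** The image in the quotient of the sup-norm ball of radius [r], as a cube of side 2r+1 around
    [x]. *)
Definition nbr r x y := cube (x - rr r) (2 * r).+1 y.

Lemma nbr_refl r x : nbr r x x.
Proof.
apply/cubeP; exists (fun=> r) => [i|]; last by rewrite -/(rr r) subrK.
by rewrite ltnS leq_pmull.
Qed.
Lemma nbr_up r x i y : nbr r (x + e i) y -> nbr r.+1 x y.
Proof.
case/cubeP => k kl ->; apply/cubeP; exists (fun j => k j + (1 + (j == i)))%N.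
  by move=> j; have := kl j; case: (j == i) => /=; clear; lia.
rewrite latD latD lat1 -/(rr 1) rrS opprD; set X := lat k; rewrite [rr 1 + e i]addrC.
by rewrite !addrA [RHS](ACl (1*5*2*4*(3*6)))/= addNr addr0.
Qed.
Lemma nbr_down r x i y : nbr r (x - e i) y -> nbr r.+1 x y.
Proof.
case/cubeP => k kl ->; apply/cubeP; exists (fun j => k j + (j != i))%N.
  by move=> j; have := kl j; case: (j != i) => /=; clear; lia.
rewrite latD rrS; have -> : lat (fun j => (j != i)) = rr 1 - e i.
  rewrite -(lat1 i) /rr -[lat (fun=> 1%N)](subrK (lat (fun j => (j == i)))) addrK.
  apply/eqP; rewrite eq_sym subr_eq -latD; apply/eqP; apply: eq_bigr => j _.
  by case: (j == i).
rewrite opprD addrA; set X := lat k; set Y := rr 1; set Z := rr r.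
by rewrite !addrA [RHS](ACl (1*6*2*4*(3*5)))/= addNr addr0.
Qed.
Lemma nbr_S r x y : nbr r x y -> nbr r.+1 x y.
Proof.
case/cubeP => k kl ->; apply/cubeP; exists (fun j => k j + 1)%N.
  by move=> j; have := kl j; clear; lia.
rewrite latD -/(rr 1) rrS opprD !addrA; set X := lat k.
by rewrite (addrAC _ X (rr 1)) subrK.
Qed.
Lemma nbr_mono r r' x y : (r <= r')%N -> nbr r x y -> nbr r' x y.
Proof. by move=> /subnK <- h; elim: (r' - r)%N => // j; rewrite addSn; exact: nbr_S. Qed.

Lemma nbr_cube r z l x y : cube z l x -> nbr r x y -> cube (z - rr r) (l + 2 * r) y.
Proof.
case/cubeP => k kl -> /cubeP[k' kl' ->]; apply/cubeP; exists (fun j => k j + k' j)%N.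
  by move=> j; have := kl j; have := kl' j; clear; lia.
by rewrite latD !addrA (addrAC z (lat k)).
Qed.

Variables (beta : R) (xi : 'I_d -> R).
(** Propagation by one site per step; the initial drift already looks one site back, hence
    [n.+1]. *)
Lemma sol_local a b n x : (forall E : V * 'I_d, nbr n.+1 x E.1 -> a E = b E) ->
  sol e beta xi a n x = sol e beta xi b n x.
Proof.
elim: n x => [|n IH] x h.
  rewrite /sol /= /u0; apply: eq_bigr => i _; rewrite !h //=; last exact: nbr_refl.
  by apply: (@nbr_down 0 x i); exact: nbr_refl.
have nbr_b m i : nbr m.+1 x (x - e i).
  by apply: (@nbr_down m x i); exact: nbr_refl.
rewrite /sol /= -!/(sol e beta xi _ n) /Tw /Sw /lap.
have e0 : sol e beta xi a n x = sol e beta xi b n x.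
  by apply: IH => E hE; apply: h; exact: nbr_S.
rewrite e0; congr (_ - _ * _); apply: eq_bigr => i _.
rewrite !h ?nbr_refl ?nbr_b //=.
rewrite (IH (x + e i)); last by move=> E hE; apply: h; exact: nbr_up hE.
by rewrite (IH (x - e i)) //; move=> E hE; apply: h; exact: nbr_down hE.
Qed.

Lemma sum_cube_le (F : V -> R) z l : (forall x, 0 <= F x) ->
  \sum_(y | cube z l y) F y <= \sum_(k : {ffun 'I_d -> 'I_l}) F (z + lat (fun i => k i)).
Proof.
move=> F0; rewrite (partition_big (fun k : {ffun 'I_d -> 'I_l} => z + lat (fun i => k i)) (cube z l)) /=.
  apply: ler_sum => y /existsP[k /eqP yk]; rewrite (bigD1 k) /=; last by rewrite yk.
  by rewrite yk lerDl sumr_ge0.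
by move=> k _; apply/existsP; exists k.
Qed.

Lemma card_cube_le z l : (#|[pred y | cube z l y]| <= l ^ d)%N.
Proof.
have := leq_imset_card (fun k : {ffun 'I_d -> 'I_l} => z + lat (fun i => k i)) (mem {ffun 'I_d -> 'I_l}).
rewrite card_ffun !card_ord; apply: leq_trans; apply: subset_leq_card.
by apply/fintype.subsetP => y /existsP[k /eqP ->]; apply/imsetP; exists k.
Qed.

End Cubes.

Lemma CS_sum (R : realType) (I : finType) (P : pred I) (f g : I -> R) :
  (\sum_(i | P i) f i * g i) ^+ 2 <= (\sum_(i | P i) f i ^+ 2) * \sum_(i | P i) g i ^+ 2.
Proof.
set X := \sum_(i | P i) f i * g i; set F := \sum_(i | P i) f i ^+ 2; set G := \sum_(i | P i) g i ^+ 2.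
have F0 : 0 <= F by rewrite sumr_ge0 // => i _; rewrite sqr_ge0.
have G0 : 0 <= G by rewrite sumr_ge0 // => i _; rewrite sqr_ge0.
have q (t : R) : 0 <= F - 2 * t * X + t ^+ 2 * G.
  rewrite /F /X /G !mulr_sumr -sumrB -big_split /=; apply: sumr_ge0 => i _.
  by have := sqr_ge0 (f i - t * g i); lra.
have [Gp|Gn] := ltP 0 G.
  have := q (X / G); have -> : F - 2 * (X / G) * X + (X / G) ^+ 2 * G = F - X ^+ 2 / G by field; lra.
  by rewrite subr_ge0 ler_pdivrMr.
have Ge : G = 0 by apply/eqP; rewrite eq_le Gn G0.
have gi i : P i -> g i = 0.
  move=> Pi; apply/eqP; rewrite -sqrf_eq0; apply/eqP.
  by apply: (psumr_eq0P _ Ge) => // j _; rewrite sqr_ge0.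
rewrite /X big1 ?expr0n ?mulr_ge0 // => i Pi; by rewrite gi ?mulr0.
Qed.

Lemma sqr_mono (R : realType) (x y : R) : 0 <= x -> x <= y -> x ^+ 2 <= y ^+ 2.
Proof. by move=> x0 xy; rewrite lerXn2r ?nnegrE // (le_trans x0). Qed.

Section Operator.
Variables (R : realType) (d : nat) (alpha beta C del : R).
Hypotheses (d_gt0 : (0 < d)%N) (alpha_gt0 : 0 < alpha) (le_ab : alpha <= beta).
Hypotheses (del_ge0 : 0 <= del) (HC : @dipole_bound R d alpha beta C del).
Local Notation c := (cst d beta).
Let c0 : 0 < c := cst_gt0 d_gt0 alpha_gt0 le_ab.

Section Fixed.
Variables (V : finZmodType) (e : 'I_d -> V) (N : nat) (a : V * 'I_d -> R).
Hypotheses (tor : torus e N) (ha : elliptic alpha beta a).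
Local Notation Tn := (Tn e beta).
Implicit Types (E F : V * 'I_d) (w : V * 'I_d -> R) (Q : pred (V * 'I_d)).

(** Mixed second difference of the heat kernel: the gradient at [E] caused by a dipole at [F]. As a
    matrix on a set [Q] of edges it governs the effect of changing the conductances of [Q]. *)
Definition Mk t E F := dg e E (Tn a t (dlt e F)).
Let fw Q w x := \sum_(E | Q E) w E * dlt e E x.

Lemma Tn_sumP n (Q : pred (V * 'I_d)) (f : V * 'I_d -> V -> R) x :
  Tn a n (fun y => \sum_(E | Q E) f E y) x = \sum_(E | Q E) Tn a n (f E) x.
Proof.
rewrite big_mkcond /=.
have -> : (fun y => \sum_(E | Q E) f E y) = fun y => \sum_E (if Q E then 1 else 0) * f E y.
  by apply/funext => y; rewrite big_mkcond; apply: eq_bigr => E _; case: ifP; rewrite ?mul1r ?mul0r.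
rewrite Tn_sum; apply: eq_bigr => E _; rewrite TnZ; by case: ifP; rewrite ?mul1r ?mul0r.
Qed.

Lemma Mk_fw Q w t F : \sum_(E | Q E) Mk t E F * w E = dg e F (Tn a t (fw Q w)).
Proof.
rewrite -dot_dlt /dot /fw; under [RHS]eq_bigr do rewrite Tn_sumP mulr_sumr.
rewrite [RHS]exchange_big /=; apply: eq_bigr => E _.
under eq_bigr do rewrite TnZ mulrCA.
by rewrite -mulr_sumr mulrC -/(dot (dlt e F) _) dot_Tn dotC dot_dlt.
Qed.

Lemma dot_fw Q w f : dot (fw Q w) f = \sum_(E | Q E) w E * dg e E f.
Proof.
rewrite /dot /fw; under eq_bigr do rewrite mulr_suml.
rewrite exchange_big /=; apply: eq_bigr => E _; rewrite -dot_dlt /dot mulr_sumr.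
by apply: eq_bigr => x _; rewrite mulrA.
Qed.

(** Duality: the squared norm pairs [w] with gradients at time 2m, whose energy is at most K times
    the squared norm at time m; one power of it then cancels. *)
Lemma sq_fw Q w m : dot (Tn a m (fw Q w)) (Tn a m (fw Q w)) <=
  c / alpha / m.+1%:R * \sum_(E | Q E) w E ^+ 2.
Proof.
set X := dot _ _; set W := \sum_(E | Q E) _; set K := c / alpha / m.+1%:R.
have W0 : 0 <= W by rewrite sumr_ge0 // => E _; rewrite sqr_ge0.
have K0 : 0 < K by rewrite divr_gt0 ?ltr0n // divr_gt0.
have X0 : 0 <= X by exact: sq_ge0.
have h1 : X ^+ 2 <= W * (K * X).
  have -> : X ^+ 2 = (\sum_(E | Q E) w E * dg e E (Tn a m (Tn a m (fw Q w)))) ^+ 2.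
    by rewrite -dot_fw dot_Tn.
  apply: le_trans (CS_sum _ _ _) _; rewrite -/W ler_wpM2l //.
  apply: (@le_trans _ _ (gradsq e (Tn a m (Tn a m (fw Q w))))).
    rewrite /gradsq [leRHS](bigID Q) /= lerDl sumr_ge0 // => E _; exact: sqr_ge0.
  have := gradsq_Tn e d_gt0 alpha_gt0 le_ab ha (Tn a m (fw Q w)) m.
  by rewrite -/X /K mulrAC.
have [Xp|Xn] := ltP 0 X; last by rewrite (le_trans Xn) // mulr_ge0 // ltW.
by move: h1; rewrite expr2 mulrA ler_pM2r // mulrC.
Qed.

Lemma op_energy Q w t : \sum_(F | Q F) (\sum_(E | Q E) Mk t E F * w E) ^+ 2 <=
  (2 * (c / alpha) * pw t (- 1)) ^+ 2 * \sum_(E | Q E) w E ^+ 2.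
Proof.
under eq_bigr do rewrite Mk_fw.
pose m := t./2; have mt : (m <= t)%N := half_le t.
set W := \sum_(E | Q E) w E ^+ 2; have W0 : 0 <= W by rewrite sumr_ge0 // => E _; rewrite sqr_ge0.
apply: (@le_trans _ _ (gradsq e (Tn a t (fw Q w)))).
  by rewrite /gradsq [leRHS](bigID Q) /= lerDl sumr_ge0 // => E _; exact: sqr_ge0.
have -> : Tn a t (fw Q w) = Tn a (t - m) (Tn a m (fw Q w)) by rewrite -TnD subnK.
apply: le_trans (gradsq_Tn e d_gt0 alpha_gt0 le_ab ha _ _) _.
have q0 : 0 < c / alpha by exact: divr_gt0.
have i1 : (t - m).+1%:R^-1 <= 2 * pw t (- 1) :> R.
  rewrite pwN pw1 -[2]invrK -invfM lef_pV2 ?posrE ?mulr_gt0 ?invr_gt0 ?ltr0n //.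
  by rewrite ler_pdivrMl // -natrM ler_nat /m; clear; lia.
have i2 : m.+1%:R^-1 <= 2 * pw t (- 1) :> R.
  rewrite pwN pw1 -[2]invrK -invfM lef_pV2 ?posrE ?mulr_gt0 ?invr_gt0 ?ltr0n //.
  by rewrite ler_pdivrMl // -natrM ler_nat /m; clear; lia.
have h := sq_fw Q w m; rewrite -/W in h.
apply: (@le_trans _ _ ((c / alpha * (c / alpha / m.+1%:R * W)) / (t - m).+1%:R)).
  by rewrite ler_wpM2r ?invr_ge0 // ler_pM2l.
have -> : c / alpha * (c / alpha / m.+1%:R * W) / (t - m).+1%:R =
  (c / alpha) ^+ 2 * W * (m.+1%:R^-1 * (t - m).+1%:R^-1) by ring.
have -> : (2 * (c / alpha) * pw t (- 1)) ^+ 2 * W = (c / alpha) ^+ 2 * W * ((2 * pw t (- 1)) * (2 * pw t (- 1))) by ring.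
apply: ler_wpM2l; first by apply: mulr_ge0 => //; exact: sqr_ge0.
by apply: ler_pM; rewrite ?invr_ge0.
Qed.

Lemma Mk_le t E F : (t <= N)%N -> Mk t E F ^+ 2 <= (C * 2 `^ (1 + del) * pw t (- (1 + del))) ^+ 2.
Proof.
move=> tN; pose m := t./2; have mt : (m <= t)%N := half_le t.
have -> : Mk t E F = dot (Tn a m (dlt e E)) (Tn a (t - m) (dlt e F)).
  by rewrite /Mk -dot_dlt -{1}(subnKC mt) TnD dot_Tn.
apply: le_trans (dot_CS _ _) _; case: HC => C0 H.
have s0 : 0 <= 1 + del by rewrite addr_ge0.
rewrite expr2; apply: ler_pM; rewrite ?sq_ge0 // -[leRHS]mulrA.
  apply: le_trans (H _ _ _ _ tor ha m E (leq_trans mt tN)) _; rewrite ler_pM2l //.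
  by apply: scale_le2 => //; exact: half_scale.
apply: le_trans (H _ _ _ _ tor ha (t - m)%N F (leq_trans (leq_subr _ _) tN)) _; rewrite ler_pM2l //.
by apply: scale_le2 => //; rewrite /m; clear; lia.
Qed.

Lemma op_hs Q w t (B : R) : (t <= N)%N -> #|Q|%:R <= B ->
  \sum_(F | Q F) (\sum_(E | Q E) Mk t E F * w E) ^+ 2 <=
  (C * 2 `^ (1 + del) * (B * pw t (- (1 + del)))) ^+ 2 * \sum_(E | Q E) w E ^+ 2.
Proof.
move=> tN QB; have B0 : 0 <= B by exact: le_trans QB.
set W := \sum_(E | Q E) w E ^+ 2; have W0 : 0 <= W by rewrite sumr_ge0 // => E _; rewrite sqr_ge0.
set D := (C * 2 `^ (1 + del) * pw t (- (1 + del))) ^+ 2.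
have D0 : 0 <= D by rewrite sqr_ge0.
have cnt (x : R) : 0 <= x -> \sum_(E | Q E) x <= B * x.
  by move=> x0; rewrite sumr_const -[x *+ _]mulr_natl ler_wpM2r.
apply: (@le_trans _ _ (\sum_(F | Q F) B * D * W)).
  apply: ler_sum => F _; apply: le_trans (CS_sum _ _ _) _; rewrite -/W ler_wpM2r //.
  apply: le_trans (cnt D D0); apply: ler_sum => E _; exact: Mk_le.
apply: le_trans (cnt _ _) _; first by apply: mulr_ge0 => //; exact: mulr_ge0.
by rewrite /D le_eqVlt; apply/orP; left; apply/eqP; ring.
Qed.

Definition opC := 2 * (c / alpha) + C * 2 `^ (1 + del).
(** Up to [opC], two bounds on the norm of [Mk] on [l^2(Q)]: 1/t from the energy, whatever [Q] is,
    and B t^-(1+del) from the Hilbert-Schmidt norm when [Q] has at most [B] edges. The first just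
    fails to be summable in t. *)
Definition opn (B : R) t := Num.min (pw t (- 1)) (B * pw t (- (1 + del))).

Lemma opC_gt0 : 0 < opC.
Proof.
case: HC => C0 _; apply: addr_gt0; first by rewrite mulr_gt0 // divr_gt0.
by rewrite mulr_gt0 // powR_gt0.
Qed.

Lemma opn_ge0 (B : R) t : 0 <= B -> 0 <= opn B t.
Proof. by move=> B0; rewrite le_min pw_ge0 mulr_ge0 // pw_ge0. Qed.

Lemma op_le Q w t (B : R) : (t <= N)%N -> #|Q|%:R <= B ->
  \sum_(F | Q F) (\sum_(E | Q E) Mk t E F * w E) ^+ 2 <=
  (opC * opn B t) ^+ 2 * \sum_(E | Q E) w E ^+ 2.
Proof.
move=> tN QB; have B0 : 0 <= B by exact: le_trans QB.
case: (HC) => C0 _; have q0 : 0 < c / alpha by exact: divr_gt0.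
have t0 : 0 < 2 `^ (1 + del) :> R by rewrite powR_gt0.
have W0 : 0 <= \sum_(E | Q E) w E ^+ 2 by rewrite sumr_ge0 // => E _; rewrite sqr_ge0.
rewrite /opn minEle; case: ifP => _.
  apply: le_trans (op_energy Q w t) _; apply: ler_wpM2r => //; apply: sqr_mono.
    by rewrite mulr_ge0 ?pw_ge0 // mulr_ge0 // ltW.
  by rewrite ler_wpM2r ?pw_ge0 // lerDl mulr_ge0 // ltW.
apply: le_trans (op_hs w tN QB) _; apply: ler_wpM2r => //; apply: sqr_mono.
  by rewrite mulr_ge0 ?mulr_ge0 ?pw_ge0 // ltW.
by rewrite ler_wpM2r ?mulr_ge0 ?pw_ge0 // lerDr mulr_ge0 // ltW.
Qed.

Definition NN (b : V * 'I_d -> R) t Q := \sum_(E | Q E) dot (Tn b t (dlt e E)) (Tn b t (dlt e E)).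

(** Duhamel between two environments that differ only on [Q]: the correction at time k is the matrix
    [Mk] on [Q] applied to dipoles evolved in [b], so it is bounded by the operator norm times a
    dipole energy in [b]. The index k = t carries the unperturbed term. *)
Lemma NN_compare (b : V * 'I_d -> R) t Q (B : R) (l : 'I_t.+1 -> R) :
  elliptic alpha beta b -> (forall E, ~~ Q E -> a E = b E) -> (t <= N)%N -> #|Q|%:R <= B ->
  (forall k, 0 < l k) -> \sum_k l k = 1 ->
  NN a t Q <= \sum_(k < t.+1) (if (k < t)%N then (beta / c * (opC * opn B k)) ^+ 2 * NN b (t.-1 - k) Q
     else NN b t Q) / l k.
Proof.
move=> hb ab tN QB l0 l1.
pose f x F k := if (k < t)%N then c^-1 * \sum_(E | Q E) Mk k E F * ((b E - a E) * Tn b (t.-1 - k) (dlt e E) x)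
  else Tn b t (dlt e F) x.
have TE' x F : Tn a t (dlt e F) x = \sum_(k < t.+1) f x F k.
  rewrite big_ord_recr /= /f ltnn; have := duhamel e beta b a t (dlt e F) (delta x).
  rewrite !dot_delta => /eqP; rewrite subr_eq => /eqP h.
  have -> : Tn a t (dlt e F) x = c^-1 * \sum_(k < t) \sum_E (b E - a E) * dg e E (Tn b (t.-1 - k) (delta x)) *
      dg e E (Tn a k (dlt e F)) + Tn b t (dlt e F) x by rewrite h; ring.
  congr (_ + _); rewrite mulr_sumr; apply: eq_bigr => k _; rewrite ltn_ord; congr (_ * _); apply/esym.
  rewrite [RHS](bigID Q) /= [X in _ = _ + X]big1 ?addr0; last first.
    by move=> E /ab ->; rewrite subrr !mul0r.
  apply: eq_bigr => E _; rewrite -!dot_dlt (dotC _ (Tn b _ _)) -dot_Tn dot_delta /Mk -dot_dlt.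
  by rewrite [RHS]mulrC mulrA.
have b0 : 0 < beta := beta_gt0 alpha_gt0 le_ab.
apply: (@le_trans _ _ (\sum_(F | Q F) \sum_x \sum_(k < t.+1) f x F k ^+ 2 / l k)).
  by apply: ler_sum => F _; apply: ler_sum => x _; rewrite -expr2 TE'; exact: sum_sqr_le.
under eq_bigr do rewrite exchange_big /=.
rewrite exchange_big /=; apply: ler_sum => k _.
under eq_bigr do rewrite -mulr_suml.
rewrite -mulr_suml ler_wpM2r ?invr_ge0 ?(ltW (l0 _)) // /f; case: ifP => kt; last first.
  by apply: ler_sum => F _; apply: ler_sum => x _; rewrite expr2.
rewrite exchange_big /=; have kN : (k <= N)%N by rewrite (leq_trans _ tN) // ltnW.
apply: (@le_trans _ _ (\sum_x c^-1 ^+ 2 * ((opC * opn B k) ^+ 2 *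
  \sum_(E | Q E) ((b E - a E) * Tn b (t.-1 - k) (dlt e E) x) ^+ 2))).
  apply: ler_sum => x _; under eq_bigr do rewrite exprMn.
  by rewrite -mulr_sumr ler_wpM2l ?sqr_ge0 //; exact: op_le.
rewrite -!mulr_sumr exchange_big /=.
have -> : (beta / c * (opC * opn B k)) ^+ 2 * NN b (t.-1 - k) Q =
  c^-1 ^+ 2 * ((opC * opn B k) ^+ 2 * (beta ^+ 2 * NN b (t.-1 - k) Q)) by ring.
rewrite ler_wpM2l ?sqr_ge0 // ler_wpM2l ?sqr_ge0 // /NN mulr_sumr; apply: ler_sum => E _.
rewrite /dot mulr_sumr; apply: ler_sum => x _; rewrite exprMn -expr2 ler_wpM2r ?sqr_ge0 //.
rewrite -real_normK ?num_real // lerXn2r ?nnegrE ?(ltW b0) //.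
by apply: (norm_diff_le (alpha := alpha) (beta := beta)) => //; rewrite gerBl ltW.
Qed.

End Fixed.
End Operator.

(** * Decorrelation *)

(** Before t/2 the minimum in [opn] is interpolated geometrically with weights 1 - eps and eps: this
    is summable, with exponent 1 + eps del, at the cost of B^eps. After t/2 the Hilbert-Schmidt
    bound alone is small enough, thanks to the restriction on [B]. *)
Lemma conv_bound (R : realType) (gm del eps : R) : 1 <= gm -> 0 < del -> gm < 1 + del ->
  0 < eps <= 1 -> exists2 C : R, 0 < C & forall (B : R) t, 1 <= B -> B <= pw t ((1 + del - gm) / 2) ->
  \sum_(k < t) opn del B k * pw (t.-1 - k) (- gm) <= C * B `^ eps * pw t (- gm).
Proof.
move=> gm1 del0 gmd /andP[eps0 eps1].
have tw0 (x : R) : 0 < 2 `^ x :> R by rewrite powR_gt0.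
pose th : R := Num.min ((1 + del - gm) / 2) 1.
have th0 : 0 < th by rewrite lt_min ltr01 andbT divr_gt0 // subr_gt0.
have th1 : th <= 1 by rewrite ge_min lexx orbT.
have th2 : th <= (1 + del - gm) / 2 by rewrite ge_min lexx.
pose K1 : R := (1 - 2 `^ (- (1 + eps * del - 1)))^-1.
have ed0 : 0 < eps * del by rewrite mulr_gt0.
have K10 : 0 < K1 by rewrite invr_gt0 subr_gt0 two_pow_lt1 //; lra.
pose K2 : R := (1 - 2 `^ (- th))^-1.
have K20 : 0 < K2 by rewrite invr_gt0 subr_gt0 two_pow_lt1.
exists (2 `^ gm * K1 + 2 `^ (1 + del) * K2); first by rewrite addr_gt0 // mulr_gt0.
move=> B t B1 Bt; have B0 : 0 < B by exact: lt_le_trans B1.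
have Be : 1 <= B `^ eps by rewrite -[leLHS](powRr0 B) ler_powR // ltW.
have on0 k : 0 <= opn del B k by exact: opn_ge0 (ltW B0).
rewrite (bigID (fun k : 'I_t => (k < t./2)%N)) /= !mulrDl; apply: lerD.
  apply: (@le_trans _ _ (\sum_(k < t | (k < t./2)%N) (B `^ eps * pw k (- (1 + eps * del))) * (2 `^ gm * pw t (- gm)))).
    apply: ler_sum => k kh; apply: ler_pM; rewrite ?pw_ge0 //.
      have mE : opn del B k = opn del B k `^ (1 - eps) * opn del B k `^ eps.
        have on1 : 0 < opn del B k by rewrite lt_min pw_gt0 mulr_gt0 // pw_gt0.
        by rewrite -powRD ?subrK ?powRr1 // gt_eqF // implybT.
      rewrite mE; apply: (@le_trans _ _ ((pw k (- 1)) `^ (1 - eps) * (B * pw k (- (1 + del))) `^ eps)).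
        apply: ler_pM; rewrite ?powR_ge0 //.
          by apply: ge0_ler_powR; rewrite ?nnegrE ?subr_ge0 ?pw_ge0 // ge_min lexx.
        by apply: ge0_ler_powR; rewrite ?nnegrE ?mulr_ge0 ?pw_ge0 ?(ltW eps0) ?(ltW B0) // ge_min lexx orbT.
      rewrite powRM ?pw_ge0 ?(ltW B0) // mulrCA ler_wpM2l ?powR_ge0 //.
      rewrite /pw -!powRrM -powRD ?pnatr_eq0 ?implybT //.
      by rewrite le_eqVlt; apply/orP; left; apply/eqP; congr (_ `^ _); ring.
    apply: scale_le2; first lra.
    by have := ltn_ord k; clear -kh; lia.
  rewrite -mulr_suml -mulr_sumr.
  have : \sum_(k < t | (k < t./2)%N) pw k (- (1 + eps * del)) <= K1.
    apply: (@le_trans _ _ (\sum_(k < t) pw k (- (1 + eps * del)))).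
      by rewrite [leRHS](bigID (fun k : 'I_t => (k < t./2)%N)) /= lerDl sumr_ge0 // => k _; exact: pw_ge0.
    by rewrite -(big_mkord xpredT (fun k => pw k (- (1 + eps * del)))); apply: sum_pw_conv; lra.
  set S1 := \sum_(k < t | _) _ => hS.
  have -> : 2 `^ gm * K1 * B `^ eps * pw t (- gm) = B `^ eps * K1 * (2 `^ gm * pw t (- gm)) by ring.
  by rewrite ler_wpM2r ?mulr_ge0 ?pw_ge0 ?(ltW (tw0 _)) // ler_wpM2l // powR_ge0.
apply: (@le_trans _ _ (\sum_(k < t | ~~ (k < t./2)%N) (B * (2 `^ (1 + del) * pw t (- (1 + del)))) * pw (t.-1 - k) (- gm))).
  apply: ler_sum => k kh; apply: ler_wpM2r; first exact: pw_ge0.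
  apply: (@le_trans _ _ (B * pw k (- (1 + del)))); first by rewrite ge_min lexx orbT.
  rewrite ler_pM2l //; apply: scale_le2; first lra.
  by clear -kh; lia.
rewrite -mulr_sumr.
have hS : \sum_(k < t | ~~ (k < t./2)%N) pw (t.-1 - k) (- gm) <= K2 * pw t th.
  apply: (@le_trans _ _ (\sum_(k < t) pw (t.-1 - k) (- gm))).
    by rewrite [leRHS](bigID (fun k : 'I_t => (k < t./2)%N)) /= lerDr sumr_ge0 // => k _; exact: pw_ge0.
  apply: (@le_trans _ _ (\sum_(k < t) pw k (th - 1))); last first.
    by rewrite -(big_mkord xpredT (fun k => pw k (th - 1))); apply: sum_pw; rewrite th0.
  rewrite [leLHS](reindex_inj rev_ord_inj) /=; apply: ler_sum => k _.
  have -> : (t.-1 - (t - k.+1) = k)%N by have := ltn_ord k; clear; lia.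
  by apply: pw_ler; lra.
apply: (@le_trans _ _ (B * (2 `^ (1 + del) * pw t (- (1 + del))) * (K2 * pw t th))).
  by rewrite ler_wpM2l // !mulr_ge0 ?pw_ge0 // ltW.
apply: (@le_trans _ _ (pw t ((1 + del - gm) / 2) * (2 `^ (1 + del) * pw t (- (1 + del))) * (K2 * pw t th))).
  by rewrite -!mulrA ler_wpM2r // !mulr_ge0 ?pw_ge0 // ltW.
have -> : pw t ((1 + del - gm) / 2) * (2 `^ (1 + del) * pw t (- (1 + del))) * (K2 * pw t th) =
  2 `^ (1 + del) * K2 * (pw t ((1 + del - gm) / 2) * pw t (- (1 + del)) * pw t th) by ring.
rewrite -[leRHS]mulrA ler_wpM2l ?mulr_ge0 ?(ltW K20) ?(ltW (tw0 _)) // -!pwD.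
apply: (@le_trans _ _ (pw t (- gm))); first by apply: pw_ler; lra.
by rewrite ler_peMl ?pw_ge0.
Qed.

Section Decorrelation.
Variables (R : realType) (d : nat) (alpha beta C del : R).
Hypotheses (d_gt0 : (0 < d)%N) (alpha_gt0 : 0 < alpha) (le_ab : alpha <= beta).
Hypotheses (del_ge0 : 0 <= del) (HC : @dipole_bound R d alpha beta C del).
Local Notation c := (cst d beta).
Let c0 : 0 < c := cst_gt0 d_gt0 alpha_gt0 le_ab.
Variable M : model d alpha beta.
Local Notation V := (mV M).
Local Notation e := (me M).
Local Notation ed := (V * 'I_d)%type.
Local Notation Om := {ffun ed * option bool -> mS M}.
Local Notation Ex := (@Ex R (mS M) (ed * option bool)%type (@mw _ _ _ _ M)).
Implicit Types (s : Om) (E : ed) (z : V).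

Definition gE s k E := dg e E (u (sw1 E s) k).
Definition dsq s t E := dot (dip s t E) (dip s t E).

Lemma KK1E t k : KK M 1 t k = #|V|%:R^-1 * \sum_E Ex (fun s => dsq s t E * gE s k E ^+ 2).
Proof.
rewrite /KK /mean; congr (_ * _).
under eq_bigr => x _ do under Ex_ext => s do rewrite expr1.
under eq_bigr do rewrite Ex_sum.
rewrite exchange_big /=; apply: eq_bigr => E _; rewrite -Ex_sum; apply: Ex_ext => s.
by rewrite -mulr_suml sum_hk.
Qed.

Lemma box_sum (F : ed -> R) l :
  \sum_z \sum_(k : {ffun 'I_d -> 'I_l}) \sum_i F (z + lat e (fun j => k j), i) = (l ^ d)%:R * \sum_E F E.
Proof.
rewrite exchange_big /= sum_edges.
under eq_bigr => k _ do rewrite (sum_shift (fun z => \sum_i F (z, i))).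
by rewrite sumr_const card_ffun !card_ord -[X in X = _]mulr_natl.
Qed.

Lemma Ex_dg_tr q k x i : Ex (fun s => `|dg e (x, i) (u s k)| ^+ q) = Ex (fun s => `|dg e (0, i) (u s k)| ^+ q).
Proof.
rewrite -[RHS](Ex_tr x); apply: Ex_ext => s; rewrite /dg /= !u_tr.
by rewrite !add0r (addrC (e i)).
Qed.

Lemma sum_dir q k x : (0 < q)%N -> \sum_i Ex (fun s => `|gE s k (x, i)| ^+ q) = bq M q k ^+ q.
Proof.
move=> q0; rewrite bqE // sum_edges.
have h y : \sum_i Ex (fun s => `|dg e (y, i) (u s k)| ^+ q) = \sum_i Ex (fun s => `|dg e (x, i) (u s k)| ^+ q).
  by apply: eq_bigr => i _; rewrite !(Ex_dg_tr q k _ i).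
under [X in _ = _ * X]eq_bigr do rewrite h.
rewrite sumr_const -[X in _ = _ * X]mulr_natl mulKf ?gt_eqF ?card_gt0 //.
by apply: eq_bigr => i _; rewrite /gE (Ex_sw1 _ (x, i) (fun s => `|dg e (x, i) (u s k)| ^+ q)).
Qed.

(** The cube of side [k.+1] at [z] enlarged by [k.+2]: a solution at time [k] sees conductances at
    distance [k.+1], and a gradient one site further. *)
Definition Qh k z : pred ed := fun E => cube e (z - rr e k.+2) (k.+1 + 2 * k.+2) E.1.
Definition Qc k : R := d%:R * ((k.+1 + 2 * k.+2) ^ d)%:R.

Lemma card_Qh k z : #|Qh k z|%:R <= Qc k.
Proof.
rewrite /Qc -natrM ler_nat mulnC -sum1_card.
have -> : \sum_(i in Qh k z) 1%N = \sum_(x | cube e (z - rr e k.+2) (k.+1 + 2 * k.+2) x) \sum_(i < d) 1%N.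
  rewrite pair_big /=; apply: eq_big => [[x i]|//]; by rewrite /in_mem /= andbT.
under eq_bigr do rewrite sum1_card card_ord.
by rewrite sum_nat_const leq_mul2r card_cube_le orbT.
Qed.

(** Over all positions [z] each edge is counted at most once per site of the enlarged cube, and the
    sum of all dipole energies equals the sum over sites of the kernel gradients. So the averaged
    energy has the rate of [grad_decay], better than the one used for a fixed edge. *)
Lemma mean_NN Cg t k : (t <= mN M)%N ->
  (forall s x, gradsq e (Tn e beta (env s) t (delta x)) <= Cg) ->
  #|V|%:R^-1 * \sum_z Ex (fun s => NN beta e (env s) t (Qh k z)) <= ((k.+1 + 2 * k.+2) ^ d)%:R * Cg.
Proof.
move=> tN hg; set L := (k.+1 + 2 * k.+2)%N; rewrite -Ex_sum -ExZ.
rewrite -[leRHS](mEx_cst M); apply: Ex_le; first exact: mw_ge0.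
move=> s; rewrite ler_pdivrMl ?card_gt0 //.
have d0 E : 0 <= dsq s t E by exact: sq_ge0.
apply: (@le_trans _ _ (\sum_z \sum_(k' : {ffun 'I_d -> 'I_L}) \sum_i dsq s t (z - rr e k.+2 + lat e (fun j => k' j), i))).
  apply: ler_sum => z _; rewrite /NN /Qh.
  have -> : \sum_(E | cube e (z - rr e k.+2) L E.1) dsq s t E =
    \sum_(x | cube e (z - rr e k.+2) L x) \sum_i dsq s t (x, i).
    rewrite big_mkcond (sum_edges (fun E => if cube e (z - rr e k.+2) L E.1 then dsq s t E else 0)) [RHS]big_mkcond /=.
    by apply: eq_bigr => x _; case: ifP => // _; rewrite big1.
  by apply: (sum_cube_le e (F := fun x => \sum_i dsq s t (x, i))) => x; rewrite sumr_ge0.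
rewrite (sum_shift (fun z => \sum_(k' : {ffun 'I_d -> 'I_L}) \sum_i dsq s t (z + lat e (fun j => k' j), i)) (- rr e k.+2)).
rewrite box_sum mulrCA; apply: ler_wpM2l => //.
have -> : \sum_E dsq s t E = \sum_x gradsq e (Tn e beta (env s) t (delta x)).
  rewrite /gradsq [RHS]exchange_big; apply: eq_bigr => E _; rewrite /dsq -sum_hk.
  by [].
rewrite mulr_natl -sumr_const; apply: ler_sum => x _; exact: hg.
Qed.

(** Stands for the squared supremum of the gradient over the cube; with an [l^q] norm instead, its
    expectation costs only the power d/q of the side. *)
Definition Gz k q z s : R :=
  rt q (\sum_(j : {ffun 'I_d -> 'I_k.+1} * 'I_d) `|gE s k (z + lat e (fun i => j.1 i), j.2)| ^+ q) ^+ 2.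

(** The gradients over the cube read the main copy inside [Qh] and the copy used by [sw1]. The
    dipole energies, once [Qh] is swapped with the third copy, read only the complement. This is why
    three copies are carried along. *)
Definition depA k z (j : ed * option bool) : bool := (Qh k z j.1 && (j.2 == None)) || (j.2 == Some false).

Lemma Gz_dep k q z : dep (depA k z) (Gz k q z).
Proof.
move=> s t st; congr (rt q _ ^+ 2); apply: eq_bigr => -[k' i] _ /=.
set E := (z + _, i); congr (`|_| ^+ q); rewrite /gE /dg.
have cE : cube e z k.+1 E.1 by apply/existsP; exists k'.
have loc E' : nbr e k.+2 E.1 E'.1 -> env (sw1 E s) E' = env (sw1 E t) E'.
  move=> h; rewrite /env !ffunE /swj /=; case: ifP => [_|_] /=.
    by rewrite st // /depA /= orbT.
  by rewrite st // /depA /= /Qh (nbr_cube cE h).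
rewrite /u; congr (_ - _); apply: sol_local => E' h; apply: loc.
  exact: nbr_up h.
exact: nbr_S.
Qed.

Lemma NNsw_dep k z t : dep (predC (depA k z)) (fun s => NN beta e (env (sw (Qh k z) true s)) t (Qh k z)).
Proof.
move=> s s' st; congr (NN beta e _ t _); apply/funext => E; rewrite /env !ffunE /swj /=.
case: ifP => QE /=; rewrite st //=.
  by rewrite /depA /= andbF.
by rewrite /depA /= QE.
Qed.

Lemma Ex_Gz k p z : Ex (Gz k (2 * p.+1) z) <= (rt (2 * p.+1) ((k.+1 ^ d)%:R) * bq M (2 * p.+1) k) ^+ 2.
Proof.
set q := (2 * p.+1)%N; have q0 : (0 < q)%N by rewrite muln_gt0.
have S0 s : 0 <= \sum_(j : {ffun 'I_d -> 'I_k.+1} * 'I_d) `|gE s k (z + lat e (fun i => j.1 i), j.2)| ^+ q.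
  by rewrite sumr_ge0 // => j _; rewrite exprn_ge0.
rewrite -(@ler_pXn2r _ p.+1) ?nnegrE ?sqr_ge0 //; last first.
  by apply: Ex_ge0 => [|s]; [exact: mw_ge0|exact: sqr_ge0].
have := Ex_pow (@mw_ge0 _ _ _ _ M) (@mw_sum _ _ _ _ M) p (fun s => sqr_ge0 _ : 0 <= Gz k q z s).
move/le_trans; apply.
rewrite -exprM exprMn [X in _ <= X * _]rtK //.
have -> : Ex (fun s => Gz k q z s ^+ p.+1) = \sum_(k' : {ffun 'I_d -> 'I_k.+1}) bq M q k ^+ q.
  transitivity (Ex (fun s => \sum_(k' : {ffun 'I_d -> 'I_k.+1}) \sum_i `|gE s k (z + lat e (fun i => k' i), i)| ^+ q)).
    by apply: Ex_ext => s; rewrite /Gz -exprM [LHS]rtK // pair_bigA.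
  rewrite Ex_sum; apply: eq_bigr => k' _; rewrite Ex_sum; exact: sum_dir.
by rewrite sumr_const card_ffun !card_ord -[X in X <= _]mulr_natl.
Qed.

Lemma box_le k q z t s : (k < mN M)%N -> (0 < q)%N ->
  \sum_(k' : {ffun 'I_d -> 'I_k.+1}) \sum_i
     dsq s t (z + lat e (fun j => k' j), i) * gE s k (z + lat e (fun j => k' j), i) ^+ 2 <=
  NN beta e (env s) t (Qh k z) * Gz k q z s.
Proof.
move=> kN q0; pose J := ({ffun 'I_d -> 'I_k.+1} * 'I_d)%type.
pose h (j : J) : ed := (z + lat e (fun i => j.1 i), j.2).
have hinj : injective h.
  move=> [k1 i1] [k2 i2] [] /addrI /(m_torus M) hk ->; congr (_, _).
  by apply/ffunP => i; apply/val_inj; apply: hk => j; exact: leq_trans (ltn_ord _) kN.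
have d0 E : 0 <= dsq s t E by exact: sq_ge0.
have g2 (j : J) : gE s k (h j) ^+ 2 <= Gz k q z s.
  rewrite -[X in X <= _]real_normK ?num_real //; apply: sqr_mono => //.
  rewrite -(@ler_pXn2r _ q) ?nnegrE ?rt_ge0 // rtK; last first.
    by rewrite sumr_ge0 // => i _; rewrite exprn_ge0.
  - by [].
  by rewrite (bigD1 j) //= lerDl sumr_ge0 // => i _; rewrite exprn_ge0.
rewrite pair_bigA /=; apply: (@le_trans _ _ (\sum_(j : J) dsq s t (h j) * Gz k q z s)).
  by apply: ler_sum => j _; apply: ler_wpM2l; [exact: d0|exact: g2].
rewrite -mulr_suml ler_wpM2r ?sqr_ge0 // /NN [leRHS]big_mkcond /=.
have fE E : 0 <= (if Qh k z E then dsq s t E else 0) by case: ifP.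
apply: le_trans (sum_inj_le hinj fE).
apply: ler_sum => j _; suff -> : Qh k z (h j) by [].
apply: (@nbr_cube _ _ e k.+2 z k.+1 (h j).1); last exact: nbr_refl.
by apply/existsP; exists j.1.
Qed.

(** Edges are grouped in cubes of side [k.+1]. In each, [box_le] separates gradients from dipole
    energies, [NN_compare] moves the latter to the environment resampled in [Qh], and independence
    factorizes the expectation. *)
Lemma decor_weights Cg p t k (l : 'I_t.+1 -> R) : 0 < Cg -> (t + k < mN M)%N ->
  (forall j s x, (j <= mN M)%N -> gradsq e (Tn e beta (env s) j (delta x)) <= Cg * pw j (- (2 * gam R d))) ->
  (forall j, 0 < l j) -> \sum_j l j = 1 ->
  KK M 1 t k <= \sum_(j < t.+1) ((k.+1 ^ d)%:R^-1 * (((k.+1 + 2 * k.+2) ^ d)%:R *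
     (Cg * pw (if (j < t)%N then t.-1 - j else t)%N (- (2 * gam R d)))) *
     (if (j < t)%N then beta / c * (opC d alpha beta C del * opn del (Qc k) j) else 1) ^+ 2 *
     (rt (2 * p.+1) ((k.+1 ^ d)%:R) * bq M (2 * p.+1) k) ^+ 2) / l j.
Proof.
move=> Cg0 tkN hg l0 l1; set q := (2 * p.+1)%N; have q0 : (0 < q)%N by rewrite muln_gt0.
have tN : (t <= mN M)%N by clear -tkN; lia.
have kN : (k < mN M)%N by clear -tkN; lia.
set A := (rt q _ * bq M q k) ^+ 2.
have w0 : 0 < (k.+1 ^ d)%:R :> R by rewrite ltr0n expn_gt0.
pose F E := Ex (fun s => dsq s t E * gE s k E ^+ 2).
rewrite KK1E -[\sum_E _](mulKf (lt0r_neq0 w0)) -(box_sum F).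
pose tj (j : 'I_t.+1) : nat := if (j < t)%N then (t.-1 - j)%N else t.
pose cj (j : 'I_t.+1) : R := if (j < t)%N then beta / c * (opC d alpha beta C del * opn del (Qc k) j) else 1.
have tjN j : (tj j <= mN M)%N.
  by rewrite /tj; case: ifP => // _; rewrite (leq_trans _ tN) // (leq_trans (leq_subr _ _)) // leq_pred.
have perz z : \sum_(k' : {ffun 'I_d -> 'I_k.+1}) \sum_i F (z + lat e (fun j => k' j), i) <=
   \sum_(j < t.+1) cj j ^+ 2 / l j * (Ex (fun s => NN beta e (env s) (tj j) (Qh k z)) * A).
  have -> : \sum_(k' : {ffun 'I_d -> 'I_k.+1}) \sum_i F (z + lat e (fun j => k' j), i) =
    Ex (fun s => \sum_(k' : {ffun 'I_d -> 'I_k.+1}) \sum_i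
     dsq s t (z + lat e (fun j => k' j), i) * gE s k (z + lat e (fun j => k' j), i) ^+ 2).
    by rewrite Ex_sum; apply: eq_bigr => k' _; rewrite Ex_sum.
  apply: (@le_trans _ _ (Ex (fun s => \sum_(j < t.+1) cj j ^+ 2 / l j *
      (NN beta e (env (sw (Qh k z) true s)) (tj j) (Qh k z) * Gz k q z s)))).
    apply: Ex_le; first exact: mw_ge0.
    move=> s; apply: le_trans (box_le z t s kN q0) _.
    have ab E : ~~ Qh k z E -> env s E = env (sw (Qh k z) true s) E.
      by move=> /negPf QE; rewrite /env ffunE /swj /= QE.
    have := NN_compare d_gt0 alpha_gt0 le_ab del_ge0 HC (m_torus M) (env_ell s)
       (env_ell (sw (Qh k z) true s)) ab tN (card_Qh k z) l0 l1.
    move=> h; apply: (@le_trans _ _ (_ * Gz k q z s)); first by apply: ler_wpM2r h; exact: sqr_ge0.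
    rewrite mulr_suml; apply: ler_sum => j _; rewrite /cj /tj; case: ifP => _.
      by rewrite le_eqVlt; apply/orP; left; apply/eqP; ring.
    by rewrite expr1n le_eqVlt; apply/orP; left; apply/eqP; ring.
  rewrite Ex_sum; apply: ler_sum => j _; rewrite ExZ; apply: ler_wpM2l.
    by apply: mulr_ge0; [exact: sqr_ge0|rewrite invr_ge0 ltW].
  under Ex_ext do rewrite mulrC.
  rewrite (Ex_indep (@mw_sum _ _ _ _ M) (@Gz_dep k q z) (@NNsw_dep k z (tj j))) mulrC.
  rewrite (Ex_sw _ (Qh k z) true (fun s => NN beta e (env s) (tj j) (Qh k z))).
  apply: ler_wpM2l; last exact: Ex_Gz.
  apply: Ex_ge0 => [|s]; first exact: mw_ge0.
  by rewrite sumr_ge0 // => E _; exact: sq_ge0.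
apply: (@le_trans _ _ (#|V|%:R^-1 * ((k.+1 ^ d)%:R^-1 * \sum_z \sum_(j < t.+1) cj j ^+ 2 / l j *
     (Ex (fun s => NN beta e (env s) (tj j) (Qh k z)) * A)))).
  rewrite ler_pM2l ?invr_gt0 ?card_gt0 // ler_pM2l ?invr_gt0 //; apply: ler_sum => z _; exact: perz.
rewrite exchange_big /= mulr_sumr mulr_sumr; apply: ler_sum => j _.
rewrite -mulr_sumr -mulr_suml -/(cj j) -/(tj j).
have hm := mean_NN k (tjN j) (fun s x => hg _ s x (tjN j)).
set Sz := \sum_z _ in hm *; set L := ((_ ^ d)%:R) in hm *.
have -> : #|V|%:R^-1 * ((k.+1 ^ d)%:R^-1 * (cj j ^+ 2 / l j * (Sz * A))) =
  (k.+1 ^ d)%:R^-1 * (cj j ^+ 2 / l j * A) * (#|V|%:R^-1 * Sz) by ring.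
apply: (@le_trans _ _ ((k.+1 ^ d)%:R^-1 * (cj j ^+ 2 / l j * A) * (L * (Cg * pw (tj j) (- (2 * gam R d)))))).
  apply: ler_wpM2l => //; apply: mulr_ge0; first by rewrite invr_ge0 ltW.
  apply: mulr_ge0; last exact: sqr_ge0.
  by apply: mulr_ge0; [exact: sqr_ge0|rewrite invr_ge0 ltW].
by rewrite le_eqVlt; apply/orP; left; apply/eqP; ring.
Qed.

End Decorrelation.

(** * The two passes *)

Section Core.
Variables (R : realType) (d : nat) (alpha beta C del : R).
Hypotheses (d_gt1 : (1 < d)%N) (alpha_gt0 : 0 < alpha) (le_ab : alpha <= beta).
Hypotheses (del_gt0 : 0 < del) (HC : @dipole_bound R d alpha beta C del).
Let d_gt0 : (0 < d)%N := ltnW d_gt1.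
Local Notation c := (cst d beta).
Let c0 : 0 < c := cst_gt0 d_gt0 alpha_gt0 le_ab.
Local Notation gam := (gam R d).
Local Notation model := (model d alpha beta).

Lemma gam_ge1 : 1 <= gam.
Proof. by rewrite /gam; have : 2%:R <= d%:R :> R; [rewrite ler_nat|lra]. Qed.

(** [ode] with the kernel of [KK_le]. The last condition on [sig] says that it beats the Hölder loss
    1 - 1/q on block sums. *)
Lemma pass1 m : 0 <= sig d del (2 ^ m) <= gam -> 1 - (2 * 2 ^ m)%:R^-1 < sig d del (2 ^ m) ->
  exists2 C1 : R, 0 < C1 & forall (M : model) n, (n <= mN M)%N ->
  aq M (2 * 2 ^ m) n <= C1 * pw n (- sig d del (2 ^ m)).
Proof.
set q := (2 * 2 ^ m)%N; set sg := sig d del (2 ^ m); move=> /andP[sg0 sgg] sgq.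
have q0 : (0 < q)%N by rewrite muln_gt0 expn_gt0.
have [C1 C10 H1] := es_bound d_gt0 alpha_gt0 le_ab m.
have pE : (2 ^ m = (2 ^ m).-1.+1)%N by rewrite prednK // expn_gt0.
have [C2 C20 H2] := KK_le d_gt0 alpha_gt0 le_ab (2 ^ m).-1 HC.
have [C3 C30 H3] := bq_le_aq d_gt0 alpha_gt0 le_ab (2 ^ m).-1.
rewrite -pE -/q -/sg in H2 H3.
pose K := C1 + C1 * C2 + C3 + 2 * d%:R * beta.
have b0 : 0 < beta := beta_gt0 alpha_gt0 le_ab.
have db : 0 < 2 * d%:R * beta by rewrite !mulr_gt0 // ltr0n.
have m12 : 0 < C1 * C2 by exact: mulr_gt0.
have K0 : 0 < K by rewrite !addr_gt0.
have [C4 C40 H4] := ode q0 K0 sgq sg0; exists C4 => // M n nN.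
apply: (H4 (mN M) (aq M q) (bq M q)) => //.
- by move=> k; exact: aq_ge0.
- by move=> k; exact: bq_ge0.
- by move=> i j ij; rewrite /q pE; exact: aq_mono.
- apply: le_trans (aq0_le alpha_gt0 le_ab M q0) _; rewrite /K; lra.
- move=> k; apply: le_trans (H3 M k) _; rewrite ler_wpM2r //; last by rewrite /K; lra.
  by rewrite -(pmulr_rge0 _ C30); apply: le_trans (H3 M k); rewrite exprn_ge0 // bq_ge0.
move=> k kN; apply: (le_trans (H1 M k (fun s => C2 * pw (k.-1 - s) (- sg) * bq M q s) kN _ _)).
- by move=> s _; rewrite mulr_ge0 ?bq_ge0 // mulr_ge0 ?pw_ge0 // ltW.
- by move=> s sk; apply: H2; rewrite (leq_trans (leq_subr _ _)) // (leq_trans (leq_pred _)).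
have S0 : 0 <= \sum_(s < k) pw (k.-1 - s) (- sg) * bq M q s.
  by rewrite sumr_ge0 // => s _; rewrite mulr_ge0 ?pw_ge0 ?bq_ge0.
have -> : \sum_(s < k) C2 * pw (k.-1 - s) (- sg) * bq M q s = C2 * \sum_(s < k) pw (k.-1 - s) (- sg) * bq M q s.
  by rewrite mulr_sumr; apply: eq_bigr => s _; rewrite mulrA.
have p1 : pw k (- gam) <= pw k (- sg) :> R by apply: pw_ler; rewrite lerN2.
have p0 := pw_ge0 k (- sg) : 0 <= _ :> R.
rewrite !mulrDr mulrA; apply: lerD.
  by apply: ler_pM; rewrite ?pw_ge0 ?(ltW C10) // /K; lra.
by apply: ler_wpM2r => //; rewrite /K; lra.
Qed.

Lemma KK_jensen (M : model) p t k : KK M 1 t k ^+ p.+1 <= KK M p.+1 t k.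
Proof.
pose X x s := \sum_E hk (M := M) s t x E ^+ 2 * dg (me M) E (u (sw1 E s) k) ^+ 2.
have X0 x s : 0 <= X x s by rewrite sumr_ge0 // => E _; rewrite mulr_ge0 ?sqr_ge0.
have E1 : KK M 1 t k = \sum_x #|mV M|%:R^-1 * Ex (@mw _ _ _ _ M) (X x).
  by rewrite /KK /mean mulr_sumr; apply: eq_bigr => x _; congr (_ * _); apply: Ex_ext => s; rewrite expr1.
have E2 : KK M p.+1 t k = \sum_x #|mV M|%:R^-1 * Ex (@mw _ _ _ _ M) (fun s => X x s ^+ p.+1).
  by rewrite /KK /mean mulr_sumr.
have v0 : 0 < #|mV M|%:R^-1 :> R by rewrite invr_gt0 card_gt0.
rewrite E1 E2; apply: (@le_trans _ _ (\sum_x #|mV M|%:R^-1 * Ex (@mw _ _ _ _ M) (X x) ^+ p.+1)).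
  apply: jensen_pow => [x| |x]; first exact: ltW.
    by rewrite sumr_const -[LHS]mulr_natl divff // gt_eqF // card_gt0.
  by apply: Ex_ge0 => //; exact: mw_ge0.
apply: ler_sum => x _; rewrite ler_pM2l //; apply: Ex_pow => //; [exact: mw_ge0|exact: mw_sum].
Qed.

Lemma Qc_bound k : 1 <= Qc R d k <= d%:R * 5 ^+ d * pw k d%:R.
Proof.
rewrite /Qc; apply/andP; split.
  by rewrite -natrM ler1n muln_gt0 d_gt0 expn_gt0 addSn.
rewrite -mulrA ler_wpM2l // /pw powR_mulrn ?ler0n // -exprMn -natrM -natrX ler_nat.
by rewrite leq_exp2r //; clear; lia.
Qed.

(** [decor_weights] with optimized weights, then [conv_bound]: the number of edges [Qc] enters only
    to the power [eps], and the supremum over the cube costs k^(d/q). *)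
Lemma decor_KK p eps : 0 < eps <= 1 -> gam < 1 + del -> exists2 C1 : R, 0 < C1 &
  forall (M : model) t k, (t + k < mN M)%N -> Qc R d k <= pw t ((1 + del - gam) / 2) ->
  KK M 1 t k <= (C1 * pw t (- gam) * (pw k (d%:R * eps + d%:R / (2 * p.+1)%:R) * bq M (2 * p.+1) k)) ^+ 2.
Proof.
move=> heps gd; have [eps0 _] := andP heps.
have [Cg Cg0 Hg] := grad_decay d_gt0 alpha_gt0 le_ab.
have [C2 C20 H2] := conv_bound gam_ge1 del_gt0 gd heps.
set q := (2 * p.+1)%N; have q0 : (0 < q)%N by rewrite muln_gt0.
have O0 := opC_gt0 d_gt0 alpha_gt0 le_ab HC.
have b0 : 0 < beta := beta_gt0 alpha_gt0 le_ab.
pose bc := beta / c; have bc0 : 0 < bc by exact: divr_gt0.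
pose O := opC d alpha beta C del.
have d0 : 0 < d%:R :> R by rewrite ltr0n.
pose D0 : R := d%:R * 5 ^+ d; have D00 : 0 < D0 by rewrite mulr_gt0 // exprn_gt0.
pose A := Num.sqrt (Cg * 5 ^+ d).
have A0 : 0 < A by rewrite sqrtr_gt0 mulr_gt0 // exprn_gt0.
exists (A * ((bc * O * C2 + 1) * D0 `^ eps)).
  rewrite mulr_gt0 // mulr_gt0 ?powR_gt0 // addr_gt0 // mulr_gt0 // mulr_gt0 //.
move=> M t k tk Qt; have /andP[Q1 Q2] := Qc_bound k.
have Q0 : 0 < Qc R d k by exact: lt_le_trans Q1.
pose Bk := rt q ((k.+1 ^ d)%:R) * bq M q k.
have Bk0 : 0 <= Bk by rewrite mulr_ge0 ?rt_ge0 ?bq_ge0.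
pose f (j : 'I_t.+1) := A * Bk * ((if (j < t)%N then bc * (O * opn del (Qc R d k) j) else 1) *
  pw (if (j < t)%N then t.-1 - j else t)%N (- gam)).
have cf0 (j : 'I_t.+1) : 0 <= (if (j < t)%N then bc * (O * opn del (Qc R d k) j) else 1).
  case: ifP => // _; apply: mulr_ge0; first exact: ltW.
  by apply: mulr_ge0; [exact: ltW|exact: opn_ge0 (ltW Q0)].
have f0 j : 0 <= f j.
  by apply: mulr_ge0; [apply: mulr_ge0 => //; exact: ltW|apply: mulr_ge0 => //; exact: pw_ge0].
have hg j s x : (j <= mN M)%N -> gradsq (me M) (Tn (me M) beta (env s) j (delta x)) <= Cg * pw j (- (2 * gam)).
  move=> jN; have -> : 2 * gam = d%:R / 2 + 1 by rewrite /gam; field.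
  exact: Hg _ _ _ _ (m_torus M) (env_ell s) _ _ jN.
have main : KK M 1 t k <= (\sum_j f j) ^+ 2.
  apply: (minkowski_weights (n := 1)) => // [l l0 l1|]; last by rewrite card_ord.
  have h := decor_weights d_gt0 alpha_gt0 le_ab (ltW del_gt0) HC p Cg0 tk hg l0 l1.
  apply: (le_trans h); apply: ler_sum => j _; rewrite -/q -/Bk -/bc -/O /f.
  set cf := (if _ then _ else 1); set tj := (if _ then _ else t).
  have -> : l j * (A * Bk * (cf * pw tj (- gam)) / l j) ^+ 2 =
    A ^+ 2 * (pw tj (- gam)) ^+ 2 * cf ^+ 2 * Bk ^+ 2 / l j.
    by field; rewrite gt_eqF.
  apply: ler_wpM2r; first by rewrite invr_ge0 ltW.
  apply: ler_wpM2r; first exact: sqr_ge0.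
  apply: ler_wpM2r; first exact: sqr_ge0.
  have -> : pw tj (- gam) ^+ 2 = pw tj (- (2 * gam)) :> R by rewrite pw_exp; congr pw; ring.
  rewrite !mulrA; apply: ler_wpM2r; first exact: pw_ge0.
  rewrite /A sqr_sqrtr; last by rewrite mulr_ge0 ?exprn_ge0 // ltW.
  rewrite [Cg * _]mulrC; apply: ler_wpM2r; first exact: ltW.
  rewrite ler_pdivrMl ?ltr0n ?expn_gt0 // -natrX -natrM ler_nat mulnC -expnMn leq_exp2r //.
  by clear; lia.
apply: (le_trans main); apply: sqr_mono; first exact: sumr_ge0.
rewrite /f -mulr_sumr big_ord_recr /= ltnn mul1r.
have -> : \sum_(j < t) (if (j < t)%N then bc * (O * opn del (Qc R d k) j) else 1) *
    pw (if (j < t)%N then t.-1 - j else t)%N (- gam) =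
  bc * O * \sum_(j < t) opn del (Qc R d k) j * pw (t.-1 - j) (- gam).
  by rewrite mulr_sumr; apply: eq_bigr => j _; rewrite ltn_ord !mulrA.
have h2 := H2 _ _ Q1 Qt.
have Qe1 : 1 <= Qc R d k `^ eps by rewrite -[leLHS](powRr0 (Qc R d k)) ler_powR // ltW.
apply: (@le_trans _ _ (A * Bk * ((bc * O * C2 + 1) * (Qc R d k `^ eps * pw t (- gam))))).
  apply: ler_wpM2l; first by apply: mulr_ge0 => //; exact: ltW.
  rewrite [(_ + 1) * _]mulrDl mul1r; apply: lerD; last by rewrite ler_peMl ?pw_ge0.
  rewrite -[bc * O * C2 * _]mulrA; apply: ler_wpM2l; first by apply: mulr_ge0; exact: ltW.
  by rewrite mulrA.
have rE : rt q ((k.+1 ^ d)%:R) = pw k (d%:R / q%:R) :> R.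
  by rewrite /rt natrX -powR_mulrn ?ler0n // -powRrM.
have Qe : Qc R d k `^ eps <= D0 `^ eps * pw k (d%:R * eps).
  rewrite /pw powRrM -powRM ?powR_ge0 ?(ltW D00) // ge0_ler_powR ?nnegrE ?(ltW eps0) ?(ltW Q0) //.
  by rewrite mulr_ge0 ?powR_ge0 // ltW.
have -> : A * ((bc * O * C2 + 1) * D0 `^ eps) * pw t (- gam) * (pw k (d%:R * eps + d%:R / q%:R) * bq M q k) =
  A * Bk * ((bc * O * C2 + 1) * ((D0 `^ eps * pw k (d%:R * eps)) * pw t (- gam))).
  by rewrite pwD /Bk rE; ring.
apply: ler_wpM2l; first by apply: mulr_ge0 => //; exact: ltW.
apply: ler_wpM2l; first by apply: addr_ge0 => //; apply: mulr_ge0; [apply: mulr_ge0; exact: ltW|exact: ltW].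
by apply: ler_wpM2r => //; exact: pw_ge0.
Qed.

(** When the cube is too large for [decor_KK], the time [t] is bounded by a power of [k]; the
    missing factor t^(gam - sig) is then at most a multiple of k^(d eps), and the bound of [KK_le]
    already has the required form. *)
Lemma full_KK p eps : 0 < eps <= 1 -> gam < 1 + del -> 0 <= gam - sig d del p.+1 ->
  (gam - sig d del p.+1) <= (1 + del - gam) / 2 * eps -> exists2 C1 : R, 0 < C1 &
  forall (M : model) t k, (t + k < mN M)%N ->
  KK M 1 t k <= (C1 * pw t (- gam) * (pw k (d%:R * eps + d%:R / (2 * p.+1)%:R) * bq M (2 * p.+1) k)) ^+ 2 /\
  KK M 1 t k <= (C1 * pw t (- sig d del p.+1) * bq M (2 * p.+1) k) ^+ 2.
Proof.
move=> heps gd gs0 gse; have /andP[eps0 eps1] := heps.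
have [C1 C10 H1] := decor_KK p heps gd.
have [C2 C20 H2] := KK_le d_gt0 alpha_gt0 le_ab p HC.
set q := (2 * p.+1)%N in H1 H2 *; set sg := sig d del p.+1 in H2 gs0 gse *.
have d0 : 0 < d%:R :> R by rewrite ltr0n.
pose D0 : R := d%:R * 5 ^+ d; have D01 : 1 <= D0.
  by rewrite /D0 -natrX -natrM ler1n muln_gt0 d_gt0 expn_gt0.
have D00 : 0 < D0 by exact: lt_le_trans D01.
exists (C1 + C2 * D0 `^ eps + C2); first by rewrite !addr_gt0 // mulr_gt0 // powR_gt0.
move=> M t k tk; have tN : (t <= mN M)%N by clear -tk; lia.
have De : 0 < C2 * D0 `^ eps by rewrite mulr_gt0 // powR_gt0.
have KK0 : 0 <= KK M 1 t k.
  apply: mean_ge0 => x; apply: Ex_ge0 => [|s]; first exact: mw_ge0.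
  by rewrite expr1 sumr_ge0 // => E _; rewrite mulr_ge0 ?sqr_ge0.
have hs : KK M 1 t k <= (C2 * pw t (- sg) * bq M q k) ^+ 2.
  have B0 : 0 <= C2 * pw t (- sg) * bq M q k by rewrite mulr_ge0 ?bq_ge0 // mulr_ge0 ?pw_ge0 // ltW.
  rewrite -(@ler_pXn2r _ p.+1) ?nnegrE ?sqr_ge0 // -exprM.
  exact: le_trans (KK_jensen M p t k) (H2 M t k tN).
have b0 : 0 <= bq M q k := bq_ge0 _ _ _.
set X := pw k (d%:R * eps + d%:R / q%:R).
have X0 : 0 <= X := pw_ge0 _ _.
split; last first.
  apply: (le_trans hs); apply: sqr_mono; first by rewrite mulr_ge0 // mulr_ge0 ?pw_ge0 // ltW.
  by apply: ler_wpM2r => //; apply: ler_wpM2r; [exact: pw_ge0|lra].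
have [Qt|tQ] := leP (Qc R d k) (pw t ((1 + del - gam) / 2)).
  apply: (le_trans (H1 M t k tk Qt)); apply: sqr_mono.
    by apply: mulr_ge0; [apply: mulr_ge0; [exact: ltW|exact: pw_ge0]|exact: mulr_ge0].
  by apply: ler_wpM2r; [exact: mulr_ge0|apply: ler_wpM2r; [exact: pw_ge0|lra]].
apply: (le_trans hs); apply: sqr_mono; first by rewrite mulr_ge0 // mulr_ge0 ?pw_ge0 // ltW.
rewrite mulrA; apply: ler_wpM2r => //.
have -> : pw t (- sg) = pw t (- gam) * pw t (gam - sg) :> R by rewrite -pwD; congr pw; ring.
rewrite mulrCA -[leRHS]mulrA [leRHS]mulrCA; apply: ler_wpM2l; first exact: pw_ge0.
apply: (@le_trans _ _ (C2 * D0 `^ eps * X)); last by apply: ler_wpM2r => //; lra.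
rewrite -mulrA ler_pM2l //; apply: (@le_trans _ _ (D0 `^ eps * pw k (d%:R * eps))); last first.
  by rewrite ler_pM2l ?powR_gt0 // /X; apply: pw_ler; rewrite lerDl divr_ge0.
have /andP[_ Q2] := Qc_bound k.
apply: (@le_trans _ _ (pw t ((1 + del - gam) / 2 * eps))); first exact: pw_ler.
rewrite /pw [t.+1%:R `^ _]powRrM [k.+1%:R `^ _]powRrM -powRM ?powR_ge0 ?(ltW D00) // ge0_ler_powR ?nnegrE ?(ltW eps0) ?powR_ge0 //.
  by rewrite mulr_ge0 ?powR_ge0 // ltW.
exact: le_trans (ltW tQ) Q2.
Qed.

(** Second pass, for the second moment of [u] only: high moments of gradients, assumed summable over
    blocks at rate [w1], enter through [full_KK], and [sharp] removes the loss in the exponent. *)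
Lemma core_bound p eps w1 th K : 0 < eps <= 1 -> gam < 1 + del -> 0 <= gam - sig d del p.+1 ->
  (gam - sig d del p.+1) <= (1 + del - gam) / 2 * eps ->
  d%:R * eps + d%:R / (2 * p.+1)%:R < w1 -> 0 <= th -> gam <= 1 - th + w1 -> 0 < K ->
  (forall n, \sum_(0 <= t < n) pw t (- sig d del p.+1) <= K * pw n th) ->
  (forall (M : model) m, (m <= mN M)%N ->
     \sum_(m <= s < (2 * m).+1 | (s <= mN M)%N) bq M (2 * p.+1) s <= K * pw m (- w1)) ->
  exists2 C2 : R, 0 < C2 & forall (M : model) n, (n <= mN M)%N -> aq M 2 n <= C2 * pw n (- gam).
Proof.
move=> heps gd gs0 gse upw th0 gw K0 sumg blk; have /andP[eps0 eps1] := heps.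
have [C1 C10 H1] := full_KK heps gd gs0 gse.
have [C3 C30 H3] := es_bound d_gt0 alpha_gt0 le_ab 0.
set q := (2 * p.+1)%N in upw blk H1 *; set sg := sig d del p.+1 in sumg H1 *.
set ups := d%:R * eps + d%:R / q%:R in upw H1.
have b0 : 0 < beta := beta_gt0 alpha_gt0 le_ab.
have db : 0 < 2 * d%:R * beta by rewrite !mulr_gt0 // ltr0n.
pose L := K + C1 + C3 + 2 * d%:R * beta; have L0 : 0 < L by rewrite !addr_gt0.
have gam0 : 0 <= gam by exact: le_trans ler01 gam_ge1.
have ups0 : 0 <= ups by rewrite addr_ge0 ?divr_ge0 // mulr_ge0 // ltW.
have sumg' n : \sum_(0 <= t < n) pw t (- sg) <= L * pw n th.
  apply: (le_trans (sumg n)); apply: ler_wpM2r; [exact: pw_ge0|rewrite /L; lra].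
have [C2 C20 H2] := sharp gam0 ups0 upw th0 gw L0 sumg'.
exists C2 => // M n nN.
pose b s := if (s <= mN M)%N then bq M q s else 0.
pose kap t s := Num.sqrt (KK M 1 t s).
have KK0 t s : 0 <= KK M 1 t s.
  apply: mean_ge0 => x; apply: Ex_ge0 => [|s']; first exact: mw_ge0.
  by rewrite expr1 sumr_ge0 // => E _; rewrite mulr_ge0 ?sqr_ge0.
have bb s : 0 <= bq M q s := bq_ge0 _ _ _.
have bE t s : (t + s < mN M)%N -> b s = bq M q s.
  by move=> h; rewrite /b (leq_trans (leq_addl t s)) // ltnW.
have ks (x y z : R) : 0 <= x -> 0 <= z -> x <= y -> x * z <= y * z by move=> *; exact: ler_wpM2r.
apply: (H2 (mN M) (aq M 2) b kap) => //.
- by move=> s; rewrite /b; case: ifP.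
- by move=> i j ij; rewrite -[2%N]/(2 * 1)%N; exact: aq_mono.
- have h2 := aq0_le alpha_gt0 le_ab M (isT : (0 < 2)%N).
  by apply: (le_trans h2); rewrite /L; lra.
- move=> m mN; have := blk M m mN; rewrite big_mkcond /= => h.
  by apply: (le_trans h); apply: ler_wpM2r; [exact: pw_ge0|rewrite /L; lra].
- move=> k kN; have := H3 M k (fun s => kap (k.-1 - s)%N s) kN.
  move=> h; apply: le_trans (h _ _) _; first by move=> s _; exact: sqrtr_ge0.
    by move=> s _; rewrite /kap muln1 sqr_sqrtr.
  apply: ler_wpM2r; last by rewrite /L; lra.
  by rewrite addr_ge0 ?pw_ge0 // sumr_ge0 // => s _; exact: sqrtr_ge0.
- move=> t s ts; rewrite (bE _ _ ts); have [h _] := H1 M t s ts.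
  have Y0 : 0 <= C1 * pw t (- gam) * (pw s ups * bq M q s).
    by apply: mulr_ge0; apply: mulr_ge0; rewrite ?pw_ge0 // ltW.
  apply: (@le_trans _ _ (C1 * pw t (- gam) * (pw s ups * bq M q s))).
    by rewrite /kap -[leRHS](ger0_norm Y0) -sqrtr_sqr ler_sqrt // sqr_ge0.
  rewrite -!mulrA; apply: ks; [exact: ltW| |rewrite /L; lra].
  by apply: mulr_ge0; [exact: pw_ge0|apply: mulr_ge0 => //; exact: pw_ge0].
move=> t s ts; rewrite (bE _ _ ts); have [_ h] := H1 M t s ts.
have Y0 : 0 <= C1 * pw t (- sg) * bq M q s.
  by apply: mulr_ge0 => //; apply: mulr_ge0; [exact: ltW|exact: pw_ge0].
apply: (@le_trans _ _ (C1 * pw t (- sg) * bq M q s)).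
  by rewrite /kap -[leRHS](ger0_norm Y0) -sqrtr_sqr ler_sqrt // sqr_ge0.
rewrite -!mulrA; apply: ks; [exact: ltW| |rewrite /L; lra].
by apply: mulr_ge0 => //; exact: pw_ge0.
Qed.

End Core.

Section BlockSums.
Variables (R : realType) (d : nat) (alpha beta : R).
Hypotheses (d_gt0 : (0 < d)%N) (alpha_gt0 : 0 < alpha) (le_ab : alpha <= beta).

Lemma block_bq p : exists2 C : R, 0 < C & forall (M : model d alpha beta) m,
  \sum_(m <= s < (2 * m).+1) bq M (2 * p.+1) s <=
  C * pw m (1 - (2 * p.+1)%:R^-1) * aq M (2 * p.+1) m.
Proof.
set q := (2 * p.+1)%N; have q0 : (0 < q)%N by rewrite muln_gt0.
have [C C0 H] := bq_le_aq d_gt0 alpha_gt0 le_ab p; rewrite -/q in H.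
exists (rt q C); first by rewrite powR_gt0.
move=> M m; apply: le_trans (block_holder m q0 (fun s => bq_ge0 M q s)) _.
rewrite -mulrA mulrCA; apply: ler_wpM2l; first exact: pw_ge0.
have a0 k : 0 <= aq M q k := aq_ge0 M q k.
have hb : 0 <= \sum_(m <= s < (2 * m).+1) bq M q s ^+ q.
  by rewrite sumr_ge0 // => s _; rewrite exprn_ge0 // bq_ge0.
apply: rt_le => //; first by rewrite mulr_ge0 ?rt_ge0.
rewrite exprMn [rt q C ^+ q]rtK ?(ltW C0) //.
apply: (@le_trans _ _ (\sum_(m <= s < (2 * m).+1) C * (aq M q s ^+ q - aq M q s.+1 ^+ q))).
  by apply: ler_sum_nat => s _; exact: H.
rewrite -mulr_sumr; apply: ler_wpM2l; first exact: ltW.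
rewrite -[X in X <= _]opprK -sumrN; under eq_bigr do rewrite opprB.
rewrite telescope_sumr; last by clear; lia.
by rewrite opprB gerBl exprn_ge0.
Qed.

Lemma partial_block (b : nat -> R) m N : (forall s, 0 <= b s) ->
  \sum_(m <= s < (2 * m).+1 | (s <= N)%N) b s <= \sum_(m <= s < (2 * m).+1) b s.
Proof.
by move=> b0; rewrite [leRHS](bigID (fun s => (s <= N)%N)) /= lerDl sumr_ge0.
Qed.

Lemma exists_pow2 (x : R) : exists m, x < (2 ^ m)%:R.
Proof.
exists (Num.truncn x).+1; apply: lt_le_trans (truncnS_gt x) _.
by rewrite ler_nat ltnW // ltn_expl.
Qed.

End BlockSums.

Lemma variance_decay_ge3 (R : realType) (d : nat) (alpha beta : R) :
  (2 < d)%N -> 0 < alpha -> alpha <= beta -> exists2 C : R, 0 < C &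
  forall (M : model d alpha beta) n, (n <= mN M)%N -> aq M 2 n <= C * pw n (- gam R d).
Proof.
move=> d2 alpha0 le_ab; have d0 : (0 < d)%N by exact: leq_trans d2.
have d1 : (1 < d)%N by exact: ltnW.
have dR : 3 <= d%:R :> R by rewrite ler_nat.
pose del : R := d%:R / 2 - 1; have del0 : 0 < del by rewrite /del; lra.
have [C C0 H] := dipole_decay d0 alpha0 le_ab.
have HC : dipole_bound d alpha beta C del.
  split => // V e N a tor ha n E nN; have := H V e N a tor ha n E nN.
  by rewrite (_ : d%:R / 2 = 1 + del) // /del; ring.
(* The rate of block sums of gradients: the gain 1/q from Hölder and the loss in [sig] cancel
   exactly, because 2 gam - 1 - del = 1. *)
pose w1 : R := gam R d - 1; have w10 : 1 / 4 <= w1 by rewrite /w1 /gam; lra.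
have w1p : 0 < w1 by lra.
(* The two losses d eps and d/q are each kept at or below w1/4, the second by taking q large. *)
pose eps : R := w1 / (4 * d%:R); have eps0 : 0 < eps by rewrite divr_gt0 // mulr_gt0 //; lra.
have dp : 0 < 4 * d%:R :> R by rewrite mulr_gt0 //; lra.
have eps1 : eps <= 1 by rewrite /eps ler_pdivrMr // mul1r /w1 /gam; lra.
have we0 : 0 < w1 / 2 * eps by rewrite mulr_gt0 // divr_gt0.
have [m hm] := @exists_pow2 R (4 * d%:R / w1 + (w1 / 2 * eps)^-1 + w1^-1 + 1).
set P : R := (2 ^ m)%:R in hm.
have i1 : 0 < 4 * d%:R / w1 by rewrite divr_gt0.
have i2 : 0 < (w1 / 2 * eps)^-1 by rewrite invr_gt0.
have i3 : 0 < w1^-1 by rewrite invr_gt0.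
have P0 : 0 < P by lra.
have P2 : 0 < 2 * P by lra.
have sigE : sig d del (2 ^ m) = gam R d - (2 * P)^-1.
  rewrite /sig -/P; congr (_ - _); rewrite -[RHS]mul1r; congr (_ / _).
  by rewrite /gam /del; field.
pose p := (2 ^ m).-1; have pE : p.+1 = (2 ^ m)%N by rewrite prednK // expn_gt0.
have qE : (2 * p.+1)%:R = 2 * P :> R by rewrite natrM pE.
have h1 : d%:R / (2 * P) < w1 / 4.
  rewrite ltr_pdivrMr // mulrC -ltr_pdivrMr; last by rewrite divr_gt0.
  have -> : d%:R / (w1 / 4) = 4 * d%:R / w1 by field; lra.
  lra.
have h2 : (2 * P)^-1 <= w1 / 2 * eps.
  by rewrite -[leRHS]invrK lef_pV2 ?posrE //; lra.
have h3 : (2 * P)^-1 < w1 by rewrite -[ltRHS]invrK ltf_pV2 ?posrE //; lra.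
have h4 : 0 < (2 * P)^-1 by rewrite invr_gt0.
have pa : 0 <= sig d del (2 ^ m) <= gam R d.
  by rewrite sigE; apply/andP; split; move: h3; rewrite /w1; lra.
have pb : 1 - (2 * 2 ^ m)%:R^-1 < sig d del (2 ^ m).
  by rewrite sigE natrM -/P; move: w1p h3; rewrite /w1; lra.
have [C1 C10 H1] := pass1 d1 alpha0 le_ab HC pa pb.
rewrite -pE in H1 sigE.
have [C2 C20 H2] := block_bq d0 alpha0 le_ab p.
pose Kc : R := (1 - 2 `^ (- (sig d del p.+1 - 1)))^-1.
have sg1 : 1 < sig d del p.+1 by rewrite sigE; move: h3; rewrite /w1; lra.
have Kc0 : 0 < Kc by rewrite invr_gt0 subr_gt0 two_pow_lt1 // subr_gt0.
pose K := Kc + C2 * C1; have K0 : 0 < K by rewrite addr_gt0 // mulr_gt0.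
have CC : 0 < C2 * C1 by exact: mulr_gt0.
apply: (core_bound (p := p) (eps := eps) (w1 := w1) (th := 0) (K := K) d1 alpha0 le_ab del0 HC) => //.
- by rewrite eps0.
- by rewrite /del /gam; lra.
- by rewrite sigE; lra.
- have -> : gam R d - sig d del p.+1 = (2 * P)^-1 by rewrite sigE; ring.
  by have -> : (1 + del - gam R d) / 2 = w1 / 2 by rewrite /del /w1 /gam; field.
- rewrite qE; have -> : d%:R * eps = w1 / 4 by rewrite /eps; field; lra.
  by move: h1 w1p; lra.
- by rewrite /w1; lra.
- move=> n; rewrite pw0 mulr1; apply: (le_trans (sum_pw_conv n sg1)); rewrite -/Kc /K; lra.
move=> M k kN; apply: (le_trans (partial_block _ _ _)); first by move=> s; exact: bq_ge0.
apply: (le_trans (H2 M k)).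
apply: (@le_trans _ _ (C2 * pw k (1 - (2 * p.+1)%:R^-1) * (C1 * pw k (- sig d del p.+1)))).
  by apply: ler_wpM2l; [rewrite mulr_ge0 ?pw_ge0 // ltW|exact: H1].
have -> : C2 * pw k (1 - (2 * p.+1)%:R^-1) * (C1 * pw k (- sig d del p.+1)) = C2 * C1 * pw k (- w1).
  have -> : pw k (- w1) = pw k (1 - (2 * p.+1)%:R^-1) * pw k (- sig d del p.+1) :> R.
    by rewrite -pwD sigE qE /w1; congr pw; ring.
  by ring.
by apply: ler_wpM2r; [exact: pw_ge0|rewrite /K; lra].
Qed.

(** * Hole filling in dimension two *)

Section Grid.
Variable R : realType.
Implicit Types (F J : nat -> R) (f A B : nat -> nat -> R).

Lemma abel F J p k : \sum_(p.+1 <= i < (p.+1 + k).+1) F i * (J i.-1 - J i) =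
  \sum_(p.+1 <= i < (p.+1 + k)) J i * (F i.+1 - F i) + J p * F p.+1 - J (p.+1 + k)%N * F (p.+1 + k)%N.
Proof.
elim: k => [|k IH].
  by rewrite addn0 big_nat1 [X in X + _ - _]big_geq //= add0r; ring.
rewrite addnS big_nat_recr /=; last by rewrite leqW // leq_addr.
rewrite IH [in RHS]big_nat_recr /=; last by rewrite leq_addr.
by ring.
Qed.

Lemma abs_telescope F p i : (p <= i)%N -> `|F i - F p| <= \sum_(p <= k < i) `|F k.+1 - F k|.
Proof.
move=> pi; rewrite -telescope_sumr //; exact: ler_norm_sum.
Qed.

Lemma sum_nat_le (b : nat -> R) p k m : (k <= m)%N -> (forall i, 0 <= b i) ->
  \sum_(p <= i < k) b i <= \sum_(p <= i < m) b i.
Proof.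
move=> km b0; have [pk|kp] := leqP p k; last by rewrite big_geq ?sumr_ge0 // ltnW.
by rewrite [leRHS](@big_cat_nat _ _ _ k) //= lerDl sumr_ge0.
Qed.

Lemma sum_nat_sqr (b : nat -> R) p k : (\sum_(p <= i < p + k) b i) ^+ 2 <= k%:R * \sum_(p <= i < p + k) b i ^+ 2.
Proof.
have -> : forall F, \sum_(p <= i < p + k) F i = \sum_(i < k) F (p + i)%N.
  move=> F; rewrite -{1}(add0n p) big_addn addKn big_mkord.
  by apply: eq_bigr => i _; rewrite addnC.
have -> : forall F, \sum_(p <= i < p + k) F i = \sum_(i < k) F (p + i)%N.
  move=> F; rewrite -{1}(add0n p) big_addn addKn big_mkord.
  by apply: eq_bigr => i _; rewrite addnC.
have := @CS_sum R 'I_k xpredT (fun=> 1) (fun i => b (p + i)%N).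
under eq_bigr do rewrite mul1r; move/le_trans; apply.
by under [X in X * _ <= _]eq_bigr do rewrite expr1n; rewrite sumr_const card_ord.
Qed.

Lemma sum_nat_sub (b : nat -> R) p p' k m : (p <= p')%N -> (k <= m)%N -> (forall i, 0 <= b i) ->
  \sum_(p' <= i < k) b i <= \sum_(p <= i < m) b i.
Proof.
move=> pp km b0; apply: le_trans (sum_nat_le p km b0).
have [pk|kp] := leqP p' k; last by rewrite big_geq ?sumr_ge0 // ltnW.
by rewrite [leRHS](@big_cat_nat _ _ _ p') //= lerDr sumr_ge0.
Qed.

Lemma sum_ends F p k : \sum_(p <= i < p + k.+2) F i =
  F p + \sum_(p.+1 <= i < p.+1 + k) F i + F (p.+1 + k)%N.
Proof.
have -> : (p + k.+2)%N = (p.+1 + k).+1 by clear; lia.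
rewrite big_ltn; last by rewrite addSn ltnS leqW // leq_addr.
by rewrite big_nat_recr /= ?addrA // leq_addr.
Qed.

Variables (f A B : nat -> nat -> R).
Definition dh i j := f i.+1 j - f i j.
Definition dv i j := f i j.+1 - f i j.
(* Energy of the horizontal and vertical edges inside the square [p, p + k]^2. *)
Definition sqen p k := \sum_(p <= j < (p + k).+1) \sum_(p <= i < p + k) dh i j ^+ 2 +
  \sum_(p <= i < (p + k).+1) \sum_(p <= j < p + k) dv i j ^+ 2.
(** Weighted Laplacian at an interior point. On the axes the truncated predecessor makes it
    meaningless, so bounds on it are assumed only at positive coordinates. *)
Definition glap i j := A i j * (f i j - f i.+1 j) + A i.-1 j * (f i j - f i.-1 j) +
  (B i j * (f i j - f i j.+1) + B i j.-1 * (f i j - f i j.-1)).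

Let dh2 i j : 0 <= dh i j ^+ 2. Proof. exact: sqr_ge0. Qed.
Let dv2 i j : 0 <= dv i j ^+ 2. Proof. exact: sqr_ge0. Qed.

Lemma sqen_normal p k : sqen p.+1 k +
  (\sum_(p.+1 <= j < (p.+1 + k).+1) (dh p j ^+ 2 + dh (p.+1 + k) j ^+ 2) +
   \sum_(p.+1 <= i < (p.+1 + k).+1) (dv i p ^+ 2 + dv i (p.+1 + k) ^+ 2)) <= sqen p k.+2.
Proof.
rewrite /sqen addrACA.
have ext (g : nat -> nat -> R) : (forall i j, 0 <= g i j) ->
  \sum_(p.+1 <= j < (p.+1 + k).+1) (\sum_(p.+1 <= i < p.+1 + k) g i j + (g p j + g (p.+1 + k)%N j)) <=
  \sum_(p <= j < (p + k.+2).+1) \sum_(p <= i < p + k.+2) g i j.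
  move=> g0; have s0 j : 0 <= \sum_(p <= i < p + k.+2) g i j by rewrite sumr_ge0.
  apply: (@le_trans _ _ (\sum_(p.+1 <= j < (p.+1 + k).+1) \sum_(p <= i < p + k.+2) g i j)).
    by apply: ler_sum_nat => j _; rewrite (sum_ends (fun i => g i j)) addrCA addrA.
  by apply: sum_nat_sub => //; clear; lia.
apply: lerD; rewrite -big_split /=; first exact: (ext (fun i j => dh i j ^+ 2)).
exact: (ext (fun j i => dv i j ^+ 2)).
Qed.

Lemma sqen_contour p k : sqen p.+1 k + (\sum_(p <= i < p + k.+2) (dh i p ^+ 2 + dh i (p + k.+2) ^+ 2) +
   \sum_(p <= j < p + k.+2) (dv p j ^+ 2 + dv (p + k.+2) j ^+ 2)) <= sqen p k.+2.
Proof.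
rewrite /sqen addrACA.
have ext (g : nat -> nat -> R) : (forall i j, 0 <= g i j) ->
  \sum_(p.+1 <= j < (p.+1 + k).+1) \sum_(p.+1 <= i < p.+1 + k) g i j +
  \sum_(p <= i < p + k.+2) (g i p + g i (p + k.+2)%N) <=
  \sum_(p <= j < (p + k.+2).+1) \sum_(p <= i < p + k.+2) g i j.
  move=> g0; have G2 (G : nat -> R) : \sum_(p <= j < (p + k.+2).+1) G j =
    G p + \sum_(p.+1 <= j < (p.+1 + k).+1) G j + G (p + k.+2)%N.
    rewrite -addnS sum_ends addnS; congr (_ + G _); clear; lia.
  rewrite G2 big_split /= addrCA addrA lerD2r lerD2l.
  by apply: ler_sum_nat => j _; apply: sum_nat_sub => //; clear; lia.
apply: lerD; first exact: (ext (fun i j => dh i j ^+ 2)).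
exact: (ext (fun j i => dv i j ^+ 2)).
Qed.

Lemma prod_le_half_sqr (x y k n c z : R) : x ^+ 2 <= k * n -> y ^+ 2 <= k * c -> k * (n + c) <= k * z -> x * y <= k * z.
Proof. by rewrite mulrDr; have := sqr_ge0 (x - y); have := sqr_ge0 x; have := sqr_ge0 y; lra. Qed.

(** The equation is tested with [f] minus a corner value; the boundary terms are normal fluxes times
    the oscillation of [f] on the contour. In the plane a contour is a curve, so this oscillation is
    at most the sum of the tangential differences. Both factors are then controlled by the energy of
    an annulus and the length of the contour. *)
Lemma caccioppoli alpha beta p k G : 0 < alpha -> (forall i j, alpha <= A i j <= beta) ->
  (forall i j, alpha <= B i j <= beta) -> (forall i j, `|f i j| <= G.1) -> (forall i j, (0 < i)%N -> (0 < j)%N -> `|glap i j| <= G.2) ->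
  alpha * sqen p.+1 k.+2 <= (k.+3)%:R ^+ 2 * (2 * G.1 * G.2) +
   beta * (4 * k.+3%:R) * (sqen p k.+4 - sqen p.+2 k).
Proof.
move=> al0 hA hB hf hg; set P := p.+1; set U := (P + k.+2)%N; pose m := f P P; pose F i j := f i j - m.
have G10 : 0 <= G.1 := le_trans (normr_ge0 _) (hf 0%N 0%N).
have G20 : 0 <= G.2 := le_trans (normr_ge0 _) (hg 1%N 1%N isT isT).
have be0 : 0 < beta by have /andP[h1 h2] := hA 0%N 0%N; exact: lt_le_trans al0 (le_trans h1 h2).
have A0 i j : 0 <= A i j by have /andP[h _] := hA i j; exact: le_trans (ltW al0) h.
have B0 i j : 0 <= B i j by have /andP[h _] := hB i j; exact: le_trans (ltW al0) h.
pose Sc := \sum_(P <= i < U) (`|dh i P| + `|dh i U|) + \sum_(P <= j < U) (`|dv P j| + `|dv U j|).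
pose Sn := \sum_(P <= j < U.+1) (`|dh p j| + `|dh U j|) + \sum_(P <= i < U.+1) (`|dv i p| + `|dv i U|).
have id1 j : \sum_(P <= i < U.+1) F i j * (A i j * (f i j - f i.+1 j) + A i.-1 j * (f i j - f i.-1 j)) =
   \sum_(P <= i < U) A i j * dh i j ^+ 2 + A p j * dh p j * F P j - A U j * dh U j * F U j.
  have := abel (fun i => F i j) (fun i => A i j * dh i j) p k.+2; rewrite -/P -/U => ab.
  transitivity (\sum_(P <= i < U.+1) F i j * (A i.-1 j * dh i.-1 j - A i j * dh i j)).
    apply: eq_big_nat => i /andP[Pi _]; congr (_ * _); rewrite /dh prednK; last exact: leq_trans Pi.
    by ring.
  rewrite ab; congr (_ + _ - _); apply: eq_bigr => i _; rewrite /F /dh; ring.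
have id2 i : \sum_(P <= j < U.+1) F i j * (B i j * (f i j - f i j.+1) + B i j.-1 * (f i j - f i j.-1)) =
   \sum_(P <= j < U) B i j * dv i j ^+ 2 + B i p * dv i p * F i P - B i U * dv i U * F i U.
  have := abel (fun j => F i j) (fun j => B i j * dv i j) p k.+2; rewrite -/P -/U => ab.
  transitivity (\sum_(P <= j < U.+1) F i j * (B i j.-1 * dv i j.-1 - B i j * dv i j)).
    apply: eq_big_nat => j /andP[Pj _]; congr (_ * _); rewrite /dv prednK; last exact: leq_trans Pj.
    by ring.
  rewrite ab; congr (_ + _ - _); apply: eq_bigr => j _; rewrite /F /dv; ring.
have a0 (x : R) : 0 <= `|x| := normr_ge0 x.
have s0 (g : nat -> R) x y : (forall i, 0 <= g i) -> 0 <= \sum_(x <= i < y) g i by move=> h; rewrite sumr_ge0.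
have sd1 := s0 (fun i => `|dh i P|) P U (fun=> a0 _).
have sd2 := s0 (fun i => `|dh i U|) P U (fun=> a0 _).
have sd3 := s0 (fun j => `|dv P j|) P U (fun=> a0 _).
have sd4 := s0 (fun j => `|dv U j|) P U (fun=> a0 _).
have PU : (P <= U)%N by rewrite /U leq_addr.
have bot i : (P <= i <= U)%N -> `|f i P - m| <= \sum_(P <= i < U) `|dh i P|.
  move=> /andP[Pi iU]; apply: le_trans (abs_telescope (fun i => f i P) Pi) _.
  exact: (@sum_nat_le (fun i => `|dh i P|)).
have lft j : (P <= j <= U)%N -> `|f P j - m| <= \sum_(P <= j < U) `|dv P j|.
  move=> /andP[Pj jU]; apply: le_trans (abs_telescope (fun j => f P j) Pj) _.
  exact: (@sum_nat_le (fun j => `|dv P j|)).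
have ScE : Sc = \sum_(P <= i < U) `|dh i P| + \sum_(P <= i < U) `|dh i U| +
   (\sum_(P <= j < U) `|dv P j| + \sum_(P <= j < U) `|dv U j|) by rewrite /Sc !big_split.
have FB i : (P <= i <= U)%N -> `|F i P| <= Sc by move=> /bot h; rewrite ScE /F; move: h sd1 sd2 sd3 sd4; lra.
have FL j : (P <= j <= U)%N -> `|F P j| <= Sc by move=> /lft h; rewrite ScE /F; move: h sd1 sd2 sd3 sd4; lra.
have FT i : (P <= i <= U)%N -> `|F i U| <= Sc.
  move=> /andP[Pi iU]; have h1 : `|f i U - f P U| <= \sum_(P <= i < U) `|dh i U|.
    apply: le_trans (abs_telescope (fun i => f i U) Pi) _; exact: (@sum_nat_le (fun i => `|dh i U|)).
  have h2 := lft U; rewrite PU leqnn in h2; have {}h2 := h2 isT.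
  have := ler_normD (f i U - f P U) (f P U - m); rewrite addrA subrK => h3.
  by rewrite ScE /F; move: h1 h2 h3 sd1 sd2 sd3 sd4; lra.
have FR j : (P <= j <= U)%N -> `|F U j| <= Sc.
  move=> /andP[Pj jU]; have h1 : `|f U j - f U P| <= \sum_(P <= j < U) `|dv U j|.
    apply: le_trans (abs_telescope (fun j => f U j) Pj) _; exact: (@sum_nat_le (fun j => `|dv U j|)).
  have h2 := bot U; rewrite PU leqnn in h2; have {}h2 := h2 isT.
  have := ler_normD (f U j - f U P) (f U P - m); rewrite addrA subrK => h3.
  by rewrite ScE /F; move: h1 h2 h3 sd1 sd2 sd3 sd4; lra.
have Sc0 : 0 <= Sc by rewrite ScE; move: sd1 sd2 sd3 sd4; lra.
have bnd (x y z : R) : 0 <= x <= beta -> `|z| <= Sc -> x * y * z <= beta * (`|y| * Sc) /\ - (x * y * z) <= beta * (`|y| * Sc).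
  move=> /andP[x0 xb] zS; have : `|x * y * z| <= beta * (`|y| * Sc).
    by rewrite !normrM (ger0_norm x0) -mulrA; apply: ler_pM => //; apply: ler_wpM2l.
  by rewrite ler_norml => /andP[h1 h2]; split; lra.
have be i j : 0 <= A i j <= beta by have /andP[_ ->] := hA i j; rewrite A0.
have bv i j : 0 <= B i j <= beta by have /andP[_ ->] := hB i j; rewrite B0.
have main : alpha * sqen P k.+2 <= \sum_(P <= j < U.+1) \sum_(P <= i < U.+1) F i j * glap i j + beta * (Sn * Sc).
  have -> : \sum_(P <= j < U.+1) \sum_(P <= i < U.+1) F i j * glap i j =
     \sum_(P <= j < U.+1) (\sum_(P <= i < U) A i j * dh i j ^+ 2 + A p j * dh p j * F P j - A U j * dh U j * F U j) +
     \sum_(P <= i < U.+1) (\sum_(P <= j < U) B i j * dv i j ^+ 2 + B i p * dv i p * F i P - B i U * dv i U * F i U).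
    under [X in _ = X + _]eq_bigr do rewrite -id1.
    under [X in _ = _ + X]eq_bigr do rewrite -id2.
    rewrite [X in _ = _ + X]exchange_big_nat /= -big_split /=; apply: eq_bigr => j _.
    by rewrite -big_split /=; apply: eq_bigr => i _; rewrite /glap mulrDr.
  have -> : beta * (Sn * Sc) = \sum_(P <= j < U.+1) (beta * (`|dh p j| * Sc) + beta * (`|dh U j| * Sc)) +
     \sum_(P <= i < U.+1) (beta * (`|dv i p| * Sc) + beta * (`|dv i U| * Sc)).
    rewrite /Sn mulrDl mulrDr !mulr_suml !mulr_sumr; congr (_ + _); apply: eq_bigr => i _; ring.
  rewrite addrACA /sqen mulrDr; apply: lerD; rewrite mulr_sumr -big_split /=.
    apply: ler_sum_nat => j /andP[Pj jU].
    have hj : (P <= j <= U)%N by rewrite Pj -ltnS.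
    have [b1 _] := bnd _ (dh U j) _ (be U j) (FR j hj).
    have [_ b2] := bnd _ (dh p j) _ (be p j) (FL j hj).
    have b3 : alpha * \sum_(P <= i < U) dh i j ^+ 2 <= \sum_(P <= i < U) A i j * dh i j ^+ 2.
      rewrite mulr_sumr; apply: ler_sum => i _; apply: ler_wpM2r => //.
      by case/andP: (hA i j).
    move: b1 b2 b3; lra.
  apply: ler_sum_nat => i /andP[Pi iU].
  have hi : (P <= i <= U)%N by rewrite Pi -ltnS.
  have [b1 _] := bnd _ (dv i U) _ (bv i U) (FT i hi).
  have [_ b2] := bnd _ (dv i p) _ (bv i p) (FB i hi).
  have b3 : alpha * \sum_(P <= j < U) dv i j ^+ 2 <= \sum_(P <= j < U) B i j * dv i j ^+ 2.
    rewrite mulr_sumr; apply: ler_sum => j _; apply: ler_wpM2r => //.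
    by case/andP: (hB i j).
  move: b1 b2 b3; lra.
have src : \sum_(P <= j < U.+1) \sum_(P <= i < U.+1) F i j * glap i j <= k.+3%:R ^+ 2 * (2 * G.1 * G.2).
  apply: (@le_trans _ _ (\sum_(P <= j < U.+1) \sum_(P <= i < U.+1) 2 * G.1 * G.2)).
    apply: ler_sum_nat => j /andP[j0 _]; apply: ler_sum_nat => i /andP[i0 _].
    apply: le_trans (ler_norm _) _; rewrite normrM.
    apply: ler_pM => //; last by apply: hg; [exact: leq_trans i0|exact: leq_trans j0].
    by apply: le_trans (ler_normB _ _) _; have := hf i j; have := hf P P; rewrite -/m; lra.
  rewrite !sumr_const_nat; have -> : (U.+1 - P = k.+3)%N by rewrite /U; clear; lia.
  by rewrite -mulrnA -[leLHS]mulr_natl natrM expr2.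
have prod : Sn * Sc <= (4 * k.+3%:R) * (sqen p k.+4 - sqen p.+2 k).
  have e1 := sqen_normal p k.+2; have e2 := sqen_contour P k; rewrite -/P -/U in e1 e2.
  set N2 := (\sum_(P <= j < U.+1) _ + _) in e1; set C2 := (\sum_(P <= i < U) _ + _) in e2.
  have two (x y : R) : (x + y) ^+ 2 <= 2 * (x ^+ 2 + y ^+ 2) by have := sqr_ge0 (x - y); lra.
  have q4 (g1 g2 g3 g4 : nat -> R) L : (\sum_(P <= i < P + L) (`|g1 i| + `|g2 i|) + \sum_(P <= i < P + L) (`|g3 i| + `|g4 i|)) ^+ 2 <=
     4 * L%:R * (\sum_(P <= i < P + L) (g1 i ^+ 2 + g2 i ^+ 2) + \sum_(P <= i < P + L) (g3 i ^+ 2 + g4 i ^+ 2)).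
    have hh (h1 h2 : nat -> R) : (\sum_(P <= i < P + L) (`|h1 i| + `|h2 i|)) ^+ 2 <= 2 * L%:R * \sum_(P <= i < P + L) (h1 i ^+ 2 + h2 i ^+ 2).
      apply: le_trans (sum_nat_sqr _ _ _) _; rewrite -mulrA mulrCA; apply: ler_wpM2l => //.
      rewrite mulr_sumr; apply: ler_sum => i _; apply: le_trans (two _ _) _.
      by rewrite !real_normK ?num_real.
    have := hh g1 g2; have := hh g3 g4; have := two (\sum_(P <= i < P + L) (`|g1 i| + `|g2 i|)) (\sum_(P <= i < P + L) (`|g3 i| + `|g4 i|)).
    move: (L%:R : R) => l; lra.
  have n1 : Sn ^+ 2 <= 4 * k.+3%:R * N2.
    have eU : (P + k.+3)%N = U.+1 by rewrite /U addnS.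
    have := q4 (dh p) (dh U) (fun i => dv i p) (fun i => dv i U) k.+3.
    by rewrite eU.
  have n2 : Sc ^+ 2 <= 4 * k.+3%:R * C2.
    have := q4 (fun i => dh i P) (fun i => dh i U) (dv P) (dv U) k.+2; rewrite -/U => h.
    apply: (le_trans h); apply: ler_wpM2r; first by rewrite addr_ge0 // sumr_ge0 // => i _; rewrite addr_ge0.
    by rewrite ler_pM2l // ler_nat.
  have K0 : 0 <= 4 * k.+3%:R :> R by rewrite mulr_ge0.
  have e3 := ler_wpM2l K0 (_ : N2 + C2 <= sqen p k.+4 - sqen p.+2 k).
  have {}e3 := e3 ltac:(move: e1 e2; rewrite /P; lra).
  exact: prod_le_half_sqr n1 n2 e3.
rewrite -/P; apply: (le_trans main); apply: lerD => //; rewrite -mulrA; apply: ler_wpM2l; first exact: ltW.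
exact: prod.
Qed.

End Grid.

Section HoleFilling.
Variable R : realType.

(** The inequality is summed over radii from s+1 to 2s+1: the annuli telescope, and the contour
    length is comparable with the number of radii. Adding 8 be times the inner energy to both sides
    fills the hole and gives a factor below 1. *)
Lemma hole_step (al be src : R) (en : nat -> R) s : 0 < al -> 0 < be -> 0 <= src ->
  (forall r, 0 <= en r) ->
  (forall r, (r <= (2 * s).+1)%N -> en r <= en r.+1) ->
  (forall r, (0 < r <= (2 * s).+1)%N -> al * en r <= (2 * r).+1%:R ^+ 2 * src +
     be * (2 * r).+1%:R * (en r.+1 - en r.-1)) ->
  en s <= (8 * be / (al + 8 * be)) * en (2 * s).+2 + 16 * s.+1%:R ^+ 2 * (src / al).
Proof.
move=> al0 be0 src0 en0 mono rec.
have mono2 r r' : (r <= r' <= (2 * s).+2)%N -> en r <= en r'.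
  move=> /andP[/subnK <-]; elim: (r' - r)%N => [|k IH] h; first exact: lexx.
  apply: le_trans (IH _) _; first by move: h; rewrite addSn; exact: ltnW.
  by rewrite addSn; apply: mono; move: h; rewrite addSn.
have t0 : 0 < s.+1%:R :> R by rewrite ltr0n.
have tel : \sum_(s.+1 <= r < (2 * s).+2) (en r.+1 - en r.-1) <= 2 * (en (2 * s).+2 - en s).
  have -> : \sum_(s.+1 <= r < (2 * s).+2) (en r.+1 - en r.-1) =
    \sum_(s.+1 <= r < (2 * s).+2) (en r.+1 - en r) + \sum_(s.+1 <= r < (2 * s).+2) (en r - en r.-1).
    by rewrite -big_split; apply: eq_bigr => r _ /=; ring.
  rewrite telescope_sumr; last by clear; lia.
  rewrite big_add1 /=.
  rewrite telescope_sumr; last by clear; lia.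
  have := mono2 (2 * s).+1 (2 * s).+2; have := mono2 s s.+1.
  rewrite !leqnn !leqnSn /= => h1 h2; have := h1 ltac:(clear; lia); have := h2 isT; lra.
have key : s.+1%:R * (al * en s) <= s.+1%:R * ((4 * s.+1%:R) ^+ 2 * src) + be * (4 * s.+1%:R) * (2 * (en (2 * s).+2 - en s)).
  have -> : s.+1%:R * (al * en s) = \sum_(s.+1 <= r < (2 * s).+2) al * en s.
    by rewrite sumr_const_nat -[RHS]mulr_natl; congr (_%:R * _); clear; lia.
  apply: (@le_trans _ _ (\sum_(s.+1 <= r < (2 * s).+2) ((4 * s.+1%:R) ^+ 2 * src + be * (4 * s.+1%:R) * (en r.+1 - en r.-1)))).
    apply: ler_sum_nat => r /andP[sr rs].
    apply: (@le_trans _ _ (al * en r)).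
      by rewrite ler_pM2l //; apply: mono2; clear -sr rs; lia.
    have rr : (2 * r).+1%:R <= 4 * s.+1%:R :> R by rewrite -natrM ler_nat; clear -rs; lia.
    apply: le_trans (rec r _) _; first by clear -sr rs; lia.
    apply: lerD; first by apply: ler_wpM2r => //; apply: sqr_mono.
    apply: ler_wpM2r; last by rewrite ler_pM2l.
    rewrite subr_ge0; apply: mono2; clear -sr rs; lia.
  rewrite big_split /= -mulr_sumr; apply: lerD.
    rewrite sumr_const_nat; have -> : ((2 * s).+2 - s.+1 = s.+1)%N by clear; lia.
    by rewrite -[src *+ _]mulr_natl mulrCA.
  by rewrite -mulr_sumr; apply: ler_wpM2l => //; rewrite !mulr_ge0 // ltW.
have k2 : al * en s <= (4 * s.+1%:R) ^+ 2 * src + 8 * be * (en (2 * s).+2 - en s).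
  by rewrite -(ler_pM2l t0); apply: (le_trans key); rewrite le_eqVlt; apply/orP; left; apply/eqP; ring.
have D0 : 0 < al + 8 * be by lra.
have e1 : (al + 8 * be) * en s <= 8 * be * en (2 * s).+2 + (4 * s.+1%:R) ^+ 2 * src by lra.
rewrite -(ler_pM2l D0); apply: (le_trans e1).
have -> : (al + 8 * be) * (8 * be / (al + 8 * be) * en (2 * s).+2 + 16 * s.+1%:R ^+ 2 * (src / al)) =
  8 * be * en (2 * s).+2 + (4 * s.+1%:R) ^+ 2 * src * ((al + 8 * be) / al).
  by field; rewrite !gt_eqF.
rewrite lerD2l ler_peMr //; first by rewrite mulr_ge0 // sqr_ge0.
by rewrite ler_pdivlMr //; lra.
Qed.

(** The radii 3 * 2^j - 2 are the orbit of 1 under s -> 2s + 2. *)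
Lemma hole_iter (th K : R) (en : nat -> R) J : 0 <= th <= 1 -> 0 <= K ->
  (forall s, ((2 * s).+2 <= 3 * 2 ^ J - 2)%N -> en s <= th * en (2 * s).+2 + s.+1%:R ^+ 2 * K) ->
  en 1%N <= th ^+ J * en (3 * 2 ^ J - 2)%N + J%:R * ((3 * 2 ^ J)%:R ^+ 2 * K).
Proof.
move=> /andP[th0 th1] K0 h; suff H j : (j <= J)%N ->
  en 1%N <= th ^+ j * en (3 * 2 ^ j - 2)%N + j%:R * ((3 * 2 ^ J)%:R ^+ 2 * K) by exact: H.
elim: j => [_|j IH jJ]; first by rewrite expn0 muln1 expr0 mul1r mul0r addr0.
apply: (le_trans (IH (ltnW jJ))).
have lt2 : (2 ^ j.+1 <= 2 ^ J)%N by rewrite leq_exp2l.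
have p2 : (0 < 2 ^ j)%N by rewrite expn_gt0.
rewrite expnS in lt2; have hs := h (3 * 2 ^ j - 2)%N _.
have {}hs := hs ltac:(clear -lt2 p2; lia).
have e1 : ((2 * (3 * 2 ^ j - 2)).+2 = 3 * 2 ^ j.+1 - 2)%N by rewrite expnS; clear -p2; lia.
rewrite e1 in hs.
have B : ((3 * 2 ^ j - 2).+1%:R ^+ 2 * K) <= (3 * 2 ^ J)%:R ^+ 2 * K :> R.
  by apply: ler_wpM2r => //; apply: sqr_mono => //; rewrite ler_nat; clear -lt2 p2; lia.
have tj0 : 0 <= th ^+ j by rewrite exprn_ge0.
have tj1 : th ^+ j <= 1 by rewrite exprn_ile1.
have B0 : 0 <= (3 * 2 ^ J)%:R ^+ 2 * K :> R by rewrite mulr_ge0 // sqr_ge0.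
have := ler_wpM2l tj0 (le_trans hs (lerD (lexx _) B)).
rewrite mulrDr [th ^+ j * (th * _)]mulrA -exprSr => hh.
have := ler_wpM2r B0 tj1; rewrite mul1r => h2.
rewrite -[j.+1%:R]natr1 mulrDl mul1r; lra.
Qed.

End HoleFilling.

(** * Pointwise gradient decay of the heat kernel in the plane *)

Section KernelBound.
Variables (R : realType) (alpha beta : R).
Hypotheses (alpha_gt0 : 0 < alpha) (le_ab : alpha <= beta).
Let d2 : (0 < 2)%N. Proof. by []. Qed.
Local Notation c := (cst 2 beta).
Let c0 : 0 < c := cst_gt0 d2 alpha_gt0 le_ab.

Lemma form_CS (V : finZmodType) (e : 'I_2 -> V) a f g : elliptic alpha beta a ->
  dot f (lap e a g) ^+ 2 <= dot f (lap e a f) * dot g (lap e a g).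
Proof.
move=> ha; have a0 E : 0 <= a E by have /andP[h _] := ha E; exact: le_trans (ltW alpha_gt0) h.
rewrite !dot_lap; have := @CS_sum R _ xpredT (fun E => Num.sqrt (a E) * dg e E f) (fun E => Num.sqrt (a E) * dg e E g).
under eq_bigr => E _ do rewrite mulrACA -expr2 sqr_sqrtr // mulrA.
under [X in _ <= X * _ -> _]eq_bigr => E _ do rewrite exprMn sqr_sqrtr // expr2 mulrA.
by under [X in _ <= _ * X -> _]eq_bigr => E _ do rewrite exprMn sqr_sqrtr // expr2 mulrA.
Qed.

(** The time is split in halves, with Cauchy-Schwarz for the scalar product in one case and for the
    energy form in the other. At a fixed time the kernel thus solves an elliptic equation with a
    source of size n^-2, to which hole filling applies. *)
Lemma kernel_bound : exists2 C : R, 0 < C &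
  forall (V : finZmodType) (e : 'I_2 -> V) N a, torus e N -> elliptic alpha beta a ->
  forall n y x, (n <= N)%N -> `|Tn e beta a n (delta y) x| <= C * pw n (- 1) /\
    `|lap e a (Tn e beta a n (delta y)) x| <= C * pw n (- 2).
Proof.
have [C C0 H] := heat_kernel d2 alpha_gt0 le_ab.
have [Cg Cg0 Hg] := grad_decay d2 alpha_gt0 le_ab.
have b0 : 0 < beta := beta_gt0 alpha_gt0 le_ab.
exists (4 * C + 4 * (beta * Cg)); first by rewrite addr_gt0 // !mulr_gt0.
move=> V e N a tor ha n y x nN; pose m := n./2.
have mn : (m <= n)%N := half_le n; have mN := leq_trans mn nN.
have nmN : (n - m <= N)%N := leq_trans (leq_subr _ _) nN.
have s1 : pw m (- 1) <= 2 * pw n (- 1) :> R.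
  by rewrite -{1}(powRr1 (ler0n R 2)); apply: scale_le2 => //; exact: half_scale.
have s1' : pw (n - m) (- 1) <= 2 * pw n (- 1) :> R.
  by rewrite -{1}(powRr1 (ler0n R 2)); apply: scale_le2 => //; rewrite /m; clear; lia.
have e1 : - (2%:R / 2) = - 1 :> R by field.
have e2 : - (2%:R / 2 + 1) = - 2 :> R by field.
have pe z : dot (Tn e beta a m (delta z)) (Tn e beta a m (delta z)) <= C * (2 * pw n (- 1)).
  by apply: le_trans (H V e N a tor ha m z mN) _; rewrite e1 ler_pM2l.
have pe' z : dot (Tn e beta a (n - m) (delta z)) (Tn e beta a (n - m) (delta z)) <= C * (2 * pw n (- 1)).
  by apply: le_trans (H V e N a tor ha (n - m)%N z nmN) _; rewrite e1 ler_pM2l.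
have sq_abs (X Y A B : R) : 0 <= Y -> X ^+ 2 <= A * B -> 0 <= A -> 0 <= B -> A <= Y -> B <= Y -> `|X| <= Y.
  move=> Y0 h A0 B0 AY BY; rewrite -(@ler_pXn2r _ 2) ?nnegrE // real_normK ?num_real //.
  by apply: (le_trans h); rewrite expr2; apply: ler_pM.
have bC : 0 < beta * Cg by rewrite mulr_gt0.
have p1 := pw_ge0 n (- 1) : 0 <= _ :> R; have p2 := pw_ge0 n (- 2) : 0 <= _ :> R.
have dec : Tn e beta a n (delta y) = Tn e beta a m (Tn e beta a (n - m) (delta y)) by rewrite -TnD subnKC.
split.
  apply: (@le_trans _ _ (C * (2 * pw n (- 1)))); last first.
    by rewrite mulrDl; have := mulr_ge0 (ltW bC) p1; have := mulr_ge0 (ltW C0) p1; lra.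
  have -> : Tn e beta a n (delta y) x = dot (Tn e beta a m (delta x)) (Tn e beta a (n - m) (delta y)).
    by rewrite -dot_Tn dot_delta dec.
  apply: sq_abs (dot_CS _ _) _ _ _ _; rewrite ?sq_ge0 //.
  by rewrite mulr_ge0 ?mulr_ge0 // ltW.
have tw2 : 2 `^ 2 = 4 :> R by rewrite powR_mulrn // -natrX.
have g1 z k : (k <= N)%N -> (n < 2 * k.+1)%N ->
   dot (Tn e beta a k (delta z)) (lap e a (Tn e beta a k (delta z))) <= 4 * (beta * Cg) * pw n (- 2).
  move=> kN nk; rewrite dot_lap; apply: (@le_trans _ _ (beta * gradsq e (Tn e beta a k (delta z)))).
    rewrite /gradsq mulr_sumr; apply: ler_sum => E _; rewrite -mulrA -expr2; apply: ler_wpM2r; first exact: sqr_ge0.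
    by case/andP: (ha E).
  have := Hg V e N a tor ha k z kN; rewrite e2 => h.
  have sc : pw k (- 2) <= 4 * pw n (- 2) :> R by rewrite -tw2; apply: scale_le2.
  have := ler_wpM2l (ltW b0) (le_trans h (ler_wpM2l (ltW Cg0) sc)); lra.
have comm : lap e a (Tn e beta a n (delta y)) x = dot (Tn e beta a m (delta x)) (lap e a (Tn e beta a (n - m) (delta y))).
  rewrite -[LHS]dot_delta dec.

  have lT f : lap e a (Tw e beta a f) = Tw e beta a (lap e a f).
    apply/funext => z; rewrite /Tw [in LHS](lapB e a f) /Sw; congr (_ - _).
    by rewrite lapZ.
  have lTn k f : lap e a (Tn e beta a k f) = Tn e beta a k (lap e a f).
    by elim: k => //= k IH; rewrite lT IH.
  by rewrite lTn dot_Tn.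
rewrite comm; apply: (@le_trans _ _ (4 * (beta * Cg) * pw n (- 2))).
  apply: sq_abs (form_CS _ _ _ ha) _ _ _ _.
  - by rewrite mulr_ge0 // mulr_ge0 // ltW.
  - rewrite dot_lap sumr_ge0 // => E _; rewrite -mulrA -expr2 mulr_ge0 ?sqr_ge0 //.
    by have /andP[h _] := ha E; exact: le_trans (ltW alpha_gt0) h.
  - rewrite dot_lap sumr_ge0 // => E _; rewrite -mulrA -expr2 mulr_ge0 ?sqr_ge0 //.
    by have /andP[h _] := ha E; exact: le_trans (ltW alpha_gt0) h.
  - by apply: g1 => //; exact: half_scale.
  - by apply: g1 => //; rewrite /m; clear; lia.
by rewrite mulrDl; have := mulr_ge0 (ltW C0) p2; lra.
Qed.

End KernelBound.

Section GradPoint.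
Variables (R : realType) (alpha beta : R).
Hypotheses (alpha_gt0 : 0 < alpha) (le_ab : alpha <= beta).
Let d2 : (0 < 2)%N. Proof. by []. Qed.
Let b0 : 0 < beta := beta_gt0 alpha_gt0 le_ab.

Section Square.
Variables (V : finZmodType) (e : 'I_2 -> V) (a : V * 'I_2 -> R) (w : V -> R) (z : V).
Let i1 : 'I_2 := lift ord0 ord0.
Definition gpt i j : V := z + (e ord0 *+ i + e i1 *+ j).
Let gf i j := w (gpt i j).
Let gA i j := a (gpt i j, ord0).
Let gB i j := a (gpt i j, i1).

Lemma gptH i j : gpt i.+1 j = gpt i j + e ord0.
Proof. by rewrite /gpt mulrSr -!addrA; congr (_ + (_ + _)); rewrite addrC. Qed.
Lemma gptV i j : gpt i j.+1 = gpt i j + e i1.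
Proof. by rewrite /gpt mulrSr !addrA. Qed.

Lemma glapE i j : glap gf gA gB i.+1 j.+1 = lap e a w (gpt i.+1 j.+1).
Proof.
rewrite /glap /lap big_ord_recl big_ord_recl big_ord0 addr0 /gf /gA /gB /=.
rewrite -[lift ord0 ord0]/i1 -gptH -gptV.
have -> : gpt i.+1 j.+1 - e ord0 = gpt i j.+1 by rewrite gptH addrK.
by have -> : gpt i.+1 j.+1 - e i1 = gpt i.+1 j by rewrite gptV addrK.
Qed.

Lemma dh_dg i j : dh gf i j = dg e (gpt i j, ord0) w.
Proof. by rewrite /dh /dg /gf gptH. Qed.
Lemma dv_dg i j : dv gf i j = dg e (gpt i j, i1) w.
Proof. by rewrite /dv /dg /gf gptV. Qed.

Lemma sqen_gradsq N m : torus e N -> (m < N)%N -> sqen gf 0 m <= gradsq e w.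
Proof.
move=> tor mN; have inj : injective (fun p : 'I_m.+1 * 'I_m.+1 => gpt p.1 p.2).
  move=> [i j] [k l] /= /addrI h.
  pose F (p q : nat) (t : 'I_2) := if t == ord0 then p else q.
  have latF p q : lat e (F p q) = e ord0 *+ p + e i1 *+ q.
    by rewrite /lat big_ord_recl big_ord_recl big_ord0 addr0.
  have Fl (p q : 'I_m.+1) t : (F p q t < N)%N.
    by rewrite /F; case: ifP => _; exact: leq_trans (ltn_ord _) mN.
  have := tor (F i j) (F k l) (Fl i j) (Fl k l); rewrite !latF => /(_ h) E.
  by have := E ord0; have := E i1; rewrite /F /= => /val_inj -> /val_inj ->.
have bnd (g : V -> R) : (forall x, 0 <= g x) -> \sum_(j < m.+1) \sum_(i < m) g (gpt i j) <= \sum_x g x.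
  move=> g0; apply: le_trans (sum_inj_le inj g0).
  rewrite -(pair_bigA _ (fun i j : 'I_m.+1 => g (gpt i j))) /= [leRHS]exchange_big /=.
  by apply: ler_sum => j _; rewrite [leRHS]big_ord_recr /= lerDl.
have bnd2 (g : V -> R) : (forall x, 0 <= g x) -> \sum_(i < m.+1) \sum_(j < m) g (gpt i j) <= \sum_x g x.
  move=> g0; apply: le_trans (sum_inj_le inj g0).
  rewrite -(pair_bigA _ (fun i j : 'I_m.+1 => g (gpt i j))) /=.
  by apply: ler_sum => j _; rewrite [leRHS]big_ord_recr /= lerDl.
rewrite /gradsq sum_edges exchange_big /= big_ord_recl big_ord_recl big_ord0 addr0 -/i1 /sqen add0n.
apply: lerD; rewrite big_mkord.
  apply: le_trans (bnd (fun x => dg e (x, ord0) w ^+ 2) _) => [|x]; last exact: sqr_ge0.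
  by apply: ler_sum => j _; rewrite big_mkord; apply: ler_sum => i _; rewrite dh_dg.
apply: le_trans (bnd2 (fun x => dg e (x, i1) w ^+ 2) _) => [|x]; last exact: sqr_ge0.
by apply: ler_sum => j _; rewrite big_mkord; apply: ler_sum => i _; rewrite dv_dg.
Qed.

(** Energy of the square of half-side [r] about the point ([rho], [rho]); the offset keeps
    coordinates in the natural numbers. *)
Definition gen rho r := sqen gf (rho - r) (2 * r).

Lemma sqen_ge0 (f : nat -> nat -> R) p k : 0 <= sqen f p k.
Proof. by rewrite addr_ge0 // sumr_ge0 // => i _; rewrite sumr_ge0 // => j _; rewrite sqr_ge0. Qed.

Lemma gen_edge rho i : (0 < rho)%N -> dg e (gpt rho rho, i) w ^+ 2 <= gen rho 1.
Proof.
case: rho => // r _; rewrite /gen subn1 muln1 /= /sqen.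
have s0 (F : nat -> R) p q k : (forall i, 0 <= F i) -> (p <= k < q)%N -> F k <= \sum_(p <= i < q) F i.
  move=> F0 /andP[pk kq]; rewrite (@big_cat_nat _ _ _ k) //=; last exact: ltnW.
  by rewrite [X in _ + X]big_ltn // addrCA lerDl addr_ge0 // sumr_ge0.
have r1 : (r <= r.+1 < r + 2)%N by rewrite leqnSn addn2 /=.
have r2 : (r <= r.+1 < (r + 2).+1)%N by rewrite leqnSn addn2 /=.
have sq0 (F : nat -> nat -> R) : (forall i j, 0 <= F i j) -> F r.+1 r.+1 <= \sum_(r <= j < (r + 2).+1) \sum_(r <= i < r + 2) F i j.
  move=> F0; apply: le_trans (s0 (fun j => \sum_(r <= i < r + 2) F i j) _ _ _ _ r2) => [|j].
    exact: (s0 (fun i => F i r.+1)).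
  by rewrite sumr_ge0.
have [->|->] : i = ord0 \/ i = i1.
  by case: i => [[|[|]]] // h; [left|right]; exact: val_inj.
- rewrite -dh_dg; apply: le_trans (sq0 (fun i j => dh gf i j ^+ 2) _) _ => [*|]; first exact: sqr_ge0.
  by rewrite lerDl sumr_ge0 // => k _; rewrite sumr_ge0 // => l _; rewrite sqr_ge0.
- rewrite -dv_dg; apply: le_trans (sq0 (fun i j => dv gf j i ^+ 2) _) _ => [*|]; first exact: sqr_ge0.
  by rewrite lerDr sumr_ge0 // => k _; rewrite sumr_ge0 // => l _; rewrite sqr_ge0.
Qed.

Lemma gen_mono rho r : (r < rho)%N -> gen rho r <= gen rho r.+1.
Proof.
move=> rr; rewrite /gen; have -> : (rho - r = (rho - r.+1).+1)%N by clear -rr; lia.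
have -> : (2 * r.+1 = (2 * r).+2)%N by clear; lia.
apply: le_trans (sqen_normal gf _ _); rewrite lerDl.
by rewrite addr_ge0 // sumr_ge0 // => i _; rewrite addr_ge0 // sqr_ge0.
Qed.

Lemma gen_rec G1 G2 rho r : elliptic alpha beta a -> (forall x, `|w x| <= G1) -> (forall x, `|lap e a w x| <= G2) ->
  (0 < r < rho)%N -> alpha * gen rho r <= (2 * r).+1%:R ^+ 2 * (2 * G1 * G2) +
   4 * beta * (2 * r).+1%:R * (gen rho r.+1 - gen rho r.-1).
Proof.
move=> ha hw hl; case: r => // r /= rr; rewrite /gen.
have [e1 e2] : (rho - r.+1 = (rho - r.+2).+1)%N /\ (rho - r = (rho - r.+2).+2)%N by clear -rr; split; lia.
have [e3 e4] : (2 * r.+1 = (2 * r).+2)%N /\ (2 * r.+2 = (2 * r).+4)%N by clear; split; lia.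
rewrite e1 e2 e3 e4.
have := @caccioppoli R gf gA gB alpha beta (rho - r.+2) (2 * r) (G1, G2) alpha_gt0
  (fun i j => ha _) (fun i j => ha _) (fun i j => hw _).
rewrite [beta * (4 * _)]mulrCA [4 * (beta * _)]mulrA; apply.
by case=> // i [|j] // _ _; rewrite glapE.
Qed.

End Square.

Let th := 8 * (4 * beta) / (alpha + 8 * (4 * beta)).
Let th_bnd : 0 < th < 1.
Proof.
have bb := b0; have D0 : 0 < alpha + 8 * (4 * beta) by rewrite addr_gt0 // !mulr_gt0.
by rewrite /th divr_gt0 ?ltr_pdivrMr ?mulr_gt0 // mul1r ltrDr.
Qed.

Lemma gen_iter (V : finZmodType) (e : 'I_2 -> V) a N w G1 G2 E J : torus e N -> elliptic alpha beta a ->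
  (forall x, `|w x| <= G1) -> (forall x, `|lap e a w x| <= G2) -> (6 * 2 ^ J <= N)%N ->
  dg e E w ^+ 2 <= th ^+ J * gradsq e w + J%:R * ((3 * 2 ^ J)%:R ^+ 2 * (16 * (2 * G1 * G2 / alpha))).
Proof.
move=> tor ha hw hl JN; set rho := (3 * 2 ^ J - 2)%N.
have p2 : (0 < 2 ^ J)%N by rewrite expn_gt0.
have rho0 : (0 < rho)%N by rewrite /rho; clear -p2; lia.
have G10 : 0 <= G1 := le_trans (normr_ge0 _) (hw 0).
have G20 : 0 <= G2 := le_trans (normr_ge0 _) (hl 0).
pose z := E.1 - (e ord0 *+ rho + e (lift ord0 ord0) *+ rho).
have cz : gpt e z rho rho = E.1 by rewrite /gpt subrK.
have h0 : dg e E w ^+ 2 <= gen e w z rho 1.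
  by have := gen_edge e w z E.2 rho0; rewrite cz -surjective_pairing.
have src0 : 0 <= 2 * G1 * G2 by rewrite !mulr_ge0.
have K0 : 0 <= 16 * (2 * G1 * G2 / alpha) by rewrite mulr_ge0 // divr_ge0 // ltW.
have th01 : 0 <= th <= 1 by case/andP: th_bnd => /ltW -> /ltW ->.
have step s : ((2 * s).+2 <= rho)%N -> gen e w z rho s <= th * gen e w z rho (2 * s).+2 + s.+1%:R ^+ 2 * (16 * (2 * G1 * G2 / alpha)).
  move=> srho; rewrite [s.+1%:R ^+ 2 * _]mulrCA [16 * _]mulrA.
  apply: hole_step => //; first by rewrite mulr_gt0.
  - by move=> r; exact: sqen_ge0.
  - by move=> r rs; apply: gen_mono; exact: leq_trans srho.
  - by move=> r /andP[r0 rs]; apply: (gen_rec z ha hw hl); rewrite r0 (leq_trans _ srho).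
apply: (le_trans h0); apply: le_trans (hole_iter th01 K0 step) _.
rewrite lerD2r; apply: ler_wpM2l; first by rewrite exprn_ge0 //; case/andP: th01.
rewrite -/rho /gen subnn; apply: (sqen_gradsq _ _ tor); rewrite /rho; clear -JN p2; lia.
Qed.

(** Hole filling from scale 1 up to a small power of n improves on the bound of a single edge by the
    whole energy, by a factor n^-del. *)
Lemma grad_point : exists2 del : R, 0 < del & exists2 C : R, 0 < C &
  forall (V : finZmodType) (e : 'I_2 -> V) N a, torus e N -> elliptic alpha beta a ->
  forall n y E, (n <= N)%N -> dg e E (Tn e beta a n (delta y)) ^+ 2 <= C * pw n (- (2 + del)).
Proof.
have /andP[th0 th1] := th_bnd.
(* [del] converts the factor [th] gained per doubling into a power of 64, for about log_64 n
   doublings; 1/3 is the most that the source term permits. *)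
have [del /andP[del0 del3] hdel] : exists2 del : R, 0 < del <= 3^-1 & th <= 64 `^ (- del).
  have l64 : 0 < ln 64 :> R by rewrite ln_gt0 // ltr1n.
  have lth : ln th < 0 by rewrite ln_lt0 // th0.
  exists (Num.min 3^-1 (- ln th / ln 64)).
    by rewrite ge_min lexx lt_min invr_gt0 ltr0n divr_gt0 // oppr_gt0.
  apply: (@le_trans _ _ (64 `^ (ln th / ln 64))); last first.
    by apply: ler_powR; rewrite ?ler1n // lerNr ge_min -mulNr lexx orbT.
  by rewrite /powR pnatr_eq0 /= divfK ?gt_eqF // lnK.
have [Ck Ck0 Hk] := kernel_bound alpha_gt0 le_ab.
have [Cg Cg0 Hg] := grad_decay d2 alpha_gt0 le_ab.
pose K := 9 * (16 * (2 * Ck * Ck / alpha)).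
have K0 : 0 < K by rewrite !mulr_gt0 ?invr_gt0.
exists del => //; exists (64 * Cg + K); first by rewrite addr_gt0 // mulr_gt0.
move=> V e N a tor ha n y E nN; set w := Tn e beta a n (delta y).
have e2 : - (2%:R / 2 + 1) = - 2 :> R by field.
have gw : gradsq e w <= Cg * pw n (- 2) by have := Hg V e N a tor ha n y nN; rewrite e2.
have p0 := pw_ge0 n (- (2 + del)) : 0 <= _ :> R.
have ew : dg e E w ^+ 2 <= gradsq e w.
  by rewrite /gradsq (bigD1 E) //= lerDl sumr_ge0 // => F _; rewrite sqr_ge0.
have split2 : pw n (- 2) = pw n del * pw n (- (2 + del)) :> R by rewrite -pwD; congr pw; ring.
have [n64|n64] := ltnP n.+1 64.
  apply: (le_trans ew); apply: (le_trans gw); rewrite split2 mulrA.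
  apply: ler_wpM2r => //; rewrite mulrC; apply: (@le_trans _ _ (64 * Cg)); last by rewrite lerDl ltW.
  rewrite ler_pM2r //; apply: (@le_trans _ _ (pw n 1)); first by apply: pw_ler; lra.
  by rewrite pw1 ler_nat ltnW.
(* The largest square has side of order n^(1/6). It fits in the torus, and the source term, of order
   J 4^J n^-3 <= 16^J n^-3, stays below n^(2/3 - 3). *)
pose J := trunc_log 64 n.+1.
have /andP[J1 J2] : (64 ^ J <= n.+1 < 64 ^ J.+1)%N by rewrite trunc_logP // trunc_log_ltn.
have J0 : (0 < J)%N by rewrite lt0n; apply/eqP => J0; move: J2 n64; rewrite J0 expn1; clear; lia.
have JN : (6 * 2 ^ J <= N)%N.
  have p2 : (0 < 2 ^ J)%N by rewrite expn_gt0.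
  have h32 : (32 * 2 ^ J <= 64 ^ J)%N.
    by rewrite -[64%N]/(32 * 2)%N expnMn leq_mul2r -{1}(expn1 32) leq_exp2l // J0 orbT.
  by move: h32 J1 nN p2; clear; lia.
have hw x : `|w x| <= Ck * pw n (- 1) by case: (Hk V e N a tor ha n y x nN).
have hl x : `|lap e a w x| <= Ck * pw n (- 2) by case: (Hk V e N a tor ha n y x nN).
apply: le_trans (gen_iter E tor ha hw hl JN) _; rewrite [leRHS]mulrDl; apply: lerD.
  have tJ : th ^+ J <= 64 * pw n (- del).
    apply: (@le_trans _ _ ((64 `^ (- del)) ^+ J)); first by rewrite lerXn2r ?nnegrE ?powR_ge0 // ltW.
    have -> : (64 `^ (- del)) ^+ J = 64 `^ del * (64 ^ J.+1)%:R `^ (- del) :> R.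
      rewrite natrX -!powR_mulrn ?powR_ge0 // -!powRrM -powRD ?pnatr_eq0 ?implybT //; congr powR.
      by rewrite -natr1; ring.
    apply: ler_pM; rewrite ?powR_ge0 //.
      rewrite -[leRHS](@powRr1 _ 64) //; apply: ler_powR; [by rewrite ler1n|lra].
    rewrite /pw !powRN lef_pV2 ?posrE ?powR_gt0 ?ltr0n ?expn_gt0 //.
    by apply: ge0_ler_powR; rewrite ?nnegrE ?ler0n ?(ltW del0) // ler_nat ltnW.
  have g0 : 0 <= gradsq e w by rewrite sumr_ge0 // => F _; rewrite sqr_ge0.
  apply: le_trans (ler_pM _ g0 tJ gw) _; first by rewrite exprn_ge0 // ltW.
  have -> : - (2 + del) = - del - 2 :> R by ring.
  by rewrite pwD le_eqVlt; apply/orP; left; apply/eqP; ring.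
have J16 : J%:R * (3 * 2 ^ J)%:R ^+ 2 <= 9 * pw n (2 / 3) :> R.
  apply: (@le_trans _ _ (9 * (16 ^ J)%:R)).
    have JJ : (J <= 2 ^ J)%N by rewrite ltnW // ltn_expl.
    have -> : (16 ^ J = (2 ^ J) ^ 4)%N by rewrite -[16%N]/(2 ^ 4)%N -!expnM mulnC.
    rewrite -natrX -!natrM ler_nat; move: (2 ^ J)%N JJ => q Jq.
    rewrite expnMn mulnCA leq_mul2l /= [X in (_ <= X)%N](expnD q 2 2) leq_mul2r; apply/orP; right.
    by apply: (leq_trans Jq); case: (q) => // k; rewrite -mulnn leq_pmulr.
  rewrite ler_pM2l // -(@ler_pXn2r _ 3) ?nnegrE ?pw_ge0 // pw_root //.
  rewrite -natrX -expnM mulnC expnM; have -> : (16 ^ 3 = 64 ^ 2)%N by [].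
  by rewrite -expnM mulnC expnM natrX /pw powR_mulrn // lerXn2r ?nnegrE ?ler0n // ler_nat.
rewrite mulrA; apply: (@le_trans _ _ (9 * pw n (2 / 3) * (16 * (2 * (Ck * pw n (- 1)) * (Ck * pw n (- 2)) / alpha)))).
  apply: ler_wpM2r => //; rewrite mulr_ge0 // divr_ge0 ?(ltW alpha_gt0) //.
  by rewrite mulr_ge0 ?mulr_ge0 ?pw_ge0 // ltW.
have -> : 9 * pw n (2 / 3) * (16 * (2 * (Ck * pw n (- 1)) * (Ck * pw n (- 2)) / alpha)) =
  K * (pw n (2 / 3) * pw n (- 1) * pw n (- 2)) by rewrite /K; ring.
by rewrite -!pwD ler_pM2l //; apply: pw_ler; lra.
Qed.

(** A squared norm is at most the supremum times the [l^1] norm: the first is given by [grad_point],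
    the second stays below 2. *)
Lemma dipole_bound2 : exists2 del : R, 0 < del & exists C, @dipole_bound R 2 alpha beta C del.
Proof.
have [del del0 [C C0 H]] := grad_point; exists (del / 2); first by rewrite divr_gt0.
have sC : 0 < Num.sqrt C by rewrite sqrtr_gt0.
exists (2 * Num.sqrt C); split; first by rewrite mulr_gt0.
move=> V e N a tor ha n E nN; set h := Tn e beta a n (dlt e E).
have hE x : h x = dg e E (Tn e beta a n (delta x)) by rewrite -[LHS]dot_delta dot_Tn dotC dot_dlt.
have sC0 := ltW sC; have C0' := ltW C0; have hb x : `|h x| <= Num.sqrt C * pw n (- (1 + del / 2)).
  rewrite -(@ler_pXn2r _ 2) ?nnegrE ?normr_ge0 ?mulr_ge0 ?pw_ge0 // real_normK ?num_real //.
  rewrite exprMn sqr_sqrtr // pw_exp hE; apply: le_trans (H V e N a tor ha n x E nN) _.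
  by rewrite le_eqVlt; apply/orP; left; apply/eqP; congr (_ * pw _ _); field.
apply: (@le_trans _ _ (\sum_x Num.sqrt C * pw n (- (1 + del / 2)) * `|h x|)).
  apply: ler_sum => x _; rewrite -expr2 -real_normK ?num_real // expr2; apply: ler_wpM2r => //.
rewrite -mulr_sumr mulrC -[2 * _ * _]mulrA; apply: ler_wpM2r; first by rewrite mulr_ge0 ?pw_ge0 // ltW.
apply: le_trans (Tn_l1 e d2 alpha_gt0 le_ab ha _ _) _.
apply: (@le_trans _ _ (\sum_x (delta (E.1 + e E.2) x + delta E.1 x))).
  by apply: ler_sum => x _; rewrite /dlt; apply: le_trans (ler_normB _ _) _; rewrite !ger0_norm // /delta ler0n.
by rewrite big_split /= !sum_delta.
Qed.

End GradPoint.

(** * Weighted estimates and total variation *)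

Section Davies.
Variables (R : realType) (V : finZmodType) (d : nat) (e : 'I_d -> V) (alpha beta : R).
Hypotheses (d_gt0 : (0 < d)%N) (alpha_gt0 : 0 < alpha) (le_ab : alpha <= beta).
Local Notation c := (cst d beta).
Let c0 : 0 < c := cst_gt0 d_gt0 alpha_gt0 le_ab.
Variable a : V * 'I_d -> R.
Hypothesis ha : elliptic alpha beta a.

(* The cross term of the carre du champ is absorbed by the dissipation, up to the logarithmic gradient of the weight. *)
Lemma weight_edge (k px py fx fy : R) : 0 < px -> 0 < py -> (py - px) ^+ 2 <= k * (px * py) ->
  - ((px + py) / 2) * (fy - fx) ^+ 2 - (py - px) * (fx + fy) * (fy - fx) <= k * (px * fx ^+ 2 + py * fy ^+ 2).
Proof.
move=> px0 py0 h; set P := px + py; have P0 : 0 < P by rewrite addr_gt0.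
set q := py - px in h *; set s := fx + fy; set D := fy - fx; set B := px * fx ^+ 2 + py * fy ^+ 2.
have k0 : 0 <= k.
  by have := le_trans (sqr_ge0 q) h; rewrite pmulr_lge0 // mulr_gt0.
have h1 : q ^+ 2 * s ^+ 2 <= k * (px * py) * (2 * (fx ^+ 2 + fy ^+ 2)).
  apply: ler_pM; rewrite ?sqr_ge0 //; have := sqr_ge0 (fx - fy); rewrite /s; lra.
have h2 : k * (px * py) * (2 * (fx ^+ 2 + fy ^+ 2)) <= 2 * P * (k * B).
  have -> : 2 * P * (k * B) = k * (2 * (P * B)) by ring.
  rewrite -mulrA; apply: ler_wpM2l => //.
  have -> : 2 * (P * B) = px * py * (2 * (fx ^+ 2 + fy ^+ 2)) + 2 * ((px * fx) ^+ 2 + (py * fy) ^+ 2).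
    by rewrite /P /B; ring.
  by rewrite lerDl mulr_ge0 // addr_ge0 // sqr_ge0.
have P2 : 0 < 2 * P by rewrite mulr_gt0.
rewrite -(ler_pM2l P2) -subr_ge0.
have h3 := sqr_ge0 (q * s + P * D).
have -> : 2 * P * (k * B) - 2 * P * (- (P / 2) * D ^+ 2 - q * s * D) =
  2 * P * (k * B) - q ^+ 2 * s ^+ 2 + (q * s + P * D) ^+ 2 by field.
by rewrite addr_ge0 // subr_ge0 (le_trans h1).
Qed.

Lemma sum_ends_edges (F : V -> R) : \sum_E (F E.1 + F (E.1 + e E.2)) = 2 * d%:R * \sum_x F x.
Proof.
rewrite (sum_edges (fun E => F E.1 + F (E.1 + e E.2))) exchange_big /=.
under eq_bigr => i _ do rewrite big_split /= (sum_shift F (e i)).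
by rewrite sumr_const card_ord -[LHS]mulr_natl; ring.
Qed.

(** Davies' method for a lazy walk: by [S_weighted], the square of [Sw] uses up half of the
    dissipation, and [weight_edge] gets by with the other half. *)
Lemma davies_step (k : R) (w f : V -> R) : 0 <= k -> (forall x, 0 < w x) ->
  (forall E, (w (E.1 + e E.2) - w E.1) ^+ 2 <= k * (w E.1 * w (E.1 + e E.2))) ->
  \sum_x w x * Tw e beta a f x ^+ 2 <= (1 + k / 2) * \sum_x w x * f x ^+ 2.
Proof.
move=> k0 w0 hw.
have a0 E : 0 <= a E by have /andP[h _] := ha E; exact: le_trans (ltW alpha_gt0) h.
have ab E : a E <= beta by case/andP: (ha E).
have b0 : 0 < beta := beta_gt0 alpha_gt0 le_ab.
have SW := S_weighted e d_gt0 alpha_gt0 le_ab ha f (fun x => ltW (w0 x)).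
pose X E := a E * (w E.1 + w (E.1 + e E.2)) * dg e E f ^+ 2.
pose Y E := a E * (w (E.1 + e E.2) - w E.1) * (f E.1 + f (E.1 + e E.2)) * dg e E f.
have exp : \sum_x w x * Tw e beta a f x ^+ 2 = \sum_x w x * f x ^+ 2 - 2 * dot (fun x => w x * f x) (Sw e beta a f) + \sum_x w x * Sw e beta a f x ^+ 2.
  by rewrite /dot mulr_sumr -sumrB -big_split /=; apply: eq_bigr => x _; rewrite /Tw; ring.
have crs : 2 * dot (fun x => w x * f x) (Sw e beta a f) = c^-1 * \sum_E (X E + Y E).
  rewrite /Sw dotZr dot_lap mulrCA; congr (_ * _); rewrite mulr_sumr; apply: eq_bigr => E _.
  by rewrite /X /Y /dg; ring.
have key : \sum_E (- (X E / 2) - Y E) <= \sum_E beta * k * (w E.1 * f E.1 ^+ 2 + w (E.1 + e E.2) * f (E.1 + e E.2) ^+ 2).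
  apply: ler_sum => E _; have := weight_edge (f E.1) (f (E.1 + e E.2)) (w0 E.1) (w0 (E.1 + e E.2)) (hw E).
  move=> /(ler_wpM2l (a0 E)) h; rewrite /X /Y /dg.
  apply: (@le_trans _ _ (a E * (k * (w E.1 * f E.1 ^+ 2 + w (E.1 + e E.2) * f (E.1 + e E.2) ^+ 2)))).
    by apply: le_trans h; rewrite le_eqVlt; apply/orP; left; apply/eqP; field.
  rewrite -[leRHS]mulrA; apply: ler_wpM2r => //.
  by rewrite mulr_ge0 // addr_ge0 // mulr_ge0 ?sqr_ge0 // ltW.
rewrite -mulr_sumr (sum_ends_edges (fun x => w x * f x ^+ 2)) in key.
have {}key := ler_wpM2l (ltW (_ : 0 < c^-1)) key.
have {}key := key ltac:(by rewrite invr_gt0).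
have e1 : c^-1 * (beta * k * (2 * d%:R * \sum_x w x * f x ^+ 2)) = k / 2 * \sum_x w x * f x ^+ 2.
  rewrite cstE; field; rewrite gt_eqF //=; have := d_gt0; rewrite lt0n -(pnatr_eq0 R); by move=> ->.
rewrite e1 in key; rewrite exp crs mulrDl mul1r.
have e2 : c^-1 * \sum_E (- (X E / 2) - Y E) = (2 * c)^-1 * (\sum_E X E) - c^-1 * \sum_E (X E + Y E).
  rewrite [(2 * c)^-1]invfM mulrC [2^-1 * _]mulrC; rewrite mulrC -mulrA -mulrBr; congr (_ * _).
  by rewrite mulr_sumr -sumrB; apply: eq_bigr => E _; field.
rewrite e2 in key; move: SW key; rewrite -/X.
set s1 := \sum_x _; set s2 := (2 * c)^-1 * _; set s3 := c^-1 * _; set s4 := k / 2 * _; set s5 := \sum_x _.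
by clearbody s1 s2 s3 s4 s5; lra.
Qed.

Lemma davies (k : R) (w f : V -> R) n : 0 <= k -> (forall x, 0 < w x) ->
  (forall E, (w (E.1 + e E.2) - w E.1) ^+ 2 <= k * (w E.1 * w (E.1 + e E.2))) ->
  \sum_x w x * Tn e beta a n f x ^+ 2 <= (1 + k / 2) ^+ n * \sum_x w x * f x ^+ 2.
Proof.
move=> k0 w0 hw; elim: n => [|n IH]; first by rewrite expr0 mul1r.
apply: le_trans (davies_step _ k0 w0 hw) _; rewrite exprS -mulrA; apply: ler_wpM2l => //.
by rewrite addr_ge0 // divr_ge0.
Qed.

Lemma nbr_sym r x y : nbr e r x y -> nbr e r y x.
Proof.
case/cubeP => k kl ->; apply/cubeP; exists (fun i => 2 * r - k i)%N.
  by move=> i; rewrite ltnS leq_subr.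
have e1 : lat e (fun i => (2 * r - k i)%N) = rr e r + rr e r - lat e k.
  apply/eqP; rewrite eq_sym subr_eq /rr -!latD; apply/eqP; apply: eq_bigr => i _.
  by congr (_ *+ _); have := kl i; clear; lia.
rewrite e1; set L := lat e k; set rho := rr e r.
by rewrite addrA [_ + (rho + rho)]addrA subrK [_ + rho]addrAC subrK addrK.
Qed.

Lemma Tn_delta_local n x y : ~~ nbr e n y x -> Tn e beta a n (delta x) y = 0.
Proof.
elim: n y => [|n IH] y h.
  rewrite /= /delta; case: eqP h => // ->; by rewrite nbr_refl.
have h0 : Tn e beta a n (delta x) y = 0 by apply: IH; apply: contra h; exact: nbr_S.
have h1 i : Tn e beta a n (delta x) (y + e i) = 0 by apply: IH; apply: contra h; exact: nbr_up.
have h2 i : Tn e beta a n (delta x) (y - e i) = 0 by apply: IH; apply: contra h; exact: nbr_down.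
rewrite -[LHS]/(Tw e beta a (Tn e beta a n (delta x)) y) /Tw /Sw /lap h0 big1 ?mulr0 ?subr0 // => i _.
by rewrite h1 h2 subr0 !mulr0 addr0.
Qed.

(** The sup-distance truncated at [m], as a count of the balls that miss; in this form its Lipschitz
    property follows from inclusions of balls. *)
Definition rho m x y : nat := \sum_(k < m) ~~ nbr e k y x.

Lemma rho_lip m x y y' : (forall r, nbr e r y x -> nbr e r.+1 y' x) -> (rho m x y' <= (rho m x y).+1)%N.
Proof.
move=> h; case: m => [|m]; first by rewrite /rho big_ord0.
rewrite /rho big_ord_recl /= -[X in (_ <= X)%N]add1n; apply: leq_add; first by case: (nbr _ _ _ _).
rewrite [X in (_ <= X)%N]big_ord_recr /=; apply: leq_trans (leq_addr _ _).
apply: leq_sum => k _; have := h k; rewrite /bump /= add1n.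
by case: (nbr e k y x) => [/(_ isT) ->|_] //; exact: leq_b1.
Qed.

Lemma rho_ge m x y r : (r < m)%N -> ~~ nbr e r y x -> (r < rho m x y)%N.
Proof.
move=> rm h; rewrite /rho -(subnKC rm) big_split_ord /=; apply: leq_trans (leq_addr _ _).
have -> : (\sum_(i < r.+1) ~~ nbr e i y x = \sum_(i < r.+1) 1)%N.
  apply: eq_bigr => i _; rewrite (contra _ h) //; apply: nbr_mono; by rewrite -ltnS.
by rewrite sum1_card card_ord.
Qed.

Lemma rho_refl m x : rho m x x = 0%N.
Proof. by rewrite /rho big1 // => k _; rewrite nbr_refl. Qed.

Definition wgt (r : R) p m x y := (1 + (rho m x y)%:R / r) ^+ p.+1.

Lemma pow_log_lip (s t r : R) p : 1 <= s -> s <= t -> t <= s + r^-1 -> 1 <= r ->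
  (t ^+ p.+1 - s ^+ p.+1) ^+ 2 <= p.+1%:R ^+ 2 * 2 ^+ p.+1 / r ^+ 2 * (s ^+ p.+1 * t ^+ p.+1).
Proof.
move=> s1 st ts r1; have r0 : 0 < r by lra.
have s0 : 0 <= s by lra. have t0 : 0 <= t by lra. have t1 : 1 <= t by lra.
have ri : r^-1 <= 1 by rewrite invf_le1.
have t2 : t <= 2 * s by lra.
have h1 : t ^+ p.+1 - s ^+ p.+1 <= p.+1%:R * t ^+ p.+1 / r.
  have := pow_tangent p t0 s0 => h.
  apply: (@le_trans _ _ (p.+1%:R * t ^+ p * (t - s))).
    by rewrite -[t - s]opprB mulrN; lra.
  apply: ler_pM; rewrite ?subr_ge0 ?mulr_ge0 ?exprn_ge0 //; last lra.
  by apply: ler_wpM2l => //; rewrite exprS ler_peMl // exprn_ge0.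
have h0 : 0 <= t ^+ p.+1 - s ^+ p.+1 by rewrite subr_ge0 lerXn2r ?nnegrE.
apply: le_trans (sqr_mono h0 h1) _; rewrite expr_div_n exprMn.
have h2 : t ^+ p.+1 <= 2 ^+ p.+1 * s ^+ p.+1 by rewrite -exprMn lerXn2r ?nnegrE // mulr_ge0.
have -> : p.+1%:R ^+ 2 * 2 ^+ p.+1 / r ^+ 2 * (s ^+ p.+1 * t ^+ p.+1) =
  p.+1%:R ^+ 2 / r ^+ 2 * ((2 ^+ p.+1 * s ^+ p.+1) * t ^+ p.+1) by ring.
rewrite mulrAC; apply: ler_wpM2l; first by rewrite divr_ge0 // ?sqr_ge0.
by rewrite expr2; apply: ler_wpM2r => //; rewrite exprn_ge0.
Qed.

Lemma wgt_ge1 r p m x y : 1 <= r -> 1 <= wgt r p m x y.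
Proof. by move=> r1; rewrite /wgt exprn_ege1 // lerDl divr_ge0 //; lra. Qed.

Lemma wgt_lip r p m x E : 1 <= r -> (wgt r p m x (E.1 + e E.2) - wgt r p m x E.1) ^+ 2 <=
  p.+1%:R ^+ 2 * 2 ^+ p.+1 / r ^+ 2 * (wgt r p m x E.1 * wgt r p m x (E.1 + e E.2)).
Proof.
move=> r1; have r0 : 0 < r by lra.
have l1 : (rho m x (E.1 + e E.2)%R <= (rho m x E.1).+1)%N.
  by apply: rho_lip => k h; apply: (@nbr_down _ _ _ _ _ E.2); rewrite addrK.
have l2 : (rho m x E.1 <= (rho m x (E.1 + e E.2)%R).+1)%N by apply: rho_lip => k; exact: nbr_up.
have g1 k : 1 <= 1 + k%:R / r by rewrite lerDl divr_ge0 //; lra.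
have lip (k l : nat) : (l <= k.+1)%N -> 1 + l%:R / r <= 1 + k%:R / r + r^-1.
  by move=> lk; rewrite -addrA lerD2l -[X in _ + X]mul1r -mulrDl ler_pM2r ?invr_gt0 // natr1 ler_nat.
have mon (k l : nat) : (l <= k)%N -> 1 + l%:R / r <= 1 + k%:R / r.
  by move=> lk; rewrite lerD2l ler_pM2r ?invr_gt0 // ler_nat.
have [h|h] := leqP (rho m x E.1) (rho m x (E.1 + e E.2)).
  by apply: pow_log_lip => //; [exact: mon|exact: lip].
rewrite -sqrrN opprB [X in _ * X]mulrC; apply: pow_log_lip => //; [exact/mon/ltnW|exact: lip].
Qed.

(** At the diffusive scale r = sqrt(n+1) the weighted norm grows by a factor 1 + O(1/n) per step, so
    it stays bounded up to time n: polynomial moments of the evolved dipole. *)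
Lemma davies_dlt p m n (E : V * 'I_d) :
  \sum_y wgt (pw n 2^-1) p m E.1 y * Tn e beta a n (dlt e E) y ^+ 2 <= expR (p.+1%:R ^+ 2 * 2 ^+ p.+1) * (4 * 2 ^+ p.+1).
Proof.
set r := pw n 2^-1; set K := p.+1%:R ^+ 2 * 2 ^+ p.+1.
have r1 : 1 <= r by rewrite -(pw0 R n) pw_ler.
have r2 : r ^+ 2 = n.+1%:R by rewrite /r pw_exp mulVf // pw1.
have K0 : 0 <= K by rewrite mulr_ge0 ?sqr_ge0 // exprn_ge0.
have k0 : 0 <= K / r ^+ 2 by rewrite divr_ge0 // sqr_ge0.
apply: le_trans (davies _ _ k0 (fun y => lt_le_trans ltr01 (wgt_ge1 p m E.1 y r1)) (fun F => wgt_lip p m E.1 F r1)) _.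
have w0 x : 0 <= wgt r p m E.1 x by apply: le_trans (wgt_ge1 p m E.1 x r1).
apply: ler_pM; first by rewrite exprn_ge0 // addr_ge0 // divr_ge0.
- by rewrite sumr_ge0 // => x _; rewrite mulr_ge0 ?sqr_ge0.
- apply: (@le_trans _ _ (expR (K / n.+1%:R) ^+ n.+1)).
    have x1 : 1 + K / r ^+ 2 / 2 <= expR (K / n.+1%:R).
      by apply: le_trans (expR_ge1Dx _); rewrite -r2 lerD2l ler_pdivrMr // ler_peMr // ler1n.
    have x0 : 1 <= 1 + K / r ^+ 2 / 2 by rewrite lerDl divr_ge0.
    apply: (@le_trans _ _ ((1 + K / r ^+ 2 / 2) ^+ n.+1)); last by rewrite lerXn2r ?nnegrE ?expR_ge0 //; lra.
    by rewrite [leRHS]exprS ler_peMl // exprn_ge0 // (le_trans ler01).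
  by rewrite -expRM_natl mulrC divfK.
apply: (@le_trans _ _ (\sum_x 2 * (wgt r p m E.1 x * delta (E.1 + e E.2) x + wgt r p m E.1 x * delta E.1 x))).
  apply: ler_sum => x _; rewrite -mulrDr [2 * _]mulrCA; apply: ler_wpM2l => //.
  by rewrite /dlt /delta; case: eqP; case: eqP; rewrite /= ?mulr1n ?mulr0n; lra.
have sd y : \sum_x wgt r p m E.1 x * delta y x = wgt r p m E.1 y.
  by under eq_bigr do rewrite mulrC; exact: dot_delta.
rewrite -mulr_sumr big_split /= !sd.
have w1 : wgt r p m E.1 E.1 = 1 by rewrite /wgt rho_refl mul0r addr0 expr1n.
have w2 : wgt r p m E.1 (E.1 + e E.2) <= 2 ^+ p.+1.
  rewrite /wgt lerXn2r ?nnegrE // ?addr_ge0 ?divr_ge0 //; first lra.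
  have l1 : (rho m E.1 (E.1 + e E.2)%R <= 1)%N.
    rewrite -[1%N]/(0.+1) -(rho_refl m E.1).
    by apply: rho_lip => k h; apply: (@nbr_down _ _ _ _ _ E.2); rewrite addrK.
  have : (rho m E.1 (E.1 + e E.2))%:R / r <= 1.
    by rewrite ler_pdivrMr ?mul1r; [apply: le_trans r1; rewrite -[leRHS]/(1%:R) ler_nat|lra].
  lra.
have : 1 <= 2 ^+ p.+1 :> R by rewrite exprn_ege1 // ler1n.
by rewrite w1; lra.
Qed.

End Davies.

(** * Total variation of the evolved dipole in the plane *)

Section TotalVariation.
Variables (R : realType) (alpha beta C del : R).
Hypotheses (alpha_gt0 : 0 < alpha) (le_ab : alpha <= beta).
Hypotheses (del_gt0 : 0 < del) (del_le1 : del <= 1) (HC : @dipole_bound R 2 alpha beta C del).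
Let d2 : (0 < 2)%N. Proof. by []. Qed.

Lemma sum_cube_sq (V : finZmodType) (e : 'I_2 -> V) r x (P : pred V) (f : V -> R) : (forall y, P y -> nbr e r y x) ->
  (\sum_(y | P y) `|f y|) ^+ 2 <= (2 * r).+1%:R ^+ 2 * \sum_(y | P y) f y ^+ 2.
Proof.
move=> h; have := @CS_sum R V P (fun=> 1) (fun y => `|f y|).
under eq_bigr do rewrite mul1r; move/le_trans; apply.
have -> : \sum_(y | P y) `|f y| ^+ 2 = \sum_(y | P y) f y ^+ 2.
  by apply: eq_bigr => y _; rewrite real_normK ?num_real.
under [X in X * _ <= _]eq_bigr do rewrite expr1n; apply: ler_wpM2r.
  by rewrite sumr_ge0 // => y _; rewrite sqr_ge0.
rewrite sumr_const -natrX ler_nat; apply: leq_trans (card_cube_le e (x - rr e r) (2 * r).+1).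
by apply: subset_leq_card; apply/fintype.subsetP => y yP; rewrite inE; apply: nbr_sym; exact: h.
Qed.

(** The plane is cut at radius s = n^(1/2 + del/4), slightly beyond the diffusive scale. Inside,
    Cauchy-Schwarz with s^2 sites against a dipole energy n^-(1+del); outside, the polynomial
    weight, finite propagation limiting the number of sites. *)
Lemma tv_bound : exists2 C' : R, 0 < C' &
  forall (V : finZmodType) (e : 'I_2 -> V) N a, torus e N -> elliptic alpha beta a ->
  forall n E, (n <= N)%N -> \sum_y `|Tn e beta a n (dlt e E) y| <= C' * pw n (- (del / 4)).
Proof.
case: HC => C0 H.
have hz (z : R) : 10 < z * del -> 2 + del / 2 <= z * (del / 4) by rewrite mulrA; have := del_gt0; have := del_le1; move: (z * del) => X; lra.
(* Outside, the weight must beat the n^2 sites reached at time n, once more than Cauchy-Schwarz's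
   own n^-(del/2) requires: (p+1) del/4 >= 2 + del/2. *)
pose p := Num.truncn (10 / del).
have hp : 2 + del / 2 <= p.+1%:R * (del / 4).
  by apply: hz; rewrite -ltr_pdivrMr //; exact: truncnS_gt.
pose K : R := expR (p.+1%:R ^+ 2 * 2 ^+ p.+1) * (4 * 2 ^+ p.+1).
have K0 : 0 < K by rewrite mulr_gt0 ?expR_gt0 // mulr_gt0 // exprn_gt0.
exists (Num.sqrt (9 * C) + Num.sqrt (9 * K)); first by rewrite addr_gt0 // sqrtr_gt0 mulr_gt0.
move=> V e N a tor ha n E nN; set h := Tn e beta a n (dlt e E).
pose s : R := pw n (2^-1 + del / 4); pose r := Num.truncn s.
have dp : 0 < del := del_gt0; have s1 : 1 <= s.
  by rewrite -(pw0 R n); apply: pw_ler; rewrite addr_ge0 ?invr_ge0 ?divr_ge0 // ltW.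
have s0 : 0 <= s := pw_ge0 _ _; have rs : r%:R <= s by rewrite truncn_le.
have sr : s < r.+1%:R by exact: truncnS_gt.
have sq_le (X A B : R) : 0 <= X -> 0 <= A -> X ^+ 2 <= A * B ^+ 2 -> 0 <= B -> X <= Num.sqrt A * B.
  move=> X0 A0 XA B0; rewrite -(@ler_pXn2r _ 2) ?nnegrE // ?mulr_ge0 ?sqrtr_ge0 //.
  by rewrite exprMn sqr_sqrtr.
rewrite (bigID (fun y => nbr e r y E.1)) /= mulrDl; apply: lerD; apply: sq_le => //;
  rewrite ?pw_ge0 ?sumr_ge0 ?mulr_ge0 ?(ltW C0) ?(ltW K0) //.
  apply: (le_trans (@sum_cube_sq V e r E.1 (fun y => nbr e r y E.1) h (fun y hy => hy))).
  apply: (@le_trans _ _ ((3 * s) ^+ 2 * (C * pw n (- (1 + del))))).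
    apply: ler_pM; [exact: sqr_ge0|by rewrite sumr_ge0 // => y _; exact: sqr_ge0| |].
      by apply: sqr_mono => //; rewrite -natr1 natrM; lra.
    apply: le_trans (H V e N a tor ha n E nN); rewrite /dot [leRHS](bigID (fun y => nbr e r y E.1)) /= -/h.
    rewrite -[leLHS]addr0; apply: lerD; last by rewrite sumr_ge0 // => y _; rewrite -expr2 sqr_ge0.
    by under eq_bigr do rewrite expr2.
  rewrite exprMn /s !pw_exp; set X := pw n _; set Y := pw n _; set Z := pw n _.
  have -> : Z = X * Y by rewrite -pwD; congr pw; field.
  by rewrite le_eqVlt; apply/orP; left; apply/eqP; ring.
pose Q y := ~~ nbr e r y E.1 && nbr e n.+1 y E.1.
have hzero y : ~~ nbr e n.+1 y E.1 -> h y = 0.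
  move=> ny; have -> : h y = Tn e beta a n (delta (E.1 + e E.2)) y - Tn e beta a n (delta E.1) y.
    by rewrite -TnB.
  rewrite !Tn_delta_local ?subrr //; apply: contra ny; first exact: nbr_S.
  by move=> /nbr_sym /nbr_up /nbr_sym.
have -> : \sum_(y | ~~ nbr e r y E.1) `|h y| = \sum_(y | Q y) `|h y|.
  rewrite (bigID (fun y => nbr e n.+1 y E.1)) /= [X in _ + X]big1 ?addr0 // => y /andP[_ ny].
  by rewrite hzero ?normr0.
apply: (le_trans (@sum_cube_sq V e n.+1 E.1 Q h _)) => [y /andP[]//|].
pose w : V -> R := wgt e (pw n 2^-1) p n.+1 E.1.
have DV := davies_dlt e d2 alpha_gt0 le_ab ha p n.+1 n E; rewrite -/w -/h -/K in DV.
have q1 : 1 <= pw n 2^-1 :> R by rewrite -[leLHS](pw0 R n); apply: pw_ler; rewrite invr_ge0.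
have wQ y : Q y -> h y ^+ 2 <= pw n (- (p.+1%:R * (del / 4))) * (w y * h y ^+ 2).
  move=> /andP[yr yn]; have rn : (r < n.+1)%N.
    by rewrite ltnNge; apply/negP => nr; move: yr; rewrite (nbr_mono nr yn).
  rewrite mulrA ler_peMl ?sqr_ge0 //.
  have hrho := rho_ge rn yr.
  have lw : pw n (p.+1%:R * (del / 4)) <= w y.
    have -> : pw n (p.+1%:R * (del / 4)) = pw n (del / 4) ^+ p.+1 :> R by rewrite pw_exp; congr pw; ring.
    rewrite /w /wgt lerXn2r ?nnegrE ?pw_ge0 // ?addr_ge0 ?divr_ge0 ?pw_ge0 //.
    apply: (@le_trans _ _ ((rho e n.+1 E.1 y)%:R / pw n 2^-1)); last by lra.
    rewrite ler_pdivlMr ?pw_gt0 // -pwD addrC -/s; apply: ltW; apply: (lt_le_trans sr).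
    by rewrite ler_nat.
  by rewrite -[leLHS](pwV n (p.+1%:R * (del / 4))) [leLHS]mulrC ler_wpM2l ?pw_ge0.
apply: (@le_trans _ _ ((3 * pw n 1) ^+ 2 * (pw n (- (p.+1%:R * (del / 4))) * K))).
  apply: ler_pM; [exact: sqr_ge0|by rewrite sumr_ge0 // => y _; exact: sqr_ge0| |].
    by apply: sqr_mono => //; rewrite pw1 -natrM ler_nat; clear; lia.
  apply: (@le_trans _ _ (\sum_(y | Q y) pw n (- (p.+1%:R * (del / 4))) * (w y * h y ^+ 2))); first exact: ler_sum.
  rewrite -mulr_sumr; apply: ler_wpM2l; rewrite ?pw_ge0 //; apply: le_trans DV.
  rewrite [leRHS](bigID Q) /= lerDl sumr_ge0 // => y _; rewrite mulr_ge0 ?sqr_ge0 //.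
  by apply: le_trans (wgt_ge1 _ _ _ _ _ q1).
rewrite exprMn !pw_exp -natrX; have -> : (3 ^ 2)%:R * pw n (1 * 2) * (pw n (- (p.+1%:R * (del / 4))) * K) =
  9 * K * (pw n (1 * 2) * pw n (- (p.+1%:R * (del / 4)))) :> R by ring.
by rewrite -pwD; apply: ler_wpM2l; [rewrite mulr_ge0 // ltW|apply: pw_ler; move: hp; set X := p.+1%:R * _; clearbody X; lra].
Qed.

(** The gradient of [u] at time n is [u] at about half time integrated against evolved dipoles of
    small total variation: Schur's test in [l^q], the sum over edges being at most 4. In the plane
    dissipation alone gains too little to pay for [ups]. *)
Lemma tv_contract p : exists2 C' : R, 0 < C' & forall (M : model 2 alpha beta) n, (n <= mN M)%N ->
  bq M (2 * p.+1) n <= C' * pw n (- (del / 8)) * aq M (2 * p.+1) (n - n./2).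
Proof.
have [C1 C10 H1] := tv_bound; set q := (2 * p.+1)%N; have q0 : (0 < q)%N by rewrite muln_gt0.
exists (rt q 4 * (C1 + 1) * 2); first by rewrite !mulr_gt0 ?powR_gt0 // addr_gt0.
move=> M n nN; set s := n./2; have sn : (s <= n)%N := half_le n.
have B0 : 0 <= C1 * pw s (- (del / 4)) by rewrite mulr_ge0 ?pw_ge0 // ltW.
have det st : \sum_E `|dg (me M) E (u st n)| ^+ q <= (C1 * pw s (- (del / 4))) ^+ q.-1 * (4 * \sum_x `|u st (n - s) x| ^+ q).
  set a := env (M := M) st; have ha := env_ell (M := M) st.
  pose H E := Tn (me M) beta a s (dlt (me M) E).
  have dgE E : dg (me M) E (u st n) = \sum_y H E y * u st (n - s) y.
    by rewrite -dot_dlt /u /sol -{1}(subnKC sn) TnD dot_Tn.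
  have pq : q = q.-1.+1 by rewrite prednK.
  have l1 E : \sum_y `|H E y| <= C1 * pw s (- (del / 4)).
    by apply: (H1 _ _ _ _ (m_torus M) ha); exact: leq_trans nN.
  apply: (@le_trans _ _ (\sum_E (C1 * pw s (- (del / 4))) ^+ q.-1 * \sum_y `|H E y| * `|u st (n - s) y| ^+ q)).
    apply: ler_sum => E _; rewrite dgE.
    apply: (@le_trans _ _ ((\sum_y `|H E y| * `|u st (n - s) y|) ^+ q)).
      rewrite lerXn2r ?nnegrE ?normr_ge0 ?sumr_ge0 //.
      by apply: le_trans (ler_norm_sum _ _ _) _; apply: ler_sum => y _; rewrite normrM.
    rewrite {1 3}pq; apply: le_trans (weighted_pow _ _ _) _ => //.
    apply: ler_wpM2r; first by rewrite sumr_ge0 // => y _; rewrite mulr_ge0 ?exprn_ge0.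
    by rewrite lerXn2r ?nnegrE // ?sumr_ge0.
  rewrite -mulr_sumr; apply: ler_wpM2l; first by rewrite exprn_ge0.
  rewrite exchange_big /= mulr_sumr; apply: ler_sum => y _; rewrite -mulr_suml; apply: ler_wpM2r; first by rewrite exprn_ge0.
  pose k := Tn (me M) beta a s (delta y).
  have k0 x : 0 <= k x by apply: (Tn_ge0 (me M) d2 alpha_gt0 le_ab ha) => z; rewrite ler0n.
  apply: (@le_trans _ _ (\sum_E (k E.1 + k (E.1 + me M E.2)))).
    apply: ler_sum => E _; have -> : H E y = dg (me M) E k.
      by rewrite /H -[LHS]dot_delta dot_Tn dotC dot_dlt.
    by apply: le_trans (ler_normB _ _) _; rewrite !ger0_norm // addrC.
  rewrite sum_ends_edges /k sum_Tn sum_delta; lra.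
have up : bq M q n ^+ q <= 4 * (C1 * pw s (- (del / 4))) ^+ q.-1 * aq M q (n - s) ^+ q.
  rewrite bqE // aqE // /mean mulrCA; apply: ler_wpM2l; first by rewrite invr_ge0.
  rewrite -(Ex_sum (@mw _ _ _ _ M) xpredT (fun E st => `|dg (me M) E (u st n)| ^+ q)).
  rewrite -(Ex_sum (@mw _ _ _ _ M) xpredT (fun x st => `|u st (n - s) x| ^+ q)) -ExZ.
  by apply: Ex_le => [st|st]; [exact: mw_ge0|apply: (le_trans (det st)); rewrite mulrA [_ * 4]mulrC].
have X0 : 0 <= rt q 4 * (C1 + 1) * 2 * pw n (- (del / 8)).
  by rewrite !mulr_ge0 ?pw_ge0 ?rt_ge0 // addr_ge0 // ltW.
rewrite -(@ler_pXn2r _ q) ?nnegrE ?bq_ge0 //; last by apply: mulr_ge0 => //; exact: aq_ge0.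
apply: (le_trans up); rewrite [leRHS]exprMn; apply: ler_wpM2r; first by rewrite exprn_ge0 ?aq_ge0.
have -> : rt q 4 * (C1 + 1) * 2 * pw n (- (del / 8)) = rt q 4 * ((C1 + 1) * (2 * pw n (- (del / 8)))) by ring.
rewrite [leRHS]exprMn [rt q 4 ^+ q]rtK //; apply: ler_wpM2l => //; rewrite !exprMn.
apply: ler_pM; rewrite ?exprn_ge0 ?pw_ge0 ?(ltW C10) //.
  apply: (@le_trans _ _ ((C1 + 1) ^+ q.-1)).
    by rewrite lerXn2r ?nnegrE ?addr_ge0 ?(ltW C10) // lerDl.
  by rewrite -{2}(prednK q0) exprS ler_peMl ?exprn_ge0 ?addr_ge0 ?lerDr ?(ltW C10).
have sc : pw s (- (del / 4)) <= 2 * pw n (- (del / 4)) :> R.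
  have dp := del_gt0; have dl := del_le1; apply: le_trans (scale_le2 _ (half_scale n)) _; first lra.
  apply: ler_wpM2r; first exact: pw_ge0.
  by rewrite -[leRHS](@powRr1 _ 2) //; apply: ler_powR; [rewrite ler1n|lra].
apply: (@le_trans _ _ ((2 * pw n (- (del / 4))) ^+ q.-1)); first by rewrite lerXn2r ?nnegrE ?mulr_ge0 ?pw_ge0.
rewrite exprMn !pw_exp; apply: ler_pM; rewrite ?exprn_ge0 ?pw_ge0 //.
  by rewrite -{2}(prednK q0) exprS ler_peMl ?exprn_ge0 // ler1n.
apply: pw_ler; have -> : q%:R = q.-1%:R + 1 :> R by rewrite natr1 prednK.
have : 1 <= q.-1%:R :> R by rewrite ler1n /q; clear; lia.
move: (q.-1%:R : R) => z z1; have : 0 <= del * (z - 1) by rewrite mulr_ge0 ?subr_ge0 // ltW.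
lra.
Qed.

End TotalVariation.

(** * Variance decay of the evolved drift *)

Lemma dipole_bound_le (R : realType) d (alpha beta C del del' : R) : del' <= del ->
  dipole_bound d alpha beta C del -> dipole_bound d alpha beta C del'.
Proof.
move=> dd [C0 H]; split => // V e N a tor ha n E nN; apply: le_trans (H V e N a tor ha n E nN) _.
by rewrite ler_pM2l //; apply: pw_ler; lra.
Qed.

Lemma variance_decay2 (R : realType) (alpha beta : R) :
  0 < alpha -> alpha <= beta -> exists2 C : R, 0 < C &
  forall (M : model 2 alpha beta) n, (n <= mN M)%N -> aq M 2 n <= C * pw n (- gam R 2).
Proof.
move=> alpha0 le_ab; have d1 : (1 < 2)%N by []. have d0 : (0 < 2)%N by [].
have [del' del'0 [C HC']] := dipole_bound2 alpha0 le_ab.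
pose del := Num.min del' (1 / 2).
have del0 : 0 < del by rewrite lt_min del'0; lra.
have delh : del <= 1 / 2 by rewrite ge_min lexx orbT.
have HC : dipole_bound 2 alpha beta C del by apply: dipole_bound_le HC'; rewrite ge_min lexx.
have gE : gam R 2 = 1 by rewrite /gam; field.
(* [tv_contract] gives gradients the rate sig + del/8, and del/8 = 2 w1, of which w1 survives on
   blocks. As sig < 1, summed kernels grow, and th = w1 meets the requirement gam <= 1 - th + w1
   with equality. *)
clearbody del; pose w1 := del / 16; have w10 : 0 < w1 by rewrite divr_gt0.
pose eps := w1 / 8; have eps0 : 0 < eps by rewrite divr_gt0.
have we0 : 0 < del / 2 * eps by rewrite mulr_gt0 // divr_gt0.
have [m hm] := @exists_pow2 R (4 / w1 + (del / 2 * eps)^-1).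
set P : R := (2 ^ m)%:R in hm.
have i1 : 0 < 4 / w1 by rewrite divr_gt0.
have i2 : 0 < (del / 2 * eps)^-1 by rewrite invr_gt0.
have P0 : 0 < P by lra.
have P2 : 0 < 2 * P by lra.
have sigE : sig 2 del (2 ^ m) = 1 - (1 - del) / (2 * P).
  by rewrite /sig -/P gE; congr (_ - _ / _); ring.
pose p := (2 ^ m).-1; have pE : p.+1 = (2 ^ m)%N by rewrite prednK // expn_gt0.
have qE : (2 * p.+1)%:R = 2 * P :> R by rewrite natrM pE.
have h0 : 0 < (2 * P)^-1 by rewrite invr_gt0.
have h1 : (2 * P)^-1 < w1 / 4.
  rewrite -[ltRHS]invrK ltf_pV2 ?posrE ?invr_gt0 ?divr_gt0 // invf_div; lra.
have h2 : (2 * P)^-1 <= del / 2 * eps by rewrite -[leRHS]invrK lef_pV2 ?posrE //; lra.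
set iP := (2 * P)^-1 in h0 h1 h2 sigE.
have h3 : 0 < (1 - del) * iP by rewrite mulr_gt0 //; lra.
have h4 : (1 - del) * iP < iP by rewrite gtr_pMl //; lra.
have h5 : iP < 1 by move: h1; rewrite /w1; lra.
have pa : 0 <= sig 2 del (2 ^ m) <= gam R 2 by rewrite sigE gE; apply/andP; split; lra.
have pb : 1 - (2 * 2 ^ m)%:R^-1 < sig 2 del (2 ^ m) by rewrite sigE natrM -/P -/iP; lra.
have [C1 C10 H1] := pass1 d1 alpha0 le_ab HC pa pb.
rewrite -pE in H1 sigE.
have del1 : del <= 1 by lra.
have [C2 C20 H2] := tv_contract alpha0 le_ab del0 del1 HC p.
pose Kc : R := (1 - 2 `^ (- w1))^-1.
have Kc0 : 0 < Kc by rewrite invr_gt0 subr_gt0 two_pow_lt1.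
have CC : 0 < C2 * (2 * C1) by rewrite !mulr_gt0.
pose K := Kc + C2 * (2 * C1); have K0 : 0 < K by rewrite addr_gt0.
set sg := sig 2 del p.+1 in H1 sigE *.
apply: (core_bound (p := p) (eps := eps) (w1 := w1) (th := w1) (K := K) d1 alpha0 le_ab del0 HC) => //.
- by rewrite eps0 /eps /w1; lra.
- by rewrite gE; lra.
- by rewrite gE -/sg sigE; lra.
- rewrite gE -/sg sigE; have -> : (1 + del - 1) / 2 * eps = del / 2 * eps by ring.
  move: h2 h4; set z := _ * iP; set z' := del / 2 * eps; lra.
- by rewrite qE -/iP /eps; move: h1 w10; clearbody w1; lra.
- exact: ltW.
- by rewrite gE; lra.
- move=> n; apply: (@le_trans _ _ (\sum_(0 <= t < n) pw t (w1 - 1))).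
    by apply: ler_sum => t _; apply: pw_ler; rewrite -/sg sigE; move: h1 h4; set z := _ * iP; lra.
  apply: le_trans (sum_pw _ _) _; first by rewrite w10 /w1; lra.
  by apply: ler_wpM2r; [exact: pw_ge0|rewrite /K lerDl ltW].
move=> M k kN.
have bk s : (k <= s)%N -> (s <= mN M)%N -> bq M (2 * p.+1) s <= C2 * (2 * C1) * pw k (- (1 + w1)).
  move=> ks sN; apply: (le_trans (H2 M s sN)).
  have s2 : (s - s./2 <= mN M)%N := leq_trans (leq_subr _ _) sN.
  have c1 : pw (s - s./2) (- sg) <= 2 * pw s (- sg) :> R.
    have sg0 : 0 <= sg by rewrite sigE; lra.
    apply: le_trans (scale_le2 sg0 (_ : (s < _)%N)) _; first by clear; lia.
    apply: ler_wpM2r; first exact: pw_ge0.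
    by rewrite -[leRHS](@powRr1 _ 2) //; apply: ler_powR; [rewrite ler1n|rewrite sigE; lra].
  have c2 := le_trans (H1 M _ s2) (ler_wpM2l (ltW C10) c1).
  have C2p : 0 <= C2 * pw s (- (del / 8)) by rewrite mulr_ge0 ?pw_ge0 // ltW.
  apply: le_trans (ler_wpM2l C2p c2) _.
  have -> : C2 * pw s (- (del / 8)) * (C1 * (2 * pw s (- sg))) = C2 * (2 * C1) * (pw s (- (del / 8)) * pw s (- sg)) by ring.
  apply: ler_wpM2l; first exact: ltW.
  rewrite -pwD; apply: (@le_trans _ _ (pw s (- (1 + w1)))); last by apply: pw_anti => //; lra.
  by apply: pw_ler; rewrite sigE; move: h1 h4; rewrite /w1; set z := _ * iP; lra.
apply: (@le_trans _ _ (\sum_(k <= s < (2 * k).+1) C2 * (2 * C1) * pw k (- (1 + w1)))).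
  rewrite big_mkcond /=; apply: ler_sum_nat => s /andP[ks _]; case: ifP => sN; first exact: bk.
  by rewrite mulr_ge0 ?pw_ge0 // ltW.
rewrite sumr_const_nat; have -> : ((2 * k).+1 - k = k.+1)%N by clear; lia.
rewrite -[leLHS]mulr_natl -(pw1 R) mulrCA -pwD.
have -> : 1 + - (1 + w1) = - w1 by ring.
by apply: ler_wpM2r; [exact: pw_ge0|rewrite /K lerDr ltW].
Qed.

Lemma variance_decay (R : realType) (d : nat) (alpha beta : R) :
  (1 < d)%N -> 0 < alpha -> alpha <= beta -> exists2 C : R, 0 < C &
  forall (M : model d alpha beta) n, (n <= mN M)%N -> aq M 2 n <= C * pw n (- gam R d).
Proof.
case: d => [|[|[|d]]] // _ ? ?; first exact: variance_decay2.
exact: variance_decay_ge3.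
Qed.

(** * Expectations and square-integrable functions *)

Section Expectation.
Context (dd : measure_display) (T : measurableType dd) (R : realType).
Variables (mu : {measure set T -> \bar R}) (D : set T).
Hypotheses (mD : measurable D).
Implicit Types (f g : T -> R).

Definition mitg f := mu.-integrable D (EFin \o f).
Definition mEr f : R := Rintegral mu D f.
Local Notation itg := mitg.
Local Notation Er := mEr.

Lemma itg_meas f : itg f -> measurable_fun D f.
Proof. by move=> /integrableP[/measurable_EFinP]. Qed.

Lemma itg_eq f g : (forall x, D x -> f x = g x) -> itg f -> itg g.
Proof. by move=> h; apply: eq_integrable => // x /set_mem Dx /=; rewrite h. Qed.

Lemma itg_le f g : measurable_fun D f -> (forall x, D x -> `|f x| <= g x) -> itg g -> itg f.
Proof.
move=> mf fg; apply: le_integrable => //; first exact/measurable_EFinP.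
move=> x Dx /=; rewrite lee_fin; apply: le_trans (fg x Dx) _; exact: ler_norm.
Qed.

Lemma itgD f g : itg f -> itg g -> itg (fun x => f x + g x).
Proof. by move=> hf hg; have := integrableD mD hf hg; apply: itg_eq. Qed.

Lemma itgZ k f : itg f -> itg (fun x => k * f x).
Proof. by move=> hf; have := integrableZl mD k hf; apply: itg_eq. Qed.

Lemma itgN f : itg f -> itg (fun x => - f x).
Proof. by move=> hf; apply: itg_eq (itgZ (- 1) hf) => x _; rewrite mulN1r. Qed.

Lemma itgB f g : itg f -> itg g -> itg (fun x => f x - g x).
Proof. by move=> hf hg; apply: itgD => //; exact: itgN. Qed.

Lemma itg_norm f : itg f -> itg (fun x => `|f x|).
Proof. exact: integrable_norm. Qed.

Lemma itg0 : itg (fun=> 0). Proof. exact: integrable0. Qed.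

Lemma itg_sum (I : finType) (F : I -> T -> R) : (forall i, itg (F i)) -> itg (fun x => \sum_i F i x).
Proof.
move=> h; have : forall s : seq I, itg (fun x => \sum_(i <- s) F i x).
  elim=> [|i s IH]; first by apply: itg_eq itg0 => x _; rewrite big_nil.
  by apply: itg_eq (itgD (h i) IH) => x _; rewrite big_cons.
exact.
Qed.

Lemma eq_Er f g : (forall x, D x -> f x = g x) -> Er f = Er g.
Proof. by move=> h; apply: eq_Rintegral => x /set_mem; exact: h. Qed.

Lemma ErD f g : itg f -> itg g -> Er (fun x => f x + g x) = Er f + Er g.
Proof. exact: RintegralD. Qed.
Lemma ErB f g : itg f -> itg g -> Er (fun x => f x - g x) = Er f - Er g.
Proof. exact: RintegralB. Qed.
Lemma ErZ k f : itg f -> Er (fun x => k * f x) = k * Er f.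
Proof. exact: RintegralZl. Qed.
Lemma Er0 : Er (fun=> 0) = 0.
Proof. by rewrite /mEr Rintegral_cst // mul0r. Qed.
Lemma ErN f : itg f -> Er (fun x => - f x) = - Er f.
Proof.
by move=> h; rewrite -mulN1r -ErZ //; apply: eq_Er => x _; rewrite mulN1r.
Qed.
Lemma Er_sum (I : finType) (F : I -> T -> R) : (forall i, itg (F i)) ->
  Er (fun x => \sum_i F i x) = \sum_i Er (F i).
Proof.
move=> h; suff H (s : seq I) : itg (fun x => \sum_(i <- s) F i x) /\ Er (fun x => \sum_(i <- s) F i x) = \sum_(i <- s) Er (F i) by have [] := H (index_enum I).
elim: s => [|i s [IH1 IH2]].
  split; first by apply: itg_eq itg0 => x _; rewrite big_nil.
  by rewrite big_nil; transitivity (Er (fun=> 0)); [apply: eq_Er => x _; rewrite big_nil|exact: Er0].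
split; first by apply: itg_eq (itgD (h i) IH1) => x _; rewrite big_cons.
by rewrite big_cons -IH2 -ErD //; apply: eq_Er => x _; rewrite big_cons.
Qed.
Lemma Er_ge0 f : (forall x, D x -> 0 <= f x) -> 0 <= Er f.
Proof. exact: Rintegral_ge0. Qed.
Lemma Er_le f g : itg f -> itg g -> (forall x, D x -> f x <= g x) -> Er f <= Er g.
Proof. exact: le_Rintegral. Qed.
Lemma Er_norm f : itg f -> `|Er f| <= Er (fun x => `|f x|).
Proof. exact: le_normr_Rintegral. Qed.
Lemma ErE f : itg f -> (\int[mu]_(x in D) (f x)%:E)%E = (Er f)%:E.
Proof. by move=> h; rewrite /mEr /Rintegral fineK //; exact: integrable_fin_num. Qed.

Lemma ae_Er f g : measurable_fun D g -> itg f -> {ae mu, forall x, D x -> f x = g x} -> itg g /\ Er f = Er g.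
Proof.
move=> mg hf fg; have mf := itg_meas hf.
have E0 (h h' : T -> R) : measurable_fun D h -> measurable_fun D h' -> {ae mu, forall x, D x -> h x = h' x} ->
   (\int[mu]_(x in D) (h x)%:E = \int[mu]_(x in D) (h' x)%:E)%E.
  move=> mh mh' hh; apply: ae_eq_integral => //; try exact/measurable_EFinP.
  by apply: filterS hh => x hx Dx /=; rewrite hx.
split; last by rewrite /mEr /Rintegral (E0 _ _ mf mg fg).
apply/integrableP; split; first exact/measurable_EFinP.
have mn (h : T -> R) : measurable_fun D h -> measurable_fun D (fun x => `|h x|) by move=> mh; exact: measurableT_comp.
have H := E0 _ _ (mn _ mf) (mn _ mg).
rewrite -[X in (X < _)%E]/(\int[mu]_(x in D) (`|g x|)%:E)%E -H; last by apply: filterS fg => x hx Dx; rewrite hx.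
by case/integrableP: hf.
Qed.

Lemma Er_cvg (F : nat -> T -> R) f g : (forall n, measurable_fun D (F n)) -> measurable_fun D f -> itg g ->
  (forall n x, D x -> `|F n x| <= g x) -> (forall x, D x -> F n x @[n --> \oo] --> f x) ->
  Er (F n) @[n --> \oo] --> Er f.
Proof.
move=> mF mf ig Fg cF.
have c0 : {ae mu, forall x, D x -> (F n x)%:E @[n --> \oo] --> (f x)%:E}.
  by apply: aeW => x Dx; apply: cvg_EFin; [near=> n|exact: cF].
have c1 : {ae mu, forall x n, D x -> (`|(F n x)%:E| <= (g x)%:E)%E}.
  by apply: aeW => x n Dx; rewrite lee_fin; exact: Fg.
have [i1 _ c2] := dominated_convergence mD (fun n => (measurable_EFinP _ _).2 (mF n)) ((measurable_EFinP _ _).2 mf) c0 ig c1.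
rewrite ErE // in c2; exact: (fine_cvg c2).
Unshelve. all: by end_near. Qed.

End Expectation.

Section SquareIntegrable.
Context (dd : measure_display) (T : measurableType dd) (R : realType).
Variable P : probability T R.
Implicit Types (b f g h : T -> R).
Local Notation itg := (mitg P setT).
Local Notation Er := (mEr P setT).
Let mT : measurable [set: T]. Proof. exact: measurableT. Qed.

Definition L2 f := measurable_fun setT f /\ itg (fun w => f w ^+ 2).

Lemma Er_cst k : Er (fun=> k) = k.
Proof. rewrite /mEr Rintegral_cst //; have h := probability_setT P.
by transitivity (k * fine (1%:E : \bar R)); [congr (_ * fine _); exact: h|rewrite mulr1]. Qed.

Lemma itg_cst k : itg (fun=> k).
Proof. by apply: finite_measure_integrable_cst. Qed.

Lemma itg_bnd f K : measurable_fun setT f -> (forall w, `|f w| <= K) -> itg f.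
Proof. by move=> mf h; apply: (itg_le mT) _ _ (itg_cst K). Qed.

Lemma L2_mul f g : L2 f -> L2 g -> itg (fun w => f w * g w).
Proof.
move=> [mf f2] [mg g2]; apply: (itg_le mT) _ _ (itgD mT f2 g2); first exact: measurable_funM.
move=> w _; rewrite normrM -[f w ^+ 2]real_normK ?num_real // -[g w ^+ 2]real_normK ?num_real //.
by have := sqr_ge0 (`|f w| - `|g w|); have := normr_ge0 (f w); have := normr_ge0 (g w); nra.
Qed.

Lemma L2_bnd f K : measurable_fun setT f -> (forall w, `|f w| <= K) -> L2 f.
Proof.
move=> mf h; split => //; apply: (@itg_bnd _ (K ^+ 2)); first exact: measurable_funX.
move=> w; rewrite ger0_norm ?sqr_ge0 // -real_normK ?num_real // lerXn2r ?nnegrE //.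
exact: le_trans (h w).
Qed.

Lemma L2_cst k : L2 (fun=> k).
Proof. exact: (@L2_bnd _ `|k|). Qed.

Lemma L2_itg f : L2 f -> itg f.
Proof. by move=> hf; apply: (itg_eq mT) _ (L2_mul hf (L2_cst 1)) => // w _; rewrite mulr1. Qed.

Lemma L2_bndM b K f : measurable_fun setT b -> (forall w, `|b w| <= K) -> L2 f -> L2 (fun w => b w * f w).
Proof.
move=> mb hb [mf f2]; split; first exact: measurable_funM.
apply: (itg_le mT) _ _ (itgZ mT (K ^+ 2) f2); first by apply: measurable_funX; exact: measurable_funM.
move=> w _; rewrite ger0_norm ?sqr_ge0 // exprMn ler_wpM2r ?sqr_ge0 // -real_normK ?num_real //.
by rewrite lerXn2r ?nnegrE // (le_trans _ (hb w)).
Qed.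

Lemma L2Z k f : L2 f -> L2 (fun w => k * f w).
Proof. by apply: (@L2_bndM _ `|k|). Qed.

Lemma L2D f g : L2 f -> L2 g -> L2 (fun w => f w + g w).
Proof.
move=> hf hg; split; first by apply: measurable_funD; [case: hf|case: hg].
have h := itgD mT (itgD mT hf.2 hg.2) (itgZ mT 2 (L2_mul hf hg)).
by apply: (itg_eq mT) _ h => w _; ring.
Qed.

Lemma L2_ext f g : f =1 g -> L2 f -> L2 g. Proof. by move=> /funext ->. Qed.

Lemma L2B f g : L2 f -> L2 g -> L2 (fun w => f w - g w).
Proof. by move=> hf hg; apply: L2_ext (L2D hf (L2Z (- 1) hg)) => w; ring. Qed.

Lemma L2_sum (I : finType) (F : I -> T -> R) : (forall i, L2 (F i)) -> L2 (fun w => \sum_i F i w).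
Proof.
move=> h; have H (s : seq I) : L2 (fun w => \sum_(i <- s) F i w); last exact: H.
elim: s => [|i s IH]; first by apply: L2_ext (L2_cst 0) => w; rewrite big_nil.
by apply: L2_ext (L2D (h i) IH) => w; rewrite big_cons.
Qed.

Lemma L2_sqr_ge0 f : 0 <= Er (fun w => f w ^+ 2).
Proof. by apply: Er_ge0 => w _; exact: sqr_ge0. Qed.

Lemma Er_young f g k : 0 < k -> L2 f -> L2 g ->
  `|Er (fun w => f w * g w)| <= k * Er (fun w => f w ^+ 2) + k^-1 * Er (fun w => g w ^+ 2).
Proof.
move=> k0 hf hg; apply: le_trans (Er_norm mT (L2_mul hf hg)) _.
rewrite -ErZ // -?ErZ //; try by [case: hf|case: hg].
have f2 := itgZ mT k hf.2; have g2 := itgZ mT k^-1 hg.2.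
rewrite -ErD //; apply: Er_le => //; first exact/itg_norm/L2_mul.
  exact: itgD.
move=> w _; rewrite normrM -[f w ^+ 2]real_normK ?num_real // -[g w ^+ 2]real_normK ?num_real //.
move: (normr_ge0 (f w)) (normr_ge0 (g w)); move: `|f w| `|g w| => x y x0 y0.
have : 0 <= k^-1 * (k * x - y) ^+ 2 by rewrite mulr_ge0 ?sqr_ge0 // invr_ge0 ltW.
have -> : k^-1 * (k * x - y) ^+ 2 = k * x ^+ 2 + k^-1 * y ^+ 2 - 2 * (x * y) by field; rewrite gt_eqF.
by have := mulr_ge0 x0 y0; lra.
Qed.

Lemma Er_CS f g : L2 f -> L2 g ->
  Er (fun w => f w * g w) ^+ 2 <= Er (fun w => f w ^+ 2) * Er (fun w => g w ^+ 2).
Proof.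
move=> hf hg; set X := Er _; set F := Er _; set G := Er _.
have q (t : R) : 0 <= F - 2 * t * X + t ^+ 2 * G.
  have : 0 <= Er (fun w => (f w - t * g w) ^+ 2) by exact: L2_sqr_ge0.
  have -> : Er (fun w => (f w - t * g w) ^+ 2) = Er (fun w => (f w ^+ 2 + (- (2 * t)) * (f w * g w)) + t ^+ 2 * g w ^+ 2).
    by apply: eq_Er => w _; ring.
  have i1 := itgZ mT (- (2 * t)) (L2_mul hf hg); have i2 := itgZ mT (t ^+ 2) hg.2.
  by rewrite (ErD mT (itgD mT hf.2 i1) i2) (ErD mT hf.2 i1) (ErZ mT _ (L2_mul hf hg)) (ErZ mT _ hg.2) -/F -/G -/X mulNr.
have [G0|G0] := leP G 0.
  have GE : G = 0 by apply/eqP; rewrite eq_le G0 L2_sqr_ge0.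
  have [->|X0] := eqVneq X 0; first by rewrite expr0n /= GE mulr0.
  have := q ((F + 1) / (2 * X)); rewrite GE mulr0 addr0.
  have -> : 2 * ((F + 1) / (2 * X)) * X = F + 1 by field.
  lra.
have := q (X / G); have -> : F - 2 * (X / G) * X + (X / G) ^+ 2 * G = F - X ^+ 2 / G by field; rewrite gt_eqF.
by rewrite subr_ge0 ler_pdivrMr.
Qed.

Lemma L2P f : f \in Lfun P 2%:E <-> L2 f.
Proof.
split=> [hf|[mf f2]].
  split; last exact: Lfun2_integrable_sqr.
  by move: hf; rewrite inE => /andP[]; rewrite inE.
rewrite inE; apply/andP; split; first by rewrite inE.
rewrite inE /= /finite_norm Lnorm.unlock; apply: poweR_lty.
case/integrableP: f2 => _; apply: le_lt_trans; rewrite le_eqVlt; apply/orP; left; apply/eqP.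
apply: eq_integral => w _ /=; congr EFin.
by rewrite powR_mulrn ?normr_ge0 // normrX.
Qed.

Lemma norm2E f : L2 f -> norm2 P f = (Num.sqrt (Er (fun w => f w ^+ 2)))%:E.
Proof.
move=> [mf f2]; rewrite /norm2 Lnorm.unlock.
have -> : (\int[P]_x `|(EFin \o f) x| `^ 2 = \int[P]_x (f x ^+ 2)%:E)%E.
  apply: eq_integral => w _ /=; congr EFin.
  by rewrite powR_mulrn ?normr_ge0 // real_normK ?num_real.
by rewrite ErE //= powR12_sqrt // L2_sqr_ge0.
Qed.

Lemma expectationE f : itg f -> ('E_P[f] = (Er f)%:E)%E.
Proof. by move=> h; rewrite unlock ErE. Qed.

End SquareIntegrable.

(** * Shift invariance of the environment *)

Section Environment.
Variables (R : realType) (alpha beta : R) (hab : alpha <= beta) (d : nat).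
Local Notation Om := (Omega hab d).
Local Notation site := (site d).
Local Notation edge := (edge d).
Local Notation tau := (@Defs.shift R alpha beta hab d).
Implicit Types (w : Om) (x y z : site) (i : 'I_d).

Lemma cond_bnd w x i : alpha <= cond w x i <= beta.
Proof. by rewrite /cond; case: (w (x, i)). Qed.

Lemma cond_shift z w x i : cond (tau z w) x i = cond w (x + z) i.
Proof. by []. Qed.

Lemma shiftD y z w : tau y (tau z w) = tau (y + z) w.
Proof. by apply/funext => -[x i]; rewrite /tau /= addrA. Qed.

Lemma shift0 w : tau 0 w = w.
Proof. by apply/funext => -[x i]; rewrite /tau /= addr0. Qed.

Lemma shiftNK z w : tau z (tau (- z) w) = w.
Proof. by rewrite shiftD subrr shift0. Qed.

Lemma measurable_coord (e : edge) (A : set (conductance hab)) :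
  measurable A -> measurable ([set w | A (w e)] : set Om).
Proof. by move=> mA; apply: sub_sigma_algebra; exists e, A. Qed.

Lemma measurable_cond x i : measurable_fun setT (fun w : Om => cond w x i).
Proof.
move=> _ B mB; rewrite setTI.
apply: (@measurable_coord (x, i) (@conductance_val R alpha beta hab @^-1` B)).
by exists B => //; rewrite setTI.
Qed.

Lemma measurable_shift z : measurable_fun setT (tau z).
Proof.
apply: (@measurability _ _ Om Om setT (tau z) (@cylinders R alpha beta hab d)) => //.
move=> _ [_ [e [A [mA ->]] <-]]; rewrite setTI.
exact: (@measurable_coord (e.1 + z, e.2)).
Qed.

HB.instance Definition _ z := isMeasurableFun.Build _ _ _ _ (tau z) (measurable_shift z).

(* Finite-dimensional cylinders: the pi-system on which a product measure is prescribed. *)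
Definition fcyl (s : seq edge) (A : edge -> set (conductance hab)) : set Om :=
  [set w | forall e, e \in s -> A e (w e)].
Definition fcyls : set (set Om) :=
  [set C | exists s A, [/\ uniq s, forall e, measurable (A e) & C = fcyl s A]].

Lemma fcyl_nil A : fcyl [::] A = setT.
Proof. by apply/seteqP; split. Qed.

Lemma fcyl_cons e s A : fcyl (e :: s) A = [set w | A e (w e)] `&` fcyl s A.
Proof.
apply/seteqP; split => w /= h.
  by split; [apply: h; rewrite mem_head|move=> e' es; apply: h; rewrite inE es orbT].
by move=> e'; rewrite inE => /orP[/eqP ->|]; [exact: h.1|exact: h.2].
Qed.

Lemma fcyl_measurable s A : (forall e, measurable (A e)) -> measurable (fcyl s A).
Proof.
move=> mA; elim: s => [|e s IH]; first by rewrite fcyl_nil; exact: measurableT.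
by rewrite fcyl_cons; apply: measurableI => //; exact: measurable_coord.
Qed.

Lemma fcyls_setI : setI_closed fcyls.
Proof.
move=> _ _ [s [A [us mA ->]]] [t [B [ut mB ->]]].
pose C e := (if e \in s then A e else setT) `&` (if e \in t then B e else setT).
exists (undup (s ++ t)), C; split; first exact: undup_uniq.
  by move=> e; apply: measurableI; case: ifP => _ //; exact: measurableT.
apply/seteqP; split => w /=.
  by move=> [h1 h2] e _; split; case: ifP => // es; [exact: h1|exact: h2].
move=> h; split => e es.
  by have := h e; rewrite mem_undup mem_cat es /= => /(_ isT) []; rewrite es.
by have := h e; rewrite mem_undup mem_cat es orbT => /(_ isT) [_]; rewrite es.
Qed.

Lemma fcyls_gen : @measurable _ Om = <<s fcyls >>.
Proof.
apply/seteqP; split.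
  apply: smallest_sub; first exact: smallest_sigma_algebra.
  move=> _ [e [A [mA ->]]]; apply: sub_sigma_algebra; exists [:: e], (fun=> A); split => //.
  by rewrite fcyl_cons fcyl_nil setIT.
apply: smallest_sub; first exact: sigma_algebra_measurable.
by move=> _ [s [A [_ mA ->]]]; exact: fcyl_measurable.
Qed.

Variables (nu : probability (conductance hab) R) (P : probability Om R).
Hypothesis hP : product_measure nu P.

Lemma P_fcyl s A : uniq s -> (forall e, measurable (A e)) -> P (fcyl s A) = (\prod_(e <- s) nu (A e))%E.
Proof. exact: hP. Qed.

(** A shift permutes the edges, so it maps cylinders to cylinders of the same probability; these
    form a generating pi-system. *)
Lemma P_shift z (B : set Om) : measurable B -> P (tau z @^-1` B) = P B.
Proof.
move=> mB.
have := @measure_unique _ R Om fcyls (fun=> setT) fcyls_gen fcyls_setI _ _ (pushforward P (tau z)) P _ _ B mB; apply.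
- by move=> _; exists [::], (fun=> setT); split => //; rewrite fcyl_nil.
- by rewrite bigcup_const.
- move=> _ [s [A [us mA ->]]]; transitivity (\prod_(e <- s) nu (A e))%E; last by symmetry; exact: P_fcyl.
  rewrite -[LHS]/(P (tau z @^-1` fcyl s A)).
  pose h (e : edge) : edge := (e.1 + z, e.2); pose h' (e : edge) : edge := (e.1 - z, e.2).
  have hK : cancel h h' by move=> [x i]; rewrite /h /h' /= addrK.
  have h'K : cancel h' h by move=> [x i]; rewrite /h /h' /= subrK.
  have -> : tau z @^-1` fcyl s A = fcyl (map h s) (A \o h').
    apply/seteqP; split => w /= H e.
      by case/mapP => e' es -> /=; rewrite hK; exact: H.
    by move=> es; have := H (h e) (map_f h es); rewrite /= hK.
  rewrite P_fcyl; last by move=> e; exact: mA.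
    by rewrite big_map; apply: eq_bigr => e _; rewrite /= hK.
  by rewrite map_inj_uniq //; exact: can_inj hK.
- by move=> _; have : (P setT < +oo)%E by rewrite probability_setT ltry.
Qed.

Local Notation itg := (mitg P setT).
Local Notation Er := (mEr P setT).
Local Notation L2 := (L2 P).
Implicit Types (f g : Om -> R).

Lemma measurable_comp_shift z f : measurable_fun setT f -> measurable_fun setT (fun w => f (tau z w)).
Proof. by move=> mf; apply: (measurableT_comp mf); exact: measurable_shift. Qed.

Let int_shift z (f : Om -> \bar R) : measurable_fun setT f ->
  (forall w, 0 <= f w)%E -> (\int[P]_w f (tau z w) = \int[P]_w f w)%E.
Proof.
move=> mf f0; rewrite -[LHS](@ge0_integral_pushforward _ _ _ _ _ _ (measurable_shift z) P setT f) //.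
by apply: eq_measure_integral => A mA _; exact: P_shift.
Qed.

Lemma itg_shift z f : itg f -> itg (fun w => f (tau z w)).
Proof.
move=> hf; have mf := itg_meas hf; apply/integrableP; split.
  by apply/measurable_EFinP; exact: measurable_comp_shift.
have := int_shift z (f := fun w => `|f w|%:E); move=> /= ->; first by case/integrableP: hf.
- by apply/measurable_EFinP; exact: measurableT_comp.
- by move=> w; rewrite lee_fin.
Qed.

Lemma Er_shift z f : itg f -> Er (fun w => f (tau z w)) = Er f.
Proof.
move=> hf; have mf := itg_meas hf; have mT : measurable [set: Om] := measurableT.
have pos g : itg g -> (forall w, 0 <= g w) -> Er (fun w => g (tau z w)) = Er g.
  move=> hg g0; rewrite /mEr /Rintegral (int_shift z (f := fun w => (g w)%:E)) //.
    by apply/measurable_EFinP; exact: itg_meas hg.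
have ip : itg (fun w => `|f w| + f w) by apply: itgD => //; exact: itg_norm.
have := pos _ ip; rewrite (ErD mT (itg_norm hf) hf).
have hs := itg_shift z hf; rewrite (ErD mT (itg_norm hs) hs) (pos (fun w => `|f w|)) //; last exact: itg_norm.
by move=> H; apply: (@addrI _ (Er (fun w => `|f w|))); apply: H => w; have := ler_norm (- f w); rewrite normrN; lra.
Qed.

Lemma L2_shift z f : L2 f -> L2 (fun w => f (tau z w)).
Proof.
by move=> [mf f2]; split; [exact: measurable_comp_shift|exact: (itg_shift z f2)].
Qed.

End Environment.

(** * From cylinders to square-integrable functions *)

Section Closure.
Variables (R : realType) (alpha beta : R) (hab : alpha <= beta) (d : nat).
Local Notation Om := (Omega hab d).
Variable P : probability Om R.
Local Notation itg := (mitg P setT).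
Local Notation Er := (mEr P setT).
Local Notation L2 := (L2 P).
Implicit Types (f g : Om -> R).
Let mT : measurable [set: Om]. Proof. exact: measurableT. Qed.

Lemma L2_indic (B : set Om) : measurable B -> L2 (\1_B).
Proof.
move=> mB; apply: (@L2_bnd _ _ _ _ _ 1); first exact: measurable_indic.
by move=> w; rewrite indicE; case: (w \in B); rewrite ?normr1 ?normr0.
Qed.

Lemma Er_indic (B : set Om) : measurable B -> Er (\1_B) = fine (P B).
Proof. by move=> mB; rewrite /mEr /Rintegral integral_indic // setIT. Qed.

Lemma sum_level M (z : R) : 0 <= z -> \sum_(j < M) ((j.+1%:R : R) <= z)%R%:R = (minn M (Num.truncn z))%:R :> R.
Proof.
move=> z0; elim: M => [|M IH]; first by rewrite big_ord0 min0n.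
rewrite big_ord_recr /= IH -truncn_ge_nat // -natrD; congr _%:R.
by case: leqP => h; rewrite ?addn1 ?addn0; lia.
Qed.

Variable Q : (Om -> R) -> Prop.
Hypothesis QD : forall f g, L2 f -> L2 g -> Q f -> Q g -> Q (fun w => f w + g w).
Hypothesis QZ : forall k f, L2 f -> Q f -> Q (fun w => k * f w).
Hypothesis Qcl : forall f, L2 f -> (forall eps, 0 < eps -> exists g, [/\ L2 g, Q g & Er (fun w => (f w - g w) ^+ 2) <= eps]) -> Q f.
Hypothesis Qcyl : forall s A, uniq s -> (forall e, measurable (A e)) -> Q (\1_(fcyl s A)).

Lemma Q_cvg f (F : nat -> Om -> R) : L2 f -> (forall n, L2 (F n)) -> (forall n, Q (F n)) ->
  Er (fun w => (f w - F n w) ^+ 2) @[n --> \oo] --> 0 -> Q f.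
Proof.
move=> hf hF QF /cvgrPdist_le cv; apply: Qcl => // eps eps0.
have [n _ /(_ n (leqnn n))] := cv _ eps0.
rewrite /= sub0r normrN ger0_norm ?L2_sqr_ge0 // => h.
by exists (F n).
Qed.

Lemma Q_indic (B : set Om) : measurable B -> Q (\1_B).
Proof.
move=> mB; have Q1 : Q (\1_[set: Om]).
  by have := @Qcyl [::] (fun=> setT) isT (fun=> measurableT); rewrite fcyl_nil.
move: B mB; rewrite (@fcyls_gen R alpha beta hab d); move=> B sB.
apply: (@dynkin_induction _ Om (@fcyls R alpha beta hab d) (fun B => Q (\1_B))) sB => //.
- exact: fcyls_gen.
- exact: fcyls_setI.
- by move=> _ [s [A [us mA ->]]]; exact: Qcyl.
- move=> S mS QS; have := QD (L2_indic mT) (L2Z (- 1) (L2_indic mS)) Q1 (QZ (-1) (L2_indic mS) QS).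
  suff -> : (fun w : Om => \1_[set: Om] w + - 1 * \1_S w) = \1_(~` S) :> (Om -> R) by [].
  by apply/funext => w; rewrite !indicE in_setT in_setC; case: (w \in S) => /=; ring.
move=> F mF tF QF; pose U n := \bigcup_(k < n) F k.
have mU n : measurable (U n) by apply: bigcup_measurable.
have mUF : measurable (\bigcup_k F k) by exact: bigcupT_measurable.
have U0 : U 0%N = set0 by rewrite /U -subset0 => w [].
have US n : \1_(U n.+1) = (fun w => \1_(U n) w + \1_(F n) w) :> (Om -> R).
  apply/funext => w; rewrite !indicE; have [Fw|Fw] := pselect (F n w).
    rewrite (mem_set Fw) (memNset (A := U n)) ?(mem_set (A := U n.+1)) ?add0r //; first by exists n => /=.
    move=> [k /= kn Fk]; have := @tF k n I I; move=> /(_ (ex_intro _ w (conj Fk Fw))) E.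
    by rewrite E ltnn in kn.
  rewrite (memNset Fw) addr0; congr ((_ : bool)%:R); apply/idP/idP => /set_mem [k /= kn Fk]; apply/mem_set.
    by exists k => //=; move: kn; rewrite ltnS leq_eqVlt => /orP[/eqP E|//]; rewrite E in Fk.
  by exists k => //=; exact: ltnW.
have QU n : Q (\1_(U n)).
  elim: n => [|n IH]; last by rewrite US; apply: QD => //; exact: L2_indic.
  rewrite U0; have := QZ 0 (L2_indic mT) Q1; suff -> : (fun w : Om => 0 * \1_[set: Om] w) = \1_set0 :> (Om -> R) by [].
  by apply/funext => w; rewrite mul0r indicE in_set0.
apply: (Q_cvg (L2_indic mUF) (fun n => L2_indic (mU n)) QU).
rewrite -(@Er_cst _ _ _ P 0); apply: (Er_cvg mT _ _ (itg_cst P 1)) => //.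
- by move=> n; apply: measurable_funX; apply: measurable_funB; exact: measurable_indic.
- move=> n w _; rewrite !indicE; case: (w \in _); case: (w \in _); rewrite /= ?subrr ?subr0 ?sub0r ?sqrrN ?expr1n ?expr0n /= ?normr1 ?normr0 //.
move=> w _; have [[k _ Fk]|nF] := pselect ((\bigcup_k F k) w).
  apply: cvg_near_cst; near=> n; have kn : (k < n)%N by near: n; exact: nbhs_infty_gt.
  rewrite !indicE (mem_set (A := U n)); last by exists k.
  by rewrite (mem_set (A := \bigcup_k F k)) ?subrr ?expr0n //; exists k.
apply: cvg_near_cst; near=> n; rewrite !indicE (memNset nF) (memNset (A := U n)) ?subrr ?expr0n //.
by move=> [k _ Fk]; apply: nF; exists k.
Unshelve. all: by end_near. Qed.

(** Approximation from below by the truncated values of floor(N f)/N, written as averages of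
    indicators of level sets through [sum_level]. *)
Lemma Q_nonneg f : L2 f -> (forall w, 0 <= f w) -> Q f.
Proof.
move=> hf f0; have [mf f2] := hf.
pose A N j := [set w : Om | j.+1%:R <= N.+1%:R * f w].
have mA N j : measurable (A N j).
  have -> : A N j = setT `&` (fun w => N.+1%:R * f w) @^-1` `[j.+1%:R, +oo[%classic.
    by apply/seteqP; split => w /=; rewrite ?in_itv /= ?andbT; [|case].
  by apply: measurable_funM => //; exact: measurable_itv.
pose F (N : nat) (w : Om) : R := N.+1%:R^-1 * \sum_(j < N.+1 * N.+1) \1_(A N j) w.
have FE N w : F N w = N.+1%:R^-1 * (minn (N.+1 * N.+1) (Num.truncn (N.+1%:R * f w)))%:R.
  rewrite /F -sum_level ?mulr_ge0 //; congr (_ * _); apply: eq_bigr => j _; rewrite indicE; congr ((_ : bool)%:R).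
  by apply/idP/idP => [/set_mem|h] //; apply/mem_set.
have LF N : L2 (F N) by apply: L2Z; apply: L2_sum => j; exact: L2_indic.
have QF N : Q (F N).
  have H n : Q (fun w => \sum_(j < n) \1_(A N j) w) /\ L2 (fun w => \sum_(j < n) \1_(A N j) w).
    elim: n => [|n [IH1 IH2]].
      split; last by apply: L2_sum => j; exact: L2_indic.
      have := QZ 0 (L2_indic mT) (Q_indic mT); suff -> : (fun w : Om => 0 * \1_[set: Om] w) = (fun w : Om => \sum_(j < 0) \1_(A N j) w) :> (Om -> R) by [].
      by apply/funext => w; rewrite mul0r big_ord0.
    have E : (fun w : Om => \sum_(j < n.+1) \1_(A N j) w) = (fun w => (\sum_(j < n) \1_(A N j) w) + \1_(A N n) w) :> (Om -> R).
      by apply/funext => w; rewrite big_ord_recr.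
    rewrite E; split; [apply: QD => //; [exact: L2_indic|exact: Q_indic]|apply: L2D => //; exact: L2_indic].
  by apply: QZ; [exact: (H _).2|exact: (H _).1].
have N0 N : 0 < N.+1%:R :> R by rewrite ltr0n.
have F0 N w : 0 <= F N w by rewrite FE mulr_ge0 ?invr_ge0.
have Fle N w : F N w <= f w.
  rewrite FE ler_pdivrMl //; apply: (@le_trans _ _ (Num.truncn (N.+1%:R * f w))%:R).
    by rewrite ler_nat geq_minr.
  by rewrite truncn_le mulr_ge0.
apply: (Q_cvg hf LF QF); rewrite -(@Er_cst _ _ _ P 0); apply: (Er_cvg mT _ _ f2) => //.
- by move=> n; apply: measurable_funX; apply: measurable_funB => //; case: (LF n).
- move=> n w _; rewrite ger0_norm ?sqr_ge0 //; apply: sqr_mono; first by rewrite subr_ge0.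
  by rewrite gerBl.
move=> w _; apply/cvgrPdist_le => eps eps0; near=> N.
rewrite sub0r normrN ger0_norm ?sqr_ge0 //.
have fN : f w <= N.+1%:R.
  apply: (@le_trans _ _ N%:R); last by rewrite ler_nat.
  by near: N; exact: nbhs_infty_ger.
have iN : N.+1%:R^-1 <= eps by apply: ltW; near: N; exact: (near_infty_natSinv_lt (PosNum eps0)).
have i1 : N.+1%:R^-1 <= 1 :> R by rewrite invf_le1 // ler1n.
have i0 : 0 <= N.+1%:R^-1 :> R by rewrite invr_ge0.
have d1 : f w - F N w <= N.+1%:R^-1.
  rewrite FE; have -> : minn (N.+1 * N.+1) (Num.truncn (N.+1%:R * f w)) = Num.truncn (N.+1%:R * f w).
    apply/minn_idPr; rewrite -ltnS -(ltr_nat R); apply: (@le_lt_trans _ _ (N.+1%:R * f w)).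
      by rewrite truncn_le mulr_ge0.
    apply: (@le_lt_trans _ _ (N.+1 * N.+1)%:R); last by rewrite ltr_nat.
    by rewrite natrM ler_pM2l.
  set t := Num.truncn _; have ht : N.+1%:R * f w < t%:R + 1 by rewrite natr1; exact: truncnS_gt.
  by rewrite lerBlDr -{1}[N.+1%:R^-1]mulr1 -mulrDr ler_pdivlMl // addrC ltW.
have d0 : 0 <= f w - F N w by rewrite subr_ge0.
apply: le_trans iN; apply: le_trans (sqr_mono d0 d1) _.
by rewrite expr2 ler_piMl.
Unshelve. all: by end_near. Qed.

(** Dynkin's theorem passes from cylinders to events, simple functions from events to nonnegative
    functions, and [f] is a difference of two of these. It serves to prove mixing. *)
Lemma L2_closure f : L2 f -> Q f.
Proof.
move=> hf; have [mf f2] := hf.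
have ha : L2 (fun w => `|f w|).
  split; first exact: measurableT_comp.
  by apply: (itg_eq mT) _ f2 => w _; rewrite real_normK ?num_real.
have p1 : Q (fun w => `|f w|) by apply: Q_nonneg.
have p2 : Q (fun w => `|f w| + f w).
  by apply: Q_nonneg => [|w]; [exact: L2D|have := ler_norm (- f w); rewrite normrN; lra].
have := QD (L2D ha hf) (L2Z (- 1) ha) p2 (QZ (-1) ha p1).
by suff -> : (fun w => `|f w| + f w + - 1 * `|f w|) = f by []; apply/funext => w; ring.
Qed.

End Closure.

Section Mixing.
Variables (R : realType) (alpha beta : R) (hab : alpha <= beta) (d : nat).
Local Notation Om := (Omega hab d).
Local Notation site := (site d).
Local Notation edge := (edge d).
Local Notation tau := (@Defs.shift R alpha beta hab d).
Variables (nu : probability (conductance hab) R) (P : probability Om R).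
Hypothesis hP : product_measure nu P.
Variable i0 : 'I_d.
Local Notation itg := (mitg P setT).
Local Notation Er := (mEr P setT).
Local Notation L2 := (L2 P).
Implicit Types (f g : Om -> R).
Let mT : measurable [set: Om]. Proof. exact: measurableT. Qed.
Local Notation ev k := (unit_vec i0 *+ k).

Definition corr k f g : R := Er (fun w => f (tau (ev k) w) * g w) - Er f * Er g.

Let sh k f : L2 f -> L2 (fun w => f (tau (ev k) w)). Proof. exact: (L2_shift hP). Qed.

Lemma Er_sqr_le f : L2 f -> Er f ^+ 2 <= Er (fun w => f w ^+ 2).
Proof.
move=> hf; have -> : Er f = Er (fun w => f w * 1) by apply: eq_Er => w _; rewrite mulr1.
have := Er_CS hf (L2_cst P 1).
have -> : Er (fun=> 1 ^+ 2) = 1 by rewrite expr1n Er_cst.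
by rewrite mulr1.
Qed.

Lemma corr_le k f g : L2 f -> L2 g -> `|corr k f g| <= 2 * Num.sqrt (Er (fun w => f w ^+ 2) * Er (fun w => g w ^+ 2)).
Proof.
move=> hf hg; set X := Er _ * Er _.
have X0 : 0 <= X by rewrite mulr_ge0 // L2_sqr_ge0.
have sq (x : R) : x ^+ 2 <= X -> `|x| <= Num.sqrt X.
  by move=> h; rewrite -sqrtr_sqr; exact: ler_wsqrtr.
apply: le_trans (ler_normB _ _) _; rewrite mulrDl mul1r; apply: lerD; apply: sq.
  have := Er_CS (sh k hf) hg; rewrite (Er_shift hP (ev k) hf.2); exact.
by rewrite exprMn; apply: ler_pM; rewrite ?sqr_ge0 ?Er_sqr_le.
Qed.

Lemma corrDl k f f' g : L2 f -> L2 f' -> L2 g -> corr k (fun w => f w + f' w) g = corr k f g + corr k f' g.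
Proof.
move=> hf hf' hg; rewrite /corr (ErD mT (L2_itg hf) (L2_itg hf')).
have -> : Er (fun w => (f (tau (ev k) w) + f' (tau (ev k) w)) * g w) = Er (fun w => f (tau (ev k) w) * g w + f' (tau (ev k) w) * g w).
  by apply: eq_Er => w _; ring.
rewrite ErD //; [ring|exact: L2_mul (sh k hf) hg|exact: L2_mul (sh k hf') hg].
Qed.
Lemma corrZl k c f g : L2 f -> L2 g -> corr k (fun w => c * f w) g = c * corr k f g.
Proof.
move=> hf hg; rewrite /corr (ErZ mT c (L2_itg hf)).
have -> : Er (fun w => c * f (tau (ev k) w) * g w) = Er (fun w => c * (f (tau (ev k) w) * g w)).
  by apply: eq_Er => w _; ring.
rewrite ErZ //; [ring|exact: L2_mul (sh k hf) hg].
Qed.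
Lemma corrDr k f g g' : L2 f -> L2 g -> L2 g' -> corr k f (fun w => g w + g' w) = corr k f g + corr k f g'.
Proof.
move=> hf hg hg'; rewrite /corr (ErD mT (L2_itg hg) (L2_itg hg')).
have -> : Er (fun w => f (tau (ev k) w) * (g w + g' w)) = Er (fun w => f (tau (ev k) w) * g w + f (tau (ev k) w) * g' w).
  by apply: eq_Er => w _; ring.
rewrite ErD //; [ring|exact: L2_mul (sh k hf) hg|exact: L2_mul (sh k hf) hg'].
Qed.
Lemma corrZr k c f g : L2 f -> L2 g -> corr k f (fun w => c * g w) = c * corr k f g.
Proof.
move=> hf hg; rewrite /corr (ErZ mT c (L2_itg hg)).
have -> : Er (fun w => f (tau (ev k) w) * (c * g w)) = Er (fun w => c * (f (tau (ev k) w) * g w)).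
  by apply: eq_Er => w _; ring.
rewrite ErZ //; [ring|exact: L2_mul (sh k hf) hg].
Qed.

Lemma cvg0_approx (b : nat -> R) : (forall eps, 0 < eps -> exists b' : nat -> R, (forall k, `|b k - b' k| <= eps) /\ b' k @[k --> \oo] --> 0) ->
  b k @[k --> \oo] --> 0.
Proof.
move=> h; apply/cvgrPdist_le => eps eps0.
have e2 : 0 < eps / 2 by rewrite divr_gt0.
have [b' [bb /cvgrPdist_le cb]] := h _ e2.
near=> k; have := bb k; have : `|0 - b' k| <= eps / 2 by near: k; exact: cb.
rewrite !sub0r !normrN => h1 h2.
have := ler_normD (b k - b' k) (b' k); rewrite subrK; lra.
Unshelve. all: by end_near. Qed.

Lemma sqrt_small (G eps : R) : 0 <= G -> 0 < eps -> exists2 del, 0 < del & forall x, 0 <= x <= del -> 2 * Num.sqrt (x * G) <= eps.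
Proof.
move=> G0 eps0; have G1 : 0 < G + 1 by lra.
exists ((eps / 2) ^+ 2 / (G + 1)); first by rewrite divr_gt0 // exprn_gt0 // divr_gt0.
move=> x /andP[x0]; rewrite ler_pdivlMr // => hx.
have : Num.sqrt (x * G) <= Num.sqrt ((eps / 2) ^+ 2) by apply: ler_wsqrtr; apply: le_trans hx; rewrite ler_wpM2l //; lra.
rewrite sqrtr_sqr ger0_norm; lra.
Qed.

Lemma P_fcyl_disjoint s t A B : uniq s -> uniq t -> (forall e, measurable (A e)) -> (forall e, measurable (B e)) ->
  (forall e, e \in s -> e \notin t) -> P (@fcyl R alpha beta hab d s A `&` fcyl t B) = (P (fcyl s A) * P (fcyl t B))%E.
Proof.
move=> us ut mA mB dis; pose C e := if e \in s then A e else B e.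
have mC e : measurable (C e) by rewrite /C; case: ifP.
have -> : fcyl s A `&` fcyl t B = fcyl (s ++ t) C.
  apply/seteqP; split => w /=.
    move=> [h1 h2] e; rewrite mem_cat /C => /orP[es|et]; first by rewrite es; exact: h1.
    by case: ifP => [es|_]; [exact: h1|exact: h2].
  move=> h; split => e es; have := h e; rewrite mem_cat es ?orbT /C.
    by rewrite es; apply.
  by move=> /(_ isT); case: ifP => // /dis; rewrite es.
rewrite (P_fcyl hP) //; last first.
  by rewrite cat_uniq us ut andbT /=; apply/hasPn => e et; apply/negP => /dis; rewrite et.
rewrite big_cat /= !(P_fcyl hP) //; congr (_ * _)%E; rewrite big_seq [RHS]big_seq; apply: eq_bigr => e es; rewrite /C.
  by rewrite es.
by case: ifP => // /dis; rewrite es.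
Qed.

(** A far translate of a finite set of edges is disjoint from any given finite set, so the
    correlation is eventually zero. *)
Lemma corr_cyl s A t B : uniq s -> uniq t -> (forall e, measurable (A e)) -> (forall e, measurable (B e)) ->
  corr k (\1_(fcyl s A)) (\1_(fcyl t B)) @[k --> \oo] --> 0.
Proof.
move=> us ut mA mB; have mF := @fcyl_measurable R alpha beta hab d s A mA; have mG := @fcyl_measurable R alpha beta hab d t B mB.
pose h k (e : edge) : edge := (e.1 + ev k, e.2); pose h' k (e : edge) : edge := (e.1 - ev k, e.2).
have hK k : cancel (h k) (h' k) by move=> [x i]; rewrite /h /h' /= addrK.
pose K : nat := (\sum_(e <- s) absz (e.1 0%R i0) + \sum_(e <- t) absz (e.1 0%R i0))%N.
have bd (r : seq edge) e : e \in r -> (absz (e.1 0%R i0) <= \sum_(e <- r) absz (e.1 0%R i0))%N.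
  move=> er; rewrite (big_rem e er) /=; exact: leq_addr.
apply: cvg_near_cst; near=> k; have kK : (K < k)%N by near: k; exact: nbhs_infty_gt.
rewrite /corr; have -> : Er (fun w => \1_(fcyl s A) (tau (ev k) w) * \1_(fcyl t B) w) = Er (\1_(fcyl (map (h k) s) (A \o h' k) `&` fcyl t B)).
  apply: eq_Er => w _; rewrite indicI /=; congr (_ * _); rewrite !indicE; congr ((_ : bool)%:R).
  apply/idP/idP => /set_mem H; apply/mem_set => /=.
    by move=> e /mapP[e' es ->] /=; rewrite hK; exact: H.
  by move=> e es; have := H _ (map_f (h k) es); rewrite /= hK.
have us' : uniq (map (h k) s) by rewrite map_inj_uniq //; exact: can_inj (hK k).
have mA' e : measurable ((A \o h' k) e) by exact: mA.
rewrite !Er_indic //; last by apply: measurableI => //; exact: fcyl_measurable.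
rewrite P_fcyl_disjoint //; last first.
  move=> _ /mapP[e es ->]; apply/negP => et.
  have h1 := bd _ _ es; have h2 := bd _ _ et.
  have : (K < k)%N := kK; rewrite ltnNge => /negP; apply.
  have E : ((h k e).1 0 i0 = e.1 0 i0 + k%:Z)%R.
    by rewrite /h /= !mxE mulmxnE /unit_vec mxE !eqxx /= -natz.
  rewrite E in h2; apply: leq_trans (leq_add h1 h2).
  by move: (e.1 0 i0); clear; lia.
have -> : P (fcyl (map (h k) s) (A \o h' k)) = P (fcyl s A).
  rewrite !(P_fcyl hP) // big_map; apply: eq_bigr => e _; by rewrite /= hK.
by rewrite fineM ?fin_num_measure // subrr.
Unshelve. all: by end_near. Qed.

Lemma corr_cvg0 f g : L2 f -> L2 g -> corr k f g @[k --> \oo] --> 0.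
Proof.
have one t B : uniq t -> (forall e, measurable (B e)) -> forall f, L2 f -> corr k f (\1_(fcyl t B)) @[k --> \oo] --> 0.
  move=> ut mB; have hg := L2_indic P (@fcyl_measurable R alpha beta hab d t B mB).
  apply: L2_closure => [f1 f2 h1 h2 c1 c2|c f1 h1 c1|f1 h1 ap|s A us mA]; last exact: corr_cyl.
  - by under eq_fun => k do rewrite corrDl //; rewrite -[0]addr0; exact: cvgD.
  - by under eq_fun => k do rewrite corrZl //; rewrite -(mulr0 c); apply: cvgMr.
  apply: cvg0_approx => eps eps0.
  have [del del0 hdel] := sqrt_small (L2_sqr_ge0 P (\1_(fcyl t B))) eps0.
  have [g' [hg' cg' Eg']] := ap _ del0; exists (fun k => corr k g' (\1_(fcyl t B))); split => // k.
  have hb := L2B h1 hg'.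
  have -> : corr k f1 (\1_(fcyl t B)) - corr k g' (\1_(fcyl t B)) = corr k (fun w => f1 w - g' w) (\1_(fcyl t B)).
    have -> : (fun w => f1 w - g' w) = (fun w => f1 w + (-1) * g' w) by apply/funext => w; ring.
    by rewrite corrDl ?corrZl //; [ring|exact: L2Z].
  by apply: le_trans (corr_le k hb hg) _; apply: hdel; rewrite L2_sqr_ge0.
move=> hf hg; move: f hf; apply: (@L2_closure R alpha beta hab d P (fun g => forall f, L2 f -> corr k f g @[k --> \oo] --> 0)) g hg.
- move=> f1 f2 h1 h2 c1 c2 f hf; under eq_fun => k do rewrite corrDr //; rewrite -[0]addr0; apply: cvgD; [exact: c1|exact: c2].
- by move=> c f1 h1 c1 f hf; under eq_fun => k do rewrite corrZr //; rewrite -(mulr0 c); apply: cvgMr; exact: c1.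
- move=> g hg ap f hf; apply: cvg0_approx => eps eps0.
  have [del del0 hdel] := sqrt_small (L2_sqr_ge0 P f) eps0.
  have [g' [hg' cg' Eg']] := ap _ del0; exists (fun k => corr k f g'); split => [k|]; last exact: cg'.
  have hb := L2B hg hg'.
  have -> : corr k f g - corr k f g' = corr k f (fun w => g w - g' w).
    have -> : (fun w => g w - g' w) = (fun w => g w + (-1) * g' w) by apply/funext => w; ring.
    by rewrite corrDr ?corrZr //; [ring|exact: L2Z].
  apply: le_trans (corr_le k hf hb) _; rewrite [X in Num.sqrt X]mulrC; apply: hdel; by rewrite L2_sqr_ge0.
- by move=> s A us mA f hf; exact: one.
Qed.

Lemma mixing f g : L2 f -> L2 g -> Er (fun w => f (tau (ev k) w) * g w) @[k --> \oo] --> Er f * Er g.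
Proof.
move=> hf hg; have := corr_cvg0 hf hg => h.
have -> : (fun k => Er (fun w => f (tau (ev k) w) * g w)) = (fun k => corr k f g + Er f * Er g).
  by apply/funext => k; rewrite subrK.
by rewrite -[X in _ --> X]add0r; apply: cvgD => //; exact: cvg_cst.
Qed.

End Mixing.

(** * The generator on the space of environments *)

Section Generator.
Variables (R : realType) (alpha beta : R) (alpha_gt0 : 0 < alpha) (hab : alpha <= beta) (d : nat) (d_gt0 : (0 < d)%N).
Local Notation Om := (Omega hab d).
Local Notation site := (site d).
Local Notation tau := (@Defs.shift R alpha beta hab d).
Variables (nu : probability (conductance hab) R) (P : probability Om R).
Hypothesis hP : product_measure nu P.
Local Notation itg := (mitg P setT).
Local Notation Er := (mEr P setT).
Local Notation L2 := (L2 P).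
Local Notation Lop := (@opL R alpha beta hab d).
Local Notation c := (cst d beta).
Local Notation av := (@unit_vec d).
Implicit Types (f g : Om -> R) (i : 'I_d).
Let mT : measurable [set: Om]. Proof. exact: measurableT. Qed.
Let c0 : 0 < c := cst_gt0 d_gt0 alpha_gt0 hab.
Let b0 : 0 < beta := beta_gt0 alpha_gt0 hab.

Definition Dd i f (w : Om) : R := f (tau (av i) w) - f w.
Definition a0 i (w : Om) : R := cond w 0 i.

Lemma a0_bnd i w : alpha <= a0 i w <= beta. Proof. exact: cond_bnd. Qed.
Lemma a0_ge0 i w : 0 <= a0 i w.
Proof. by case/andP: (a0_bnd i w) => h _; exact: le_trans (ltW alpha_gt0) h. Qed.
Lemma a0_norm i w : `|a0 i w| <= beta.
Proof. by rewrite ger0_norm ?a0_ge0 //; case/andP: (a0_bnd i w). Qed.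
Lemma a0_meas i : measurable_fun setT (a0 i). Proof. exact: measurable_cond. Qed.
Lemma a0_tau i w : a0 i (tau (- av i) w) = cond w (- av i) i.
Proof. by rewrite /a0 cond_shift add0r. Qed.

Lemma L2_a0 i : L2 (a0 i). Proof. exact: L2_bnd (a0_meas i) (a0_norm i). Qed.
Lemma L2_a0M i f : L2 f -> L2 (fun w => a0 i w * f w).
Proof. exact: L2_bndM (a0_meas i) (a0_norm i). Qed.
Lemma L2_Dd i f : L2 f -> L2 (Dd i f).
Proof. by move=> hf; apply: L2B => //; exact: (L2_shift hP). Qed.

Lemma by_parts i (G z : Om -> R) : L2 G -> L2 z ->
  Er (fun w => G w * Dd i z w) = Er (fun w => z w * (G (tau (- av i) w) - G w)).
Proof.
move=> hG hz; have hzs := L2_shift hP (av i) hz; have hGs := L2_shift hP (- av i) hG.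
have -> : Er (fun w => G w * Dd i z w) = Er (fun w => G w * z (tau (av i) w) - z w * G w).
  by apply: eq_Er => w _; rewrite /Dd; ring.
have -> : Er (fun w => z w * (G (tau (- av i) w) - G w)) = Er (fun w => z w * G (tau (- av i) w) - z w * G w).
  by apply: eq_Er => w _; ring.
rewrite !ErB //; try exact: L2_mul.
rewrite -(Er_shift hP (- av i) (L2_mul hG hzs)); congr (_ - _).
by apply: eq_Er => w _; rewrite shiftNK mulrC.
Qed.

Lemma opL_div f w : Lop f w = \sum_i (a0 i (tau (- av i) w) * Dd i f (tau (- av i) w) - a0 i w * Dd i f w).
Proof.
by apply: eq_bigr => i _; rewrite a0_tau /Dd shiftNK /a0; ring.
Qed.

Lemma L2_opL f : L2 f -> L2 (Lop f).
Proof.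
move=> hf; apply: L2_ext (fun w => esym (opL_div f w)) _; apply: L2_sum => i.
have h := L2_a0M i (L2_Dd i hf); exact: L2B (L2_shift hP (- av i) h) h.
Qed.

Lemma opL_form f g : L2 f -> L2 g -> Er (fun w => g w * Lop f w) = \sum_i Er (fun w => a0 i w * Dd i f w * Dd i g w).
Proof.
move=> hf hg; have h i := L2_a0M i (L2_Dd i hf); have hs i := L2_shift hP (- av i) (h i).
have -> : Er (fun w => g w * Lop f w) = Er (fun w => \sum_i g w * (a0 i (tau (- av i) w) * Dd i f (tau (- av i) w) - a0 i w * Dd i f w)).
  by apply: eq_Er => w _; rewrite opL_div mulr_sumr.
rewrite Er_sum //; last by move=> i; apply: L2_mul => //; exact: L2B (hs i) (h i).
by apply: eq_bigr => i _; rewrite by_parts.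
Qed.

Lemma opL_sym f g : L2 f -> L2 g -> Er (fun w => g w * Lop f w) = Er (fun w => f w * Lop g w).
Proof. by move=> hf hg; rewrite !opL_form //; apply: eq_bigr => i _; apply: eq_Er => w _; rewrite mulrAC. Qed.

Lemma opL_ge0 f : L2 f -> 0 <= Er (fun w => f w * Lop f w).
Proof.
move=> hf; rewrite opL_form // sumr_ge0 // => i _; apply: Er_ge0 => w _.
by rewrite -mulrA -expr2 mulr_ge0 ?sqr_ge0 // a0_ge0.
Qed.

Lemma Dd_sqr i f : L2 f -> Er (fun w => Dd i f w ^+ 2) <= 4 * Er (fun w => f w ^+ 2).
Proof.
move=> hf; have hs := L2_shift hP (av i) hf.
apply: (@le_trans _ _ (Er (fun w => 2 * f (tau (av i) w) ^+ 2 + 2 * f w ^+ 2))).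
  apply: Er_le => //; [exact: (L2_Dd i hf).2|exact: (itgD mT (itgZ mT 2 hs.2) (itgZ mT 2 hf.2))|].
  by move=> w _; rewrite /Dd; have := sqr_ge0 (f (tau (av i) w) + f w); lra.
rewrite (ErD mT (itgZ mT 2 hs.2) (itgZ mT 2 hf.2)) (ErZ mT 2 hs.2) (ErZ mT 2 hf.2) (Er_shift hP (av i) hf.2); lra.
Qed.

Lemma opL_le f : L2 f -> Er (fun w => f w * Lop f w) <= c * Er (fun w => f w ^+ 2).
Proof.
move=> hf; rewrite opL_form //; apply: (@le_trans _ _ (\sum_(i < d) beta * (4 * Er (fun w => f w ^+ 2)))).
  apply: ler_sum => i _; have hD := L2_Dd i hf.
  apply: (@le_trans _ _ (beta * Er (fun w => Dd i f w ^+ 2))); last by rewrite ler_pM2l // Dd_sqr.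
  rewrite -(ErZ mT beta hD.2); apply: Er_le => //; [exact: L2_mul (L2_a0M i hD) hD|exact: itgZ hD.2|].
  by move=> w _; rewrite -mulrA -expr2 ler_wpM2r ?sqr_ge0 //; case/andP: (a0_bnd i w).
by rewrite sumr_const card_ord -[leLHS]mulr_natl cstE; lra.
Qed.

Definition Tom f (w : Om) : R := f w - c^-1 * Lop f w.

Lemma L2_Tom f : L2 f -> L2 (Tom f).
Proof. by move=> hf; apply: L2B => //; apply: L2Z; exact: L2_opL. Qed.

Lemma Tom_sym f g : L2 f -> L2 g -> Er (fun w => g w * Tom f w) = Er (fun w => f w * Tom g w).
Proof.
move=> hf hg; have e1 (f1 g1 : Om -> R) : L2 f1 -> L2 g1 -> Er (fun w => g1 w * Tom f1 w) = Er (fun w => g1 w * f1 w) - c^-1 * Er (fun w => g1 w * Lop f1 w).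
  move=> hf1 hg1; have hm := L2_mul hg1 (L2_opL hf1); rewrite -(ErZ mT _ hm) -ErB //; last exact: itgZ hm.
    by apply: eq_Er => w _; rewrite /Tom; ring.
  exact: L2_mul.
rewrite !e1 // (opL_sym hf hg); congr (_ - _); by apply: eq_Er => w _; rewrite mulrC.
Qed.

Variable xi : 'rV[R]_d.
Local Notation dr := (@drift R alpha beta hab d xi).

Lemma drift_div w : dr w = \sum_i (xi 0 i * a0 i w - xi 0 i * a0 i (tau (- av i) w)).
Proof. by apply: eq_bigr => i _; rewrite a0_tau mulrBr. Qed.

Lemma L2_drift : L2 dr.
Proof.
apply: L2_ext (fun w => esym (drift_div w)) _; apply: L2_sum => i; apply: L2B; apply: L2Z; first exact: L2_a0.
exact: L2_shift hP _ _ (L2_a0 i).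
Qed.

Lemma drift_parts z : L2 z -> Er (fun w => z w * dr w) = - \sum_i Er (fun w => xi 0 i * a0 i w * Dd i z w).
Proof.
move=> hz; have h i := L2Z (xi 0 i) (L2_a0 i); have hs i := L2_shift hP (- av i) (h i).
have -> : Er (fun w => z w * dr w) = Er (fun w => \sum_i z w * (xi 0 i * a0 i w - xi 0 i * a0 i (tau (- av i) w))).
  by apply: eq_Er => w _; rewrite drift_div mulr_sumr.
rewrite Er_sum //; last by move=> i; apply: L2_mul => //; exact: L2B (h i) (hs i).
rewrite -sumrN; apply: eq_bigr => i _; rewrite (by_parts i (h i) hz) -ErN //.
  by apply: eq_Er => w _; ring.
by apply: L2_mul => //; exact: L2B (hs i) (h i).
Qed.

Definition UU n := iter n Tom dr.
(** These will be the moments of 1 - x/c under the spectral measure of the drift. *)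
Definition mm j : R := Er (fun w => dr w * UU j w).

Lemma L2_UU n : L2 (UU n).
Proof. by elim: n => [|n IH]; [exact: L2_drift|exact: L2_Tom]. Qed.

Lemma mmD (i j : nat) : Er (fun w => UU i w * UU j w) = mm (i + j).
Proof.
elim: i j => [|i IH] j //; rewrite addSnnS -IH.
have -> : Er (fun w => UU i.+1 w * UU j w) = Er (fun w => UU j w * Tom (UU i) w) by apply: eq_Er => w _; rewrite mulrC.
by rewrite Tom_sym //; exact: L2_UU.
Qed.

Lemma mm_even n : mm n.*2 = Er (fun w => UU n w ^+ 2).
Proof. by rewrite -addnn -mmD; apply: eq_Er => w _; rewrite expr2. Qed.

Lemma mm_odd n : mm n.*2.+1 = mm n.*2 - c^-1 * Er (fun w => UU n w * Lop (UU n) w).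
Proof.
have hU := L2_UU n; have hm := L2_mul hU (L2_opL hU).
rewrite -addnn -addnS -!mmD -(ErZ mT _ hm) -ErB //; [|exact: L2_mul|exact: itgZ hm].
by apply: eq_Er => w _; rewrite /= /Tom; ring.
Qed.

Lemma mm_odd_le n : mm n.*2.+1 <= mm n.*2.
Proof. by rewrite mm_odd gerBl mulr_ge0 ?invr_ge0 ?(ltW c0) // opL_ge0 //; exact: L2_UU. Qed.

(** Even moments are squared norms; an odd one is the preceding even one minus a form of [L] divided
    by [c], and [L <= c]. *)
Lemma mm_ge0 j : 0 <= mm j.
Proof.
rewrite -(odd_double_half j); case: (odd j) => /=; rewrite ?add0n; last by rewrite mm_even L2_sqr_ge0.
by rewrite add1n mm_odd subr_ge0 mm_even ler_pdivrMl // opL_le //; exact: L2_UU.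
Qed.

Lemma mm_decay (C eta : R) : 0 <= eta -> 0 < C -> (forall n, Er (fun w => UU n w ^+ 2) <= C * pw n (- eta)) ->
  forall j, mm j <= C * 2 `^ eta * pw j (- eta).
Proof.
move=> eta0 C0 h j; have j2 : (j < 2 * (j./2).+1)%N := half_scale j.
have h2 : mm j <= mm (j./2).*2.
  by rewrite -{1}(odd_double_half j); case: (odd j); rewrite ?add1n ?add0n // mm_odd_le.
rewrite mm_even in h2; apply: (le_trans h2); apply: (le_trans (h _)); rewrite -mulrA ler_pM2l //.
exact: scale_le2.
Qed.

(** A partial Neumann series for the inverse of [L], on which [L] telescopes: [Phi 0 n] is a
    square-integrable approximate corrector. *)
Definition Phi m n w : R := c^-1 * \sum_(m <= j < n) UU j w.

Lemma sum_UU_L2 m n : L2 (fun w => \sum_(m <= j < n) UU j w).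
Proof.
have -> : (fun w => \sum_(m <= j < n) UU j w) = (fun w => \sum_(j < n - m) UU (j + m) w).
  by apply/funext => w; rewrite -{1}[m]add0n big_addn big_mkord.
by apply: L2_sum => j; exact: L2_UU.
Qed.

Lemma L2_Phi m n : L2 (Phi m n).
Proof. by apply: L2Z; exact: sum_UU_L2. Qed.

Lemma opLD f g w : Lop (fun w => f w + g w) w = Lop f w + Lop g w.
Proof. by rewrite /opL -big_split; apply: eq_bigr => i _ /=; ring. Qed.
Lemma opLZ k f w : Lop (fun w => k * f w) w = k * Lop f w.
Proof. by rewrite /opL mulr_sumr; apply: eq_bigr => i _ /=; ring. Qed.

Lemma opL_Phi m n w : (m <= n)%N -> Lop (Phi m n) w = UU m w - UU n w.
Proof.
move=> mn; rewrite -(subnK mn); elim: (n - m)%N => [|k IH].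
  have -> : Phi m (0 + m) = (fun w => 0 * UU 0 w) by apply/funext => v; rewrite /Phi add0n big_geq // mulr0 mul0r.
  by rewrite opLZ mul0r add0n subrr.
have -> : Phi m (k.+1 + m) = (fun w => Phi m (k + m) w + c^-1 * UU (k + m) w).
  by apply/funext => v; rewrite /Phi addSn big_nat_recr ?leq_addl //= mulrDr.
rewrite (opLD (Phi m (k + m)) (fun w => c^-1 * UU (k + m) w)) (opLZ c^-1 (UU (k + m))) IH addSn -[UU (k + m).+1 w]/(Tom (UU (k + m)) w) /Tom; ring.
Qed.

Lemma Er_UU_Phi l m n : Er (fun w => UU l w * Phi m n w) = c^-1 * \sum_(m <= j < n) mm (l + j).
Proof.
have [mn|nm] := leqP m n; last first.
  rewrite !big_geq ?(ltnW nm) // mulr0 -[RHS](@Er_cst _ _ _ P 0); apply: eq_Er => w _.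
  by rewrite /Phi big_geq ?(ltnW nm) // !mulr0.
rewrite -(subnK mn); elim: (n - m)%N => [|k IH].
  rewrite add0n !big_geq // mulr0 -[RHS](@Er_cst _ _ _ P 0); apply: eq_Er => w _.
  by rewrite /Phi big_geq // !mulr0.
have i1 := L2_mul (L2_UU l) (L2_Phi m (k + m)); have i2 := L2_mul (L2_UU l) (L2_UU (k + m)).
have -> : Er (fun w => UU l w * Phi m (k.+1 + m) w) = Er (fun w => UU l w * Phi m (k + m) w + c^-1 * (UU l w * UU (k + m) w)).
  by apply: eq_Er => w _; rewrite /Phi addSn big_nat_recr ?leq_addl //=; ring.
rewrite (ErD mT i1 (itgZ mT _ i2)) (ErZ mT _ i2) IH mmD addSn [in RHS]big_nat_recr ?leq_addl //=; ring.
Qed.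

Lemma Phi_energy m n : (m <= n)%N -> Er (fun w => Phi m n w * Lop (Phi m n) w) <= c^-1 * \sum_(m <= j < n) mm (m + j).
Proof.
move=> mn; have i1 := L2_mul (L2_UU m) (L2_Phi m n); have i2 := L2_mul (L2_UU n) (L2_Phi m n).
have -> : Er (fun w => Phi m n w * Lop (Phi m n) w) = Er (fun w => UU m w * Phi m n w - UU n w * Phi m n w).
  by apply: eq_Er => w _; rewrite opL_Phi //; ring.
rewrite ErB // !Er_UU_Phi gerBl mulr_ge0 ?invr_ge0 ?(ltW c0) // sumr_ge0 // => j _; exact: mm_ge0.
Qed.

End Generator.

(** * The homogenized matrix as a series of correlations of the drift *)

Section Corrector.
Variables (R : realType) (alpha beta : R) (alpha_gt0 : 0 < alpha) (hab : alpha <= beta) (d : nat) (d_gt0 : (0 < d)%N).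
Local Notation Om := (Omega hab d).
Local Notation site := (site d).
Local Notation tau := (@Defs.shift R alpha beta hab d).
Variables (nu : probability (conductance hab) R) (P : probability Om R).
Hypothesis hP : product_measure nu P.
Local Notation itg := (mitg P setT).
Local Notation Er := (mEr P setT).
Local Notation L2 := (L2 P).
Local Notation Lop := (@opL R alpha beta hab d).
Local Notation c := (cst d beta).
Local Notation av := (@unit_vec d).
Local Notation a0 := (@a0 R alpha beta hab d).
Local Notation Dd := (@Dd R alpha beta hab d).
Implicit Types (f g z : Om -> R) (i : 'I_d) (x : site).
Let mT : measurable [set: Om]. Proof. exact: measurableT. Qed.
Let c0 : 0 < c := cst_gt0 d_gt0 alpha_gt0 hab.
Let b0 : 0 < beta := beta_gt0 alpha_gt0 hab.
Let i0 : 'I_d := Ordinal d_gt0.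
Local Notation ev k := (unit_vec i0 *+ k).

Variable xi : 'rV[R]_d.
Local Notation dr := (@drift R alpha beta hab d xi).
Local Notation UU := (@UU R alpha beta hab d xi).
Local Notation mm := (@mm R alpha beta hab d P xi).
Local Notation Phi := (@Phi R alpha beta hab d xi).

Lemma a0E i x w : a0 i (tau x w) = cond w (0 + x) i. Proof. by []. Qed.
Lemma DdE i f w : Dd i f w = f (tau (av i) w) - f w. Proof. by []. Qed.

Lemma qform_diag (w : Om) (v : 'rV[R]_d) : qform (Amat w 0) v = \sum_i a0 i w * v 0 i ^+ 2.
Proof.
rewrite /qform /Amat mul_mx_diag !mxE; apply: eq_bigr => i _.
by rewrite !mxE -/(a0 i w) mulrAC -expr2 mulrC.
Qed.

Variables (phi : site -> Om -> R).
Hypothesis hphi : corrector P xi phi.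

Definition chi i w := phi (av i) w.

Lemma chi_stat x i w : phi (x + av i) w - phi x w = chi i (tau x w).
Proof.
case: hphi => _ p0 st _ _; have := st 0 x w; rewrite add0r => /rowP /(_ i).
by rewrite !mxE add0r p0 subr0.
Qed.

Lemma L2_chi i : L2 (chi i).
Proof.
case: hphi => _ p0 _ /(_ 0 i) [h _] _; have := (L2P P _).1 h; apply: L2_ext => w.
by rewrite mxE add0r p0 subr0.
Qed.

Lemma Er_chi i : Er (chi i) = 0.
Proof.
case: hphi => _ p0 _ /(_ 0 i) [h1 h2] _; have hL := L2_itg ((L2P P _).1 h1).
rewrite (expectationE hL) in h2; case: h2 => <-; apply: eq_Er => w _.
by rewrite mxE add0r p0 subr0.
Qed.

Definition flux i w := (xi 0 i + chi i w) * a0 i w.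

Lemma L2_flux i : L2 (flux i).
Proof.
have h := L2_a0M alpha_gt0 i (L2D (L2_cst P (xi 0 i)) (L2_chi i)).
by apply: L2_ext h => w; rewrite /flux mulrC.
Qed.

Lemma flux_ae : {ae P, forall w, \sum_i (flux i w - flux i (tau (- av i) w)) = 0}.
Proof.
case: hphi => _ _ _ _; apply: filterS => w /(_ 0) /eqP; rewrite oppr_eq0 => /eqP h.
have E i x : ((xi + grad (phi ^~ w) x) *m Amat w x) 0 i = flux i (tau x w).
  by rewrite /Amat mul_mx_diag !mxE chi_stat /flux a0E add0r.
by rewrite -[RHS]h; apply: eq_bigr => i _; rewrite !E shift0 sub0r.
Qed.

Lemma weak_form z : L2 z -> \sum_i Er (fun w => flux i w * Dd i z w) = 0.
Proof.
move=> hz; have hs i := L2_shift hP (- av i) (L2_flux i).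
under eq_bigr => i _ do rewrite (by_parts hP i (L2_flux i) hz).
have hi i : itg (fun w => z w * (flux i (tau (- av i) w) - flux i w)) by apply: L2_mul => //; exact: L2B (hs i) (L2_flux i).
rewrite -Er_sum // -[RHS](@Er_cst _ _ _ P 0); symmetry.
apply: (proj2 (ae_Er mT _ (itg_cst P 0) _)); first exact: itg_meas (itg_sum mT hi).
apply: filterS flux_ae => w h _; rewrite -mulr_sumr.
have -> : \sum_i (flux i (tau (- av i) w) - flux i w) = - \sum_i (flux i w - flux i (tau (- av i) w)).
  by rewrite -sumrN; apply: eq_bigr => i _; ring.
by rewrite h oppr0 mulr0.
Qed.

Lemma phi_cocycle k x w : phi (ev k) (tau x w) = phi (x + ev k) w - phi x w.
Proof.
case: hphi => _ p0 _ _ _; elim: k => [|k IH]; first by rewrite mulr0n addr0 p0 subrr.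
rewrite mulrSr; have := chi_stat (ev k) i0 (tau x w); rewrite shiftD -[ev k + x]addrC => h1.
have := chi_stat (x + ev k) i0 w; rewrite -[x + ev k + av i0]addrA => h2.
by move: h1 h2 IH; lra.
Qed.

(** The corrector is not stationary and cannot serve as a test function. For each k its increment
    over [ev k], up to sign, is square integrable, with gradient [chi] minus a far shift of [chi],
    which mixing makes invisible as k grows. *)
Definition zk k w := - phi (ev k) w.

Lemma L2_zk k : L2 (zk k).
Proof.
case: hphi => _ p0 _ _ _; elim: k => [|k IH].
  by apply: L2_ext (L2_cst P 0) => w; rewrite /zk mulr0n p0 oppr0.
apply: L2_ext (L2B IH (L2_shift hP (ev k) (L2_chi i0))) => w.
by have := chi_stat (ev k) i0 w; rewrite /zk mulrSr; lra.
Qed.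

Lemma Dd_zk k i w : Dd i (zk k) w = chi i w - chi i (tau (ev k) w).
Proof.
rewrite DdE /zk phi_cocycle; have := chi_stat (ev k) i w; rewrite [av i + _]addrC /chi; lra.
Qed.

Lemma mix_chi i h : L2 h -> Er (fun w => h w * chi i (tau (ev k) w)) @[k --> \oo] --> 0.
Proof.
move=> hh; have := mixing hP i0 (L2_chi i) hh; rewrite Er_chi mul0r => m.
by under eq_fun => k do under eq_Er => w _ do rewrite mulrC.
Qed.

Lemma mix_chi_sum (h : 'I_d -> Om -> R) : (forall i, L2 (h i)) ->
  \sum_i Er (fun w => h i w * chi i (tau (ev k) w)) @[k --> \oo] --> 0.
Proof.
move=> hh; suff H (s : seq 'I_d) : \sum_(i <- s) Er (fun w => h i w * chi i (tau (ev k) w)) @[k --> \oo] --> 0 by exact: H.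
elim: s => [|i s IH]; first by under eq_fun => k do rewrite big_nil; exact: cvg_cst.
have -> : (fun k => \sum_(j <- i :: s) Er (fun w => h j w * chi j (tau (ev k) w))) =
  (fun k => Er (fun w => h i w * chi i (tau (ev k) w)) + \sum_(j <- s) Er (fun w => h j w * chi j (tau (ev k) w))).
  by apply/funext => k; rewrite big_cons.
have m1 := mix_chi i (hh i); have := cvgD m1 IH; rewrite addr0; exact.
Qed.

Lemma Er_Dd_zk k i h : L2 h -> Er (fun w => h w * Dd i (zk k) w) = Er (fun w => h w * chi i w) - Er (fun w => h w * chi i (tau (ev k) w)).
Proof.
move=> hh; rewrite -ErB //; [|exact: L2_mul (L2_chi i)|exact: L2_mul (L2_shift hP _ (L2_chi i))].
by apply: eq_Er => w _; rewrite Dd_zk mulrBr.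
Qed.

(** Tested with [zk k], the equation equates this pairing with that of the flux and the shifted
    [chi], which tends to zero by mixing since [chi] has mean zero. *)
Lemma flux_chi : \sum_i Er (fun w => flux i w * chi i w) = 0.
Proof.
have h k : \sum_i Er (fun w => flux i w * chi i (tau (ev k) w)) = \sum_i Er (fun w => flux i w * chi i w).
  have := weak_form (L2_zk k); under eq_bigr => i _ do rewrite (Er_Dd_zk k i (L2_flux i)).
  by rewrite sumrB => /eqP; rewrite subr_eq0 => /eqP.
have := mix_chi_sum L2_flux; under eq_fun => k do rewrite h.
by move=> cv; apply/esym; apply: cvg_unique cv _; [exact: Rhausdorff|exact: cvg_cst].
Qed.

(** By [flux_chi] the energy of the corrected field is linear in [chi]: this is its difference with
    the energy of the constant field [xi]. *)
Definition YY := \sum_i Er (fun w => xi 0 i * a0 i w * chi i w).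

Let axi i : L2 (fun w => xi 0 i * a0 i w). Proof. by apply: L2Z; exact: L2_a0. Qed.

Lemma itg_qform : itg (fun w => qform (Amat w 0) xi).
Proof.
have h : itg (fun w => \sum_i xi 0 i * a0 i w * xi 0 i).
  by apply: itg_sum => // i; apply: L2_mul; [exact: axi|exact: L2_cst].
by apply: (itg_eq mT) _ h => w _; rewrite qform_diag; apply: eq_bigr => i _; ring.
Qed.

Lemma hom_energy : itg (fun w => qform (Amat w 0) (xi + grad (phi ^~ w) 0)) /\
  Er (fun w => qform (Amat w 0) (xi + grad (phi ^~ w) 0)) = Er (fun w => qform (Amat w 0) xi) + YY.
Proof.
have gE w i : grad (phi ^~ w) 0 0 i = chi i w.
  by rewrite mxE; have := chi_stat 0 i w; rewrite shift0.
have i1 i : itg (fun w => xi 0 i * a0 i w * chi i w) by apply: L2_mul; [exact: axi|exact: L2_chi].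
have i2 i : itg (fun w => flux i w * chi i w) by apply: L2_mul; [exact: L2_flux|exact: L2_chi].
have I1 := itg_sum mT i1; have I2 := itg_sum mT i2.
have E w : qform (Amat w 0) xi + \sum_i xi 0 i * a0 i w * chi i w + \sum_i flux i w * chi i w =
   qform (Amat w 0) (xi + grad (phi ^~ w) 0).
  rewrite !qform_diag -!big_split /=; apply: eq_bigr => i _.
  by rewrite [(xi + _) 0 i]mxE gE /flux; ring.
have I3 := itgD mT (itgD mT itg_qform I1) I2.
split; first by apply: (itg_eq mT) _ I3 => w _; exact: E.
have -> : Er (fun w => qform (Amat w 0) (xi + grad (phi ^~ w) 0)) = Er (fun w => qform (Amat w 0) xi + \sum_i xi 0 i * a0 i w * chi i w + \sum_i flux i w * chi i w).
  by apply: eq_Er => w _; rewrite E.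
rewrite (ErD mT (itgD mT itg_qform I1) I2) (ErD mT itg_qform I1) !Er_sum //.
by rewrite flux_chi addr0.
Qed.

Lemma chi_parts z : L2 z -> \sum_i Er (fun w => a0 i w * Dd i z w * chi i w) = Er (fun w => z w * dr w).
Proof.
move=> hz; have hD i := L2_Dd hP i hz.
have := weak_form hz; have -> : \sum_i Er (fun w => flux i w * Dd i z w) =
  \sum_i (Er (fun w => xi 0 i * a0 i w * Dd i z w) + Er (fun w => a0 i w * Dd i z w * chi i w)).
  apply: eq_bigr => i _; rewrite -ErD //.
  - by apply: eq_Er => w _; rewrite /flux; ring.
  - exact: L2_mul (axi i) (hD i).
  - exact: L2_mul (L2_a0M alpha_gt0 i (hD i)) (L2_chi i).
rewrite big_split /= (drift_parts alpha_gt0 hP xi hz) => h; lra.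
Qed.

Variables (eta Cm : R).
Hypotheses (eta_gt0 : 0 < eta) (Cm_gt0 : 0 < Cm).
Hypothesis hmm : forall j, mm j <= Cm * pw j (- (1 + eta)).

Definition TT (M : nat) : R := (1 - 2 `^ (- eta))^-1 * Cm * pw M (- eta).

Lemma tail_le M M' : \sum_(M <= j < M') mm (M + j) <= TT M.
Proof.
have e0 := eta_gt0.
apply: (@le_trans _ _ (\sum_(M <= j < M') Cm * pw j (- (1 + eta)))).
  apply: ler_sum => j _; apply: le_trans (hmm _) _; rewrite ler_pM2l //; apply: pw_anti; [lra|exact: leq_addl].
rewrite -mulr_sumr; apply: le_trans (ler_wpM2l (ltW Cm_gt0) (sum_pw_tail M M' e0)) _.
by rewrite /TT mulrCA mulrA.
Qed.

Definition Kchi := 4 * \sum_i Er (fun w => chi i w ^+ 2).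

Lemma zk_UU_cvg k : Er (fun w => zk k w * UU M w) @[M --> \oo] --> 0.
Proof.
apply/cvgrPdist_le => eps eps0; set Z := Er (fun w => zk k w ^+ 2).
have Z0 : 0 <= Z := L2_sqr_ge0 _ _.
have Z1 : 0 < Z * Cm + 1 by rewrite ltr_wpDl // mulr_ge0 // ltW.
have e1 : 0 < 1 + eta by rewrite addr_gt0.
have [M0 hM0] := @pw_small R (1 + eta) (eps ^+ 2 / (Z * Cm + 1)) e1 (divr_gt0 (exprn_gt0 2 eps0) Z1).
exists M0 => // M /= M0M; rewrite sub0r normrN.
have cs := Er_CS (L2_zk k) (L2_UU alpha_gt0 hP xi M); rewrite -/Z -(mm_even alpha_gt0 hP) in cs.
rewrite -(@ler_pXn2r _ 2) ?nnegrE ?(ltW eps0) // real_normK ?num_real //; apply: (le_trans cs).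
have M2 : (M0 <= M.*2)%N by rewrite -addnn; exact: leq_trans M0M (leq_addr _ _).
have h := le_trans (hmm M.*2) (ler_wpM2l (ltW Cm_gt0) (hM0 _ M2)).
apply: le_trans (ler_wpM2l Z0 h) _.
have -> : Z * (Cm * (eps ^+ 2 / (Z * Cm + 1))) = eps ^+ 2 * (Z * Cm) / (Z * Cm + 1) by ring.
by rewrite ler_pdivrMr // ler_wpM2l ?sqr_ge0 // lerDl.
Qed.

(** [U_M] is [L Phi] up to a remainder [U_M'] that vanishes as M' grows with k fixed. Young's
    inequality bounds the energy pairing of [zk] with [Phi] uniformly in k, the second factor being
    a tail of the moments. *)
Lemma zk_UU_le k M del : 0 < del -> `|Er (fun w => zk k w * UU M w)| <= del * Kchi + del^-1 * (beta * (c^-1 * TT M)).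
Proof.
move=> del0; apply/ler_addgt0Pr => eps eps0.
have [M1 _ hM1] := (cvgrPdist_le _ _).1 (zk_UU_cvg k) eps eps0.
pose M' := maxn M M1; have MM' : (M <= M')%N by exact: leq_maxl.
have := hM1 M' (leq_maxr _ _); rewrite /= sub0r normrN => hM'.
have hz := L2_zk k; have hTh := L2_Phi alpha_gt0 hP xi M M'.
have hDz i := L2_Dd hP i hz; have hDT i := L2_Dd hP i hTh.
have E : Er (fun w => zk k w * UU M w) = Er (fun w => zk k w * UU M' w) + \sum_i Er (fun w => Dd i (zk k) w * (a0 i w * Dd i (Phi M M') w)).
  have -> : \sum_i Er (fun w => Dd i (zk k) w * (a0 i w * Dd i (Phi M M') w)) = Er (fun w => zk k w * Lop (Phi M M') w).
    by rewrite (opL_form alpha_gt0 hP hTh hz); apply: eq_bigr => i _; apply: eq_Er => w _; rewrite mulrC.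
  rewrite -ErD //; [|exact: L2_mul hz (L2_UU alpha_gt0 hP xi M')|exact: L2_mul hz (L2_opL alpha_gt0 hP hTh)].
  by apply: eq_Er => w _; rewrite opL_Phi //; ring.
rewrite E addrC; apply: le_trans (ler_normD _ _) _; apply: lerD => //.
apply: le_trans (ler_norm_sum _ _ _) _.
apply: (@le_trans _ _ (\sum_i (del * (4 * Er (fun w => chi i w ^+ 2)) + del^-1 * (beta * Er (fun w => a0 i w * Dd i (Phi M M') w * Dd i (Phi M M') w))))).
  apply: ler_sum => i _; apply: le_trans (Er_young del0 (hDz i) (L2_a0M alpha_gt0 i (hDT i))) _.
  apply: lerD; [rewrite ler_pM2l //|rewrite ler_pM2l ?invr_gt0 //].
    have hs := L2_shift hP (ev k) (L2_chi i); have h2 := (L2_chi i).2.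
    apply: (@le_trans _ _ (Er (fun w => 2 * chi i w ^+ 2 + 2 * chi i (tau (ev k) w) ^+ 2))).
      apply: Er_le => //; [exact: (hDz i).2|exact: (itgD mT (itgZ mT 2 h2) (itgZ mT 2 hs.2))|].
      by move=> w _; rewrite Dd_zk; have := sqr_ge0 (chi i w + chi i (tau (ev k) w)); lra.
    rewrite (ErD mT (itgZ mT 2 h2) (itgZ mT 2 hs.2)) (ErZ mT 2 h2) (ErZ mT 2 hs.2) (Er_shift hP (ev k) h2); lra.
  have hm := L2_mul (L2_a0M alpha_gt0 i (hDT i)) (hDT i).
  rewrite -(ErZ mT beta hm); apply: Er_le => //; [exact: (L2_a0M alpha_gt0 i (hDT i)).2|exact: itgZ hm|].
  move=> w _; have /andP[_ ab] := a0_bnd i w; have ag := a0_ge0 alpha_gt0 i w.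
  have -> : (a0 i w * Dd i (Phi M M') w) ^+ 2 = a0 i w * (a0 i w * Dd i (Phi M M') w * Dd i (Phi M M') w) by ring.
  by apply: ler_wpM2r => //; rewrite -mulrA -expr2 mulr_ge0 ?sqr_ge0.
rewrite big_split /= -!mulr_sumr; apply: lerD => //.
rewrite ler_pM2l ?invr_gt0 // ler_pM2l // -(opL_form alpha_gt0 hP hTh hTh).
apply: le_trans (Phi_energy alpha_gt0 d_gt0 hP xi MM') _; rewrite ler_pM2l ?invr_gt0 //; exact: tail_le.
Qed.

(** For large k, [zk] replaces the corrector both in [YY] and in the pairing with [Phi 0 M]; the
    drift terms cancel and only the pairing with [U_M] is left. *)
Lemma YY_partial M del : 0 < del -> `|YY + c^-1 * \sum_(0 <= j < M) mm j| <= del * Kchi + del^-1 * (beta * (c^-1 * TT M)).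
Proof.
move=> del0; apply/ler_addgt0Pr => eps eps0.
have hPh := L2_Phi alpha_gt0 hP xi 0 M; have hDP i := L2_a0M alpha_gt0 i (L2_Dd hP i hPh).
have c12 : (\sum_i Er (fun w => xi 0 i * a0 i w * chi i (tau (ev k) w)) + \sum_i Er (fun w => a0 i w * Dd i (Phi 0 M) w * chi i (tau (ev k) w))) @[k --> \oo] --> 0.
  by rewrite -[X in _ --> X]addr0; apply: cvgD; [exact: mix_chi_sum axi|exact: mix_chi_sum hDP].
have [k _ /(_ k (leqnn k))] := (cvgrPdist_le _ _).1 c12 eps eps0; rewrite /= sub0r normrN.
set e1 := \sum_i _; set e2 := \sum_i _ => he; have hz := L2_zk k.
have E1 : YY = - Er (fun w => zk k w * dr w) + e1.
  rewrite (drift_parts alpha_gt0 hP xi hz) opprK /YY /e1 -big_split; apply: eq_bigr => i _ /=.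
  by rewrite (Er_Dd_zk k i (axi i)) subrK.
have E2 : c^-1 * \sum_(0 <= j < M) mm j = Er (fun w => zk k w * dr w) - Er (fun w => zk k w * UU M w) + e2.
  have -> : c^-1 * \sum_(0 <= j < M) mm j = Er (fun w => Phi 0 M w * dr w).
    transitivity (Er (fun w => UU 0 w * Phi 0 M w)); first by rewrite (Er_UU_Phi alpha_gt0 hP).
    by apply: eq_Er => w _; rewrite mulrC.
  rewrite -(chi_parts hPh) -ErB //; [|apply: L2_mul => //; exact: (L2_drift alpha_gt0 hP)|exact: L2_mul hz (L2_UU alpha_gt0 hP xi M)].
  have -> : Er (fun w => zk k w * dr w - zk k w * UU M w) = Er (fun w => zk k w * Lop (Phi 0 M) w).
    by apply: eq_Er => w _; rewrite opL_Phi // mulrBr.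
  rewrite (opL_form alpha_gt0 hP hPh hz) /e2 -big_split; apply: eq_bigr => i _ /=.
  by rewrite (Er_Dd_zk k i (hDP i)) subrK.
have -> : YY + c^-1 * \sum_(0 <= j < M) mm j = - Er (fun w => zk k w * UU M w) + (e1 + e2) by rewrite E1 E2; ring.
apply: le_trans (ler_normD _ _) _; rewrite normrN; apply: lerD => //; exact: zk_UU_le.
Qed.

Lemma YY_cvg : c^-1 * (\sum_(0 <= j < M) mm j) @[M --> \oo] --> - YY.
Proof.
have K0 : 0 <= Kchi by rewrite mulr_ge0 // sumr_ge0 // => i _; exact: L2_sqr_ge0.
have lt1 := two_pow_lt1 eta_gt0.
pose B := Kchi + beta * (c^-1 * ((1 - 2 `^ (- eta))^-1 * Cm)) + 1.
have B0 : 0 < B.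
  by rewrite ltr_wpDl // addr_ge0 // !mulr_ge0 ?invr_ge0 ?(ltW c0) ?(ltW b0) ?(ltW Cm_gt0) // subr_ge0 ltW.
apply/cvgrPdist_le => eps eps0; have e2 : 0 < eta / 2 by rewrite divr_gt0.
have [M0 hM0] := @pw_small R (eta / 2) (eps / B) e2 (divr_gt0 eps0 B0).
exists M0 => // M /= M0M; rewrite -normrN opprB opprK addrC.
(* This parameter balances the fixed energy of the corrector against a tail of size M^-eta. *)
apply: le_trans (YY_partial M (pw_gt0 M (- (eta / 2)))) _.
have -> : pw M (- (eta / 2)) * Kchi + (pw M (- (eta / 2)))^-1 * (beta * (c^-1 * TT M)) = (B - 1) * pw M (- (eta / 2)).
  have pe : pw M (- eta) = pw M (- (eta / 2)) * pw M (- (eta / 2)) :> R by rewrite -pwD; congr pw; field.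
  have := pw_gt0 M (- (eta / 2)) : 0 < _ :> R; rewrite /TT pe /B; set p := pw M _ => p0.
  have -> : p^-1 * (beta * (c^-1 * ((1 - 2 `^ (- eta))^-1 * Cm * (p * p)))) = (p^-1 * p) * p * (beta * (c^-1 * ((1 - 2 `^ (- eta))^-1 * Cm))) by ring.
  by rewrite mulVf ?gt_eqF //; ring.
have h := hM0 M M0M; rewrite ler_pdivlMr // in h; have := pw_ge0 M (- (eta / 2)) : 0 <= _ :> R.
rewrite mulrBl mul1r; move: h; set p := pw M _; clearbody B p; lra.
Qed.

End Corrector.

Lemma hom_series (R : realType) (alpha beta : R) (alpha_gt0 : 0 < alpha) (hab : alpha <= beta) (d : nat) (d_gt0 : (0 < d)%N)
  (nu : probability (conductance hab) R) (P : probability (Omega hab d) R) (xi : 'rV[R]_d) (A : 'M[R]_d) (eta Cm : R) :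
  product_measure nu P -> homogenized_matrix P A -> 0 < eta -> 0 < Cm ->
  (forall j, @mm R alpha beta hab d P xi j <= Cm * pw j (- (1 + eta))) ->
  (cst d beta)^-1 * (\sum_(0 <= j < M) @mm R alpha beta hab d P xi j) @[M --> \oo] -->
    mEr P setT (fun w => qform (Amat w 0) xi) - qform A xi.
Proof.
move=> hP [_ /(_ xi) [phi [hphi E]]] eta0 Cm0 h.
have [i1 E1] := hom_energy alpha_gt0 d_gt0 hP hphi.
rewrite (expectationE i1) E1 in E; case: E => ->.
rewrite opprD addNKr; exact: (YY_cvg alpha_gt0 d_gt0 hP hphi eta0 Cm0 h).
Qed.

(** * Transfer of the variance decay from finite tori *)

Section FiniteLaw.
Variables (R : realType) (alpha beta : R) (hab : alpha <= beta) (d : nat).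
Local Notation Om := (Omega hab d).
Local Notation edge := (edge d).
Variables (nu : probability (conductance hab) R) (S : finType) (bin : conductance hab -> S).
Hypothesis mbin : forall s, measurable [set x | bin x = s].

Definition law s : R := fine (nu [set x | bin x = s]).

Lemma law_ge0 s : 0 <= law s. Proof. exact: fine_ge0. Qed.

Lemma lawE s : nu [set x | bin x = s] = (law s)%:E.
Proof. by rewrite /law fineK // fin_num_measure. Qed.

Lemma law_sum : \sum_s law s = 1.
Proof.
have U t q : [set x | bin x \in t :: q] = [set x | bin x = t] `|` [set x | bin x \in q].
  apply/seteqP; split => x /=; first by rewrite inE => /orP[/eqP h|h]; [left|right].
  by case=> [->|h]; rewrite inE ?eqxx // h orbT.
have h (r : seq S) : uniq r -> nu [set x | bin x \in r] = (\sum_(s <- r) law s)%:E.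
  elim: r => [_|s r IH /andP[sr ur]].
    by rewrite big_nil (_ : [set x | _] = set0) ?measure0 //; apply/seteqP; split.
  rewrite U.
  have mr : measurable [set x | bin x \in r].
    elim: (r) => [|t q IHq]; first by rewrite (_ : [set x | _] = set0); [exact: measurable0|apply/seteqP; split].
    by rewrite U; exact: measurableU.
  rewrite measureU //; last by apply/seteqP; split => x //= [-> h]; rewrite h in sr.
  by rewrite big_cons EFinD; congr (_ + _)%E; [exact: lawE|exact: IH].
have := h (index_enum S) (index_enum_uniq S).
have -> : [set x | bin x \in index_enum S] = setT by apply/seteqP; split => x //= _; rewrite mem_index_enum.
by rewrite probability_setT => -[].
Qed.

Variables (P : probability Om R).
Hypothesis hP : product_measure nu P.
Variables (J : finType) (iota : J -> edge).
Hypothesis iota_inj : injective iota.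
Local Notation itg := (mitg P setT).
Local Notation Er := (mEr P setT).
Let mT : measurable [set: Om]. Proof. exact: measurableT. Qed.
Definition sample (w : Om) : {ffun J -> S} := [ffun j => bin (w (iota j))].
Definition fiber (s : {ffun J -> S}) : set Om := [set w | sample w = s].

Let A (s : {ffun J -> S}) (e : edge) : set (conductance hab) :=
  if [pick j | iota j == e] is Some j then [set x | bin x = s j] else setT.

Let A_iota s j : A s (iota j) = [set x | bin x = s j].
Proof. by rewrite /A; case: pickP => [k /eqP /iota_inj ->|/(_ j)] //; rewrite eqxx. Qed.

Let mA s e : measurable (A s e).
Proof. by rewrite /A; case: pickP => // _; exact: measurableT. Qed.

Let fiberE s : fiber s = fcyl (map iota (enum J)) (A s).
Proof.
apply/seteqP; split => w /=.
  by move=> sw e /mapP[j _ ->]; rewrite A_iota /= -sw ffunE.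
move=> h; apply/ffunP => j; rewrite ffunE.
by have := h (iota j) (map_f iota (mem_enum J j)); rewrite A_iota.
Qed.

Lemma fiber_meas s : measurable (fiber s).
Proof. by rewrite fiberE; apply: fcyl_measurable => e; exact: mA. Qed.

Lemma P_fiber s : fine (P (fiber s)) = \prod_j law (s j).
Proof.
rewrite fiberE (P_fcyl hP); [|by rewrite map_inj_uniq ?enum_uniq|by move=> e; exact: mA].
rewrite big_map -[RHS]big_enum /=.
have h (r : seq J) : (\prod_(j <- r) nu (A s (iota j)) = (\prod_(j <- r) law (s j))%:E)%E.
  by elim: r => [|j r IH]; rewrite ?big_nil // !big_cons IH A_iota lawE EFinM.
by rewrite h.
Qed.

Lemma sample_expand (F : {ffun J -> S} -> R) w : F (sample w) = \sum_s F s * \1_(fiber s) w.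
Proof.
rewrite (bigD1 (sample w)) //= big1 ?addr0 => [|s sw].
  by rewrite indicE mem_set // mulr1.
by rewrite indicE memNset ?mulr0 // /fiber /= => /esym; exact/eqP.
Qed.

Lemma sample_itg (F : {ffun J -> S} -> R) : itg (fun w => F (sample w)).
Proof.
have h : itg (fun w => \sum_s F s * \1_(fiber s) w).
  by apply: itg_sum => // s; apply: itgZ => //; exact: L2_itg (L2_indic P (fiber_meas s)).
by apply: (itg_eq mT) _ h => w _; rewrite -sample_expand.
Qed.

Lemma Er_sample (F : {ffun J -> S} -> R) : Er (fun w => F (sample w)) = Ex law F.
Proof.
have hi s : itg (fun w => \1_(fiber s) w) := L2_itg (L2_indic P (fiber_meas s)).
have -> : Er (fun w => F (sample w)) = Er (fun w => \sum_s F s * \1_(fiber s) w).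
  by apply: eq_Er => w _; exact: sample_expand.
rewrite Er_sum //; last by move=> s; exact: itgZ.
apply: eq_bigr => s _; rewrite ErZ // (Er_indic P (fiber_meas s)) P_fiber mulrC; by [].
Qed.

End FiniteLaw.

Lemma cvg_sumr (R : realType) (I : finType) (F : I -> nat -> R) (l : I -> R) :
  (forall i, F i k @[k --> \oo] --> l i) -> \sum_i F i k @[k --> \oo] --> \sum_i l i.
Proof.
move=> h; suff H (s : seq I) : \sum_(i <- s) F i k @[k --> \oo] --> \sum_(i <- s) l i by exact: H.
elim: s => [|i s IH]; first by under eq_fun => k do rewrite big_nil; rewrite big_nil; exact: cvg_cst.
have -> : (fun k => \sum_(j <- i :: s) F j k) = (fun k => F i k + \sum_(j <- s) F j k).
  by apply/funext => k; rewrite big_cons.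
rewrite big_cons; have m1 := h i; exact: (cvgD m1 IH).
Qed.

(** * Reading the evolved drift of the lattice on a torus *)

Section LatticeSolution.
Variables (R : realType) (alpha beta : R) (hab : alpha <= beta) (d : nat) (xi : 'rV[R]_d).
Local Notation site := (site d).
Local Notation edge := (edge d).
Local Notation c := (cst d beta).
Local Notation av := (@unit_vec d).
Implicit Types (a : edge -> R) (x : site).

(** The evolution run in a fixed environment, which makes its continuity in the conductances
    visible. *)
Fixpoint lsol a n x : R := if n is n'.+1 then
    lsol a n' x - c^-1 * \sum_i (a (x, i) * (lsol a n' x - lsol a n' (x + av i)) +
                                 a (x - av i, i) * (lsol a n' x - lsol a n' (x - av i)))
  else \sum_i xi 0 i * (a (x, i) - a (x - av i, i)).

Lemma UU_lsol n (w : Omega hab d) x : UU xi n (Defs.shift x w) = lsol (fun e => conductance_val (w e)) n x.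
Proof.
elim: n x => [|n IH] x.
  by apply: eq_bigr => i _; rewrite !cond_shift add0r [- _ + x]addrC.
rewrite [LHS]/= /Tom /= IH; congr (_ - _ * _); apply: eq_bigr => i _.
by rewrite !cond_shift !shiftD !IH add0r ![_ + x]addrC.
Qed.

Lemma lsol_cvg (a_ : nat -> edge -> R) a : (forall e, a_ k e @[k --> \oo] --> a e) ->
  forall n x, lsol (a_ k) n x @[k --> \oo] --> lsol a n x.
Proof.
move=> h; elim=> [|n IH] x /=.
  apply: cvg_sumr => i; apply: cvgM; first exact: cvg_cst.
  by apply: cvgB; exact: h.
apply: cvgB; first exact: IH.
apply: cvgM; first exact: cvg_cst.
apply: cvg_sumr => i; apply: cvgD; apply: cvgM; try exact: h; apply: cvgB; exact: IH.
Qed.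

Lemma lsol_bound a n x : 0 < beta -> (forall e, `|a e| <= beta) -> (forall i, `|xi 0 i| <= 1) -> (0 < d)%N ->
  `|lsol a n x| <= 2 ^+ n * (2 * d%:R * beta).
Proof.
move=> b0 ha hxi d0; have dR : 0 < d%:R :> R by rewrite ltr0n.
have c0 : 0 < c by rewrite cstE !mulr_gt0.
elim: n x => [|n IH] x /=.
  rewrite expr0 mul1r; apply: le_trans (ler_norm_sum _ _ _) _.
  apply: (@le_trans _ _ (\sum_(i < d) (2 * beta))); last by rewrite sumr_const card_ord -[leLHS]mulr_natl; lra.
  apply: ler_sum => i _; rewrite normrM -[leRHS]mul1r; apply: ler_pM => //.
  by apply: le_trans (ler_normB _ _) _; have := ha (x, i); have := ha (x - av i, i); lra.
set K := 2 ^+ n * (2 * d%:R * beta) in IH *; have -> : 2 ^+ n.+1 * (2 * d%:R * beta) = K + K by rewrite exprS /K; ring.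
apply: le_trans (ler_normB _ _) _; apply: lerD => //.
rewrite normrM gtr0_norm ?invr_gt0 // ler_pdivrMl //; apply: le_trans (ler_norm_sum _ _ _) _.
apply: (@le_trans _ _ (\sum_(i < d) (beta * (2 * K) + beta * (2 * K)))); last first.
  by rewrite sumr_const card_ord -[leLHS]mulr_natl cstE; lra.
have t2 y z : `|lsol a n y - lsol a n z| <= 2 * K.
  by apply: le_trans (ler_normB _ _) _; have := IH y; have := IH z; lra.
apply: ler_sum => i _; apply: le_trans (ler_normD _ _) _; rewrite !normrM.
by apply: lerD; apply: ler_pM.
Qed.

End LatticeSolution.

Section Rounding.
Variables (R : realType) (alpha beta : R) (hab : alpha <= beta) (m : nat).
Local Notation cond_t := (conductance hab).

(** The integer part of (m+1)(t - alpha)/(beta - alpha), capped at m; counting avoids a division, so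
    the case alpha = beta needs no other definition. *)
Definition level (t : R) : nat := \sum_(j < m) (j.+1%:R * (beta - alpha) <= (t - alpha) * m.+1%:R)%R.
Definition binval (s : 'I_m.+1) : R := alpha + (beta - alpha) * (s%:R / m.+1%:R).

Lemma level_lt t : (level t < m.+1)%N.
Proof.
rewrite ltnS; apply: (@leq_trans (\sum_(j < m) 1)%N); last by rewrite sum1_card card_ord.
by apply: leq_sum => j _; exact: leq_b1.
Qed.

Definition rbin (x : cond_t) : 'I_m.+1 := Ordinal (level_lt (conductance_val x)).

Let m0 : 0 < m.+1%:R :> R. Proof. by rewrite ltr0n. Qed.
Let ba : 0 <= beta - alpha. Proof. by rewrite subr_ge0. Qed.

Lemma binval_bnd s : alpha <= binval s <= beta.
Proof.
have h : s%:R / m.+1%:R <= 1 :> R by rewrite ler_pdivrMr // mul1r ler_nat ltnW.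
have h0 : 0 <= s%:R / m.+1%:R :> R by rewrite divr_ge0 // ltW.
by rewrite /binval lerDl mulr_ge0 //= -lerBrDl; apply: le_trans (ler_wpM2l ba h) _; rewrite mulr1.
Qed.

Lemma round_le (x : cond_t) : `|binval (rbin x) - conductance_val x| <= (beta - alpha) / m.+1%:R.
Proof.
have [t [/andP[t0 t1] xt]] : exists t, alpha <= t <= beta /\ conductance_val x = t by case: x => t h; exists t.
rewrite /binval /= xt -(ler_pM2r m0) divfK ?gt_eqF // -[X in _ * X](gtr0_norm m0) -normrM.
have -> : (alpha + (beta - alpha) * ((level t)%:R / m.+1%:R) - t) * m.+1%:R = (beta - alpha) * (level t)%:R - (t - alpha) * m.+1%:R.
  by field; rewrite gt_eqF.
have y0 : 0 <= t - alpha by rewrite subr_ge0.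
have yD : t - alpha <= beta - alpha by rewrite lerD2r.
move: ba y0 yD; rewrite /level; move: (beta - alpha) (t - alpha) => D y D0 y0 yD.
have [D0'|Dp] := leP D 0.
  have -> : D = 0 by apply/eqP; rewrite eq_le D0' D0.
  have -> : y = 0 by apply/eqP; rewrite eq_le y0 andbT (le_trans yD).
  by rewrite !mul0r subrr normr0.
have z0 : 0 <= y * m.+1%:R / D by rewrite divr_ge0 ?mulr_ge0 // ltW.
have -> : (\sum_(j < m) (j.+1%:R * D <= y * m.+1%:R)%R = minn m (Num.truncn (y * m.+1%:R / D)))%N.
  apply/eqP; rewrite -(eqr_nat R) natr_sum -sum_level //; apply/eqP; apply: eq_bigr => j _.
  by rewrite ler_pdivlMr.
set k := Num.truncn _; have k1 : k%:R * D <= y * m.+1%:R by rewrite -ler_pdivlMr // truncn_le.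
have k2 : y * m.+1%:R < k%:R * D + D by rewrite -[X in _ + X]mul1r -mulrDl natr1 -ltr_pdivrMr // truncnS_gt.
have yN : y * m.+1%:R <= m%:R * D + D by rewrite -[X in _ + X]mul1r -mulrDl natr1 mulrC ler_pM2l.
rewrite ler_norml [D * _]mulrC; case: (leqP m k) => h; last by move: k1 k2; move: (k%:R * D) (y * _) => X Y; lra.
have hm : m%:R * D <= k%:R * D by rewrite ler_pM2r // ler_nat.
by move: yN (le_trans hm k1); move: (m%:R * D) (y * _) => X Y; lra.
Qed.

Lemma val_meas : measurable_fun setT (fun x : cond_t => conductance_val x : R).
Proof. by move=> _ B mB; rewrite setTI; exists B => //; rewrite setTI. Qed.

Lemma rbin_meas s : measurable [set x | rbin x = s].
Proof.
pose B (j : 'I_m) := [set x : cond_t | j.+1%:R * (beta - alpha) <= (conductance_val x - alpha) * m.+1%:R].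
have mB j : measurable (B j).
  have -> : B j = setT `&` (fun x : cond_t => (conductance_val x - alpha) * m.+1%:R) @^-1` `[j.+1%:R * (beta - alpha), +oo[%classic.
    by apply/seteqP; split => x /=; rewrite ?in_itv /= ?andbT; [|case].
  apply: measurable_funM => //; first by apply: measurable_funB => //; exact: val_meas.
have mS : measurable_fun setT (fun x : cond_t => \sum_(j < m) \1_(B j) x : R).
  by apply: measurable_sum => j; exact: measurable_indic.
have -> : [set x | rbin x = s] = setT `&` (fun x : cond_t => \sum_(j < m) \1_(B j) x : R) @^-1` [set s%:R].
  have E (x : cond_t) : \sum_(j < m) \1_(B j) x = (level (conductance_val x))%:R :> R.
    rewrite /level natr_sum; apply: eq_bigr => j _; rewrite indicE; congr ((_ : bool)%:R).
    by apply/idP/idP => [/set_mem|h] //; apply/mem_set.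
  apply/seteqP; split => x /=; first by move=> <-; split => //; rewrite E.
  by move=> [_]; rewrite E => /eqP; rewrite eqr_nat => /eqP h; exact: val_inj.
exact: mS.
Qed.

End Rounding.

Section TorusModel.
Variables (R : realType) (alpha beta : R) (alpha_gt0 : 0 < alpha) (hab : alpha <= beta) (d : nat) (d_gt0 : (0 < d)%N).
Variables (nu : probability (conductance hab) R) (P : probability (Omega hab d) R).
Hypothesis hP : product_measure nu P.
Variable xi : 'rV[R]_d.
Hypothesis hxi : forall i, `|xi 0 i| <= 1.
Variables (n m : nat).
Local Notation p := (2 * n).+2.
Local Notation V := 'rV['I_p.+2]_d.
Local Notation site := (site d).
Local Notation edge := (edge d).
Local Notation av := (@unit_vec d).
Local Notation Er := (mEr P setT).
Implicit Types (x : V).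

Definition te (i : 'I_d) : V := delta_mx 0 i.

Lemma te_torus : torus te n.
Proof.
have latE k j : (lat te k) 0 j = (k j)%:R.
  rewrite /lat summxE (bigD1 j) //= big1 ?addr0 => [|i ij]; rewrite mulmxnE /te mxE ?eqxx //.
  by rewrite eq_sym (negPf ij) andbF mul0rn.
move=> k l kN lN /rowP h j; have := h j; rewrite !latE => /(congr1 val).
by rewrite !Zp_nat /= !modn_small //; [have := lN j|have := kN j]; lia.
Qed.

Definition cx x (j : 'I_d) : nat := x 0 j.
Definition rep x : site := \row_j ((cx x j)%:Z - n.+1%:Z).
Definition code (o : option bool) : nat := if o is Some b then b.+1 else 0.
(** The three copies of the torus environment are read on three disjoint translates, along the
    diagonal, of one box of Z^d; independence of the conductances then provides all copies at
    once. *)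
Definition emb (j : (V * 'I_d) * option bool) : edge := (rep j.1.1 + const_mx (code j.2 * p.+2)%N%:Z, j.1.2).

Lemma cx_lt x j : (cx x j < p.+2)%N. Proof. exact: ltn_ord. Qed.

Lemma code_inj : injective code.
Proof. by move=> [[]|] [[]|]. Qed.

Lemma emb_inj : injective emb.
Proof.
move=> [[x i] o] [[y j] o'] [] /rowP h ->.
have key k : (cx x k + code o * p.+2 = cx y k + code o' * p.+2)%N.
  by have := h k; rewrite !mxE /=; lia.
have mo k : cx x k = cx y k /\ code o = code o'.
  have e1 := congr1 (fun t => t %% p.+2)%N (key k); have e2 := congr1 (fun t => t %/ p.+2)%N (key k).
  rewrite /= ![(_ + _ * p.+2)%N]addnC !modnMDl !modn_small ?cx_lt // in e1.
  by rewrite /= ![(_ + _ * p.+2)%N]addnC !divnMDl // !divn_small ?cx_lt // !addn0 in e2.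
have -> : o = o' by apply: code_inj; case: (mo (Ordinal d_gt0)).
have -> // : x = y.
by apply/rowP => k; apply: val_inj; case: (mo k).
Qed.

Definition tmodel : model d alpha beta :=
  @Model R d alpha beta V te n te_torus 'I_m.+1 (law nu (@rbin R alpha beta hab m))
    (@law_ge0 _ _ _ _ nu _ _) (law_sum nu (@rbin_meas R alpha beta hab m)) (@binval R alpha beta m)
    (@binval_bnd R alpha beta hab m) (fun i => xi 0 i) hxi.

Local Notation smp := (sample (@rbin R alpha beta hab m) emb).
Definition acond (w : Omega hab d) (e : edge) : R := binval alpha beta (rbin m (w e)).

Lemma env_sample w x i : env (M := tmodel) (smp w) (x, i) = acond w (rep x, i).
Proof.
by rewrite /env /= ffunE /emb /= /acond mul0n (_ : const_mx _ = 0) ?addr0 //; apply/rowP => j; rewrite !mxE.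
Qed.

Lemma cx_up x i j : (cx x i < p.+1)%N -> cx (x + te i) j = (cx x j + (j == i))%N.
Proof.
rewrite /cx => h; rewrite !mxE eqxx andTb; case: (eqVneq j i) => [->|_]; last by rewrite addr0 addn0.
by rewrite /= modn_small addn1.
Qed.

Lemma cx_down x i j : (0 < cx x i)%N -> (cx (x - te i) j + (j == i))%N = cx x j.
Proof.
move=> h; have lt : (cx (x - te i) i < p.+1)%N.
  have := ltn_ord ((x - te i) 0 i); rewrite ltnS leq_eqVlt => /orP[/eqP E|//].
  have : cx (x - te i + te i) i = 0%N by rewrite /cx mxE /= E !mxE !eqxx /= addn1 modnn.
  by rewrite subrK => h0; rewrite h0 in h.
by rewrite -(cx_up j lt) subrK.
Qed.

Lemma rep_up x i : (cx x i < p.+1)%N -> rep (x + te i) = rep x + av i.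
Proof.
by move=> h; apply/rowP => j; rewrite !mxE cx_up // eqxx /=; case: (j == i) => /=; lia.
Qed.

Lemma rep_down x i : (0 < cx x i)%N -> rep (x - te i) = rep x - av i.
Proof.
move=> h; apply/rowP => j; rewrite !mxE -(cx_down j h) eqxx /=; case: (j == i) => /=; lia.
Qed.

(** Torus and lattice agree as long as the point is more than [k] steps from the seam. The side 2n+4
    leaves enough room around the centre [xc] up to time n. *)
Lemma u_sample w k x : (forall j, k < cx x j < p.+1 - k)%N -> u (M := tmodel) (smp w) k x = lsol beta xi (acond w) k (rep x).
Proof.
elim: k x => [|k IH] x hx.
  rewrite /u /sol /= /u0; apply: eq_bigr => i _; have := hx i => /andP[h1 h2].
  by rewrite !env_sample rep_down.
have hi i : (cx x i < p.+1)%N by have /andP[_] := hx i; lia.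
have h0 i : (0 < cx x i)%N by have /andP[+ _] := hx i; lia.
have IH0 : u (M := tmodel) (smp w) k x = lsol beta xi (acond w) k (rep x).
  by apply: IH => j; have := hx j; clear; lia.
have IHu i : u (M := tmodel) (smp w) k (x + te i) = lsol beta xi (acond w) k (rep x + av i).
  by rewrite -rep_up //; apply: IH => j; have := hx j; rewrite (cx_up j (hi i)); case: (j == i); clear; lia.
have IHd i : u (M := tmodel) (smp w) k (x - te i) = lsol beta xi (acond w) k (rep x - av i).
  by rewrite -rep_down //; apply: IH => j; have := hx j; have := cx_down j (h0 i); case: (j == i); clear; lia.
transitivity (Tw te beta (env (M := tmodel) (smp w)) (u (M := tmodel) (smp w) k) x); first by [].
rewrite /Tw /Sw /lap [RHS]/= -IH0; congr (_ - _ * _); apply: eq_bigr => i _.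
by rewrite -IHu -IHd !env_sample rep_down.
Qed.

Definition xc : V := const_mx (inord n.+1).

Let xcE j : cx xc j = n.+1. Proof. by rewrite /cx mxE inordK //; lia. Qed.

Let acondE w : lsol beta xi (acond w) n 0 ^+ 2 = `|u (M := tmodel) (smp w) n xc| ^+ 2.
Proof.
have rc : rep xc = 0 by apply/rowP => j; rewrite mxE xcE mxE subrr.
by rewrite real_normK ?num_real // u_sample ?rc // => j; rewrite xcE; lia.
Qed.

Lemma itg_acond : mitg P setT (fun w => lsol beta xi (acond w) n 0 ^+ 2).
Proof.
have := sample_itg (@rbin_meas R alpha beta hab m) P emb_inj (fun s => `|u (M := tmodel) s n xc| ^+ 2).
by apply: itg_eq => [|w _]; [exact: measurableT|rewrite acondE].
Qed.

Lemma Er_acond : Er (fun w => lsol beta xi (acond w) n 0 ^+ 2) = aq tmodel 2 n ^+ 2.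
Proof.
have -> : Er (fun w => lsol beta xi (acond w) n 0 ^+ 2) = Er (fun w => `|u (M := tmodel) (smp w) n xc| ^+ 2).
  by apply: eq_Er => w _; exact: acondE.
rewrite (Er_sample (@rbin_meas R alpha beta hab m) hP emb_inj (fun s => `|u (M := tmodel) s n xc| ^+ 2)).
rewrite aqE //; symmetry; rewrite -[RHS](mean_cst tmodel); congr (_ * _); apply: eq_bigr => x _.
transitivity (Ex (@mw _ _ _ _ tmodel) (fun s => `|u (M := tmodel) s n xc| ^+ 2)); last by [].
rewrite -[RHS](Ex_tr (M := tmodel) (x - xc)); apply: Ex_ext => s; by rewrite u_tr [xc + _]addrC subrK.
Qed.

End TorusModel.


(** For fixed n the torus of side 2n+4 represents the evolution exactly, and only the values of the
    conductances are rounded. The bound being uniform over models, dominated convergence removes the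
    rounding. *)
Lemma UU_decay (R : realType) (alpha beta : R) (alpha_gt0 : 0 < alpha) (hab : alpha <= beta) (d : nat) : (1 < d)%N ->
  exists2 C : R, 0 < C & forall (nu : probability (conductance hab) R) (P : probability (Omega hab d) R),
  product_measure nu P -> forall xi : 'rV[R]_d, (forall i, `|xi 0 i| <= 1) ->
  forall n, mEr P setT (fun w => UU xi n w ^+ 2) <= C * pw n (- (d%:R / 2 + 1)).
Proof.
move=> d1; have d0 : (0 < d)%N := ltnW d1; have b0 := beta_gt0 alpha_gt0 hab.
have [C C0 H] := variance_decay d1 alpha_gt0 hab; exists (C ^+ 2); first by rewrite exprn_gt0.
move=> nu P hP xi hxi n; have mT : measurable [set: Omega hab d] := measurableT.
pose F m (w : Omega hab d) := lsol beta xi (acond m w) n 0 ^+ 2.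
pose K : R := 2 ^+ n * (2 * d%:R * beta).
have K0 : 0 <= K by rewrite mulr_ge0 ?exprn_ge0 // !mulr_ge0 // ltW.
have UE (w : Omega hab d) : UU xi n w ^+ 2 = lsol beta xi (fun e => conductance_val (w e)) n 0 ^+ 2.
  by rewrite -UU_lsol shift0.
have ab x : alpha <= x <= beta -> `|x| <= beta.
  by move=> /andP[x0 x1]; rewrite ger0_norm //; exact: le_trans (ltW alpha_gt0) x0.
have cv : mEr P setT (F m) @[m --> \oo] --> mEr P setT (fun w => UU xi n w ^+ 2).
  apply: (Er_cvg mT _ _ (itg_cst P (K ^+ 2))).
  - by move=> m; exact: itg_meas (itg_acond alpha_gt0 d0 nu P hxi n m).
  - by apply: measurable_funX; case: (L2_UU alpha_gt0 hP xi n).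
  - move=> m w _; rewrite /F normrX; apply: sqr_mono => //.
    by apply: lsol_bound => // e; apply: ab; exact: binval_bnd.
  move=> w _; rewrite UE; have lc : lsol beta xi (acond m w) n 0 @[m --> \oo] --> lsol beta xi (fun e => conductance_val (w e)) n 0.
    apply: lsol_cvg => e; apply/cvgrPdist_le => eps eps0; near=> m.
    rewrite distrC; apply: le_trans (round_le m (w e)) _.
    rewrite ler_pdivrMr ?ltr0n // mulrC -ler_pdivrMr //; apply: ltW; apply: (@lt_le_trans _ _ m%:R); last by rewrite ler_nat.
    by near: m; exact: nbhs_infty_gtr.
  exact: (cvgM lc lc).
apply/ler_addgt0Pr => eps eps0.
have [m _ /(_ m (leqnn m))] := (cvgrPdist_le _ _).1 cv eps eps0; rewrite /= ler_norml => /andP[_ h].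
have hm : mEr P setT (F m) <= C ^+ 2 * pw n (- (d%:R / 2 + 1)).
  rewrite /F (Er_acond alpha_gt0 d0 hP hxi n m).
  have := H (tmodel alpha_gt0 d0 nu hxi n m) n (leqnn n) => h1.
  apply: le_trans (sqr_mono (aq_ge0 _ _ _) h1) _; rewrite exprMn pw_exp.
  by rewrite /gam mulNr divfK.
lra.
Unshelve. all: by end_near. Qed.

(** * Positive functionals on polynomials and the functional calculus *)

Section PositiveFunctional.
Variables (R : realType) (Lam : {poly R} -> R) (b : R).
Hypothesis Lam_lin : forall a p q, Lam (a *: p + q) = a * Lam p + Lam q.
Hypothesis b_ge0 : 0 <= b.
Hypothesis Lam_pos : forall a m, 0 <= Lam ('X^a * (b%:P - 'X) ^+ m).

Let Lam0 : Lam 0 = 0.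
Proof. have := Lam_lin 1 0 0; rewrite scaler0 addr0 mul1r; move: (Lam 0) => z; lra. Qed.
Let LamD p q : Lam (p + q) = Lam p + Lam q.
Proof. by rewrite -{1}[p]scale1r Lam_lin mul1r. Qed.
Let LamZ a p : Lam (a *: p) = a * Lam p.
Proof. by rewrite -[a *: p]addr0 Lam_lin Lam0 addr0. Qed.
Let Lam_sum n (F : nat -> {poly R}) : Lam (\sum_(i < n) F i) = \sum_(i < n) Lam (F i).
Proof. by elim: n => [|n IH]; rewrite ?big_ord0 // !big_ord_recr /= LamD IH. Qed.

Let Lam_coef r : Lam r = \sum_(i < size r) r`_i * Lam 'X^i.
Proof.
rewrite -{1}[r]coefK poly_def (Lam_sum _ (fun i => r`_i *: 'X^i)).
by apply: eq_bigr => i _; rewrite LamZ.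
Qed.

Let bin_ffact_shift N i k : (i + k <= N)%N -> ('C(N, k + i) * (k + i) ^_ i = N ^_ i * 'C(N - i, k))%N.
Proof.
move=> h; have h1 : (k + i <= N)%N by rewrite addnC.
have h2 : (k <= N - i)%N by rewrite leq_subRL ?(leq_trans (leq_addr k i)).
have h3 : (i <= N)%N := leq_trans (leq_addr k i) h.
apply/eqP; rewrite -(eqn_pmul2r (fact_gt0 (N - i - k))) -(eqn_pmul2r (fact_gt0 k)); apply/eqP.
have e1 := bin_fact h1; have e2 := bin_fact h2; have e3 := ffact_fact (leq_addl k i); have e4 := ffact_fact h3.
rewrite addnK in e3; have e5 : (N - (k + i) = N - i - k)%N by rewrite -subnDA addnC.
rewrite e5 in e1.
transitivity (N`!)%N; [rewrite -e1 -e3|rewrite -e4 -e2]; ring.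
Qed.

Let W N k : R := b ^- N * ('C(N, k)%:R * Lam ('X^k * (b%:P - 'X) ^+ (N - k))).
Let theta N k i : R := (k ^_ i)%:R / (N ^_ i)%:R.

Let W_ge0 N k : 0 <= W N k.
Proof. by rewrite mulr_ge0 ?invr_ge0 ?exprn_ge0 // mulr_ge0. Qed.

(** Expand b^(N-i) as ((b - X) + X)^(N-i): the i-th moment becomes an average, under the Bernstein
    weights, of a ratio of falling factorials close to (k/N)^i. *)
Let moment N i : 0 < b -> (i <= N)%N -> Lam 'X^i = b ^+ i * \sum_(k < N.+1) W N k * theta N k i.
Proof.
move=> b0 iN; have f0 : (N ^_ i)%:R != 0 :> R by rewrite pnatr_eq0 -lt0n ffact_gt0.
have e1 : b ^+ (N - i) * Lam 'X^i = \sum_(k < (N - i).+1) 'C(N - i, k)%:R * Lam ('X^(i + k) * (b%:P - 'X) ^+ (N - (i + k))).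
  rewrite -LamZ -mul_polyC polyC_exp mulrC.
  have -> : b%:P ^+ (N - i) = ((b%:P - 'X) + 'X) ^+ (N - i) :> {poly R} by rewrite subrK.
  rewrite exprDn mulr_sumr (Lam_sum _ (fun k => 'X^i * ((b%:P - 'X) ^+ (N - i - k) * 'X^k *+ 'C(N - i, k)))).
  apply: eq_bigr => k _; rewrite -LamZ scaler_nat -subnDA -mulrnAr; congr Lam.
  by rewrite exprD !mulrnAr -mulrA [X in 'X^i * X *+ _]mulrC.
have -> : Lam 'X^i = b ^- (N - i) * (b ^+ (N - i) * Lam 'X^i) by rewrite mulKf // expf_neq0 // gt_eqF.
rewrite e1 -(big_mkord xpredT (fun k => W N k * theta N k i)) (@big_cat_nat _ _ _ i) //=; last exact: leqW.
rewrite [X in _ * (X + _)]big1_seq ?add0r; last first.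
  by move=> k; rewrite mem_index_iota => /andP[_ /= ki]; rewrite /theta ffact_small // mul0r mulr0.
rewrite -[X in \sum_(X <= _ < _) _]add0n big_addn subSn // big_mkord !mulr_sumr; apply: eq_bigr => k _.
have h : (i + k <= N)%N by rewrite -leq_subRL // -ltnS.
have e2 := congr1 (fun n : nat => n%:R : R) (bin_ffact_shift h); rewrite !natrM in e2.
have eik : (k + i = i + k)%N := addnC k i; rewrite eik in e2; rewrite /W /theta eik.
have eb : b ^- (N - i) = b ^+ i * b ^- N by rewrite -{2}(subnK iN) exprD invfM mulrC mulfVK // expf_neq0 // gt_eqF.
rewrite eb; move: (Lam _) => L; transitivity (b ^+ i * b ^- N * L * (('C(N, i + k))%:R * ((i + k) ^_ i)%:R) / (N ^_ i)%:R); last by ring.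
rewrite e2; move: (b ^+ i / b ^+ N) ('C(N - i, k)%:R : R) f0 => u v; move: ((N ^_ i)%:R : R) => z z0; by field.
Qed.

Let theta_close N k i : (k <= N)%N -> (i < N)%N -> 0 <= theta N k i <= 1 /\ `|theta N k i - (k%:R / N%:R) ^+ i| <= (i * i)%:R / (N - i)%:R.
Proof.
move=> kN; elim: i => [|i IH] iN.
  by rewrite /theta !ffactn0 divr1 expr0 subrr normr0 muln0 mul0r lexx ler01.
have [/andP[t0 t1] h] := IH (ltnW iN); have N0 : 0 < N%:R :> R by rewrite ltr0n (leq_ltn_trans _ iN).
have ni : 0 < (N - i)%:R :> R by rewrite ltr0n subn_gt0 ltnW.
set a : R := (k - i)%:R / (N - i)%:R; set t : R := k%:R / N%:R in h *.
have eS : theta N k i.+1 = theta N k i * a by rewrite /theta !ffactnSr !natrM invfM /a; ring.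
have a0 : 0 <= a by rewrite divr_ge0.
have a1 : a <= 1 by rewrite ler_pdivrMr // mul1r ler_nat leq_sub2r.
have tt0 : 0 <= t by rewrite divr_ge0.
have tt1 : t <= 1 by rewrite ler_pdivrMr // mul1r ler_nat.
have ha : `|a - t| <= i%:R / (N - i)%:R.
  have ik : (k - i)%:R * N%:R <= k%:R * (N - i)%:R :> R.
    by rewrite -!natrM ler_nat; clear -kN iN; nia.
  have ik2 : k%:R * (N - i)%:R <= (k - i)%:R * N%:R + i%:R * N%:R :> R.
    by rewrite -!natrM -natrD ler_nat; clear -kN iN; nia.
  have -> : a - t = ((k - i)%:R * N%:R - k%:R * (N - i)%:R) / (N%:R * (N - i)%:R).
    by rewrite /a /t; field; rewrite !gt_eqF.
  rewrite normrM [X in _ * X]ger0_norm ?invr_ge0 ?mulr_ge0 // ler_pdivrMr ?mulr_gt0 //.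
  rewrite mulrA mulrAC mulfVK ?gt_eqF // [X in `|X|]addrC ler0_norm ?subr_le0 //; last by move: ik; lra.
  by move: ik2; lra.
split; first by rewrite eS mulr_ge0 // mulr_ile1.
rewrite eS exprSr.
have -> : theta N k i * a - t ^+ i * t = (theta N k i - t ^+ i) * a + t ^+ i * (a - t) by ring.
apply: le_trans (ler_normD _ _) _; rewrite normrM (ger0_norm a0) [`|t ^+ i * _|]normrM (ger0_norm (exprn_ge0 i tt0)).
apply: (@le_trans _ _ ((i * i)%:R / (N - i)%:R + i%:R / (N - i)%:R)).
  apply: lerD; first by apply: le_trans h; rewrite ler_piMr.
  by apply: le_trans ha; rewrite ler_piMl // exprn_ile1.
rewrite -mulrDl; apply: ler_pM; rewrite ?addr_ge0 ?invr_ge0 // -?natrD ?ler_nat; first by clear; nia.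
by rewrite lef_pV2 ?posrE ?ltr0n ?subn_gt0 ?ler_nat ?leq_sub2l // ltnW.
Qed.

(* The Bernstein weights [W N k >= 0] represent [Lam] up to [O(1/N)] by point masses at [b k / N]. *)
Lemma positive_functional_le r M : (forall x, 0 <= x <= b -> r.[x] <= M) -> Lam r <= M * Lam 1.
Proof.
move=> hr; have L1 : 0 <= Lam 1 by have := Lam_pos 0 0; rewrite expr0 mul1r.
have [b0|b0] := eqVneq b 0.
  have z i : Lam ('X^(i.+1)) = 0.
    apply: le_anti; have := Lam_pos i 1; have := Lam_pos i.+1 0.
    rewrite b0 expr0 mulr1 => ->; rewrite andbT sub0r expr1 mulrN -exprSr -scaleN1r LamZ; lra.
  have -> : Lam r = r`_0 * Lam 1.
    rewrite Lam_coef; case E: (size r) => [|n].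
      by rewrite big_ord0 nth_default ?mul0r // E.
    by rewrite big_ord_recl big1 ?addr0 // => i _; rewrite z mulr0.
  by rewrite ler_wpM2r // -horner_coef0; apply: hr; rewrite lexx b0 lexx.
have {}b0 : 0 < b by rewrite lt_neqAle eq_sym b0.
pose s := size r; pose E := \sum_(i < s) `|r`_i| * b ^+ i * (s * s)%:R.
have E0 : 0 <= E by rewrite sumr_ge0 // => i _; rewrite !mulr_ge0 // exprn_ge0.
have key n : Lam r <= (M + E / n.+1%:R) * Lam 1.
  pose N := (s + n.+1)%N; have sN : (s < N)%N by rewrite /N addnS ltnS leq_addr.
  have L1E : Lam 1 = \sum_(k < N.+1) W N k.
    have := moment b0 (leq0n N); rewrite !expr0 mul1r => ->; apply: eq_bigr => k _.
    by rewrite /theta !ffactn0 divr1 mulr1.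
  have -> : Lam r = \sum_(k < N.+1) W N k * \sum_(i < s) r`_i * b ^+ i * theta N k i.
    rewrite Lam_coef; under eq_bigr => i _ do rewrite (moment b0 (ltnW (ltn_trans (ltn_ord i) sN))) mulrA mulr_sumr.
    rewrite exchange_big /=; apply: eq_bigr => k _; rewrite mulr_sumr; apply: eq_bigr => i _; ring.
  rewrite L1E mulr_sumr; apply: ler_sum => k _; rewrite mulrC ler_wpM2r ?W_ge0 //.
  have kN : (k <= N)%N by rewrite -ltnS.
  have N0 : 0 < N%:R :> R by rewrite ltr0n (leq_ltn_trans _ sN).
  pose x := b * (k%:R / N%:R).
  have hx : r.[x] <= M.
    apply: hr; rewrite /x mulr_ge0 ?divr_ge0 ?(ltW b0) //= ler_piMr ?(ltW b0) //.
    by rewrite ler_pdivrMr // mul1r ler_nat.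
  have -> : \sum_(i < s) r`_i * b ^+ i * theta N k i = r.[x] + \sum_(i < s) r`_i * b ^+ i * (theta N k i - (k%:R / N%:R) ^+ i).
    rewrite horner_coef -/s -big_split; apply: eq_bigr => i _ /=; rewrite /x exprMn; ring.
  apply: lerD => //; rewrite /E mulr_suml; apply: ler_sum => i _.
  apply: le_trans (ler_norm _) _; rewrite !normrM (ger0_norm (exprn_ge0 i (ltW b0))) -[leRHS]mulrA.
  rewrite ler_wpM2l ?mulr_ge0 ?exprn_ge0 ?(ltW b0) //.
  have [_ h] := theta_close kN (ltn_trans (ltn_ord i) sN); apply: le_trans h _.
  have si := ltn_ord i; apply: ler_pM; rewrite ?invr_ge0 // ?ler_nat; first by rewrite leq_mul // ltnW.
  rewrite lef_pV2 ?posrE ?ltr0n ?subn_gt0 ?(ltn_trans si sN) // ler_nat /N; move: (nat_of_ord i) si => i' si.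
  by clearbody s; clear -si; lia.
apply/ler_addgt0Pr => eps eps0; pose A := E * Lam 1.
have A0 : 0 <= A by rewrite mulr_ge0.
have := key (Num.bound (A / eps)); set n := Num.bound _ => h; apply: le_trans h _.
rewrite mulrDl lerD2l mulrAC -/A ler_pdivrMr // mulrC -ler_pdivrMr //.
apply: ltW; apply: lt_le_trans (archi_boundP _) _; first by rewrite divr_ge0 // ltW.
by rewrite -/n ler_nat.
Qed.

End PositiveFunctional.

(** * Functional calculus on polynomials of the generator *)

Section FunctionalCalculus.
Context (dd : measure_display) (T : measurableType dd) (R : realType).
Variables (P : probability T R) (L : (T -> R) -> (T -> R)) (c : R).
Local Notation itg := (mitg P setT).
Local Notation Er := (mEr P setT).
Local Notation L2 := (L2 P).
Hypothesis L_lin : forall a f g w, L (fun v => a * f v + g v) w = a * L f w + L g w.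
Hypothesis L_L2 : forall f, L2 f -> L2 (L f).
Hypothesis L_sym : forall f g, L2 f -> L2 g -> Er (fun w => g w * L f w) = Er (fun w => f w * L g w).
Hypothesis L_ge0 : forall f, L2 f -> 0 <= Er (fun w => f w * L f w).
Hypothesis c_gt0 : 0 < c.
Hypothesis L_le : forall f, L2 f -> Er (fun w => f w * L f w) <= c * Er (fun w => f w ^+ 2).
Implicit Types (p q : {poly R}) (f g : T -> R).
Let mT : measurable [set: T]. Proof. exact: measurableT. Qed.

Lemma poly_op_widen n p f w : (size p <= n)%N -> poly_op L p f w = \sum_(i < n) p`_i * iter i L f w.
Proof.
move=> h; rewrite /poly_op (big_ord_widen_cond _ xpredT (fun i => p`_i * iter i L f w) h) big_mkcond /=.
by apply: eq_bigr => i _; case: ltnP => // h2; rewrite nth_default // mul0r.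
Qed.

Lemma poly_op_lin a p q f w : poly_op L (a *: p + q) f w = a * poly_op L p f w + poly_op L q f w.
Proof.
pose n := maxn (size p) (size q).
rewrite !(@poly_op_widen n) ?leq_maxl ?leq_maxr //; last first.
  by apply: leq_trans (size_polyD _ _) _; rewrite geq_max leq_maxr (leq_trans (size_scale_leq _ _)) ?leq_maxl.
by rewrite mulr_sumr -big_split; apply: eq_bigr => i _ /=; rewrite coefD coefZ; ring.
Qed.

Lemma poly_opC a f w : poly_op L a%:P f w = a * f w.
Proof. by rewrite (@poly_op_widen 1) ?size_polyC_leq1 // big_ord1 coefC. Qed.

Let L0 w : L (fun=> 0) w = 0.
Proof.
have -> : (fun=> 0) = (fun v : T => (-1) * 0 + 0) :> (T -> R) by apply/funext => v; ring.
by have -> := L_lin (-1) (fun=> 0) (fun=> 0) w; rewrite mulN1r addNr.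
Qed.

Let L_sum n (a : nat -> R) (F : nat -> T -> R) w : L (fun v => \sum_(i < n) a i * F i v) w = \sum_(i < n) a i * L (F i) w.
Proof.
elim: n => [|n IH].
  by rewrite big_ord0 -[RHS](L0 w); congr (L _ w); apply/funext => v; rewrite big_ord0.
rewrite big_ord_recr /= -IH addrC -L_lin; congr (L _ w); apply/funext => v; by rewrite big_ord_recr /= addrC.
Qed.

Lemma poly_opMX p f w : poly_op L (p * 'X) f w = L (poly_op L p f) w.
Proof.
rewrite (@poly_op_widen (size p).+1); last by have [->|h] := eqVneq p 0; rewrite ?mul0r ?size_poly0 // size_mulX.
rewrite big_ord_recl coefMX mul0r add0r.
have -> : poly_op L p f = (fun v => \sum_(i < size p) p`_i * iter i L f v) by [].
rewrite (L_sum _ (fun i => p`_i) (fun i => iter i L f)).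
by apply: eq_bigr => i _; rewrite coefMX.
Qed.

Lemma poly_opM p q f w : poly_op L (p * q) f w = poly_op L p (poly_op L q f) w.
Proof.
elim/poly_ind: p w => [|p a IH] w.
  by rewrite mul0r /poly_op size_poly0 !big_ord0.
have -> : (p * 'X + a%:P) * q = a *: q + (p * q) * 'X by rewrite -mul_polyC; ring.
rewrite poly_op_lin poly_opMX [p * 'X + _]addrC -[a%:P]alg_polyC poly_op_lin poly_opMX.
rewrite -polyC1 poly_opC mul1r; congr (_ + L _ w); exact/funext.
Qed.

Lemma poly_opX f w : poly_op L 'X f w = L f w.
Proof.
rewrite -[X in poly_op L X]mul1r poly_opMX; congr (L _ w); apply/funext => u.
by rewrite -polyC1 poly_opC mul1r.
Qed.

Lemma L2_poly_op p f : L2 f -> L2 (poly_op L p f).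
Proof.
move=> hf; apply: L2_sum => i; apply: L2Z; elim: (nat_of_ord i) => //= n; exact: L_L2.
Qed.

Lemma poly_op_sym p f g : L2 f -> L2 g -> Er (fun w => g w * poly_op L p f w) = Er (fun w => f w * poly_op L p g w).
Proof.
move=> hf hg; elim/poly_ind: p f g hf hg => [|p a IH] f g hf hg.
  by apply: eq_Er => w _; rewrite /poly_op size_poly0 !big_ord0 !mulr0.
have e h w : poly_op L (p * 'X + a%:P) h w = a * h w + L (poly_op L p h) w.
  by rewrite addrC -alg_polyC poly_op_lin poly_opMX -polyC1 poly_opC mul1r.
have e2 h w : L (poly_op L p h) w = poly_op L p (L h) w.
  by rewrite -poly_opMX poly_opM (_ : poly_op L 'X h = L h) //; apply/funext => v; exact: poly_opX.
have e3 (h k : T -> R) : L2 h -> L2 k -> Er (fun w => k w * poly_op L (p * 'X + a%:P) h w) = a * Er (fun w => k w * h w) + Er (fun w => k w * L (poly_op L p h) w).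
  move=> hh hk; have i1 := L2_mul hk hh; have i2 := L2_mul hk (L_L2 (L2_poly_op p hh)).
  by rewrite -(ErZ mT _ i1) -(ErD mT (itgZ mT a i1) i2); apply: eq_Er => w _; rewrite e; ring.
rewrite !e3 //; congr (_ * _ + _); first by apply: eq_Er => w _; rewrite mulrC.
rewrite (L_sym (L2_poly_op p hf) hg).
have -> : Er (fun w => poly_op L p f w * L g w) = Er (fun w => L g w * poly_op L p f w) by apply: eq_Er => w _; rewrite mulrC.
rewrite IH //; last exact: L_L2.
by apply: eq_Er => w _; rewrite -e2.
Qed.

Definition Lam f p : R := Er (fun w => f w * poly_op L p f w).

Lemma Lam_sqr f p q : L2 f -> Lam f (p ^+ 2 * q) = Lam (poly_op L p f) q.
Proof.
move=> hf; rewrite /Lam.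
have -> : Er (fun w => f w * poly_op L (p ^+ 2 * q) f w) = Er (fun w => f w * poly_op L p (poly_op L q (poly_op L p f)) w).
  apply: eq_Er => w _; have -> : p ^+ 2 * q = p * (q * p) by ring.
  rewrite poly_opM; congr (_ * poly_op L p _ w); apply/funext => v; exact: poly_opM.
rewrite poly_op_sym //; last by do 2!apply: L2_poly_op.
by apply: eq_Er => w _; rewrite mulrC.
Qed.

Lemma Lam_lin f a p q : L2 f -> Lam f (a *: p + q) = a * Lam f p + Lam f q.
Proof.
move=> hf; have i1 := L2_mul hf (L2_poly_op p hf); have i2 := L2_mul hf (L2_poly_op q hf).
by rewrite /Lam -(ErZ mT _ i1) -(ErD mT (itgZ mT a i1) i2); apply: eq_Er => w _; rewrite poly_op_lin; ring.
Qed.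

Lemma Lam0 f : L2 f -> Lam f 0 = 0.
Proof. move=> hf; have := Lam_lin 1 0 0 hf; rewrite scaler0 addr0 mul1r; move: (Lam f 0) => z; lra. Qed.

Lemma Lam1 f : Lam f 1 = Er (fun w => f w ^+ 2).
Proof. by apply: eq_Er => w _; rewrite -polyC1 poly_opC mul1r expr2. Qed.

Lemma LamX f : Lam f 'X = Er (fun w => f w * L f w).
Proof. by apply: eq_Er => w _; rewrite poly_opX. Qed.

Lemma LamX2 f : L2 f -> Lam f 'X^2 = Er (fun w => L f w ^+ 2).
Proof. by move=> hf; rewrite -[X in Lam f X]mulr1 Lam_sqr // Lam1; apply: eq_Er => w _; rewrite poly_opX. Qed.

(** By symmetry even powers are moved onto [f]. What remains is 1, X, b - X or X (b - X), and each
    is nonnegative by one of the bounds on [L]. *)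
Lemma Lam_pos f b a m : L2 f ->
  (forall g, L2 g -> Er (fun w => g w * L g w) <= b * Er (fun w => g w ^+ 2)) ->
  (forall g, L2 g -> Er (fun w => L g w ^+ 2) <= b * Er (fun w => g w * L g w)) ->
  0 <= Lam f ('X^a * (b%:P - 'X) ^+ m).
Proof.
move=> hf h1 h2; pose p := 'X^(a./2) * (b%:P - 'X) ^+ m./2.
have -> : 'X^a * (b%:P - 'X) ^+ m = p ^+ 2 * ('X^(odd a) * (b%:P - 'X) ^+ odd m).
  rewrite -{1}(odd_double_half a) -{1}(odd_double_half m) -!muln2 /p !exprD !exprM; ring.
rewrite Lam_sqr //; have hg := L2_poly_op p hf; move: (poly_op L p f) hg => g hg {p}.
have {}h1 := h1 g hg; have {}h2 := h2 g hg; have h3 := L_ge0 hg; have h4 : 0 <= Er (fun w => g w ^+ 2) := L2_sqr_ge0 P g.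
rewrite -(LamX g) -(Lam1 g) -(LamX2 hg) in h1 h2 h3 h4.
case: (odd a); case: (odd m) => /=; rewrite ?expr0 ?expr1 ?mul1r ?mulr1 //.
- have -> : 'X * (b%:P - 'X) = b *: 'X + (-1) *: 'X^2 + 0 :> {poly R} by rewrite -!mul_polyC; ring.
  by rewrite -addrA !Lam_lin // Lam0 //; move: h2; lra.
- have -> : b%:P - 'X = (-1) *: 'X + b *: 1 + 0 :> {poly R} by rewrite -!mul_polyC; ring.
  by rewrite -addrA !Lam_lin // Lam0 //; move: h1; lra.
Qed.

(* Positivity of [L] at [b g - L g] gives [|L g|^2 <= b (g, L g)]. *)
Lemma form_sqr_le b : 0 < b -> (forall g, L2 g -> Er (fun w => g w * L g w) <= b * Er (fun w => g w ^+ 2)) ->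
  forall g, L2 g -> Er (fun w => L g w ^+ 2) <= b * Er (fun w => g w * L g w).
Proof.
move=> b0 h g hg; have h1 := h _ (L_L2 hg); have h2 := L_ge0 (L2_poly_op ('X - b%:P) hg).
rewrite -LamX -Lam_sqr // in h2.
have e1 : Er (fun w => L g w * L (L g) w) = Lam g ('X^2 * 'X).
  by rewrite Lam_sqr // LamX; congr (mEr P setT); apply/funext => w; rewrite (_ : poly_op L 'X g = L g) //; apply/funext => v; rewrite poly_opX.
rewrite e1 -(LamX2 hg) in h1; rewrite -(LamX2 hg) -(LamX g).
have e2 : ('X - b%:P) ^+ 2 * 'X = 1 *: ('X^2 * 'X) + (- (2 * b) *: 'X^2 + ((b ^+ 2) *: 'X + 0)) :> {poly R}.
  by rewrite -!mul_polyC polyCN polyCM polyC_exp polyC_natr; ring.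
rewrite e2 !Lam_lin // Lam0 // in h2.
rewrite -(ler_pM2l b0); move: h1 h2; rewrite expr2; nra.
Qed.

Lemma functional_calculus_poly (Psi : R -> R) q f : L2 f -> (forall x, 0 <= x <= c -> Psi x = q.[x]) ->
  functional_calculus P L Psi f (poly_op L q f).
Proof.
move=> hf hq; have hg := L2_poly_op q hf; split; first exact/L2P.
move=> K p hK hp.
have K0 : 0 <= K.
  have h1 : L2 (fun=> 1) := L2_cst P 1; have := hK _ ((L2P _ _).2 h1).
  rewrite (norm2E h1) (norm2E (L_L2 h1)).
  rewrite -EFinM lee_fin => h; have := le_trans (sqrtr_ge0 _) h.
  have -> : Er (fun=> 1 ^+ 2) = 1 by rewrite Er_cst expr1n.
  by rewrite sqrtr1 mulr1.

have nK g : L2 g -> Er (fun w => L g w ^+ 2) <= K ^+ 2 * Er (fun w => g w ^+ 2).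
  move=> h; have := hK g ((L2P _ _).2 h); rewrite !norm2E //; last exact: L_L2.
  rewrite -EFinM lee_fin => h1; rewrite -(sqr_sqrtr (L2_sqr_ge0 P (L g))) -(sqr_sqrtr (L2_sqr_ge0 P g)) -exprMn.
  by apply: sqr_mono => //; exact: sqrtr_ge0.
have fK g : L2 g -> Er (fun w => g w * L g w) <= K * Er (fun w => g w ^+ 2).
  move=> h; rewrite -(ler_pXn2r (_ : (0 < 2)%N)) ?nnegrE ?L_ge0 ?mulr_ge0 ?L2_sqr_ge0 //.
  apply: le_trans (Er_CS h (L_L2 h)) _; rewrite exprMn expr2 mulrA mulrC.
  by rewrite ler_wpM2r ?L2_sqr_ge0 // nK.
(* Convergence is known on [0, K] only and [Psi] agrees with [q] on [0, c] only; both numbers bound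
   the form of [L], hence so does the smaller one. *)
pose b := Num.min K c; have b0 : 0 <= b by rewrite le_min K0 ltW.
have bK : b <= K by rewrite ge_min lexx.
have bc : b <= c by rewrite ge_min lexx orbT.
have h1 g : L2 g -> Er (fun w => g w * L g w) <= b * Er (fun w => g w ^+ 2).
  by move=> h; rewrite /b; case: (leP K c) => _; [exact: fK|exact: L_le].
have h2 g : L2 g -> Er (fun w => L g w ^+ 2) <= b * Er (fun w => g w * L g w).
  have [bz|bz] := eqVneq b 0; last by apply: form_sqr_le => //; rewrite lt_neqAle eq_sym bz.
  move=> h; have K00 : K = 0.
    by move: bz; rewrite /b; case: (leP K c) => // _ cz; move: c_gt0; rewrite cz ltxx.
  by rewrite bz mul0r; have := nK g h; rewrite K00 expr2 !mul0r.
pose S := Er (fun w => f w ^+ 2); have S0 : 0 <= S := L2_sqr_ge0 P f.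
have key n eps : 0 < eps -> (forall x, 0 <= x <= K -> `|(p n).[x] - Psi x| <= eps) ->
    norm2 P (fun w => poly_op L (p n) f w - poly_op L q f w) = (Num.sqrt (Er (fun w => (poly_op L (p n) f w - poly_op L q f w) ^+ 2)))%:E /\
    Num.sqrt (Er (fun w => (poly_op L (p n) f w - poly_op L q f w) ^+ 2)) <= eps * Num.sqrt S.
  move=> e0 he; split; first by apply: norm2E; apply: L2B => //; exact: L2_poly_op.
  have -> : Er (fun w => (poly_op L (p n) f w - poly_op L q f w) ^+ 2) = Lam f ((p n - q) ^+ 2).
    rewrite -[X in Lam f X]mulr1 Lam_sqr // Lam1; apply: eq_Er => w _; congr (_ ^+ 2).
    by rewrite addrC -mulN1r -poly_op_lin scaleN1r addrC.
  apply: (@le_trans _ _ (Num.sqrt (eps ^+ 2 * S))); last by rewrite sqrtrM ?sqr_ge0 // sqrtr_sqr (gtr0_norm e0).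
  rewrite ler_wsqrtr // /S -Lam1; apply: (@positive_functional_le _ (Lam f) b) => //.
  - by move=> a r s; exact: Lam_lin.
  - by move=> a m; exact: Lam_pos.
  move=> x /andP[x0 xb]; rewrite !hornerE -(hq x) ?x0 ?(le_trans xb) //.
  rewrite -real_normK ?num_real //; apply: sqr_mono => //; apply: he; rewrite x0; exact: le_trans bK.
apply/fine_cvgP; split.
  have := hp 1 ltr01; apply: filterS => n h; by have [-> _] := key n 1 ltr01 h.
apply/cvgrPdist_le => eps e0; pose e := eps / (Num.sqrt S + 1).
have s0 : 0 <= Num.sqrt S := sqrtr_ge0 S.
have ee : 0 < e by rewrite divr_gt0 // ltr_wpDl.
have := hp e ee; apply: filterS => n h; have [/= -> h3] := key n e ee h; rewrite /= sub0r normrN ger0_norm ?sqrtr_ge0 //.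
apply: le_trans h3 _; rewrite /e mulrAC ler_pdivrMr ?ltr_wpDl // ler_pM2l //; lra.
Qed.

End FunctionalCalculus.

(** * The spectral measure of the drift *)

Section Spectral.
Variables (R : realType) (alpha beta : R) (alpha_gt0 : 0 < alpha) (hab : alpha <= beta) (d : nat) (d_gt0 : (0 < d)%N).
Local Notation Om := (Omega hab d).
Variables (nu : probability (conductance hab) R) (P : probability Om R).
Hypothesis hP : product_measure nu P.
Variable xi : 'rV[R]_d.
Variable e : {measure set (measurableTypeR R) -> \bar R}.
Local Notation dr := (@drift R alpha beta hab d xi).
Local Notation Lop := (@opL R alpha beta hab d).
Local Notation c := (cst d beta).
Local Notation mm := (@mm R alpha beta hab d P xi).
Local Notation UU := (@UU R alpha beta hab d xi).
Hypothesis he : spectral_measure P Lop dr e.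
Hypothesis mm_cvg0 : mm j @[j --> \oo] --> 0.
Let c0 : 0 < c := cst_gt0 d_gt0 alpha_gt0 hab.
Local Notation IR := (`[0%R, +oo[%classic : set (measurableTypeR R)).
Local Notation D := (`]0%R, c]%classic : set (measurableTypeR R)).
Let mI : measurable IR. Proof. exact: measurable_itv. Qed.
Let mD : measurable D. Proof. exact: measurable_itv. Qed.

Let L_lin a f g w : Lop (fun v => a * f v + g v) w = a * Lop f w + Lop g w.
Proof. by rewrite (opLD (fun v => a * f v) g) (opLZ a f). Qed.

Lemma spectral_poly (Psi : R -> R) (q : {poly R}) : {within `[0, +oo[%classic, continuous Psi} ->
  (exists M : R, forall x : R, 0 <= x -> `|Psi x| <= M) -> (forall x, 0 <= x <= c -> Psi x = q.[x]) ->
  (\int[e]_(x in IR) (Psi x)%:E)%E = (Lam P Lop dr q)%:E.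
Proof.
move=> cPsi bPsi hq; have hdr := L2_drift alpha_gt0 hP xi.
have fc : functional_calculus P Lop Psi dr (poly_op Lop q dr).
  apply: (@functional_calculus_poly _ _ _ P Lop c) => //.
  - by move=> f hf; apply: (L2_opL alpha_gt0 hP hf).
  - by move=> f g hf hg; apply: (opL_sym alpha_gt0 hP hf hg).
  - by move=> f hf; apply: (opL_ge0 alpha_gt0 hP hf).
  - by move=> f hf; apply: (opL_le alpha_gt0 hP hf).
have i1 := L2_mul hdr (L2_poly_op (L2_opL alpha_gt0 hP) q hdr).
by rewrite -(he.2 _ _ cPsi bPsi fc) (expectationE i1).
Qed.

(** Test functions must be bounded; a polynomial frozen beyond [c] is, and is unchanged on [0, c],
    where the operator lives. *)
Lemma spectral_horner (q : {poly R}) : (\int[e]_(x in IR) (q.[Num.min x c])%:E)%E = (Lam P Lop dr q)%:E.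
Proof.
apply: spectral_poly.
- apply: continuous_subspaceT => x.
  have h : {for x, continuous (@id R \min (fun=> c))} by apply: continuous_min; [exact: cvg_id|exact: cvg_cst].
  exact: (continuous_comp h (@continuous_horner _ q _)).
- exists (\sum_(i < size q) `|q`_i| * c ^+ i) => x x0.
  have m0 : 0 <= Num.min x c by rewrite le_min x0 ltW.
  rewrite horner_coef; apply: le_trans (ler_norm_sum _ _ _) _; apply: ler_sum => i _.
  by rewrite normrM ler_wpM2l // normrX lerXn2r ?nnegrE ?(ltW c0) // ger0_norm // ge_min lexx orbT.
- by move=> x /andP[_ xc]; rewrite min_l.
Qed.

Definition rhof (x : R) : R := 1 - c^-1 * x.

Let rq : {poly R} := 1 - c^-1 *: 'X.
Let rqE x : rq.[x] = rhof x. Proof. by rewrite /rq /rhof !hornerE. Qed.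

Lemma Lam_rho j : Lam P Lop dr (rq ^+ j) = mm j.
Proof.
apply: eq_Er => w _; congr (_ * _); elim: j w => [|j IH] w.
  by rewrite expr0 -polyC1 poly_opC mul1r.
rewrite exprSr /rq mulrBr mulr1 -scalerAr addrC -scaleNr poly_op_lin (poly_opMX L_lin) IH /= /Tom.
have -> : poly_op Lop ((1 - c^-1 *: 'X) ^+ j) dr = UU j by apply/funext.
rewrite /UU; ring.
Qed.

Lemma spectral_moment j : (\int[e]_(x in IR) (rhof (Num.min x c) ^+ j)%:E)%E = (mm j)%:E.
Proof.
rewrite -Lam_rho -spectral_horner; apply: eq_integral => x _; by rewrite horner_exp rqE.
Qed.

Let mrho j : measurable_fun IR (fun x => rhof (Num.min x c) ^+ j).
Proof.
apply: measurable_funX; apply: measurable_funB => //; apply: measurable_funM => //.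
exact: measurable_minr.
Qed.

Lemma rho_ge0 x : 0 <= x <= c -> 0 <= rhof x <= 1.
Proof.
move=> /andP[x0 xc]; rewrite /rhof subr_ge0 gerBl mulr_ge0 ?invr_ge0 ?(ltW c0) // andbT.
by rewrite mulrC ler_pdivrMr // mul1r.
Qed.

Let rho_min_ge0 x : IR x -> 0 <= rhof (Num.min x c) <= 1.
Proof.
rewrite /= in_itv /= andbT => x0; apply: rho_ge0; by rewrite le_min x0 (ltW c0) ge_min lexx orbT.
Qed.

(** Tested with a bounded continuous function that vanishes up to [c] and is positive beyond: the
    zero polynomial represents it. *)
Lemma spectral_null_gt : e `]c, +oo[%classic = 0%E.
Proof.
pose Psi (x : R) := Num.min (Num.max (x - c) 0) 1.
have h : (\int[e]_(x in IR) (Psi x)%:E)%E = 0%E.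
  rewrite (@spectral_poly Psi 0).
  - by rewrite (Lam0 (L2_opL alpha_gt0 hP) (L2_drift alpha_gt0 hP xi)).
  - apply: continuous_subspaceT => x.
    have h1 : {for x, continuous ((fun x => x - c) \max (fun=> 0))}.
      by apply: continuous_max; [apply: cvgB; [exact: cvg_id|exact: cvg_cst]|exact: cvg_cst].
    exact: (continuous_min h1 (cvg_cst _)).
  - exists 1 => x _; rewrite ger0_norm /Psi ?ge_min ?lexx ?orbT // le_min ler01 andbT le_max lexx orbT //.
  - by move=> x /andP[_ xc]; rewrite horner0 /Psi max_r ?subr_le0 // min_l.
have mPsi : measurable_fun IR Psi.
  apply: measurable_minr => //; apply: measurable_maxr => //; exact: measurable_funB.
have P0 x : 0 <= Psi x by rewrite /Psi le_min ler01 andbT le_max lexx orbT.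
have : (\int[e]_(x in IR) `|(Psi x)%:E|)%E = 0%E.
  by rewrite -h; apply: eq_integral => x _; rewrite gee0_abs // lee_fin.
have mEP : measurable_fun IR (EFin \o Psi) by exact/measurable_EFinP.
move=> /(ae_eq_integral_abs e mI mEP).1 [N [mN N0 sub]].
apply/eqP; rewrite -measure_le0 -N0; apply: le_measure; rewrite ?inE //.
move=> x /=; rewrite in_itv /= andbT => cx; apply: sub => /= /(_ _).
rewrite in_itv /= andbT (ltW (lt_trans c0 cx)) => /(_ isT) [].
rewrite /Psi; have : 0 < Num.min (Num.max (x - c) 0) 1 by rewrite lt_min ltr01 andbT lt_max subr_gt0 cx.
by move=> /lt0r_neq0/eqP.
Qed.

(** All powers of [rhof] equal 1 at 0, so the mass there is below every moment [mm j]. *)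
Lemma spectral_null0 : e [set 0] = 0%E.
Proof.
have h j : (e [set 0%R] <= (mm j)%:E)%E.
  rewrite -spectral_moment.
  apply: (@le_trans _ _ (\int[e]_(x in [set 0%R]) (rhof (Num.min x c) ^+ j)%:E)%E).
    have -> : (\int[e]_(x in [set 0%R]) (rhof (Num.min x c) ^+ j)%:E = \int[e]_(x in [set 0%R]) (1%:E : \bar R))%E.
      by apply: eq_integral => x; rewrite inE => ->; rewrite min_l ?(ltW c0) // /rhof mulr0 subr0 expr1n.
    by rewrite integral_cst // mul1e.
  apply: ge0_subset_integral => //; first exact/measurable_EFinP.
    by move=> x /rho_min_ge0 /andP[r0 _]; rewrite lee_fin exprn_ge0.
  by move=> x ->; rewrite /= in_itv /= lexx.
apply/eqP; rewrite -measure_le0; apply/lee_addgt0Pr => eps eps0; rewrite add0e.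
have [j _ /(_ j (leqnn j))] := (cvgrPdist_le _ _).1 mm_cvg0 eps eps0; rewrite /= sub0r normrN => hj.
by apply: le_trans (h j) _; rewrite lee_fin (le_trans (ler_norm _) hj).
Qed.

Let N : set (measurableTypeR R) := [set 0] `|` `]c, +oo[%classic.
Let mN : measurable N. Proof. exact: measurableU. Qed.
Let N0 : e N = 0%E.
Proof. by rewrite measureU0 ?spectral_null0 // spectral_null_gt. Qed.
Let DE : IR `\` N = D.
Proof.
apply/seteqP; split => x /=; rewrite /N !in_itv /= ?andbT.
  move=> [x0 /not_orP[/eqP xn /negP xc]]; move: xc; rewrite in_itv /= andbT -leNgt => ->.
  by rewrite lt_neqAle eq_sym x0 xn.
move=> /andP[x0 xc]; split; first exact: ltW.
by rewrite in_itv /= andbT => -[xz|]; [move: x0; rewrite xz ltxx|rewrite ltNge xc].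
Qed.

Lemma spectral_restrict (F : R -> R) : measurable_fun IR F -> mitg e D F ->
  (\int[e]_(x in IR) (F x)%:E)%E = (mEr e D F)%:E.
Proof.
move=> mF iF; rewrite -(ErE mD iF) -DE; apply: negligible_integral => //.
apply/(negligible_integrable mN mI _ N0); first exact/measurable_EFinP.
by rewrite DE.
Qed.

Lemma spectral_fin : (e D < +oo)%E.
Proof.
have := spectral_moment 0; under eq_integral do rewrite expr0; rewrite integral_cst // mul1e => h.
apply: (@le_lt_trans _ _ (e IR)); last by rewrite h ltry.
by apply: le_measure; rewrite ?inE // -DE; exact: subDsetl.
Qed.

Lemma spectral_itg (F : R -> R) K : measurable_fun D F -> (forall x, 0 < x <= c -> `|F x| <= K) -> mitg e D F.
Proof.
move=> mF h; have iK : mitg e D (fun=> K).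
  apply/integrableP; split; first exact: measurable_cst.
  rewrite integral_cst //= lte_mul_pinfty ?lee_fin ?spectral_fin //.
apply: (itg_le mD mF _ iK) => x; rewrite /= in_itv /=; exact: h.
Qed.

Lemma measurable_rho j : measurable_fun D (fun x => rhof x ^+ j).
Proof. by apply: measurable_funX; apply: measurable_funB => //; apply: measurable_funM. Qed.

Lemma itg_rho j : mitg e D (fun x => rhof x ^+ j).
Proof.
apply: (@spectral_itg _ 1 (measurable_rho j)) => x /andP[x0 xc].
have /andP[r0 r1] := rho_ge0 (introT andP (conj (ltW x0) xc)).
by rewrite ger0_norm ?exprn_ge0 // exprn_ile1.
Qed.

Lemma Er_rho j : mEr e D (fun x => rhof x ^+ j) = mm j.
Proof.
have i1 : mitg e D (fun x => rhof (Num.min x c) ^+ j).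
  by apply: itg_eq (itg_rho j) => // x; rewrite /= in_itv /= => /andP[_ xc]; rewrite min_l.
have := spectral_restrict (mrho j) i1; rewrite spectral_moment => -[->].
by apply: eq_Er => x; rewrite /= in_itv /= => /andP[_ xc]; rewrite min_l.
Qed.

End Spectral.

(** * Comparison of the approximation with the partial sums *)

Section Kernel.
Variables (R : realType) (mu : R).
Hypothesis mu_gt0 : 0 < mu.
Implicit Types (x : R) (k i I J K : nat).

(** This is Q(0)/Q(x), the relative error of P/Q as an approximation of 1/x. *)
Definition hfun k x : R := \prod_(i < k) (2 ^+ i * mu / (2 ^+ i * mu + x)) ^+ 2.
Definition hcst k : R := \prod_(i < k) (2 ^+ i) ^+ 2.

Let p2 i : 0 < 2 ^+ i * mu. Proof. by rewrite mulr_gt0 // exprn_gt0. Qed.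

Lemma Qpoly_horner k x : (Qpoly mu k).[x] = \prod_(i < k) (2 ^+ i * mu + x) ^+ 2.
Proof. by rewrite /Qpoly horner_prod; apply: eq_bigr => i _; rewrite !hornerE. Qed.

Lemma Qpoly_gt0 k x : 0 <= x -> 0 < (Qpoly mu k).[x].
Proof. by move=> x0; rewrite Qpoly_horner prodr_gt0 // => i _; rewrite exprn_gt0 // ltr_pwDl. Qed.

Lemma Qpoly0 k : (Qpoly mu k).[0] = 2 ^+ (k * k.-1) * mu ^+ (2 * k).
Proof.
rewrite Qpoly_horner; elim: k => [|k IH]; first by rewrite big_ord0 mul0n muln0 !expr0 mulr1.
rewrite big_ord_recr /= IH addr0 exprMn -exprM mulrACA -!exprD; congr (2 ^+ _ * mu ^+ _); last by rewrite mulnS addnC.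
by case: k {IH} => //= k; lia.
Qed.

Lemma PQpoly k x : 0 < x -> (Ppoly mu k).[x] / (Qpoly mu k).[x] = (1 - hfun k x) / x.
Proof.
move=> x0; have Q0 := lt0r_neq0 (Qpoly_gt0 k (ltW x0)).
have hE : hfun k x = (Qpoly mu k).[0] / (Qpoly mu k).[x].
  rewrite !Qpoly_horner -prodfV -big_split; apply: eq_bigr => i _ /=.
  by rewrite addr0 exprMn exprVn.
have e1 : Ppoly mu k * 'X = Qpoly mu k - ((Qpoly mu k).[0])%:P.
  rewrite Qpoly0 divpK // -[X in X %| _]subr0 -polyC0 dvdp_XsubCl rootE !hornerE Qpoly0 subrr //.
have := congr1 (fun p => p.[x]) e1; rewrite !hornerE => e2.
by rewrite hE -[1](divff Q0) -mulrBl -e2; field; rewrite Q0 gt_eqF.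
Qed.

Let fac_ge0 x i : 0 <= x -> 0 <= 2 ^+ i * mu / (2 ^+ i * mu + x) <= 1.
Proof.
move=> x0; have h := ltr_pwDl (p2 i) x0.
by rewrite divr_ge0 ?(ltW (p2 i)) ?(ltW h) //= ler_pdivrMr // mul1r lerDl.
Qed.

Lemma hfun_bnd k x : 0 <= x -> 0 <= hfun k x <= 1.
Proof.
move=> x0; rewrite prodr_ge0 /=; last by move=> i _; exact: sqr_ge0.
by apply: prodr_ile1 => i _; have /andP[f0 f1] := fac_ge0 i x0; rewrite exprn_ge0 // exprn_ile1.
Qed.

Lemma hfun_anti k k' x : 0 <= x -> (k' <= k)%N -> hfun k x <= hfun k' x.
Proof.
move=> x0 /subnK <-; elim: (k - k')%N => [|n IH] //; rewrite addSn /hfun big_ord_recr /=; apply: le_trans IH.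
have /andP[f0 f1] := fac_ge0 (n + k') x0; have /andP[h0 _] := hfun_bnd (n + k') x0.
by rewrite ler_piMr // exprn_ile1.
Qed.

Lemma hfun_le k x : 0 <= x -> hfun k x <= hcst k * (mu / (mu + x)) ^+ (2 * k).
Proof.
move=> x0; elim: k => [|k IH]; first by rewrite /hfun /hcst !big_ord0 muln0 mulr1.
rewrite /hfun /hcst !big_ord_recr /= mulnS addnC exprD mulrACA.
have mx : 0 < mu + x by rewrite ltr_pwDl.
have /andP[h0 _] := hfun_bnd k x0; apply: ler_pM => //; first exact: sqr_ge0.
rewrite -exprMn; apply: sqr_mono; first by case/andP: (fac_ge0 k x0).
rewrite -[leLHS]mulrA ler_pM2l ?exprn_gt0 // ler_pM2l //.
by rewrite lef_pV2 ?posrE ?ltr_pwDl // lerD2r ler_peMl ?exprn_ege1 ?ler1n // ltW.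
Qed.

(** From 1 + y <= exp y in each factor; the exponents form a geometric series with sum (4 - 4/2^k)
    x/mu, whence uniformity in [k]. *)
Lemma hfun_ge k x : 0 <= x -> expR (- (4 * x / mu)) <= hfun k x.
Proof.
move=> x0; apply: (@le_trans _ _ (expR (- ((4 - 4 / 2 ^+ k) * x / mu)))).
  rewrite ler_expR lerN2 ler_pM2r ?invr_gt0 // ler_wpM2r // gerBl divr_ge0 // exprn_ge0 //.
elim: k => [|k IH]; first by rewrite /hfun big_ord0 expr0 divr1 subrr !mul0r oppr0 expR0.
rewrite /hfun big_ord_recr /=; set y := x / (2 ^+ k * mu).
have y0 : 0 <= y by rewrite divr_ge0 // ltW.
have e2 : 2 ^+ k != 0 :> R by rewrite expf_neq0.
have -> : 2 ^+ k * mu / (2 ^+ k * mu + x) = (1 + y)^-1.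
  by rewrite /y; field; rewrite e2 (gt_eqF mu_gt0) /= gt_eqF // ltr_pwDl.
have -> : - ((4 - 4 / 2 ^+ k.+1) * x / mu) = - ((4 - 4 / 2 ^+ k) * x / mu) + - y *+ 2.
  by rewrite /y exprS mulr2n; field; rewrite e2 (gt_eqF mu_gt0).
rewrite expRD; apply: ler_pM; rewrite ?expR_ge0 //.
have -> : - y *+ 2 = 2%:R * - y by rewrite mulr_natl.
rewrite expRM_natl expRN; apply: sqr_mono; first by rewrite invr_ge0 expR_ge0.
by rewrite lef_pV2 ?posrE ?expR_gt0 ?ltr_pwDl // expR_ge1Dx.
Qed.

Variable c : R.
Hypothesis c_gt0 : 0 < c.
Local Notation ro x := (1 - c^-1 * x).

Lemma ro_ge0 x : 0 <= x <= c -> 0 <= ro x <= 1.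
Proof.
move=> /andP[x0 xc]; rewrite subr_ge0 gerBl mulr_ge0 ?invr_ge0 ?(ltW c_gt0) // andbT.
by rewrite mulrC ler_pdivrMr // mul1r.
Qed.

Lemma ro_pow_le J k x : 0 <= x <= c -> 4 * c / mu <= J%:R -> ro x ^+ J <= hfun k x.
Proof.
move=> xc hJ; have /andP[x0 _] := xc; apply: le_trans (hfun_ge k x0).
apply: (@le_trans _ _ (expR (- (c^-1 * x)) ^+ J)).
  have /andP[r0 _] := ro_ge0 xc.
  by rewrite lerXn2r ?nnegrE ?expR_ge0 //; exact: expR_ge1Dx.
rewrite -expRM_natl ler_expR mulrN lerN2.
have -> : 4 * x / mu = 4 * c / mu * (c^-1 * x) by field; rewrite !gt_eqF.
by rewrite ler_wpM2r // mulr_ge0 // invr_ge0 ltW.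
Qed.

Definition Ssum J x : R := c^-1 * \sum_(j < J) ro x ^+ j.

Lemma Ssum_ge0 J x : 0 <= x <= c -> 0 <= Ssum J x.
Proof.
move=> xc; have /andP[r0 _] := ro_ge0 xc.
by rewrite mulr_ge0 ?invr_ge0 ?(ltW c_gt0) // sumr_ge0 // => i _; rewrite exprn_ge0.
Qed.

Lemma SsumE J x : 0 < x -> Ssum J x = (1 - ro x ^+ J) / x.
Proof.
move=> x0; have -> : 1 - ro x ^+ J = c^-1 * x * \sum_(j < J) ro x ^+ j.
  by rewrite -[1](expr1n _ J) subrXX expr1n; congr (_ * _); [ring|apply: eq_bigr => i _; rewrite expr1n mul1r].
by rewrite /Ssum mulrAC mulfK ?gt_eqF.
Qed.

(** The difference is (h - ro^J)/x: nonnegative by [ro_pow_le] once J is large, and at most h (1 -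
    ro^J)/x because h <= 1. Thus [Ssum J] takes the place of 1/x and nothing singular at 0 has to be
    integrated. *)
Lemma Ssum_diff J k x : 0 < x <= c -> 4 * c / mu <= J%:R ->
  0 <= Ssum J x - (Ppoly mu k).[x] / (Qpoly mu k).[x] <= hfun k x * Ssum J x.
Proof.
move=> /andP[x0 xc] hJ; have xc' : 0 <= x <= c by rewrite ltW.
have h1 := ro_pow_le k xc' hJ; have /andP[_ h2] := hfun_bnd k (ltW x0).
have /andP[r0 _] := ro_ge0 xc'; have rJ := exprn_ge0 J r0.
rewrite PQpoly // SsumE // mulrA -mulrBl divr_ge0 ?(ltW x0) //=; last by move: h1; lra.
rewrite ler_pM2r ?invr_gt0 //; move: h1 h2 rJ; set h := hfun _ _; set r := _ ^+ J => h1 h2 rJ.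
have := mulr_ge0 rJ (_ : 0 <= 1 - h); rewrite subr_ge0 => /(_ h2); lra.
Qed.

(* [X = mu / (mu + x)] solves [X (1 + mu / c) = mu / c + ro x * X]; iterating gives powers of [ro x] with polynomially growing coefficients. *)
Lemma Xpow_le K I x : 0 <= x <= c ->
  (mu / (mu + x)) ^+ K.+1 <= ro x ^+ I + (mu / c) ^+ K.+1 * \sum_(i < I) i.+1%:R ^+ K * ro x ^+ i.
Proof.
move=> xc; have /andP[x0 _] := xc; have /andP[r0 _] := ro_ge0 xc.
set X := mu / (mu + x); set m := mu / c; set r := ro x.
have m0 : 0 < m by rewrite divr_gt0.
have mx : 0 < mu + x by rewrite ltr_pwDl.
have X0 : 0 <= X by rewrite divr_ge0 // ltW.
have X1 : X <= 1 by rewrite ler_pdivrMr // mul1r lerDl.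
have XE : X * (1 + m) = m + r * X by rewrite /X /m /r; field; rewrite !gt_eqF.
elim: K I => [|K IHK] I.
  elim: I => [|I IHI]; first by rewrite !expr1 expr0 big_ord0 mulr0 addr0.
  rewrite expr1 in IHI *; apply: (@le_trans _ _ (m + r * X)).
    by rewrite -XE mulrDr mulr1 lerDl mulr_ge0 // ltW.
  rewrite big_ord_recl expr0 mulr1 mulrDr mulr1 addrCA lerD2l.
  apply: le_trans (ler_wpM2l r0 IHI) _; rewrite mulrDr -exprS lerD2l mulrCA ler_pM2l // mulr_sumr.
  by apply: ler_sum => i _; rewrite !expr0 !mul1r -exprS.
elim: I => [|I IHI]; first by rewrite big_ord0 mulr0 addr0 expr0 exprn_ile1.
have m1 : 0 < 1 + m by rewrite addr_gt0.
rewrite -(ler_pM2r m1).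
have -> : X ^+ K.+2 * (1 + m) = m * X ^+ K.+1 + r * X ^+ K.+2.
  by rewrite exprSr -mulrA XE; ring.
apply: le_trans (lerD (ler_wpM2l (ltW m0) (IHK I.+1)) (ler_wpM2l r0 IHI)) _.
set S1 := \sum_(i < I.+1) i.+1%:R ^+ K * r ^+ i; set S2 := \sum_(i < I) i.+1%:R ^+ K.+1 * r ^+ i.
set S := \sum_(i < I.+1) i.+1%:R ^+ K.+1 * r ^+ i.
have S0 : 0 <= S by rewrite sumr_ge0 // => i _; rewrite mulr_ge0 ?exprn_ge0.
have hS : S1 + r * S2 <= S.
  rewrite /S1 /S2 /S !big_ord_recl !expr0 !mulr1 !expr1n -addrA lerD2l mulr_sumr -big_split /=.
  apply: ler_sum => i _; rewrite /bump /= !add1n.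
  have -> : r * (i.+1%:R ^+ K.+1 * r ^+ i) = i.+1%:R ^+ K.+1 * r ^+ i.+1 by rewrite [r ^+ i.+1]exprS mulrCA.
  rewrite -mulrDl ler_wpM2r ?exprn_ge0 // [leRHS]exprS -[X in X * _]natr1 mulrDl mul1r addrC lerD2r.
  by rewrite exprS ler_wpM2l // lerXn2r ?nnegrE // ler_nat.
have mk : 0 < m ^+ K.+2 by rewrite exprn_gt0.
have h1 := ler_wpM2l (ltW mk) hS; have h2 := mulr_ge0 (ltW m0) (mulr_ge0 (ltW mk) S0); rewrite -/r.
have -> : m * (r ^+ I.+1 + m ^+ K.+1 * S1) + r * (r ^+ I + m ^+ K.+2 * S2) = (1 + m) * r ^+ I.+1 + m ^+ K.+2 * (S1 + r * S2).
  by rewrite [in m ^+ K.+2]exprS exprS; ring.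
move: h1 h2; set A := m ^+ K.+2 * _; set B := m ^+ K.+2 * S; set Z := r ^+ _; move: A B Z => A B Z; lra.
Qed.

End Kernel.

Section Approximation.
Variables (R : realType) (alpha beta : R) (alpha_gt0 : 0 < alpha) (hab : alpha <= beta) (d : nat) (d_gt0 : (0 < d)%N).
Variables (nu : probability (conductance hab) R) (P : probability (Omega hab d) R).
Hypothesis hP : product_measure nu P.
Variables (xi : 'rV[R]_d) (Ahom Amuk : 'M[R]_d) (mu : R) (k : nat) (s Cm : R).
Local Notation c := (cst d beta).
Local Notation mm := (@mm R alpha beta hab d P xi).
Hypotheses (hA : homogenized_matrix P Ahom) (hAk : approx_matrix P mu k Amuk) (mu_gt0 : 0 < mu).
Hypotheses (s_gt0 : 0 < s) (Cm_gt0 : 0 < Cm).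
Hypothesis hmm : forall j, mm j <= Cm * pw j (- (1 + s)).
Let c0 : 0 < c := cst_gt0 d_gt0 alpha_gt0 hab.

Definition Acst : R := c^-1 * (Cm * (1 - 2 `^ (- s))^-1).

Lemma Acst_gt0 : 0 < Acst.
Proof. by rewrite !mulr_gt0 ?invr_gt0 // subr_gt0; exact: two_pow_lt1. Qed.

Lemma mm_tail i J : c^-1 * \sum_(j < J) mm (i + j) <= Acst * pw i (- s).
Proof.
rewrite /Acst -mulrA ler_pM2l ?invr_gt0 // -mulrA.
apply: le_trans (ler_wpM2l (ltW Cm_gt0) (sum_pw_tail i (i + J) s_gt0)).
have -> : \sum_(i <= j < i + J) pw j (- (1 + s)) = \sum_(j < J) pw (i + j) (- (1 + s)) :> R.
  by rewrite -{1}[i]add0n big_addn addKn big_mkord; apply: eq_bigr => j _; rewrite addnC.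
by rewrite mulr_sumr; apply: ler_sum.
Qed.

Lemma mm_to0 : mm j @[j --> \oo] --> 0.
Proof.
apply/cvgrPdist_le => eps eps0; have s1 : 0 < 1 + s by rewrite addr_gt0.
have [M0 hM0] := @pw_small R (1 + s) (eps / Cm) s1 (divr_gt0 eps0 Cm_gt0).
exists M0 => // j /= Mj; rewrite sub0r normrN ger0_norm ?(mm_ge0 alpha_gt0 d_gt0 hP) //.
by apply: le_trans (hmm j) _; have := hM0 j Mj; rewrite ler_pdivlMr // mulrC.
Qed.

Section SpectralSide.
Variable e : {measure set (measurableTypeR R) -> \bar R}.
Hypothesis he : spectral_measure P (@opL R alpha beta hab d) (@drift R alpha beta hab d xi) e.
Local Notation D := (`]0%R, c]%classic : set (measurableTypeR R)).
Local Notation Er := (mEr e D).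
Local Notation itg := (mitg e D).
Local Notation S := (Ssum c).
Local Notation ro := (@rhof R beta d).
Local Notation G := (fun x : R => (Ppoly mu k).[x] / (Qpoly mu k).[x]).
Let mD : measurable D. Proof. exact: measurable_itv. Qed.

Let itgro i := itg_rho alpha_gt0 d_gt0 hP he i.
Let Erro i := Er_rho alpha_gt0 d_gt0 hP he mm_to0 i.

Let roS i J x : ro x ^+ i * S J x = c^-1 * \sum_(j < J) ro x ^+ (i + j).
Proof. by rewrite /Ssum mulrCA mulr_sumr; congr (_ * _); apply: eq_bigr => j _; rewrite exprD. Qed.

Let itg_roS i J : itg (fun x => ro x ^+ i * S J x).
Proof.
apply: (itg_eq mD (fun x _ => esym (roS i J x))); apply: itgZ => //; apply: itg_sum => // j; exact: itgro.
Qed.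

Let Er_roS i J : Er (fun x => ro x ^+ i * S J x) = c^-1 * \sum_(j < J) mm (i + j).
Proof.
have -> : Er (fun x => ro x ^+ i * S J x) = Er (fun x => c^-1 * \sum_(j < J) ro x ^+ (i + j)) by apply: eq_Er => x _; exact: roS.
rewrite ErZ //; last by apply: itg_sum => // j; exact: itgro.
rewrite Er_sum //.
by congr (_ * _); apply: eq_bigr => j _; rewrite Erro.
Qed.

Let itgS J : itg (S J).
Proof. by apply: itg_eq (itg_roS 0 J) => // x _; rewrite expr0 mul1r. Qed.
Lemma ErS J : Er (S J) = c^-1 * \sum_(j < J) mm j.
Proof. by rewrite -(Er_roS 0); apply: eq_Er => x _; rewrite expr0 mul1r. Qed.

Let mG : measurable_fun (`[0%R, +oo[%classic : set (measurableTypeR R)) G.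
Proof.
apply: subspace_continuous_measurable_fun; first exact: measurable_itv.
apply: continuous_in_subspaceT => x; rewrite inE /= in_itv /= andbT => x0.
apply: cvgM; first exact: continuous_horner.
by apply: cvgV; [exact: lt0r_neq0 (Qpoly_gt0 mu_gt0 k x0)|exact: continuous_horner].
Qed.

Let J0 : nat := (Num.truncn (4 * c / mu)).+1.
Let J0_le J : (J0 <= J)%N -> 4 * c / mu <= J%:R.
Proof. by move=> h; apply: le_trans (ltW (truncnS_gt _)) _; rewrite ler_nat. Qed.

Let itgG : itg G.
Proof.
apply: (itg_le mD _ _ (itgS J0)).
  by apply: measurable_funS mG => // x; rewrite /= !in_itv /= => /andP[/ltW ->].
move=> x; rewrite /= in_itv /= => x0c; have /andP[x0 xc] := x0c.
have /andP[h _] := Ssum_diff mu_gt0 c0 k x0c (J0_le (leqnn _)).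
rewrite ger0_norm; first by rewrite -subr_ge0.
rewrite PQpoly // divr_ge0 ?(ltW x0) // subr_ge0.
by case/andP: (hfun_bnd mu_gt0 k (ltW x0)).
Qed.

Lemma spectral_G : (\int[e]_(x in `[0%R, +oo[%classic) ((Ppoly mu k).[x] / (Qpoly mu k).[x])%:E)%E = (Er G)%:E.
Proof. exact: (spectral_restrict alpha_gt0 d_gt0 hP he mm_to0 mG itgG). Qed.

Lemma ErSG J : (J0 <= J)%N -> 0 <= Er (S J) - Er G.
Proof.
move=> hJ; rewrite -(ErB mD (itgS J) itgG); apply: Er_ge0 => x; rewrite /= in_itv /= => x0c.
by case/andP: (Ssum_diff mu_gt0 c0 k x0c (J0_le hJ)).
Qed.

Lemma ErSG_le1 J : (J0 <= J)%N -> Er (S J) - Er G <= Acst.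
Proof.
move=> hJ; apply: (@le_trans _ _ (Er (S J))).
  rewrite gerBl; apply: Er_ge0 => x; rewrite /= in_itv /= => /andP[x0 xc].
  rewrite PQpoly // divr_ge0 ?(ltW x0) // subr_ge0.
  by case/andP: (hfun_bnd mu_gt0 k (ltW x0)).
by rewrite ErS; have := mm_tail 0 J; rewrite pw0n mulr1.
Qed.

(** [Xpow_le] replaces h by powers of [ro], and multiplying [Ssum J] by the i-th power shifts the
    moments to a tail of size i^-s. A smaller [k'] is allowed since h decreases in its index; this
    is what later frees the constant from [k]. *)
Lemma ErSG_le J I k' : (J0 <= J)%N -> (0 < k' <= k)%N ->
  Er (S J) - Er G <= hcst R k' * Acst * (pw I (- s) + (mu / c) ^+ (2 * k') * \sum_(i < I) pw i ((2 * k').-1%:R - s)).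
Proof.
move=> hJ /andP[k0 kk]; pose K := (2 * k').-1; have KE : (2 * k' = K.+1)%N by rewrite /K; lia.
pose W x := ro x ^+ I * S J x + (mu / c) ^+ K.+1 * \sum_(i < I) i.+1%:R ^+ K * (ro x ^+ i * S J x).
have h0 : 0 <= hcst R k' by rewrite prodr_ge0 // => i _; exact: sqr_ge0.
have m0 : 0 <= (mu / c) ^+ K.+1 by rewrite exprn_ge0 // divr_ge0 // ltW.
have i1 : itg (fun x => \sum_(i < I) i.+1%:R ^+ K * (ro x ^+ i * S J x)) by apply: itg_sum => // i; exact: (itgZ mD _ (itg_roS i J)).
have iW : itg W := itgD mD (itg_roS I J) (itgZ mD _ i1).
rewrite -(ErB mD (itgS J) itgG); apply: (@le_trans _ _ (Er (fun x => hcst R k' * W x))).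
  apply: Er_le => //; [exact: (itgB mD (itgS J) itgG)|exact: (itgZ mD _ iW)|].
  move=> x; rewrite /= in_itv /= => x0c; have /andP[x0 xc] := x0c; have xc' : 0 <= x <= c by rewrite ltW.
  have /andP[_ h1] := Ssum_diff mu_gt0 c0 k x0c (J0_le hJ); apply: le_trans h1 _.
  have S0 := Ssum_ge0 c0 J xc'.
  apply: (@le_trans _ _ (hcst R k' * (mu / (mu + x)) ^+ K.+1 * S J x)).
    rewrite ler_wpM2r // -KE; apply: le_trans (hfun_anti mu_gt0 (ltW x0) kk) _; exact: hfun_le (ltW x0).
  rewrite -mulrA ler_wpM2l //; apply: le_trans (ler_wpM2r S0 (Xpow_le mu_gt0 c0 K I xc')) _.
  rewrite /W mulrDl lerD2l -mulrA ler_wpM2l // mulr_suml; apply: ler_sum => i _; by rewrite mulrA.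
rewrite (ErZ mD _ iW) -mulrA ler_wpM2l // (ErD mD (itg_roS I J) (itgZ mD _ i1)) (ErZ mD _ i1).
rewrite Er_sum //; last by move=> i; exact: (itgZ mD _ (itg_roS i J)).
rewrite mulrDr; apply: lerD; first by rewrite Er_roS; exact: mm_tail.
rewrite mulrCA KE ler_wpM2l // mulr_sumr; apply: ler_sum => i _.
rewrite (ErZ mD _ (itg_roS i J)) Er_roS; apply: le_trans (ler_wpM2l _ (mm_tail i J)) _; first by rewrite exprn_ge0.
by rewrite mulrCA -/K pwD -powR_mulrn.
Qed.

End SpectralSide.

(** Both matrices subtract a quantity from the same average of the conductances. Their difference is
    a limit in J of partial sums minus the spectral integral, bounded independently of J. *)
Lemma approx_bound : 0 <= qform (Amuk - Ahom) xi <= Acst /\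
  forall I k', (0 < k' <= k)%N -> qform (Amuk - Ahom) xi <=
    hcst R k' * Acst * (pw I (- s) + (mu / c) ^+ (2 * k') * \sum_(i < I) pw i ((2 * k').-1%:R - s)).
Proof.
have [_ /(_ xi) [e [he E]]] := hAk; have cvS := hom_series alpha_gt0 d_gt0 hP hA s_gt0 Cm_gt0 hmm.
have iq : mitg P setT (fun w => qform (Amat w 0) xi) by exact: itg_qform.
rewrite (expectationE iq) (spectral_G he) -EFinB in E; case: E => E.
have -> : qform (Amuk - Ahom) xi = qform Amuk xi - qform Ahom xi.
  by rewrite /qform mulmxBr mulmxBl !mxE.
rewrite E; set g := mEr e _ _; set q := mEr P _ _; set a := qform _ _.
have cv : c^-1 * (\sum_(0 <= j < J) mm j) - g @[J --> \oo] --> q - g - a.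
  by rewrite addrAC; apply: cvgB => //; exact: cvg_cst.
have SE J : c^-1 * (\sum_(0 <= j < J) mm j) = mEr e `]0, c]%classic (Ssum c J).
  by rewrite (ErS he) big_mkord.
have nJ (Q : nat -> Prop) : (forall J, ((Num.truncn (4 * c / mu)).+1 <= J)%N -> Q J) -> \forall J \near \oo, Q J.
  by move=> h; exists (Num.truncn (4 * c / mu)).+1.
split; first (apply/andP; split).
- by apply: (cvgr_to_ge cv); apply: nJ => J hJ; rewrite SE; exact: ErSG.
- by apply: (cvgr_to_le cv); apply: nJ => J hJ; rewrite SE; exact: ErSG_le1.
- by move=> I k' hk; apply: (cvgr_to_le cv); apply: nJ => J hJ; rewrite SE; exact: ErSG_le.
Qed.

End Approximation.

(** * Choice of the truncation order and the error functions *)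

Section ErrorFunction.
Variable R : realType.
Implicit Types (D c mu x t : R) (k I n : nat).

Lemma ln_plus_ge1 x : 1 <= ln_plus x. Proof. by rewrite /ln_plus le_max lexx orbT. Qed.

Lemma Err0E D k mu : 0 < mu -> Err D 0 k%:R mu = if (2 * k)%:R < D / 2 then mu ^+ (2 * k) else
  if (2 * k)%:R == D / 2 then mu ^+ (2 * k) * ln_plus mu^-1 else mu `^ (D / 2).
Proof.
move=> m0; have -> : ((2 * k)%:R < D / 2) = (k%:R < D / 4) by rewrite natrM; apply/idP/idP; lra.
have -> : ((2 * k)%:R == D / 2) = (k%:R == D / 4) by rewrite natrM; apply/eqP/eqP; lra.
rewrite /Err addr0 powRr0 mulr1 powRr1 ?(le_trans ler01 (ln_plus_ge1 _)) //.
by have -> : mu `^ (2 * k%:R) = mu ^+ (2 * k) by rewrite -natrM powR_mulrn // ltW.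
Qed.

Lemma Err_ge1 D k mu : 0 < D -> 1 < mu -> 1 <= Err D 0 k%:R mu.
Proof.
move=> D0 m1; have h : 1 <= mu ^+ (2 * k) by rewrite exprn_ege1 // ltW.
rewrite Err0E ?(lt_trans ltr01 m1) //; case: ifP => // _; case: ifP => _.
  by rewrite mulr_ege1 // ln_plus_ge1.
by rewrite -[leLHS](powRr0 mu) ler_powR ?(ltW m1) // ltW // divr_gt0.
Qed.

Lemma Err_le_q D q k mu : 0 <= q -> 0 < mu -> Err D 0 k%:R mu <= Err D q k%:R mu.
Proof.
move=> q0 m0; rewrite /Err; case: ifP => // _; case: ifP => _; rewrite ler_wpM2l ?powR_ge0 //.
  by rewrite ler_powR ?ln_plus_ge1 // lerD2l.
by rewrite ler_powR ?ln_plus_ge1.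
Qed.

Lemma harmonic_le n : \sum_(i < n) pw i (-1) <= 1 + ln n%:R :> R.
Proof.
case: n => [|n]; first by rewrite big_ord0 ln0 // addr0.
elim: n => [|n IH]; first by rewrite big_ord1 pw0n ln1 addr0.
rewrite big_ord_recr /=; apply: le_trans (lerD IH (lexx _)) _; rewrite -addrA lerD2l.
have n1 : 0 < n.+1%:R :> R by []; have n2 : 0 < n.+2%:R :> R by [].
have := @le_ln1Dx R (- n.+2%:R^-1); rewrite ltrN2 invf_lt1 // ltr1n => /(_ isT).
have E : n.+2%:R = n.+1%:R + 1 :> R by rewrite natr1.
have -> : 1 + - n.+2%:R^-1 = n.+1%:R / n.+2%:R :> R.
  by apply: (mulIf (lt0r_neq0 n2)); rewrite mulrBl mul1r divfK ?mulVf ?gt_eqF // E addrK.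
by rewrite ln_div ?posrE // pwN pw1; move: (n.+2%:R^-1) (ln _) (ln _) => z u v; lra.
Qed.

Lemma sum_pw_pos t : 0 < t -> exists2 C : R, 0 < C & forall n, \sum_(i < n) pw i (t - 1) <= C * pw n t.
Proof.
move=> t0; have [t1|t1] := leP t 1.
  exists (1 - 2 `^ (- t))^-1; first by rewrite invr_gt0 subr_gt0; exact: two_pow_lt1.
  by move=> n; rewrite -(big_mkord xpredT (fun i => pw i (t - 1))); apply: sum_pw; rewrite t0.
exists 1 => // n; rewrite mul1r; apply: (@le_trans _ _ (\sum_(i < n) pw n (t - 1))).
  by apply: ler_sum => i _; apply: pw_mono; [lra|exact: ltnW].
have -> : pw n t = pw n (t - 1) * n.+1%:R by rewrite -pw1 -pwD subrK.
by rewrite sumr_const card_ord -[leLHS]mulr_natr ler_wpM2l ?pw_ge0 // ler_nat.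
Qed.

(** The sum has exponent 2k - 1 - D/2: it converges, is harmonic, or grows like a power according as
    2k is below, at or above D/2. These are the three cases of [Err]. *)
Lemma Err_dominates D c k : 0 < D -> 0 < c -> (0 < k)%N -> exists2 C : R, 0 < C &
  forall mu, 0 < mu <= 1 -> exists I, pw I (- (D / 2)) + (mu / c) ^+ (2 * k) * \sum_(i < I) pw i ((2 * k).-1%:R - D / 2) <= C * Err D 0 k%:R mu.
Proof.
move=> D0 c0 k0; set s := D / 2; have s0 : 0 < s by rewrite divr_gt0.
(* Truncation at order 1/mu makes the remainder I^-(D/2) comparable with mu^(D/2). *)
pose I mu := Num.truncn mu^-1; pose ck := c ^- (2 * k).
have ck0 : 0 < ck by rewrite invr_gt0 exprn_gt0.
have KE : (2 * k).-1%:R = (2 * k)%:R - 1 :> R by rewrite -[in RHS](@prednK (2 * k)) ?muln_gt0 // -natr1 addrK.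
have hI mu : 0 < mu <= 1 -> [/\ (I mu)%:R <= mu^-1, mu^-1 <= (I mu).+1%:R, (I mu).+1%:R <= 2 / mu & 1 <= mu^-1].
  move=> /andP[m0 m1]; have v1 : 1 <= mu^-1 by rewrite invf_ge1.
  have v0 : 0 <= mu^-1 by rewrite invr_ge0 ltW.
  have h : (I mu)%:R <= mu^-1 by rewrite truncn_le.
  split => //; first exact: ltW (truncnS_gt _).
  by rewrite -natr1; lra.
have hs mu : 0 < mu <= 1 -> pw (I mu) (- s) <= mu `^ s.
  move=> m01; have /andP[m0 m1] := m01; have [_ h _ _] := hI mu m01.
  have -> : mu `^ s = (mu^-1 `^ s)^-1 by rewrite -[mu^-1]powR_inv1 ?(ltW m0) // -powRrM mulN1r powRN invrK.
  rewrite pwN lef_pV2 ?posrE ?powR_gt0 ?invr_gt0 //.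
  by rewrite ge0_ler_powR ?nnegrE ?invr_ge0 ?(ltW s0) ?(ltW m0).
have split_mu mu S : (mu / c) ^+ (2 * k) * S = ck * (mu ^+ (2 * k) * S) by rewrite exprMn exprVn /ck; ring.
case: (ltgtP (2 * k)%:R s) => ks.
- pose C1 := (1 - 2 `^ (- (1 + (s - (2 * k)%:R) - 1)))^-1.
  have C10 : 0 < C1 by rewrite invr_gt0 subr_gt0; apply: two_pow_lt1; lra.
  exists (1 + ck * C1); first by rewrite addr_gt0 // mulr_gt0.
  move=> mu m01; have /andP[m0 m1] := m01; exists (I mu); rewrite Err0E // -/s ks split_mu mulrDl mul1r.
  apply: lerD.
    by apply: le_trans (hs mu m01) _; rewrite -powR_mulrn ?(ltW m0) // ger_powR ?m0 // ltW.
  rewrite -mulrA ler_pM2l // mulrC ler_pM2r ?exprn_gt0 // KE.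
  have -> : (2 * k)%:R - 1 - s = - (1 + (s - (2 * k)%:R)) by ring.
  by rewrite -(big_mkord xpredT (fun i => pw i _)); apply: sum_pw_conv; lra.
- have [|C1 C10 hC] := @sum_pw_pos ((2 * k)%:R - s); first lra.
  exists (1 + ck * (C1 * 2 `^ ((2 * k)%:R - s))); first by rewrite addr_gt0 // !mulr_gt0 // powR_gt0.
  move=> mu m01; have /andP[m0 m1] := m01; have [_ _ h2 _] := hI mu m01; exists (I mu).
  rewrite Err0E // -/s ltNge (ltW ks) /= gt_eqF // split_mu mulrDl mul1r; apply: lerD; first exact: hs.
  rewrite -mulrA ler_pM2l // KE.
  have -> : (2 * k)%:R - 1 - s = (2 * k)%:R - s - 1 by ring.
  apply: (@le_trans _ _ (mu ^+ (2 * k) * (C1 * (2 / mu) `^ ((2 * k)%:R - s)))).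
    rewrite ler_pM2l ?exprn_gt0 //; apply: le_trans (hC _) _; rewrite ler_pM2l //.
    by rewrite ge0_ler_powR ?nnegrE ?divr_ge0 ?(ltW m0) //; lra.
  rewrite powRM ?invr_ge0 ?(ltW m0) // -powR_mulrn ?(ltW m0) // -[mu^-1]powR_inv1 ?(ltW m0) // -powRrM mulN1r.
  have -> : mu `^ s = mu `^ (2 * k)%:R * mu `^ (- ((2 * k)%:R - s)).
    by rewrite -powRD ?(gt_eqF m0) ?implybT //; congr (_ `^ _); ring.
  by rewrite le_eqVlt; apply/orP; left; apply/eqP; ring.
- exists (1 + ck * 2); first by rewrite addr_gt0 // mulr_gt0.
  move=> mu m01; have /andP[m0 m1] := m01; have [h1 h2 _ h3] := hI mu m01; exists (I mu).
  have lp := ln_plus_ge1 mu^-1; have mk : 0 < mu ^+ (2 * k) by rewrite exprn_gt0.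
  rewrite Err0E // -/s ks ltxx eqxx split_mu mulrDl mul1r; apply: lerD.
    by apply: le_trans (hs mu m01) _; rewrite -ks powR_mulrn ?(ltW m0) // ler_peMr // ltW.
  rewrite -mulrA ler_pM2l // mulrCA ler_pM2l // KE ks.
  have -> : s - 1 - s = -1 by ring.
  apply: le_trans (harmonic_le _) _.
  have : ln (I mu)%:R <= ln_plus mu^-1.
    have [->|i0] := posnP (I mu); first by rewrite ln0 // (le_trans ler01).
    by rewrite /ln_plus le_max ler_ln ?posrE ?ltr0n ?invr_gt0 // h1.
  by move: lp; lra.
Qed.

(** With D among 2, d, 6 and d - 6; the condition D <= d is what the decay rate 1 + d/2 of the
    moments can serve. *)
Lemma error_bound_exponent d : (1 < d)%N -> exists2 D : R, 0 < D <= d%:R &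
  forall k mu, 0 < mu -> Err D 0 k%:R mu <= error_bound d 0 k mu.
Proof.
move=> d1; rewrite /error_bound; have [->|d2] := eqVneq d 2%N; first by exists 2 => //; rewrite ltr0n lexx.
have [_|d5] := boolP (2 < d <= 5)%N; first by exists d%:R => //; rewrite ltr0n (ltnW d1) lexx.
have [->|d6] := eqVneq d 6%N.
  by exists 6 => // [|k mu m0]; [rewrite ltr0n lexx|exact: Err_le_q].
have d7 : (6 < d)%N by clear -d1 d2 d5 d6; lia.
have [_|_] := boolP (6 < d <= 12)%N; first by exists 6 => //; rewrite ltr0n ler_nat (ltnW d7).
exists (d%:R - 6) => //; rewrite subr_gt0 ltr_nat d7 /=; lra.
Qed.

End ErrorFunction.

Theorem theorem3 (R : realType) (alpha beta : R)
    (halpha : 0 < alpha) (hab : alpha <= beta) :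
  exists q : R, 0 <= q /\
  forall d : nat, (2 <= d)%N ->
  exists C : R, 0 < C /\
  forall (nu : probability (conductance hab) R)
         (P : probability (Omega hab d) R),
    product_measure nu P ->
  forall Ahom : 'M[R]_d, homogenized_matrix P Ahom ->
  forall (xi : 'rV[R]_d) (mu : R) (k : nat) (Amuk : 'M[R]_d),
    euclid_norm xi = 1 -> 0 < mu -> (1 <= k)%N ->
    approx_matrix P mu k Amuk ->
    0 <= qform (Amuk - Ahom) xi <= C * error_bound d q k mu.
Proof.
(* The variance decays without logarithm, also in the plane, so q = 0 will do. *)
exists 0; split => // d d1; have d0 : (0 < d)%N := ltnW d1.
have [D /andP[D0 Dd] hD] := error_bound_exponent R d1.
have [CU CU0 hU] := UU_decay halpha hab d1; have c0 := cst_gt0 d0 halpha hab.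
pose s := D / 2; have s0 : 0 < s by rewrite divr_gt0.
pose eta := d%:R / 2 + 1 : R; pose Cm := CU * 2 `^ eta.
have eta0 : 0 <= eta by rewrite addr_ge0 // divr_ge0.
have Cm0 : 0 < Cm by rewrite mulr_gt0 // powR_gt0.
pose A := Acst beta d s Cm; have A0 : 0 < A := Acst_gt0 halpha hab d0 s0 Cm0.
(* The constants of [Err_dominates] depend on [k]; choice gathers them in a function, of which only
   the values up to [d] are summed. *)
have H k : exists C : R, (0 < k)%N -> 0 < C /\ forall mu, 0 < mu <= 1 -> exists I : nat,
    pw I (- s) + (mu / cst d beta) ^+ (2 * k) * \sum_(i < I) pw i ((2 * k).-1%:R - s) <= C * Err D 0 k%:R mu.
  have [->|k0] := posnP k; first by exists 0.
  by have [C C0 hC] := Err_dominates D0 c0 k0; exists C.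
have [F hF] := boolp.choice H.
pose G k : R := if k is 0%N then 0 else hcst R k * F k.
have G0 k : 0 <= G k.
  by case: k => //= k; rewrite mulr_ge0 ?(ltW (hF k.+1 _).1) // prodr_ge0 // => i _; exact: sqr_ge0.
pose B := \sum_(k < d.+1) G k; have B0 : 0 <= B by rewrite sumr_ge0.
exists (A * (1 + B)); split; first by rewrite mulr_gt0 // ltr_pwDl.
move=> nu P hP Ahom hA xi mu k Amuk xi1 m0 k0 hAk.
have hxi i : `|xi 0 i| <= 1.
  have e1 : \sum_j xi 0 j ^+ 2 = 1.
    by rewrite -(sqr_sqrtr (sumr_ge0 _ (fun j _ => sqr_ge0 (xi 0 j)))) -/(euclid_norm xi) xi1 expr1n.
  rewrite -(@ler_pXn2r _ 2) ?nnegrE // real_normK ?num_real // expr1n -e1 (bigD1 i) //= lerDl sumr_ge0 // => j _.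
  exact: sqr_ge0.
have hmm j : mm P xi j <= Cm * pw j (- (1 + s)).
  apply: le_trans (mm_decay halpha d0 hP eta0 CU0 (hU nu P hP xi hxi) j) _; rewrite ler_pM2l //.
  apply: pw_ler; rewrite /eta /s; lra.
have [/andP[q0 q1] qI] := approx_bound halpha d0 hP hA hAk m0 s0 Cm0 hmm.
rewrite q0 /=; apply: (@le_trans _ _ (A * (1 + B) * Err D 0 k%:R mu)); last first.
  by apply: ler_wpM2l (hD k mu m0); rewrite mulr_ge0 ?addr_ge0 // ltW.
(* For mu > 1 the error function is at least 1 and the bound by [Acst] suffices. *)
have [m1|m1] := leP mu 1; last first.
  apply: le_trans q1 _; rewrite -mulrA ler_peMr ?(ltW A0) // mulr_ege1 ?lerDl //; exact: Err_ge1.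
(* Beyond [d] the error function no longer depends on [k], so lowering [k] to [d] loses nothing and
   leaves finitely many constants. *)
pose k' := minn k d; have k'0 : (0 < k')%N by rewrite leq_min k0.
have kk : (0 < k' <= k)%N by rewrite k'0 geq_minl.
have EE : Err D 0 k'%:R mu = Err D 0 k%:R mu.
  rewrite /k'; case: (leqP k d) => // dk; rewrite !Err0E //.
  have h1 : D / 2 < (2 * d)%:R by move: D0 Dd; rewrite natrM; lra.
  have h2 : D / 2 < (2 * k)%:R by apply: lt_le_trans h1 _; rewrite ler_nat leq_mul2l ltnW.
  by rewrite !ltNge (ltW h1) (ltW h2) /= !gt_eqF.
have [F0 /(_ mu) [|I hI]] := hF k' k'0; first by rewrite m0.
apply: le_trans (qI I k' kk) _; rewrite -/A.
have h0 : 0 <= hcst R k' by rewrite prodr_ge0 // => i _; exact: sqr_ge0.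
apply: le_trans (ler_wpM2l _ hI) _; first by rewrite mulr_ge0 // ltW.
rewrite EE mulrA -[_ * F k']mulrAC -/(G k'.-1.+1).
have E0 : 0 <= Err D 0 k%:R mu.
  by rewrite /Err; case: ifP => _; [|case: ifP => _]; rewrite ?mulr_ge0 ?powR_ge0.
apply: ler_wpM2r => //; rewrite [leLHS]mulrC ler_pM2l //.
have k'd : (k' < d.+1)%N by rewrite ltnS geq_minr.
apply: (@le_trans _ _ (G k')); first by rewrite -(prednK k'0).
rewrite /B (bigD1 (Ordinal k'd)) //= addrCA lerDl addr_ge0 // sumr_ge0 //.
Qed.
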